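(* Let $\mathcal{C}$ be a species with $\mathcal{C}_1\neq\emptyset$ and $\lvert\mathcal{C}_n\rvert\sim b\,n^{-(1+\alpha)}\rho^{-n}n!$ as $n\to\infty$, for constants $b,\rho>0$ and $1<\alpha<2$. Let $\mathcal{G}=\textsc{SET}\circ\mathcal{C}$ and, for $\lambda\in(0,1)$, let $N:=\lfloor\lambda n\rfloor$. Then, as $n\to\infty$, $$\frac{N!}{n!}\lvert\mathcal{G}_{n,N}\rvert\sim \begin{cases} c_{-}(\lambda)\,n^{-\alpha}\rho^{-n}C(\rho)^N, & \lambda\in(0,\lambda^{*}),\\ c\, n^{-1/\alpha}\rho^{-n}C(\rho)^N, & \lambda=\lambda^{*},\\ c_{+}(\lambda)\,n^{-1/2}x_\lambda^{-n}C(x_\lambda)^N, & \lambda\in(\lambda^{*},1), \end{cases}$$ where $\lambda^{*}=\frac{C(\rho)}{\rho C'(\rho)}$, $c_{-}(\lambda)=\frac{b\lambda}{C(\rho)(1-\lambda/\lambda^{*})^{\alpha+1}}$, $c=\left(\frac{\alpha C(\rho)}{\lambda^{*}b\lvert\Gamma(1-\alpha)\rvert}\right)^{1/\alpha}\frac{1}{\lvert\Gamma(-1/\alpha)\rvert}$, for $\lambda\in(\lambda^*,1)$ the number $x_\lambda\in(0,\rho)$ is the unique solution of $x_\lambda C'(x_\lambda)/C(x_\lambda)=1/\lambda$, and $c_{+}(\lambda)=(2\pi\sigma_\lambda^2\lambda)^{-1/2}$ with $\sigma_\lambda^2=\frac{x_\lambda^2C''(x_\lambda)}{C(x_\lamb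da)}+\frac1\lambda-\frac1{\lambda^2}$.
   Context: A species $\mathcal{F}$ assigns to each finite set $U$ a finite set $\mathcal{F}[U]$ of objects (e.g. graphs with vertex set $U$) and to each bijection $U\to V$ a compatible bijection $\mathcal{F}[U]\to\mathcal{F}[V]$; $\mathcal{F}_n:=\mathcal{F}[\{1,\dots,n\}]$, and the exponential generating function is $F(x)=\sum_n\lvert\mathcal{F}_n\rvert x^n/n!$. Here $\mathcal{C}$ has no objects of size $0$ and $C(x)$ is its exponential generating function (radius of convergence $\rho$). $\mathcal{G}=\textsc{SET}\circ\mathcal{C}$ is the species whose objects on a label set $U$ are sets of $\mathcal{C}$-objects whose label sets form a partition of $U$ (e.g. graphs all of whose components lie in a class $\mathcal{C}$ of connected graphs). $\mathcal{G}_{n,k}$ is the set of $\mathcal{G}$-objects on $\{1,\dots,n\}$ with exactly $k$ components (i.e., partition blocks), so $\frac{k!}{n!}\lvert\mathcal{G}_{n,k}\rvert=[x^n]C(x)^k$. $\Gamma$ denotes the Gamma function. *)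

(* Defs.v *)
From HB Require Import structures.
From Stdlib Require Import FunctionalExtensionality.
From mathcomp Require Import all_boot all_order all_algebra.

Set Implicit Arguments.
Unset Strict Implicit.
Unset Printing Implicit Defensive.

(* The two laws force [relabel] to be independent of the proof of bijectivity
   and to be itself bijective: a species is a functor from the groupoid of
   finite sets and bijections to finite sets. *)
Record species := Species {
  objects :> finType -> finType;
  relabel : forall (U V : finType) (f : U -> V),
    bijective f -> objects U -> objects V;
  relabel_id : forall (U : finType) (idU : bijective (@id U)) (x : objects U),
    relabel idU x = x;
  relabel_comp : forall (U V W : finType) (f : U -> V) (g : V -> W)
      (fbij : bijective f) (gbij : bijective g) (gfbij : bijective (g \o f))
      (x : objects U),
    relabel gfbij x = relabel gbij (relabel fbij x)
}.

Section SetOf.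
Variable C : species.

Definition block (U : finType) (B : {set U}) : finType := {x : U | x \in B}.

Definition component (U : finType) : finType := {B : {set U} & C (block B)}.

(* A set of C-objects with pairwise distinct label sets, these label sets
   forming a partition of U. *)
Definition is_assembly (U : finType) (S : {set component U}) : bool :=
  dinjectiveb (@tag _ _) S && partition [set tag s | s in S] [set: U].

Definition assembly (U : finType) : finType :=
  {S : {set component U} | is_assembly S}.

Section Relabel.
Variables (U V : finType) (f : U -> V).

Definition block_map (B : {set U}) (x : block B) : block (f @: B) :=
  exist _ (f (val x)) (imset_f f (valP x)).

Hypothesis fbij : bijective f.

Lemma block_map_bij (B : {set U}) : bijective (@block_map B).
Proof.
apply: inj_card_bij => [x y [/(bij_inj fbij) exy]|]; first exact: val_inj.
by rewrite !card_sig card_imset //; exact: bij_inj.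
Qed.

Definition component_map (s : component U) : component V :=
  Tagged (fun B => C (block B)) (relabel (block_map_bij (tag s)) (tagged s)).

Lemma assembly_map_subproof (S : {set component U}) :
  is_assembly S -> is_assembly (component_map @: S).
Proof.
have finj := bij_inj fbij.
case/andP=> /dinjectiveP Sinj Spart; apply/andP; split.
  apply/dinjectiveP => _ _ /imsetP[s sS ->] /imsetP[t tS ->] /= est.
  by rewrite (Sinj s t sS tS) //; exact: (imset_inj finj) est.
rewrite -imset_comp (eq_imset (g := (fun B : {set U} => f @: B) \o tag)) //.
rewrite imset_comp.
suff -> : [set: V] = f @: [set: U] by rewrite imset_partition.
apply/setP => y; rewrite inE; case: fbij => g _ gK.
by apply/esym/imsetP; exists (g y); rewrite ?inE ?gK.
Qed.

Definition assembly_map (S : assembly U) : assembly V :=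
  exist (fun T : {set component V} => is_assembly T) _
    (assembly_map_subproof (valP S)).

End Relabel.

Lemma eq_component (U V : finType) (B : {set U}) (B1 B2 : {set V})
    (h1 : block B -> block B1) (h2 : block B -> block B2)
    (b1 : bijective h1) (b2 : bijective h2) (c : C (block B)) :
  B1 = B2 -> (forall x, val (h1 x) = val (h2 x)) ->
  Tagged (fun D => C (block D)) (relabel b1 c) =
  Tagged (fun D => C (block D)) (relabel b2 c).
Proof.
move=> eB; case: B2 / eB h2 b2 => h2 b2 eh.
have {}eh : h1 = h2.
  by apply: functional_extensionality => x; apply/val_inj/eh.
case: h2 / eh b2 => b2; have idb : bijective (@id (block B1)) by exists id.
by rewrite (relabel_comp b2 idb b1) relabel_id.
Qed.

Lemma assembly_map_id (U : finType) (idU : bijective (@id U))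
  (S : assembly U) : assembly_map idU S = S.
Proof.
apply: val_inj => /=; rewrite -[RHS]imset_id; apply: eq_imset => -[B c] /=.
have idb : bijective (@id (block B)) by exists id.
rewrite -[RHS]/(Tagged (fun D => C (block D)) c) -[in RHS](relabel_id idb c).
by apply: eq_component => //=; rewrite imset_id.
Qed.

Lemma assembly_map_comp (U V W : finType) (f : U -> V) (g : V -> W)
    (fbij : bijective f) (gbij : bijective g) (gfbij : bijective (g \o f))
    (S : assembly U) :
  assembly_map gfbij S = assembly_map gbij (assembly_map fbij S).
Proof.
apply: val_inj => /=; rewrite -imset_comp; apply: eq_imset => -[B c] /=.
rewrite /component_map /=.
have cb := bij_comp (block_map_bij gbij (f @: B)) (block_map_bij fbij B).
rewrite -(relabel_comp (block_map_bij fbij B) _ cb).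
by apply: eq_component => //=; rewrite imset_comp.
Qed.

Definition SET_of : species :=
  Species assembly_map_id assembly_map_comp.

Definition card_SET_of (n k : nat) : nat :=
  #|[set S : SET_of 'I_n | #|val S| == k]|.

End SetOf.

(* Imported only now because classical_sets shadows setT, set0 and other names
   of finset. *)
From mathcomp Require Import all_classical all_reals all_analysis.
Import Order.TTheory GRing.Theory Num.Theory.
Import numFieldNormedType.Exports.
Local Open Scope classical_set_scope.
Local Open Scope ring_scope.

Definition egf_coef (R : realType) (F : species) (n : nat) : R :=
  #|F 'I_n|%:R / n`!%:R.

(* The k-th derivative of the exponential generating function is the sum of the
   k-times termwise differentiated series.  It is the usual derivative inside
   the disc of convergence, and also makes sense on its boundary. *)
Definition egf (R : realType) (F : species) (k : nat) (x : R) : R :=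
  limn (pseries (iter k (@pseries_diffs R) (egf_coef R F)) x).

Definition Gamma_integral (R : realType) (x : R) : R :=
  \int[lebesgue_measure]_(t in `]0, +oo[) (t `^ (x - 1) * expR (- t)).

(* Euler's integral, extended to negative non-integers by
   Gamma x = Gamma (x + m) / (x (x + 1) ... (x + m - 1)),
   where m is the least natural number with 0 < x + m. *)
Definition Gamma (R : realType) (x : R) : R :=
  let m := Num.truncn (1 - x) in
  Gamma_integral (x + m%:R) / \prod_(i < m) (x + i%:R).

(* Main.v *)
(* Put p_n = |C_n| / n!, so that N!/n! |G_{n,N}| = [x^n] C(x)^N.  For a radius
   0 < x <= rho the weights q_k = p_k x^k / C(x) form a probability law, and
   [x^n] C(x)^N = C(x)^N x^{-n} P(S_N = n) for the random walk S with steps q;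
   the three regimes are three local limit theorems for S_{floor(lambda n)}.

   If lambda > lambda*, the saddle point x makes the mean of q equal to
   1/lambda; all moments are finite, and Fourier inversion gives a Gaussian
   local limit theorem.

   If lambda < lambda*, take x = rho: the walk falls short of n by a linear
   amount, and the event S_N = n is realised by one big jump.  Truncating the
   steps at n^theta for a theta < 1 close enough to 1, exponential moments kill the
   contribution of no jump, and a crude bound kills that of two jumps.

   If lambda = lambda*, take x = rho: the mean of q is 1/lambda and the limit
   is stable.  To avoid computing the density of the stable law at its centre,
   q is replaced by the lazy law (1 - lambda) delta_0 + lambda q, of mean 1.
   By the cycle lemma P(S_n = n - 1) / n is then the law of the hitting time of
   a left-continuous walk, whose generating function T solves T(z) = z Q(T(z)),
   so that 1 - T(z) is asymptotic to a constant times (1 - z)^{1/alpha}.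
   Fourier estimates show that these probabilities oscillate slowly, and a
   Tauberian argument inverts the transform.  The laziness is finally removed
   by concentration of the binomial law. *)

Require Import Defs.
From mathcomp Require Import all_boot all_order all_algebra.
From mathcomp Require Import ring lra.
Import Order.TTheory GRing.Theory Num.Theory.

Set Implicit Arguments.
Unset Strict Implicit.
Unset Printing Implicit Defensive.
Local Open Scope ring_scope.

(** * Counting assemblies *)

(** In the critical case the obstacle is the inversion of the transform. It is known to first order
    only, along the real axis, and nothing makes the hitting probabilities monotone. So a model K
    n^(-1-b) with b = 1/alpha and the same first-order transform is subtracted, and the difference
    e_n is shown to be o(n^(-1-b)). In place of monotonicity stands |e_n - e_m| <= C (m - n)
    n^(-2-b), one power better than the size of e_n. A generic Fourier bound is too weak for this:
    changing by d the number N of steps or the target costs d N^(-2/alpha). Changing both by d,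
    along the drift of a walk of mean 1, costs only d N^(-1-1/alpha), and this is the move from n to
    m in the hitting probabilities. The generic bound suffices to remove the laziness: the binomial
    number of steps fluctuates by n^(1/2), and n^(1/2-2/alpha) is negligible against n^(-1/alpha)
    because alpha < 2. The lower bounds on the decay of characteristic functions all rest on the
    atom at 1, positive because there is an object of size 1. *)

Fixpoint cpow (R : pzRingType) (q : nat -> R) (N n : nat) : R :=
  if N is N'.+1 then \sum_(m < n.+1) q m * cpow q N' (n - m) else (n == 0)%:R.

(** Any truncation degree [L > n] gives the same coefficient, so identities between powers of series
    can be proved in the ring of polynomials. *)
Lemma cpowE (R : nzRingType) (q : nat -> R) (L N n : nat) : (n < L)%N ->
  cpow q N n = ((\poly_(k < L) q k) ^+ N)`_n.
Proof.
elim: N n => [|N IH] n nL; first by rewrite expr0 coef1.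
rewrite exprS coefM /=; apply: eq_bigr => m _.
have mL : (m < L)%N by apply: leq_ltn_trans nL; rewrite -ltnS.
by rewrite coef_poly mL IH // (leq_ltn_trans (leq_subr _ _)).
Qed.

Section Assemblies.
Variables (C : species) (U : finType).
Implicit Types (D : {set U}) (S : {set component C U}) (s t : component C U).

(** Working with subsets [D] of a fixed [U] lets a component be removed by passing to [D :\: tag s],
    without relabelling onto a new type. *)
Definition assemblies D k : {set {set component C U}} :=
  [set S : {set component C U} | [&& dinjectiveb (@tag _ _) S,
     partition [set tag s | s in S] D & #|S| == k]].

Lemma assembliesP D k S : reflect
  [/\ {in S, forall s, tag s != set0},
      {in S &, forall s t, s != t -> [disjoint tag s & tag t]},
      \bigcup_(s in S) tag s = D & #|S| = k]
  (S \in assemblies D k).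
Proof.
rewrite inE; apply: (iffP and3P) => [[/dinjectiveP inj /and3P[/eqP cov triv n0] /eqP cS]
  | [n0 dis cov cS]].
  split=> // [s sS|s t sS tS nst|].
  - by apply: contraNneq n0 => <-; apply: imset_f.
  - apply: (trivIsetP triv); rewrite ?imset_f //.
    by apply: contra_neq nst => /inj; apply.
  - by rewrite -cov cover_imset.
split; last by rewrite cS.
- apply/dinjectiveP => s t sS tS est; apply: contraTeq (n0 s sS) => nst.
  by have := dis _ _ sS tS nst; rewrite -setI_eq0 -est setIid negbK.
- apply/and3P; split.
  + by rewrite cover_imset cov.
  + apply/trivIsetP => _ _ /imsetP[s sS ->] /imsetP[t tS ->] nst.
    by apply: dis => //; apply: contra_neq nst => ->.
  + by apply/imsetP => -[s sS e0]; have := n0 s sS; rewrite -e0 eqxx.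
Qed.

Lemma assembliesU1 D k s S : s \notin S ->
  (s |: S \in assemblies D k.+1) =
  [&& tag s \subset D, tag s != set0 & S \in assemblies (D :\: tag s) k].
Proof.
move=> sS; apply/assembliesP/and3P => [[n0 dis cov cS]|[sD s0 /assembliesP[n0 dis cov cS]]].
- have disS : [disjoint tag s & \bigcup_(t in S) tag t].
    apply: bigcup_disjoint => t tS.
    by apply: dis; rewrite ?inE ?eqxx ?tS ?orbT //; apply: contraNneq sS => ->.
  rewrite big_setU1 //= in cov.
  split; first by rewrite -cov subsetUl.
    by apply: n0; rewrite !inE eqxx.
  apply/assembliesP; split=> [t tS|t u tS uS|| ].
  + by apply: n0; rewrite inE tS orbT.
  + by apply: dis; rewrite inE ?tS ?uS orbT.
  + rewrite -cov setDUl setDv set0U; apply/esym/setDidPl.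
    by rewrite disjoint_sym.
  + by move: cS; rewrite cardsU1 sS => -[].
- have disS t : t \in S -> [disjoint tag s & tag t].
    move=> tS; rewrite disjoint_sym; apply: disjointWl (_ : tag t \subset D :\: tag s) _.
      by rewrite -cov; apply: bigcup_sup.
    by rewrite disjoints_subset; apply/subsetP => x; rewrite !inE => /andP[].
  split=> [t|t u|| ].
  + by rewrite in_setU1 => /predU1P[->//|/n0].
  + rewrite !in_setU1 => /predU1P[->|tS] /predU1P[->|uS]; rewrite ?eqxx // => ntu.
    * exact: disS.
    * by rewrite disjoint_sym; apply: disS.
    * exact: dis.
  + rewrite big_setU1 //= cov -[RHS](setID _ (tag s)) setIC.
    by rewrite (setIidPl sD).
  + by rewrite cardsU1 sS cS.
Qed.

(* Both sides count assemblies with one distinguished component. *)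
Lemma card_assembliesS D k :
  (k.+1 * #|assemblies D k.+1| =
   \sum_(s : component C U | (tag s \subset D) && (tag s != set0))
     #|assemblies (D :\: tag s) k|)%N.
Proof.
transitivity (\sum_(S in assemblies D k.+1) \sum_(s in S) 1)%N.
  rewrite mulnC -sum_nat_const; apply: eq_bigr => S /assembliesP[_ _ _ <-].
  by rewrite sum1_card.
rewrite (exchange_big_dep predT) //= [LHS](bigID (fun s => (tag s \subset D) && (tag s != set0))) /=.
rewrite [X in (_ + X)%N]big1 ?addn0 => [|s ns]; last first.
  apply: big_pred0 => S; apply/negbTE; apply: contra ns => /andP[SD sS].
  move: SD; rewrite -(setD1K sS) assembliesU1; first by case/and3P => -> ->.
  by rewrite !inE eqxx.
apply: eq_bigr => s /andP[sD s0].
have sNS S : S \in assemblies (D :\: tag s) k -> s \notin S.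
  case/assembliesP => _ _ cov _; apply: contra s0 => sS.
  have : tag s \subset D :\: tag s by rewrite -cov; apply: bigcup_sup.
  by rewrite subsetD => /andP[_]; rewrite -setI_eq0 setIid.
rewrite sum1_card; transitivity #|[set s |: S | S in assemblies (D :\: tag s) k]|; last first.
  by rewrite card_in_imset // => S T /sNS sS /sNS sT e; rewrite -(setU1K sS) e setU1K.
apply: eq_card => S; apply/idP/imsetP => [|[T TD ->]].
  rewrite unfold_in /= => /andP[SD sS]; exists (S :\ s); last by rewrite setD1K.
  by move: SD; rewrite -{1}(setD1K sS) assembliesU1 ?inE ?eqxx // => /and3P[].
rewrite unfold_in /=; apply/andP.
by split; rewrite ?setU11 // assembliesU1 ?sNS // sD s0.
Qed.

End Assemblies.

(** Relabellings along [f] and along its inverse cancel by functoriality. Their composites are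
    relabellings along maps that are the identity only pointwise, whence functional
    extensionality. *)
Lemma card_relabel (C : species) (U V : finType) : #|U| = #|V| -> #|C U| = #|C V|.
Proof.
move=> eUV.
have [f fb] : exists f : U -> V, bijective f.
  by exists (fun x => enum_val (cast_ord eUV (enum_rank x)));
     exists (fun y => enum_val (cast_ord (esym eUV) (enum_rank y))) => x;
     rewrite enum_valK ?cast_ordK ?cast_ordKV enum_rankK.
have [g fK gK] := fb.
have gb : bijective g by exists f.
have cf : bijective (f \o g) by exists id => x /=; rewrite gK.
have cg : bijective (g \o f) by exists id => x /=; rewrite fK.
have rid (W : finType) (h : W -> W) (hb : bijective h) : h =1 id -> relabel (s := C) hb =1 id.
  move=> hid x; have eh : h = id by apply: FunctionalExtensionality.functional_extensionality.
  by case: _ / (esym eh) hb => hb; exact: relabel_id.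
apply: (bij_eq_card (f := relabel (s := C) fb)).
exists (relabel gb) => x; rewrite -(relabel_comp _ _ cf) || rewrite -(relabel_comp _ _ cg); exact: rid.
Qed.

(** Induction on [k]: removing a distinguished component with [m] labels leaves [#|D| - m] labels,
    its label set can be chosen in ['C(#|D|, m)] ways, and the factorials turn this binomial
    convolution into that of [cpow]. *)
Lemma card_assemblies (R : numFieldType) (C : species) (U : finType)
    (D : {set U}) (k : nat) : #|C 'I_0| = 0%N ->
  k`!%:R * #|assemblies C D k|%:R =
    #|D|`!%:R * cpow (fun n => #|C 'I_n|%:R / n`!%:R : R) k #|D|.
Proof.
move=> C0; set p := fun n => _.
elim: k D => [|k IH] D /=.
  rewrite fact0 mul1r.
  have [D0|D0] := eqVneq D set0.
    rewrite D0 cards0 fact0 mul1r eqxx (_ : assemblies C set0 0 = [set set0]) ?cards1 //.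
    apply/setP => S; rewrite in_set1; apply/assembliesP/eqP => [[_ _ _ /eqP]|->].
      by rewrite cards_eq0 => /eqP.
    by split; rewrite ?cards0 ?big_set0 // => s; rewrite inE.
  rewrite cards_eq0 (negbTE D0) mulr0 (_ : assemblies C D 0 = set0) ?cards0 //.
  apply/setP => S; rewrite [RHS]in_set0; apply/assembliesP => -[_ _ cov /eqP].
  by rewrite cards_eq0 => /eqP S0; move: cov; rewrite S0 big_set0 => /esym/eqP; apply/negP.
rewrite factS mulnC natrM -mulrA -natrM card_assembliesS natr_sum mulr_sumr.
transitivity (\sum_(B : {set U} | (B \subset D) && (B != set0))
   #|C 'I_#|B| |%:R * ((#|D| - #|B|)`!%:R * cpow p k (#|D| - #|B|))).
  rewrite (partition_big (fun s : component C U => tag s)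
    (fun B : {set U} => (B \subset D) && (B != set0))) //=.
  apply: eq_bigr => B /andP[BD B0].
  rewrite -(@card_relabel C (block B)); last by rewrite card_sig card_ord.
  have cD : #|D :\: B| = (#|D| - #|B|)%N by rewrite cardsD (setIidPr BD).
  transitivity (\sum_(s : component C U | tag s == B) (#|D :\: B|`!%:R * cpow p k #|D :\: B|)).
    apply: eq_big => [s|s /andP[_ /eqP <-]]; last by rewrite IH.
    by case: (altP (tag s =P B)) => [->|]; rewrite ?andbF // BD B0.
  rewrite cD sumr_const -[LHS]mulr_natl; congr (_ * _); congr (_%:R).
  pose f (c : C (block B)) : component C U := Tagged (fun B => C (block B)) c.
  have finj : injective f.
    by move=> c d /eqP; rewrite -tag_eqE /tag_eq /= eqxx tagged_asE => /eqP.
  rewrite -(card_codom finj); apply: eq_card => s; rewrite -[s \in _]/(tag s == B).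
  apply/eqP/codomP => [|[c ->]//].
  by case: s => B' c /= eB; case: _ / (esym eB) c => c; exists c.
rewrite (partition_big (fun B : {set U} => inord #|B| : 'I_#|D|.+1) predT) //= mulr_sumr.
apply: eq_bigr => m _.
(* Blocks are nonempty, so [m = 0] contributes nothing on the left; on the right this is
   [#|C 'I_0| = 0]. *)
have [m0|m_gt0] := posnP m.
  rewrite [in RHS]m0 /p C0 !mul0r mulr0 big1 // => B /andP[/andP[BD B0] /eqP/(congr1 val)].
  rewrite /= inordK ?ltnS ?subset_leq_card // m0 => /eqP.
  by rewrite cards_eq0 (negbTE B0).
transitivity (\sum_(B : {set U} | (B \subset D) && (#|B| == m))
   #|C 'I_m|%:R * ((#|D| - m)`!%:R * cpow p k (#|D| - m))).
  apply: eq_big => [B|B /andP[/andP[BD _] /eqP/(congr1 val)]]; last first.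
    by rewrite /= inordK ?ltnS ?subset_leq_card // => ->.
  case BD : (B \subset D) => //=.
  have -> : (inord #|B| == m) = (#|B| == m :> nat).
    by rewrite -(inj_eq val_inj) /= inordK ?ltnS ?subset_leq_card.
  by case: (altP (#|B| =P m)) => [e|]; rewrite ?andbF // andbT -card_gt0 e m_gt0.
rewrite sumr_const -[LHS]mulr_natr [X in _ * X%:R](_ : _ = 'C(#|D|, m)); last first.
  by rewrite -cards_draws; apply: eq_card => B; rewrite !inE.
have mD : (m <= #|D|)%N by rewrite -ltnS.
rewrite -[#|D|`!](bin_fact mD) !natrM /p.
have f0 : (m`!%:R : R) != 0 by rewrite pnatr_eq0 -lt0n fact_gt0.
rewrite [RHS]mulrA; set c := cpow _ _ _; move: f0; move: (m`!%:R) => x x0.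
set y := _%:R; set z := _%:R; set w := _%:R.
by field.
Qed.

Lemma card_SET_ofE (R : numFieldType) (C : species) (n k : nat) : #|C 'I_0| = 0%N ->
  k`!%:R / n`!%:R * (card_SET_of C n k)%:R =
    cpow (fun n => #|C 'I_n|%:R / n`!%:R : R) k n.
Proof.
move=> C0.
have -> : card_SET_of C n k = #|assemblies C [set: 'I_n] k|.
  rewrite /card_SET_of -(card_imset _ val_inj); apply: eq_card => S; rewrite inE.
  apply/imsetP/and3P => [[T]|[Si Sp cS]].
    by rewrite inE => cT ->; have /andP[? ?] := valP T; split.
  by exists (exist _ S (introT andP (conj Si Sp))) => //; rewrite inE.
rewrite mulrAC card_assemblies // cardsT card_ord mulrAC divff ?mul1r //.
by rewrite pnatr_eq0 -lt0n fact_gt0.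
Qed.

(* Imported only now because classical_sets shadows names of finset. *)
From mathcomp Require Import all_classical all_reals all_analysis.
From mathcomp Require Import measurable_realfun complex.
Import numFieldNormedType.Exports.
Local Open Scope classical_set_scope.
Local Open Scope ring_scope.
Local Notation Re := complex.Re.
Local Notation Im := complex.Im.

(** * Regularly varying sequences *)

Section Powers.
Variable R : realType.
Implicit Types a x y : R.

Lemma powR_mvt a x y : 0 < x -> x < y ->
  exists2 c, x < c < y & y `^ a - x `^ a = a * c `^ (a - 1) * (y - x).
Proof.
move=> x0 xy.
have [z|  |c] := @MVT R (@powR R ^~ a) (fun z => a * z `^ (a - 1)) x y xy.
- rewrite in_itv /= => /andP[xz _]; apply: is_derive1_powR; exact: lt_trans xz.
- apply: derivable_within_continuous => z; rewrite in_itv /= => /andP[xz _].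
  by have /@ex_derive := is_derive1_powR a (lt_le_trans x0 xz).
by rewrite in_itv => /= xcy ->; exists c.
Qed.

(** Mean value theorem for [x ^ (- a)]. Such telescoping bounds stand in for comparison with an
    integral in the tail estimates below. *)
Lemma powRN_tele a (k : nat) : 0 < a -> (0 < k)%N ->
  a * k.+1%:R `^ (- (1 + a)) <= k%:R `^ (- a) - k.+1%:R `^ (- a)
    <= a * k%:R `^ (- (1 + a)).
Proof.
move=> a0 k0; have k0' : 0 < k%:R :> R by rewrite ltr0n.
have [|c /andP[kc ck]] := powR_mvt (- a) k0' (_ : _ < k.+1%:R); first by rewrite ltr_nat.
have -> : k.+1%:R - k%:R = 1 :> R by rewrite -natr1; ring.
rewrite mulr1 mulNr => e.
have -> : k%:R `^ (- a) - k.+1%:R `^ (- a) = a * c `^ (- a - 1) by rewrite -opprB e opprK.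
rewrite !ler_pM2l //.
rewrite (_ : - a - 1 = - (1 + a)); last by ring.
have a1 : 0 <= 1 + a by rewrite addr_ge0 // ltW.
have cp : 0 < c by exact: lt_trans kc.
rewrite !powRN !lef_pV2 ?posrE ?powR_gt0 // ?ltr0n //.
by rewrite !ge0_ler_powR ?nnegrE ?ler0n // ltW.
Qed.

Lemma sum_powR_le a (K : nat) : 0 < a <= 1 ->
  \sum_(1 <= k < K.+1) k%:R `^ (a - 1) <= K%:R `^ a / a :> R.
Proof.
move=> /andP[a0 a1]; elim: K => [|K IH].
  by rewrite big_geq // divr_ge0 ?powR_ge0 // ltW.
rewrite big_nat_recr //= (le_trans (lerD IH (lexx _))) //.
rewrite -lerBrDl -mulrBl ler_pdivlMr //.
have [->|K0] := posnP K; first by rewrite !powR1 mul1r powR0 ?subr0 // gt_eqF.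
have K0' : 0 < K%:R :> R by rewrite ltr0n.
have [|c /andP[kc ck] ->] := powR_mvt a K0' (_ : _ < K.+1%:R); first by rewrite ltr_nat.
have -> : K.+1%:R - K%:R = 1 :> R by rewrite -natr1; ring.
rewrite mulr1 mulrC ler_pM2l //.
have cp : 0 < c by exact: lt_trans kc.
rewrite -[a - 1]opprB !powRN lef_pV2 ?posrE ?powR_gt0 // ?ltr0n //.
by rewrite ge0_ler_powR ?nnegrE ?ler0n ?subr_ge0 // ltW.
Qed.

Lemma cvg_powRy a : 0 < a -> (n%:R `^ a : R) @[n --> \oo] --> +oo.
Proof.
move=> a0; apply/cvgryPge => A; near=> n.
have : (Num.max A 1) `^ (a^-1) <= n%:R by near: n; exact: nbhs_infty_ger.
move=> /(ge0_ler_powR (ltW a0)); rewrite !nnegrE powR_ge0 ler0n => /(_ isT isT).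
rewrite -powRrM mulVf ?gt_eqF // powRr1 ?le_max ?ler01 ?orbT //.
by apply: le_trans; rewrite le_max lexx.
Unshelve. all: by end_near. Qed.

Lemma cvg_powRN0 a : 0 < a -> (n%:R `^ (- a) : R) @[n --> \oo] --> 0.
Proof.
move=> a0; under eq_fun do rewrite powRN.
by apply/gtr0_cvgV0; [near=> n; rewrite powR_gt0 // ltr0n; near: n; exists 1%N|exact: cvg_powRy].
Unshelve. all: by end_near. Qed.

End Powers.

Section NonnegSeries.
Variable R : realType.
Implicit Types a q : nat -> R.

Lemma nnseries_le q l n : (forall k, 0 <= q k) -> series q @ \oo --> l ->
  series q n <= l.
Proof.
move=> q0 ql; rewrite -(cvg_lim _ ql) //; apply: nondecreasing_cvgn_le.
  by apply: nondecreasing_series => k _ _.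
by apply/cvg_ex; exists l.
Qed.

Lemma nnseries_cvg q M : (forall k, 0 <= q k) -> (forall n, series q n <= M) ->
  exists2 l, series q @ \oo --> l & l <= M.
Proof.
move=> q0 qM; have cq : cvgn (series q).
  apply: nondecreasing_is_cvgn; first by apply: nondecreasing_series => k _ _.
  by exists M => _ [n _ <-].
exists (limn (series q)) => //; apply: limr_le => //; exact: nearW.
Qed.

Lemma series_ge_cvg q l M : (forall n, series q n <= M) -> series q @ \oo --> l -> l <= M.
Proof.
move=> qM ql; rewrite -(cvg_lim _ ql) //; apply: limr_le; last exact: nearW.
by apply/cvg_ex; exists l.
Qed.

Lemma cvg_seriesZ a (c l : R) : series a @ \oo --> l ->
  series (fun k => c * a k) @ \oo --> c * l.
Proof.
move=> al; rewrite (_ : series _ = fun n => c * series a n); first exact: cvgMr.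
by apply/funext => n; rewrite /series /= mulr_sumr.
Qed.

Lemma cvg_seriesD a q (l m : R) : series a @ \oo --> l -> series q @ \oo --> m ->
  series (fun k => a k + q k) @ \oo --> l + m.
Proof.
move=> al qm; rewrite (_ : series _ = fun n => series a n + series q n); first exact: cvgD.
by apply/funext => n; rewrite /series /= big_split.
Qed.

Lemma cvg_series_abs a q (l : R) : (forall k, `|a k| <= q k) ->
  series q @ \oo --> l -> exists2 m, series a @ \oo --> m & `|m| <= l.
Proof.
move=> aq ql.
have q0 k : 0 <= q k by exact: le_trans (aq k).
have ca : cvgn (series (fun k => `|a k|)).
  by apply: (series_le_cvg _ q0 aq) => //; apply/cvg_ex; exists l.
have ca' : cvgn (series a) by exact: normed_cvg.
exists (limn (series a)) => //; apply: le_trans (lim_series_norm ca) _.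
rewrite -(cvg_lim _ ql) //; apply: lim_series_le => //.
by apply/cvg_ex; exists l.
Qed.

Lemma cvg_seriesS a (l : R) : series a @ \oo --> l ->
  series (fun k => a k.+1) @ \oo --> l - a 0%N.
Proof.
move=> al; rewrite (_ : series _ = fun n => series a n.+1 - a 0%N).
  by apply: cvgB; [rewrite (cvg_shiftS (series a))|exact: cvg_cst].
by apply/funext => n; rewrite /series /= big_nat_recl // addrAC subrr add0r.
Qed.

Lemma cvg_powR (T : Type) {F : set_system T} {FF : Filter F} (u : T -> R) (p l : R) :
  0 < l -> u x @[x --> F] --> l -> u x `^ p @[x --> F] --> l `^ p.
Proof.
move=> l0 ul; apply: (@cvg_comp _ _ _ u (fun z : R => z `^ p) F (nbhs l)) => //.
have : differentiable (fun z : R => z `^ p) l; last exact: differentiable_continuous.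
apply/derivable1_diffP.
by have /@ex_derive := is_derive1_powR p l0.
Qed.

(* [a k] is compared with the telescoping differences of [k ^ (- g)]. *)
Lemma cvg_tail a (g c l : R) : 0 < g -> series a @ \oo --> l ->
  a k * k%:R `^ (1 + g) @[k --> \oo] --> c ->
  (l - series a m) * m%:R `^ g @[m --> \oo] --> c / g.
Proof.
move=> g0 al ac.
pose b k : R := k%:R `^ (- g).
pose d k := b k - b k.+1.
have b0 : b @ \oo --> 0 by exact: cvg_powRN0.
have b1 : d k * k%:R `^ (1 + g) @[k --> \oo] --> g.
  apply: (squeeze_cvgr (f := fun k : nat => g * (1 - k.+1%:R^-1) `^ (1 + g)) (h := fun=> g)).
  - near=> k; have k0 : (0 < k)%N by near: k; exists 1%N.
    have k0' : 0 < k%:R :> R by rewrite ltr0n.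
    have /andP[lo hi] := powRN_tele g0 k0; apply/andP; split.
      have -> : 1 - k.+1%:R^-1 = k%:R / k.+1%:R :> R.
        by rewrite -natr1; field; rewrite natr1 pnatr_eq0.
      rewrite powRM ?invr_ge0 ?ler0n // -powR_inv1 ?ler0n // -powRrM mulN1r mulrCA mulrC.
      by rewrite ler_wpM2r ?powR_ge0.
    rewrite (le_trans (ler_wpM2r (powR_ge0 _ _) hi)) // -mulrA powRN mulVf ?mulr1 //.
    by rewrite gt_eqF // powR_gt0.
  - rewrite -[X in _ --> X]mulr1; apply: cvgMr.
    suff : (1 - k.+1%:R^-1 : R) `^ (1 + g) @[k --> \oo] --> (1 : R) `^ (1 + g) by rewrite powR1.
    apply: (@cvg_powR nat \oo _ (fun k : nat => 1 - k.+1%:R^-1)) => //.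
    by rewrite -[X in _ --> X]subr0; apply: cvgB; [exact: cvg_cst|exact: cvg_harmonic].
  - exact: cvg_cst.
have ab : (a k - c / g * d k) * k%:R `^ (1 + g) @[k --> \oo] --> 0.
  have h : a k * k%:R `^ (1 + g) - c / g * (d k * k%:R `^ (1 + g)) @[k --> \oo]
      --> c - c / g * g by apply: cvgB => //; apply: cvgMr.
  move: h; rewrite mulfVK ?gt_eqF // subrr; apply: cvg_trans; apply: near_eq_cvg.
  by apply: nearW => k /=; ring.
have key e : 0 < e -> \forall m \near \oo, `|l - series a m - c / g * b m| <= e * b m.
  move=> e0.
  have eg0 : 0 < e * (g / 2) by rewrite mulr_gt0 // divr_gt0.
  have : \forall k \near \oo, `|a k - c / g * d k| <= e * d k.
    near=> k; have k0 : (0 < k)%N by near: k; exists 1%N.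
    have kp : 0 < k%:R `^ (1 + g) :> R by rewrite powR_gt0 // ltr0n.
    rewrite -(ler_pM2r kp) -[X in `|_| * X](gtr0_norm kp) -normrM -[X in _ <= X]mulrA.
    apply: (@le_trans _ _ (e * (g / 2))).
      near: k; have /cvgrPdist_le/(_ _ eg0) := ab.
      by apply: filterS => k' /=; rewrite sub0r normrN.
    rewrite ler_pM2l //; near: k; apply: (cvgr_ge _ b1).
    by rewrite ltr_pdivrMr // ltr_pMr // ltr1n.
  move=> -[k0 _ hk]; exists k0 => // m /= km.
  have bound M : (m <= M)%N -> `|series a M - series a m - c / g * (b m - b M)| <= e * (b m - b M).
    elim: M => [|M IH]; first by rewrite leqn0 => /eqP ->; rewrite !subrr !mulr0 subr0 normr0.
    rewrite leq_eqVlt => /predU1P[->|mM]; first by rewrite !subrr !mulr0 subr0 normr0.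
    have -> : series a M.+1 - series a m - c / g * (b m - b M.+1) =
      (series a M - series a m - c / g * (b m - b M)) + (a M - c / g * d M).
      by rewrite seriesSr /d; ring.
    have -> : e * (b m - b M.+1) = e * (b m - b M) + e * d M by rewrite /d; ring.
    apply: le_trans (ler_normD _ _) _; apply: lerD; first exact: IH.
    by apply: hk => /=; exact: leq_trans km _.
  have lim1 : `|series a M - series a m - c / g * (b m - b M)| @[M --> \oo] -->
      `|l - series a m - c / g * b m|.
    have -> : l - series a m - c / g * b m = l - series a m - c / g * (b m - 0) by rewrite subr0.
    apply: cvg_norm; apply: cvgB.
      by apply: cvgB => //; exact: cvg_cst.
    by apply: cvgMr; apply: cvgB => //; exact: cvg_cst.
  rewrite -(cvg_lim _ lim1) //; apply: limr_le; first by apply/cvg_ex; eexists; exact: lim1.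
  exists m => // M /= mM; apply: le_trans (bound _ mM) _.
  by rewrite ler_pM2l // gerBl powR_ge0.
apply/cvgrPdist_le => e e0; near=> m.
have m0 : 0 < m%:R `^ g :> R by rewrite powR_gt0 // ltr0n; near: m; exists 1%N.
have : `|l - series a m - c / g * b m| <= e * b m by near: m; exact: key.
rewrite /b powRN ler_pdivlMr // -[X in `|_| * X](gtr0_norm m0) -normrM.
by rewrite mulrBl mulfVK ?gt_eqF // distrC.
Unshelve. all: by end_near. Qed.

End NonnegSeries.

(** The additional term [a m] is of order [m ^ (- 1 - g)], negligible against the tail. *)
Lemma cvg_tailS (R : realType) (a : nat -> R) (g c l : R) : 0 < g -> series a @ \oo --> l ->
  a k * k%:R `^ (1 + g) @[k --> \oo] --> c ->
  (l - series a m.+1) * m%:R `^ g @[m --> \oo] --> c / g.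
Proof.
move=> g0 al ac; have h := cvg_tail g0 al ac.
have h' : a m * m%:R `^ g @[m --> \oo] --> (0 : R).
  have h2 : a m * m%:R `^ (1 + g) * m%:R `^ (- 1) @[m --> \oo] --> c * 0.
    by apply: cvgM => //; apply: cvg_powRN0.
  move: h2; rewrite mulr0; apply: cvg_trans; apply: near_eq_cvg; near=> m.
  rewrite -mulrA -powRD; first by congr (_ * _ `^ _); ring.
  by rewrite pnatr_eq0 -lt0n; apply/implyP => _; near: m; exists 1%N.
have h2 : (l - series a m) * m%:R `^ g - a m * m%:R `^ g @[m --> \oo] --> c / g - 0.
  exact: cvgB.
move: h2; rewrite subr0; apply: cvg_trans; apply: near_eq_cvg.
by apply: nearW => m /=; rewrite seriesSr; ring.
Unshelve. all: by end_near. Qed.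

(** * Integrals on segments and the Gamma integral *)

Section Integrals.
Variable R : realType.
Implicit Types (f g : R -> R) (a b c : R).
Local Notation mu := (@lebesgue_measure R).

Definition itg a b f : R := \int[mu]_(x in `[a, b]) f x.

Lemma itg_integrable a b f : {within `[a, b], continuous f} ->
  mu.-integrable `[a, b] (EFin \o f).
Proof. by move=> cf; apply: continuous_compact_integrable => //; exact: segment_compact. Qed.

Lemma itg_le a b f g : {within `[a, b], continuous f} -> {within `[a, b], continuous g} ->
  (forall x, a <= x <= b -> f x <= g x) -> itg a b f <= itg a b g.
Proof.
move=> cf cg fg; apply: le_Rintegral => //; try exact: itg_integrable.
Qed.

Lemma itg_FTC a b f F : a < b -> {within `[a, b], continuous f} ->
  (forall x, a <= x <= b -> is_derive x 1 F (f x)) -> itg a b f = F b - F a.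
Proof.
move=> ab cf dF; rewrite /itg /Rintegral.
have dF' x : a <= x <= b -> derivable F x 1 by move=> /dF h; exact: ex_derive.
rewrite (@continuous_FTC2 _ f F) //; last first.
  by move=> x /=; rewrite in_itv /= derive1E => /andP[ax xb]; apply: derive_val; apply: dF; rewrite !ltW.
split=> [x|  |].
- by rewrite in_itv /= => /andP[ax xb]; apply: dF'; rewrite !ltW.
- apply: cvg_at_right_filter; apply: differentiable_continuous; apply/derivable1_diffP.
  by apply: dF'; rewrite lexx ltW.
- apply: cvg_at_left_filter; apply: differentiable_continuous; apply/derivable1_diffP.
  by apply: dF'; rewrite lexx ltW.
Qed.

Lemma itg_cat a b c f : a <= b -> b <= c -> {within `[a, c], continuous f} ->
  itg a c f = itg a b f + itg b c f.
Proof.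
move=> ab bc cf; have If := itg_integrable cf.
have := @Rintegral_itvB R f (BLeft a) (BRight c) b If; rewrite !bnd_simp => /(_ ab bc).
rewrite Rintegral_itv_obnd_cbnd => [e|]; first by rewrite /itg -e addrC subrK.
by apply: integrableS If => //; apply: subset_itv; rewrite bnd_simp.
Qed.

Lemma itg_cst a b k : a <= b -> itg a b (fun=> k) = k * (b - a).
Proof.
rewrite le_eqVlt => /predU1P[->|ab].
  by rewrite /itg set_itv1 Rintegral_set1 subrr mulr0.
have dk (t : R) : a <= t <= b -> is_derive t 1 (fun t => k * t) k.
  by move=> _; apply: is_derive_eq; rewrite /GRing.scale /= mulr1.
have ck : {within `[a, b], continuous (fun _ : R => k)}.
  by apply: continuous_subspaceT => t; exact: cvg_cst.
by rewrite (itg_FTC ab ck dk) mulrBr.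
Qed.

End Integrals.

Section GammaIntegral.
Variable R : realType.
Local Notation mu := (@lebesgue_measure R).
Variable x : R.
Hypothesis x01 : 0 < x < 1.
Let g (t : R) : R := t `^ (x - 1) * expR (- t).

Let x_gt0 : 0 < x. Proof. by case/andP: x01. Qed.

Lemma gamma_fun_cont (t : R) : 0 < t -> {for t, continuous g}.
Proof.
move=> t0; apply: cvgM; first by apply: cvg_powR.
by apply: continuous_comp; [exact: opp_continuous|exact: continuous_expR].
Qed.

Lemma gamma_fun_within (a b : R) : 0 < a -> {within `[a, b], continuous g}.
Proof.
move=> a0; apply: continuous_in_subspaceT => t; rewrite inE /= in_itv /= => /andP[at_ _].
by apply: gamma_fun_cont; exact: lt_le_trans at_.
Qed.

Lemma gamma_fun_dec (s t : R) : 0 < s -> s <= t -> g t <= g s.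
Proof.
move=> s0 st; have t0 : 0 < t by exact: lt_le_trans st.
apply: ler_pM; rewrite ?powR_ge0 ?expR_ge0 //; last by rewrite ler_expR lerN2.
rewrite -[x - 1]opprB !powRN lef_pV2 ?posrE ?powR_gt0 //.
by rewrite ge0_ler_powR ?nnegrE ?(ltW s0) ?(ltW t0) // subr_ge0 ltW //; case/andP: x01.
Qed.

Lemma gamma_fun_ge0 t : 0 <= g t.
Proof. by rewrite mulr_ge0 ?powR_ge0 ?expR_ge0. Qed.

(** Below 1 the integrand is compared with [t ^ (x - 1)], whose integral is at most [1 / x], and
    above 1 with [exp (- t)]. *)
Lemma gamma_fun_itg_bound (a b : R) : 0 < a -> a <= 1 -> 1 <= b -> itg a b g <= x^-1 + 1.
Proof.
move=> a0 a1 b1; rewrite (@itg_cat _ _ 1) //; last exact: gamma_fun_within.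
apply: lerD.
  have [->|a1'] := eqVneq a 1.
    by rewrite /itg set_itv1 Rintegral_set1 invr_ge0 ltW.
  have {}a1' : a < 1 by rewrite lt_neqAle a1' a1.
  have cp : {within `[a, 1], continuous (fun t : R => t `^ (x - 1))}.
    apply: continuous_in_subspaceT => t; rewrite inE /= in_itv /= => /andP[at_ _].
    by apply: cvg_powR; [exact: lt_le_trans at_|].
  apply: (@le_trans _ _ (itg a 1 (fun t : R => t `^ (x - 1)))).
    apply: itg_le => //; first exact: gamma_fun_within.
    move=> t /andP[at_ _]; rewrite ler_piMr ?powR_ge0 // -expR0 ler_expR oppr_le0.
    by rewrite ltW // (lt_le_trans a0).
  have dp (t : R) : a <= t <= 1 -> is_derive t 1 (fun t => x^-1 * t `^ x) (t `^ (x - 1)).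
    move=> /andP[at_ _]; have t0 : 0 < t by exact: lt_le_trans at_.
    have -> : t `^ (x - 1) = x^-1 *: (x * t `^ (x - 1)).
      by rewrite /GRing.scale /= mulrA mulVf ?mul1r // gt_eqF.
    by apply: is_deriveZ; exact: is_derive1_powR.
  rewrite (itg_FTC a1' cp dp) powR1 mulr1 gerBl mulr_ge0 ?powR_ge0 // invr_ge0.
  exact: ltW.
have [->|b1'] := eqVneq b 1; first by rewrite /itg set_itv1 Rintegral_set1.
have {}b1' : 1 < b by rewrite lt_neqAle eq_sym b1' b1.
have ce : {within `[1, b], continuous (fun t : R => expR (- t))}.
  apply: continuous_subspaceT => t.
  by apply: continuous_comp; [exact: opp_continuous|exact: continuous_expR].
apply: (@le_trans _ _ (itg 1 b (fun t : R => expR (- t)))).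
  apply: itg_le => //; first exact: gamma_fun_within.
  move=> t /andP[t1 _]; rewrite ler_piMl ?expR_ge0 //.
  have t0 : 0 < t by exact: lt_le_trans t1.
  have : 1 `^ (1 - x) <= t `^ (1 - x).
    by rewrite ge0_ler_powR ?nnegrE ?(ltW t0) // subr_ge0 ltW //; case/andP: x01.
  by rewrite powR1 -[x - 1]opprB powRN invf_le1 ?powR_gt0.
have de (t : R) : 1 <= t <= b -> is_derive t 1 (fun t => - expR (- t)) (expR (- t)).
  by move=> _; apply: is_derive_eq; rewrite /GRing.scale /=; ring.
rewrite (itg_FTC b1' ce de) opprK (@le_trans _ _ (expR (-1))) //.
  by rewrite gerDr oppr_le0 expR_ge0.
Qed.

(** Monotone convergence along segments that exhaust the half-line. After this, only integrals of
    continuous functions over segments have to be handled. *)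
Lemma Gamma_integral_lim :
  itg n.+1%:R^-1 n.+1%:R g @[n --> \oo] --> Gamma_integral x.
Proof.
pose D : set R := `]0, +oo[%classic.
pose F n : set R := `[n.+1%:R^-1, n.+1%:R]%classic.
have mg : measurable_fun D (EFin \o g).
  apply/measurable_EFinP; apply: open_continuous_measurable_fun; first exact: interval_open.
  by move=> t; rewrite inE /D /= in_itv /= andbT => t0; exact: gamma_fun_cont.
have ndF : nondecreasing_seq F.
  move=> m n mn; apply/subsetPset; apply: subset_itv; rewrite bnd_simp.
    by rewrite lef_pV2 ?posrE ?ltr0n // ler_nat.
  by rewrite ler_nat.
have UF : \bigcup_n F n = D.
  rewrite /D; apply/seteqP; split => t /=.
    by move=> [n _]; rewrite /F /= !in_itv /= andbT => /andP[nt _]; apply: lt_le_trans nt; rewrite invr_gt0 ltr0n.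
  rewrite in_itv /= andbT => t0.
  pose n := Num.truncn (Num.max t t^-1).
  exists n => //; rewrite /F /= in_itv /=.
  have : Num.max t t^-1 < n.+1%:R by exact: truncnS_gt.
  rewrite gt_max => /andP[tn tVn]; rewrite (ltW tn) andbT.
  by rewrite -[t]invrK lef_pV2 ?posrE ?invr_gt0 ?ltr0n // ltW.
have Fsub n : F n `<=` D by rewrite -UF; exact: bigcup_sup.
have cvgE : (\int[mu]_(t in F n) (g t)%:E)%E @[n --> \oo] -->
    (\int[mu]_(t in D) (g t)%:E)%E.
  rewrite -UF; apply: ge0_nondecreasing_set_cvg_integral => //.
  - by move=> i; exact: measurable_itv.
  - by move=> i; apply: (@measurable_funS _ _ _ _ D) => //; exact: measurable_itv.
  - by move=> i t _; rewrite lee_fin gamma_fun_ge0.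
have IE n : (\int[mu]_(t in F n) (g t)%:E)%E = (itg n.+1%:R^-1 n.+1%:R g)%:E.
  rewrite /itg /Rintegral fineK //; apply: integrable_fin_num => //.
  by apply: itg_integrable; apply: gamma_fun_within; rewrite invr_gt0 ltr0n.
have Ifin : (\int[mu]_(t in D) (g t)%:E)%E \is a fin_num.
  rewrite ge0_fin_numE; last by apply: integral_ge0 => t _; rewrite lee_fin gamma_fun_ge0.
  apply: (@le_lt_trans _ _ (x^-1 + 1)%:E); last exact: ltry.
  rewrite -(cvg_lim _ cvgE) //; apply: lime_le; first by apply/cvg_ex; eexists; exact: cvgE.
  apply: nearW => n; rewrite IE lee_fin; apply: gamma_fun_itg_bound.
  - by rewrite invr_gt0 ltr0n.
  - by rewrite invf_le1 ?ltr0n // ler1n.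
  - by rewrite ler1n.
rewrite /Gamma_integral /Rintegral -/D.
have h : (\int[mu]_(t in F n) (g t)%:E)%E @[n --> \oo] -->
    (fine (\int[mu]_(t in D) (g t)%:E)%E)%:E by rewrite fineK.
have h2 : fine (\int[mu]_(t in F n) (g t)%:E)%E @[n --> \oo] -->
    fine (\int[mu]_(t in D) (g t)%:E)%E by exact: fine_cvg h.
move: h2; by apply: cvg_trans; apply: near_eq_cvg; apply: nearW => n /=; rewrite IE.
Qed.

Lemma itg_le_Gamma (a b : R) : 0 < a -> a <= b -> itg a b g <= Gamma_integral x.
Proof.
move=> a0 ab; rewrite -(cvg_lim _ Gamma_integral_lim) //.
apply: limr_ge; first by apply/cvg_ex; eexists; exact: Gamma_integral_lim.
near=> n.
have na : n.+1%:R^-1 <= a.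
  rewrite -[a]invrK lef_pV2 ?posrE ?invr_gt0 ?ltr0n //.
  apply: (@le_trans _ _ n%:R); last by rewrite ler_nat.
  by near: n; exact: nbhs_infty_ger.
have nb : b <= n.+1%:R.
  apply: (@le_trans _ _ n%:R); last by rewrite ler_nat.
  by near: n; exact: nbhs_infty_ger.
have n0 : 0 < n.+1%:R^-1 :> R by rewrite invr_gt0 ltr0n.
rewrite (@itg_cat _ n.+1%:R^-1 a n.+1%:R) // ?(le_trans ab) //; last exact: gamma_fun_within.
rewrite (@itg_cat _ a b n.+1%:R) //; last exact: gamma_fun_within.
have pos u v : 0 <= itg u v g by apply: Rintegral_ge0 => t _; exact: gamma_fun_ge0.
by rewrite addrCA lerDl addr_ge0.
Unshelve. all: by end_near. Qed.

Lemma Gamma_integral_gt0 : 0 < Gamma_integral x.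
Proof.
apply: lt_le_trans (itg_le_Gamma ltr01 (_ : 1 <= 2)); last by rewrite ler1n.
apply: (@lt_le_trans _ _ (itg 1 2 (fun=> g 2))).
  rewrite itg_cst ?ler1n // pmulr_lgt0; first by rewrite mulr_gt0 ?powR_gt0 ?expR_gt0.
  by rewrite subr_gt0 ltr1n.
apply: itg_le; first by apply: continuous_subspaceT => t; exact: cvg_cst.
  exact: gamma_fun_within.
by move=> t /andP[t1 t2]; apply: gamma_fun_dec => //; exact: lt_le_trans t1.
Qed.

End GammaIntegral.

(** * Abelian theorems *)

Section Abelian.
Variable R : realType.
Implicit Types (a q : nat -> R) (x z s : R).

Definition psum a z : R := limn (series (fun n => a n * z ^+ n)).

Lemma psum_cvg a z M : (forall n, `|a n| <= M) -> `|z| < 1 ->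
  series (fun n => a n * z ^+ n) @ \oo --> psum a z.
Proof.
move=> aM z1; apply: normed_cvg.
apply: (@series_le_cvg _ _ (geometric M `|z|)) => [n|n|n|].
- exact: normr_ge0.
- by rewrite /= mulr_ge0 ?exprn_ge0 // (le_trans _ (aM 0%N)).
- by rewrite /= normrM normrX ler_wpM2r ?exprn_ge0.
- by apply: is_cvg_geometric_series; rewrite normr_id.
Qed.

Lemma psum_cvg1 a z (w : nat -> R) (l : R) : (forall n, `|a n| <= w n) ->
  series w @ \oo --> l -> 0 <= z <= 1 ->
  series (fun n => a n * z ^+ n) @ \oo --> psum a z.
Proof.
move=> aw wl /andP[z0 z1]; have [n|m hm _] := @cvg_series_abs _ (fun n => a n * z ^+ n) w l _ wl.
  rewrite normrM (le_trans _ (aw n)) // ler_piMr // normrX exprn_ile1 //.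
  by rewrite ger0_norm.
by rewrite /psum (cvg_lim _ hm).
Qed.

(** Summation by parts: the deficit at [z] is [1 - z] times the generating function of the tails. A
    small deficit thus becomes a divergent transform, to which [abelian] applies. *)
Lemma psum_tail q (l : R) z : (forall k, 0 <= q k) -> series q @ \oo --> l -> 0 <= z < 1 ->
  l - psum q z = (1 - z) * psum (fun m => l - series q m.+1) z.
Proof.
move=> q0 ql /andP[z0 z1].
pose T m := l - series q m.+1.
have tb m : 0 <= l - series q m <= l.
  rewrite subr_ge0 nnseries_le // gerBl.
  by rewrite /series /= sumr_ge0.
have qb n : `|q n| <= l.
  rewrite ger0_norm // (le_trans _ (nnseries_le n.+1 q0 ql)) // /series /= big_nat_recr //=.
  by rewrite lerDr sumr_ge0.
have zn : `|z| < 1 by rewrite ger0_norm.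
have cq := psum_cvg qb zn.
have cT : series (fun m => T m * z ^+ m) @ \oo --> psum T z.
  apply: (@psum_cvg _ _ l) => // n; have /andP[t0 tl] := tb n.+1.
  by rewrite ger0_norm.
have id M : (1 - z) * series (fun m => T m * z ^+ m) M =
    l - series (fun n => q n * z ^+ n) M - (l - series q M) * z ^+ M.
  elim: M => [|M IH]; first by rewrite /series /= !big_geq // expr0; ring.
  rewrite !(seriesSr _ M) mulrDr IH /T exprS !(seriesSr _ M); ring.
have c0 : (l - series q M) * z ^+ M @[M --> \oo] --> 0.
  rewrite -[X in _ --> X](mulr0 (l - l)); apply: cvgM.
    by apply: cvgB => //; exact: cvg_cst.
  exact: cvg_expr.
have h1 : (1 - z) * series (fun m => T m * z ^+ m) M @[M --> \oo] --> (1 - z) * psum T z.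
  exact: cvgMr.
have h2 : (1 - z) * series (fun m => T m * z ^+ m) M @[M --> \oo] --> l - psum q z - 0.
  under eq_fun do rewrite id; apply: cvgB => //; apply: cvgB => //; exact: cvg_cst.
by rewrite -[LHS]subr0; apply: cvg_unique h2 h1.
Qed.

(** With [g t = t ^ (x - 1) exp (- t)], the left-hand side is the Riemann sum of [g] of mesh [s]. As
    [g] decreases, this sum lies between integrals of [g], up to its first term. *)
Lemma abelian_pow x : 0 < x < 1 ->
  s `^ x * psum (fun n => n%:R `^ (x - 1)) (expR (- s)) @[s --> 0^'+] --> Gamma_integral x.
Proof.
move=> x01; have /andP[x0 x1] := x01.
pose g (t : R) : R := t `^ (x - 1) * expR (- t).
have x1n : x - 1 != 0 by rewrite subr_eq0 lt_eqF.
have stepE s n : 0 < s ->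
    s `^ x * (n%:R `^ (x - 1) * expR (- s) ^+ n) = s * g (n%:R * s).
  move=> s0; rewrite /g powRM ?ler0n ?(ltW s0) // -expRM_natl mulrN.
  rewrite -(mulr_powRB1 (ltW s0) x0); ring.
have gwithin u v : 0 < u -> {within `[u, v], continuous g} by exact: gamma_fun_within.
have blk u v : 0 < u -> u <= v -> (v - u) * g v <= itg u v g <= (v - u) * g u.
  move=> u0 uv; rewrite mulrC -itg_cst // [X in _ <= _ <= X]mulrC -itg_cst //.
  have ck (k : R) : {within `[u, v], continuous (fun _ : R => k)}.
    by apply: continuous_subspaceT => t; exact: cvg_cst.
  apply/andP; split; apply: itg_le => //; try exact: gwithin; move=> t /andP[ut tv].
    by apply: gamma_fun_dec => //; exact: lt_le_trans ut.
  by apply: gamma_fun_dec.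
have up s M : 0 < s -> \sum_(1 <= n < M.+2) s * g (n%:R * s) <= s * g s + itg s (M.+1%:R * s) g.
  move=> s0; elim: M => [|M IH].
    by rewrite big_nat1 !mul1r lerDl /itg set_itv1 Rintegral_set1.
  rewrite big_nat_recr //= (le_trans (lerD IH (lexx _))) // -addrA lerD2l.
  have uv : M.+1%:R * s <= M.+2%:R * s by rewrite ler_wpM2r ?(ltW s0) // ler_nat.
  have u0 : 0 < M.+1%:R * s by rewrite mulr_gt0.
  rewrite (@itg_cat _ s (M.+1%:R * s) (M.+2%:R * s)) //; last exact: gwithin.
    rewrite lerD2l; have /andP[+ _] := blk _ _ u0 uv.
    by apply: le_trans; rewrite -mulrBl -[M.+2%:R]natr1 addrAC subrr add0r mul1r.
  by rewrite ler_peMl ?(ltW s0) // ler1n.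
have dn s M : 0 < s -> itg s (M.+1%:R * s) g <= \sum_(1 <= n < M.+1) s * g (n%:R * s).
  move=> s0; elim: M => [|M IH].
    by rewrite big_geq // mul1r /itg set_itv1 Rintegral_set1.
  have uv : M.+1%:R * s <= M.+2%:R * s by rewrite ler_wpM2r ?(ltW s0) // ler_nat.
  have u0 : 0 < M.+1%:R * s by rewrite mulr_gt0.
  rewrite (@itg_cat _ s (M.+1%:R * s) (M.+2%:R * s)) //; last exact: gwithin.
    rewrite big_nat_recr //= lerD //; have /andP[_] := blk _ _ u0 uv.
    by move/le_trans; apply; rewrite -mulrBl -[M.+2%:R]natr1 addrAC subrr add0r mul1r.
  by rewrite ler_peMl ?(ltW s0) // ler1n.
pose w n : R := n%:R `^ (x - 1).
have wb n : `|w n| <= 1.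
  rewrite ger0_norm ?powR_ge0 // /w; have [->|n0] := posnP n; first by rewrite powR0 // ler01.
  rewrite -[x - 1]opprB powRN invf_le1 ?powR_gt0 ?ltr0n //.
  have : 1 `^ (1 - x) <= n%:R `^ (1 - x) :> R.
    by rewrite ge0_ler_powR ?nnegrE ?ler0n ?ler1n // subr_ge0 ltW.
  by rewrite powR1.
have cs s : 0 < s -> \sum_(1 <= n < M.+2) s * g (n%:R * s) @[M --> \oo] --> s `^ x * psum w (expR (- s)).
  move=> s0; have y1 : `|expR (- s)| < 1 by rewrite ger0_norm ?expR_ge0 // expR_lt1 oppr_lt0.
  have h : s `^ x * series (fun n => w n * expR (- s) ^+ n) M @[M --> \oo]
      --> s `^ x * psum w (expR (- s)) by apply: cvgMr; exact: psum_cvg wb y1.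
  have := h; rewrite -(cvg_shiftn 2); apply: cvg_trans; apply: near_eq_cvg; apply: nearW => M /=.
  (* By convention 0 raised to a nonzero power is 0, even for this negative exponent, so the term
     [n = 0] vanishes and the Riemann sum starts at [n = 1]. *)
  rewrite addn2 /series /= big_nat_recl // {1}/w powR0 // mul0r add0r mulr_sumr big_add1 /=.
  by apply: eq_bigr => n _; rewrite stepE.
have hup s : 0 < s -> s `^ x * psum w (expR (- s)) <= s `^ x + Gamma_integral x.
  move=> s0; rewrite -(cvg_lim _ (cs _ s0)) //; apply: limr_le.
    by apply/cvg_ex; eexists; exact: cs.
  apply: nearW => M; apply: le_trans (up _ _ s0) _; apply: lerD.
    rewrite -[X in s * g X]mul1r -(stepE _ 1%N) // ler_piMr ?powR_ge0 // powR1 mul1r.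
    by rewrite expr1 -expR0 ler_expR oppr_le0 ltW.
  by apply: itg_le_Gamma => //; rewrite ler_peMl ?(ltW s0) // ler1n.
have hdn (s : R) (a b : R) : 0 < s -> s <= a -> a <= b -> itg a b g <= s `^ x * psum w (expR (- s)).
  move=> s0 sa ab; have a0 : 0 < a by exact: lt_le_trans sa.
  rewrite -(cvg_lim _ (cs _ s0)) //; apply: limr_ge.
    by apply/cvg_ex; eexists; exact: cs.
  near=> M; apply: le_trans (dn _ _ s0).
  have bM : b <= M.+2%:R * s.
    rewrite -ler_pdivrMr // (@le_trans _ _ M%:R) ?ler_nat //; last by rewrite -addn2 leq_addr.
    by near: M; exact: nbhs_infty_ger.
  rewrite (@itg_cat _ s a (M.+2%:R * s)) //; [|exact: le_trans ab bM|exact: gwithin].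
  rewrite (@itg_cat _ a b (M.+2%:R * s)) //; last exact: gwithin.
  have pos u v : 0 <= itg u v g by apply: Rintegral_ge0 => t _; exact: gamma_fun_ge0.
  by rewrite addrCA lerDl addr_ge0.
have hG := Gamma_integral_lim x01.
apply/cvgrPdist_le => e e0.
have [n0 hn0] : exists n, Gamma_integral x - itg n.+1%:R^-1 n.+1%:R g <= e.
  have /cvgrPdist_le/(_ _ e0)[n _ /(_ n)] := hG.
  by move=> /(_ (leqnn _)) h; exists n; exact: le_trans (ler_norm _) h.
pose a := n0.+1%:R^-1 : R; pose b := n0.+1%:R : R.
have a0 : 0 < a by rewrite invr_gt0 ltr0n.
have ab : a <= b by rewrite (@le_trans _ _ 1) ?invf_le1 ?ltr0n ?ler1n.
near=> s; have s0 : 0 < s by near: s; exact: nbhs_right_gt.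
have sa : s <= a by near: s; apply: nbhs_right_le.
have sx : s `^ x <= e.
  by near: s; apply: (cvgr_le _ (powR_cvg0 x0)).
rewrite distrC ler_norml; apply/andP; split.
  by have := hdn _ _ _ s0 sa ab; move: hn0; rewrite -/a -/b; lra.
by have := hup _ s0; move: sx; rewrite -/w; lra.
Unshelve. all: by end_near. Qed.

(** The sequence is split into [c] times the model [w] and a remainder [u]. For large [n] the
    remainder is at most a small multiple of the model, and the finitely many other terms are killed
    by the factor [s ^ x]. *)
Lemma abelian x a (c : R) : 0 < x < 1 -> a n * n%:R `^ (1 - x) @[n --> \oo] --> c ->
  s `^ x * psum a (expR (- s)) @[s --> 0^'+] --> c * Gamma_integral x.
Proof.
move=> x01 ac; have /andP[x0 x1] := x01.
pose w n : R := n%:R `^ (x - 1).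
pose u n := a n - c * w n.
have x1n : x - 1 != 0 by rewrite subr_eq0 lt_eqF.
have wb n : `|w n| <= 1.
  rewrite ger0_norm ?powR_ge0 // /w; have [->|n0] := posnP n; first by rewrite powR0 // ler01.
  rewrite -[x - 1]opprB powRN invf_le1 ?powR_gt0 ?ltr0n //.
  have : 1 `^ (1 - x) <= n%:R `^ (1 - x) :> R.
    by rewrite ge0_ler_powR ?nnegrE ?ler0n ?ler1n // subr_ge0 ltW.
  by rewrite powR1.
have ub e : 0 < e -> exists n0, forall n, (n0 <= n)%N -> `|u n| <= e * w n.
  move=> e0; have /cvgrPdist_le/(_ _ e0)[n0 _ h] := ac.
  exists n0.+1 => n n0n; have n_gt0 : (0 < n)%N by exact: leq_ltn_trans n0n.
  have wp : 0 < w n by rewrite powR_gt0 // ltr0n.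
  have := h n (ltnW n0n); rewrite -(ler_pM2r wp) -[X in `|_| * X](gtr0_norm wp) -normrM.
  rewrite mulrBl -mulrA [X in a n * X](_ : _ = 1); first by rewrite mulr1 distrC.
  rewrite /w -powRD; first by rewrite (_ : 1 - x + (x - 1) = 0) ?powRr0 //; ring.
  by rewrite pnatr_eq0 -lt0n n_gt0 implybT.
have [n1 hn1] := ub 1 ltr01.
have [K hK] : exists K, forall n, `|u n| <= K + w n.
  exists (\sum_(k < n1) `|u k|) => n; have [n1n|nn1] := leqP n1 n.
    by rewrite (le_trans (hn1 _ n1n)) // mul1r lerDr sumr_ge0.
  by rewrite (bigD1 (Ordinal nn1)) //= -addrA lerDl addr_ge0 ?sumr_ge0 // powR_ge0.
have uB n : `|u n| <= K + 1 by rewrite (le_trans (hK n)) // lerD2l (le_trans (ler_norm _) (wb n)).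
have aE s : 0 < s -> psum a (expR (- s)) = c * psum w (expR (- s)) + psum u (expR (- s)).
  move=> s0; have y1 : `|expR (- s)| < 1 by rewrite ger0_norm ?expR_ge0 // expR_lt1 oppr_lt0.
  have := cvg_seriesD (cvg_seriesZ (c := c) (psum_cvg wb y1)) (psum_cvg uB y1).
  rewrite {1}/psum => /cvg_lim <- //; congr (limn (series _)); apply/funext => n.
  by rewrite /u; ring.
have key e : 0 < e -> \forall s \near 0^'+, `|s `^ x * psum u (expR (- s))| <= e.
  move=> e0.
  have G0 := Gamma_integral_gt0 x01.
  pose d := e / (2 * (Gamma_integral x + 1)).
  have d0 : 0 < d by rewrite divr_gt0 // mulr_gt0 // addr_gt0.
  have [n0 hn0] := ub d d0.
  pose f n := if (n < n0)%N then `|u n| else 0.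
  pose L := \sum_(k < n0) `|u k|.
  have fL : series f @ \oo --> L.
    apply: cvg_near_cst; exists n0 => // n /= n0n; rewrite /series /= (big_cat_nat (n := n0)) //=.
    rewrite [X in _ + X]big1_seq ?addr0 => [|k /andP[_]]; last first.
      by rewrite mem_index_iota /f => /andP[n0k _]; rewrite ltnNge n0k.
    by rewrite big_mkord; apply: eq_bigr => k _; rewrite /f ltn_ord.
  have L0 : 0 <= L by rewrite sumr_ge0.
  near=> s; have s0 : 0 < s by near: s; exact: nbhs_right_gt.
  have y1 : `|expR (- s)| < 1 by rewrite ger0_norm ?expR_ge0 // expR_lt1 oppr_lt0.
  have [n|m hm mle] := @cvg_series_abs _ (fun n => u n * expR (- s) ^+ n)
    (fun n => f n + d * (w n * expR (- s) ^+ n)) (L + d * psum w (expR (- s))) _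
    (cvg_seriesD fL (cvg_seriesZ (c := d) (psum_cvg wb y1))).
    rewrite normrM normrX (ger0_norm (expR_ge0 _)) mulrA.
    have yn0 : 0 <= expR (- s) ^+ n by rewrite exprn_ge0 // expR_ge0.
    have yn1 : expR (- s) ^+ n <= 1 by rewrite exprn_ile1 ?expR_ge0 // -expR0 ler_expR oppr_le0 ltW.
    rewrite /f; case: ltnP => [_|n0n].
      apply: (@le_trans _ _ `|u n|); first by rewrite ler_piMr.
        rewrite lerDl; apply: mulr_ge0 => //; apply: mulr_ge0; [exact: ltW|exact: powR_ge0].
    by rewrite add0r ler_wpM2r // hn0.
  rewrite /psum (cvg_lim _ hm) // normrM ger0_norm ?powR_ge0 //.
  apply: le_trans (ler_wpM2l (powR_ge0 _ _) mle) _.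
  rewrite mulrDr mulrCA (splitr e); apply: lerD.
    near: s; have : s `^ x * L @[s --> 0^'+] --> 0 * L by apply: cvgMl; exact: powR_cvg0.
    by rewrite mul0r => /cvgr_le; apply; rewrite divr_gt0.
  have -> : e / 2 = d * (Gamma_integral x + 1).
    by rewrite /d; field; rewrite gt_eqF // addr_gt0.
  rewrite ler_pM2l //; near: s; apply: (cvgr_le _ (abelian_pow x01)).
  by rewrite ltrDl.
have -> : c * Gamma_integral x = c * Gamma_integral x + 0 by rewrite addr0.
have h1 : c * (s `^ x * psum w (expR (- s))) + s `^ x * psum u (expR (- s)) @[s --> 0^'+]
    --> c * Gamma_integral x + 0.
  apply: cvgD; first by apply: cvgMr; exact: abelian_pow.
  apply/cvgrPdist_le => e /key; apply: filterS => s; by rewrite sub0r normrN.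
apply: cvg_trans h1; apply: near_eq_cvg; near=> s.
by rewrite aE; [ring|near: s; exact: nbhs_right_gt].
Unshelve. all: by end_near. Qed.

Lemma expR_ratio : (1 - expR (- s)) / s @[s --> 0^'+] --> (1 : R).
Proof.
apply: (squeeze_cvgr (f := fun s => expR (- s)) (h := fun=> 1)); last exact: cvg_cst.
  near=> s; have s0 : 0 < s by near: s; exact: nbhs_right_gt.
  rewrite ler_pdivlMr // ler_pdivrMr // mul1r; apply/andP; split.
    rewrite lerBrDr -[X in _ + X]mulr1 -mulrDr -[X in _ <= X](expR0) -(addNr s) expRD.
    by rewrite ler_pM2l ?expR_gt0 // addrC expR_ge1Dx.
  by rewrite lerBlDr addrC -lerBlDr (le_trans _ (expR_ge1Dx (- s))).
apply: cvg_at_right_filter; rewrite -[X in _ --> X]expR0 -[X in expR X]oppr0.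
by apply: continuous_comp; [exact: opp_continuous|exact: continuous_expR].
Unshelve. all: by end_near. Qed.

(** The tails of [q] are equivalent to [c / b * m ^ (- b)], so [abelian] with exponent [1 - b]
    applies to the right-hand side of [psum_tail]. *)
Lemma abelian_deficit b q (c l : R) : 0 < b < 1 -> (forall k, 0 <= q k) ->
  series q @ \oo --> l -> q n * n%:R `^ (1 + b) @[n --> \oo] --> c ->
  (l - psum q (expR (- s))) / s `^ b @[s --> 0^'+] --> c / b * Gamma_integral (1 - b).
Proof.
move=> /andP[b0 b1] q0 ql qc; pose T m := l - series q m.+1.
have Tc : T m * m%:R `^ (1 - (1 - b)) @[m --> \oo] --> c / b.
  have -> : 1 - (1 - b) = b by ring.
  exact: cvg_tailS.
have b' : 0 < 1 - b < 1 by rewrite subr_gt0 b1 gtrBl.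
have h : (1 - expR (- s)) / s * (s `^ (1 - b) * psum T (expR (- s))) @[s --> 0^'+]
    --> 1 * (c / b * Gamma_integral (1 - b)).
  by apply: cvgM; [exact: expR_ratio|exact: abelian b' Tc].
move: h; rewrite mul1r; apply: cvg_trans; apply: near_eq_cvg.
near=> s; have s0 : 0 < s by near: s; exact: nbhs_right_gt.
rewrite (@psum_tail q l) //; last by rewrite expR_ge0 expR_lt1 oppr_lt0.
rewrite powRB ?powRr1 ?(ltW s0) //; last by rewrite gt_eqF ?implybT.
by field; rewrite !gt_eqF ?powR_gt0.
Unshelve. all: by end_near. Qed.

End Abelian.

(** * Taylor estimates for the complex exponential *)

Section Trig.
Variable R : realType.
Implicit Types x t : R.

Lemma mvt0 (f df : R -> R) (g : R -> R) x : 0 <= x -> (forall t, is_derive t 1 f (df t)) ->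
  f 0 = 0 -> (forall t, 0 <= t <= x -> `|df t| <= g x) -> `|f x| <= g x * x.
Proof.
move=> x0 dfP f0 h; have [->|xn0] := eqVneq x 0; first by rewrite f0 normr0 mulr0.
have {}x0 : 0 < x by rewrite lt_neqAle eq_sym xn0 x0.
have [|c] := @MVT R f df 0 x x0 (fun t _ => dfP t).
  by apply: derivable_within_continuous => t _; exact: ex_derive.
rewrite in_itv /= => /andP[c0 cx]; rewrite f0 !subr0 => ->.
by rewrite normrM (gtr0_norm x0) ler_wpM2r ?(ltW x0) // h // !ltW.
Qed.

Lemma sin_abs_le x : `|sin x| <= `|x|.
Proof.
wlog x0 : x / 0 <= x.
  by move=> h; have [/h//|xn] := leP 0 x; rewrite -normrN -sinN -[`|x|]normrN h // oppr_ge0 ltW.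
rewrite (ger0_norm x0) -[leRHS]mul1r; apply: (@mvt0 sin cos (fun=> 1)) => //; first exact: sin0.
by move=> t _; exact: cos_max.
Qed.

Lemma one_sub_cos x : 1 - cos x = 2 * sin (x / 2) ^+ 2.
Proof.
have {1}-> : x = (x / 2) *+ 2 by rewrite mulr2n; field.
by rewrite cos_mulr2n cos2sin2; ring.
Qed.

Lemma one_sub_cos_bound x : 0 <= 1 - cos x <= x ^+ 2 / 2.
Proof.
rewrite one_sub_cos mulr_ge0 ?sqr_ge0 //=.
have : sin (x / 2) ^+ 2 <= (x / 2) ^+ 2 by rewrite -ler_norml || rewrite -[leLHS]real_normK ?num_real // -[leRHS]real_normK ?num_real // ler_pXn2r ?nnegrE ?normr_ge0 ?sin_abs_le.
by rewrite expr_div_n; lra.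
Qed.

Lemma sin_sub_bound x : `|sin x - x| <= `|x| ^+ 3 / 2.
Proof.
wlog x0 : x / 0 <= x.
  move=> h; have [/h//|xn] := leP 0 x.
  by rewrite -normrN opprB addrC -sinN -[X in _ + X]opprK -[`|x|]normrN h // oppr_ge0 ltW.
have -> : `|x| ^+ 3 / 2 = (x ^+ 2 / 2) * x by rewrite (ger0_norm x0); ring.
apply: (@mvt0 (fun t => sin t - t) (fun t => cos t - 1) (fun x => x ^+ 2 / 2)) => //.
  by rewrite sin0 subrr.
move=> t /andP[t0 tx]; have /andP[c0 c1] := one_sub_cos_bound t.
rewrite -normrN opprB ger0_norm //; apply: le_trans c1 _.
by rewrite ler_pM2r // ler_pXn2r ?nnegrE.
Qed.

Lemma cos_sub_bound x : `|cos x - 1 + x ^+ 2 / 2| <= x ^+ 4 / 2.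
Proof.
wlog x0 : x / 0 <= x.
  move=> h; have [/h//|xn] := leP 0 x.
  have e4 : (- x) ^+ 4 = x ^+ 4 by ring.
  by rewrite -cosN -e4 -[x ^+ 2]sqrrN h // oppr_ge0 ltW.
have -> : x ^+ 4 / 2 = (x ^+ 3 / 2) * x by ring.
apply: (@mvt0 (fun t => cos t - 1 + t ^+ 2 / 2) (fun t => t - sin t) (fun x => x ^+ 3 / 2)) => //.
- move=> t; apply: is_derive_eq; rewrite /GRing.scale /=; by field.
- by rewrite cos0; ring.
move=> t /andP[t0 tx]; rewrite distrC; apply: le_trans (sin_sub_bound t) _.
by rewrite ler_pM2r // (ger0_norm t0) ler_pXn2r ?nnegrE.
Qed.

End Trig.

Section ComplexAux.
Variable R : realType.
Local Notation Cx := (R[i])%C.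
Implicit Types (z w : Cx) (t s : R).
(** The modulus with values in [R]; the norm of [R[i]] takes its values in [R[i]]. *)
Definition cabs z : R := Num.sqrt (Re z ^+ 2 + Im z ^+ 2).
Definition cis t : Cx := Complex (cos t) (sin t).

Lemma cReD z w : Re (z + w) = Re z + Re w. Proof. by case: z w => [? ?] [? ?]. Qed.
Lemma cImD z w : Im (z + w) = Im z + Im w. Proof. by case: z w => [? ?] [? ?]. Qed.
Lemma cReN z : Re (- z) = - Re z. Proof. by case: z. Qed.
Lemma cImN z : Im (- z) = - Im z. Proof. by case: z. Qed.
Lemma cReM z w : Re (z * w) = Re z * Re w - Im z * Im w. Proof. by case: z w => [? ?] [? ?]. Qed.
Lemma cImM z w : Im (z * w) = Re z * Im w + Im z * Re w. Proof. by case: z w => [? ?] [? ?]. Qed.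
Lemma Cx_eq z w : Re z = Re w -> Im z = Im w -> z = w.
Proof. by case: z w => [? ?] [? ?] /= -> ->. Qed.
Lemma Re_sum (I : Type) (r : seq I) (F : I -> Cx) : Re (\sum_(i <- r) F i) = \sum_(i <- r) Re (F i).
Proof. exact: (big_morph _ cReD (erefl : Re (0 : Cx) = 0)). Qed.
Lemma Im_sum (I : Type) (r : seq I) (F : I -> Cx) : Im (\sum_(i <- r) F i) = \sum_(i <- r) Im (F i).
Proof. exact: (big_morph _ cImD (erefl : Im (0 : Cx) = 0)). Qed.

Lemma cabsE z : (cabs z)%:C%C = `|z|. Proof. by rewrite normc_def. Qed.
Lemma cabs_ge0 z : 0 <= cabs z. Proof. exact: sqrtr_ge0. Qed.
Lemma cabs_sq z : cabs z ^+ 2 = Re z ^+ 2 + Im z ^+ 2.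
Proof. by rewrite sqr_sqrtr // addr_ge0 ?sqr_ge0. Qed.
Lemma cabsM z w : cabs (z * w) = cabs z * cabs w.
Proof. by apply: complexI; rewrite rmorphM /= !cabsE normrM. Qed.
Lemma cabsD z w : cabs (z + w) <= cabs z + cabs w.
Proof. by rewrite -lecR rmorphD /= !cabsE ler_normD. Qed.
Lemma cabsN z : cabs (- z) = cabs z.
Proof. by apply: complexI; rewrite !cabsE normrN. Qed.
Lemma cabsX z n : cabs (z ^+ n) = cabs z ^+ n.
Proof. by apply: complexI; rewrite rmorphXn /= !cabsE normrX. Qed.
Lemma cabsR (x : R) : cabs x%:C%C = `|x|.
Proof. by rewrite /cabs /= expr0n /= addr0 sqrtr_sqr. Qed.
Lemma cabs_sum (I : Type) (r : seq I) (P : pred I) (F : I -> Cx) :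
  cabs (\sum_(i <- r | P i) F i) <= \sum_(i <- r | P i) cabs (F i).
Proof.
elim/big_rec2: _ => [|i x y _ h]; first by rewrite /cabs /= expr0n /= addr0 sqrtr0.
by apply: le_trans (cabsD _ _) _; rewrite lerD2l.
Qed.
Lemma Re_le_cabs z : `|Re z| <= cabs z.
Proof. by rewrite -sqrtr_sqr ler_wsqrtr // lerDl sqr_ge0. Qed.
Lemma cabs_le z (a b : R) : `|Re z| <= a -> `|Im z| <= b -> cabs z <= a + b.
Proof.
move=> ha hb; have a0 := le_trans (normr_ge0 _) ha; have b0 := le_trans (normr_ge0 _) hb.
rewrite -(ler_pXn2r (n := 2)) ?nnegrE ?cabs_ge0 ?addr_ge0 // cabs_sq.
rewrite -(real_normK (num_real (Re z))) -(real_normK (num_real (Im z))).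
rewrite (@le_trans _ _ (a ^+ 2 + b ^+ 2)) //; first by apply: lerD; rewrite ler_pXn2r ?nnegrE.
by rewrite sqrrD addrAC lerDl mulrn_wge0 // mulr_ge0.
Qed.

Lemma cabs_subX z w (M : R) n : cabs z <= M -> cabs w <= M ->
  cabs (z ^+ n.+1 - w ^+ n.+1) <= n.+1%:R * M ^+ n * cabs (z - w).
Proof.
move=> zM wM; rewrite subrXX cabsM mulrC ler_wpM2r ?cabs_ge0 //.
apply: le_trans (cabs_sum _ _ _) _; apply: le_trans (_ : _ <= \sum_(i < n.+1) M ^+ n) _; last first.
  by rewrite sumr_const card_ord -[leLHS]mulr_natl.
apply: ler_sum => i _; rewrite cabsM !cabsX.
have -> : M ^+ n = M ^+ (n.+1.-1 - i) * M ^+ i by rewrite -exprD subnK // -ltnS.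
have M0 := le_trans (cabs_ge0 _) zM.
by apply: ler_pM; rewrite ?exprn_ge0 ?cabs_ge0 // lerXn2r ?nnegrE ?cabs_ge0.
Qed.

Lemma cis0 : cis 0 = 1. Proof. by rewrite /cis cos0 sin0. Qed.
Lemma cisD s t : cis (s + t) = cis s * cis t.
Proof. by apply: Cx_eq; rewrite ?cReM ?cImM /= ?cosD ?sinD //; ring. Qed.
Lemma cisM n t : cis (n%:R * t) = cis t ^+ n.
Proof.
elim: n => [|n IH]; first by rewrite mul0r cis0.
by rewrite -natr1 mulrDl mul1r cisD IH exprSr.
Qed.
Lemma cabs_cis t : cabs (cis t) = 1. Proof. by rewrite /cabs /= cos2Dsin2 sqrtr1. Qed.

Lemma cabs_cis_sub1 t : cabs (cis t - 1) <= `|t|.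
Proof.
rewrite -(ler_pXn2r (n := 2)) ?nnegrE ?cabs_ge0 // cabs_sq cReD cImD cReN cImN /=.
rewrite real_normK ?num_real // oppr0 addr0.
have /andP[_ h] := one_sub_cos_bound t; have := cos2Dsin2 t; move: h.
move: (cos t) (sin t) => c s; nra.
Qed.

(** The quantity is the same as in [cis_order2]; this bound is the better one for large [t], and
    [chf_centered] uses both. *)
Lemma cis_order1 t : cabs (cis t - 1 - Complex 0 t) <= 2 * `|t|.
Proof.
apply: le_trans (cabsD _ _) _; rewrite cabsN mulr2n mulrDl mul1r; apply: lerD.
  exact: cabs_cis_sub1.
by rewrite /cabs /= expr0n /= add0r sqrtr_sqr.
Qed.

Lemma cis_order2 t : cabs (cis t - 1 - Complex 0 t) <= 2 * t ^+ 2.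
Proof.
have [t1|t1] := leP `|t| 1; last first.
  apply: le_trans (cis_order1 t) _; rewrite ler_pM2l // -real_normK ?num_real //.
  by rewrite expr2 ler_peMl // ltW.
have /andP[c0 c1] := one_sub_cos_bound t.
apply: le_trans (@cabs_le _ (t ^+ 2 / 2) (t ^+ 2 / 2) _ _) _.
- by rewrite !cReD !cReN /= subr0 -normrN opprB ger0_norm.
- rewrite !cImD !cImN /= subr0; apply: le_trans (sin_sub_bound t) _.
  rewrite ler_pM2r // -[t ^+ 2]real_normK ?num_real //.
  exact: ler_wiXn2l.
- by have := sqr_ge0 t; lra.
Qed.

Lemma cis_order3 t : cabs (cis t - 1 - Complex 0 t + (t ^+ 2 / 2)%:C%C) <= 3 * `|t| ^+ 3.
Proof.
have t2 : t ^+ 2 = `|t| ^+ 2 by rewrite real_normK ?num_real.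
have [t1|t1] := leP `|t| 1; last first.
  apply: le_trans (cabsD _ _) _; apply: le_trans (lerD (cis_order1 t) (lexx _)) _.
  have h (u : R) : 1 < u -> 2 * u + u ^+ 2 / 2 <= 3 * u ^+ 3.
    move=> u1; have a : 0 <= (u - 1) * u by apply: mulr_ge0; lra.
    have b : 0 <= (u - 1) * u ^+ 2 by apply: mulr_ge0; [lra|exact: sqr_ge0].
    lra.
  by rewrite cabsR [X in _ + X]ger0_norm ?divr_ge0 ?sqr_ge0 // t2; exact: h.
apply: le_trans (@cabs_le _ (`|t| ^+ 3 / 2) (`|t| ^+ 3 / 2) _ _) _.
- rewrite !cReD !cReN /= subr0; apply: le_trans (cos_sub_bound t) _.
  have -> : t ^+ 4 = `|t| ^+ 4 by rewrite -[t ^+ 4]/(t ^+ (2 * 2)) exprM t2 -exprM.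
  by rewrite ler_pM2r //; exact: ler_wiXn2l.
- by rewrite !cImD !cImN /= subr0 addr0 sin_sub_bound.
- by have : 0 <= `|t| ^+ 3 by [rewrite exprn_ge0|]; lra.
Qed.

(** Convergence is taken componentwise, so that only real limits are ever computed. *)
Definition ccvg (u : nat -> Cx) z := (Re (u n) @[n --> \oo] --> Re z) /\ (Im (u n) @[n --> \oo] --> Im z).

Lemma ccvg_cst z : ccvg (fun=> z) z. Proof. by split; exact: cvg_cst. Qed.
Lemma ccvgD u v z w : ccvg u z -> ccvg v w -> ccvg (fun n => u n + v n) (z + w).
Proof.
move=> [ur ui] [vr vi]; split; rewrite ?cReD ?cImD.
  by under eq_fun do rewrite cReD; exact: cvgD.
by under eq_fun do rewrite cImD; exact: cvgD.
Qed.
Lemma ccvgM u v z w : ccvg u z -> ccvg v w -> ccvg (fun n => u n * v n) (z * w).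
Proof.
move=> [ur ui] [vr vi]; split; rewrite ?cReM ?cImM.
  by under eq_fun do rewrite cReM; apply: cvgB; exact: cvgM.
by under eq_fun do rewrite cImM; apply: cvgD; exact: cvgM.
Qed.
Lemma ccvgR (u : nat -> R) (l : R) : u @ \oo --> l -> ccvg (fun n => (u n)%:C%C) l%:C%C.
Proof. by move=> h; split => //; exact: cvg_cst. Qed.
Lemma ccvg_le u z (K : R) : (forall n, cabs (u n) <= K) -> ccvg u z -> cabs z <= K.
Proof.
move=> uK [ur ui].
have K0 : 0 <= K by exact: le_trans (cabs_ge0 _) (uK 0%N).
rewrite -(ler_pXn2r (n := 2)) ?nnegrE ?cabs_ge0 // cabs_sq.
have h : Re (u n) ^+ 2 + Im (u n) ^+ 2 @[n --> \oo] --> Re z ^+ 2 + Im z ^+ 2.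
  by rewrite !expr2; under eq_fun do rewrite !expr2; apply: cvgD; exact: cvgM.
rewrite -(cvg_lim _ h) //; apply: limr_le; first by apply/cvg_ex; eexists; exact: h.
by apply: nearW => n; rewrite -cabs_sq ler_pXn2r ?nnegrE ?cabs_ge0.
Qed.

Definition ccont (f : R -> Cx) := continuous (fun t => Re (f t)) /\ continuous (fun t => Im (f t)).
Lemma ccontM f g : ccont f -> ccont g -> ccont (fun t => f t * g t).
Proof.
move=> [fr fi] [gr gi]; split => t; rewrite /continuous_at.
  by rewrite cReM; under eq_fun do rewrite cReM; apply: cvgB; apply: cvgM; [exact: fr|exact: gr|exact: fi|exact: gi].
by rewrite cImM; under eq_fun do rewrite cImM; apply: cvgD; apply: cvgM; [exact: fr|exact: gi|exact: fi|exact: gr].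
Qed.
Lemma ccontB f g : ccont f -> ccont g -> ccont (fun t => f t - g t).
Proof.
move=> [fr fi] [gr gi]; split => t; rewrite /continuous_at.
  by rewrite cReD cReN; under eq_fun do rewrite cReD cReN; apply: cvgB; [exact: fr|exact: gr].
by rewrite cImD cImN; under eq_fun do rewrite cImD cImN; apply: cvgB; [exact: fi|exact: gi].
Qed.
Lemma ccont_cst z : ccont (fun=> z). Proof. by split => t; exact: cvg_cst. Qed.
Lemma ccontX f n : ccont f -> ccont (fun t => f t ^+ n).
Proof.
move=> cf; elim: n => [|n IH]; first exact: ccont_cst.
by under [X in ccont X]eq_fun do rewrite exprS; exact: ccontM.
Qed.
Lemma ccont_cis (x : R) : ccont (fun t => cis (x * t)).
Proof.
by split => t; apply: continuous_comp; [exact: mulrl_continuous|exact: continuous_cos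
  |exact: mulrl_continuous|exact: continuous_sin].
Qed.

End ComplexAux.

Section ItgMore.
Variable R : realType.
Implicit Types (f g : R -> R) (a b : R).

Lemma itg_integrableT a b f : continuous f ->
  lebesgue_measure.-integrable `[a, b] (EFin \o f).
Proof. by move=> cf; apply: itg_integrable; exact: continuous_subspaceT. Qed.

Lemma itgD a b f g : continuous f -> continuous g ->
  itg a b (fun t => f t + g t) = itg a b f + itg a b g.
Proof. by move=> cf cg; apply: RintegralD => //; exact: itg_integrableT. Qed.

Lemma itgB a b f g : continuous f -> continuous g ->
  itg a b (fun t => f t - g t) = itg a b f - itg a b g.
Proof. by move=> cf cg; apply: RintegralB => //; exact: itg_integrableT. Qed.

Lemma itgZ a b (k : R) f : continuous f -> itg a b (fun t => k * f t) = k * itg a b f.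
Proof. by move=> cf; apply: RintegralZl => //; exact: itg_integrableT. Qed.

Lemma itg_sum a b n (F : nat -> R -> R) : (forall i, continuous (F i)) ->
  itg a b (fun t => \sum_(i < n) F i t) = \sum_(i < n) itg a b (F i).
Proof.
move=> cF; elim: n => [|n IH].
  rewrite big_ord0; under [X in itg _ _ X]eq_fun do rewrite big_ord0.
  by rewrite /itg Rintegral_cst // mul0r.
rewrite big_ord_recr /= -IH -itgD //.
  by congr itg; apply/funext => t; rewrite big_ord_recr.
move=> t; elim: n {IH} => [|n IH].
  under [X in continuous_at _ X]eq_fun do rewrite big_ord0; exact: cvg_cst.
under [X in continuous_at _ X]eq_fun do rewrite big_ord_recr /=.
by apply: cvgD => //; exact: cF.
Qed.

Lemma itg_abs_le a b f g : continuous f -> continuous g ->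
  (forall x, a <= x <= b -> `|f x| <= g x) -> `|itg a b f| <= itg a b g.
Proof.
move=> cf cg fg; apply: le_trans (le_normr_Rintegral _ (itg_integrableT a b cf)) _ => //.
apply: itg_le => //; try exact: continuous_subspaceT.
by apply: continuous_subspaceT => t; apply: cvg_norm; exact: cf.
Qed.

End ItgMore.

(** * Characteristic functions *)

Section CharFun.
Variable R : realType.
Local Notation Cx := (R[i])%C.
Variables (q : nat -> R) (mu : R).
Hypothesis q0 : forall k, 0 <= q k.
Hypothesis q1 : series q @ \oo --> (1 : R).
Hypothesis qmu : series (fun k => k%:R * q k) @ \oo --> mu.

Definition chf (t : R) : Cx :=
  Complex (limn (series (fun k => q k * cos (k%:R * t)))) (limn (series (fun k => q k * sin (k%:R * t)))).

Lemma chf_cvg t : ccvg (fun n => \sum_(k < n) (q k)%:C%C * cis (k%:R * t)) (chf t).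
Proof.
split => /=.
  have -> : (fun n => Re (\sum_(k < n) (q k)%:C%C * cis (k%:R * t))) = series (fun k => q k * cos (k%:R * t)).
    apply/funext => n; rewrite Re_sum /series /= big_mkord; apply: eq_bigr => k _.
    by rewrite ?cReM /= mul0r subr0.
  have [k|m h _] := @cvg_series_abs _ (fun k => q k * cos (k%:R * t)) q 1 _ q1.
    by rewrite normrM (ger0_norm (q0 k)) ler_piMr // cos_max.
  by rewrite (cvg_lim _ h).
have -> : (fun n => Im (\sum_(k < n) (q k)%:C%C * cis (k%:R * t))) = series (fun k => q k * sin (k%:R * t)).
  apply/funext => n; rewrite Im_sum /series /= big_mkord; apply: eq_bigr => k _.
  by rewrite ?cImM /= mul0r addr0.
have [k|m h _] := @cvg_series_abs _ (fun k => q k * sin (k%:R * t)) q 1 _ q1.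
  by rewrite normrM (ger0_norm (q0 k)) ler_piMr // sin_max.
by rewrite (cvg_lim _ h).
Qed.

Lemma cabs_qz k (z : Cx) : cabs ((q k)%:C%C * z) = q k * cabs z.
Proof. by rewrite cabsM cabsR ger0_norm. Qed.

Lemma sum_ord_le (a : nat -> R) (l : R) n : (forall k, 0 <= a k) -> series a @ \oo --> l ->
  \sum_(k < n) a k <= l.
Proof. by move=> a0 al; have := nnseries_le n a0 al; rewrite /series /= big_mkord. Qed.

Lemma chf_le1 t : cabs (chf t) <= 1.
Proof.
apply: ccvg_le (chf_cvg t) => n; apply: le_trans (cabs_sum _ _ _) _.
apply: le_trans (sum_ord_le n q0 q1); apply: ler_sum => k _.
by rewrite cabs_qz cabs_cis mulr1.
Qed.

Lemma ccvg_mass : ccvg (fun n => \sum_(k < n) (q k)%:C%C) 1.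
Proof.
have := ccvgR q1; have -> // : (fun n => (series q n)%:C%C) = (fun n => \sum_(k < n) (q k)%:C%C).
by apply/funext => n; rewrite /series /= big_mkord rmorph_sum.
Qed.

Lemma chf_sub1 t : cabs (chf t - 1) <= mu * `|t|.
Proof.
have h := ccvgD (chf_cvg t) (ccvgM (ccvg_cst (-1)) ccvg_mass).
rewrite mulr1 in h; apply: ccvg_le h => n.
rewrite mulr_sumr -big_split /=; apply: le_trans (cabs_sum _ _ _) _.
have k0 k : 0 <= k%:R * q k by rewrite mulr_ge0.
apply: (@le_trans _ _ ((\sum_(k < n) k%:R * q k) * `|t|)); last first.
  by rewrite ler_wpM2r //; exact: (@sum_ord_le (fun k => k%:R * q k) mu n k0 qmu).
rewrite mulr_suml; apply: ler_sum => k _.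
have -> : (q k)%:C%C * cis (k%:R * t) + -1 * (q k)%:C%C = (q k)%:C%C * (cis (k%:R * t) - 1) by ring.
rewrite cabs_qz [_ * q k]mulrC -mulrA ler_wpM2l // (le_trans (cabs_cis_sub1 _)) //.
by rewrite normrM (ger0_norm (ler0n _ _)).
Qed.

Lemma chf_lip s t : cabs (chf t - chf s) <= mu * `|t - s|.
Proof.
have h := ccvgD (chf_cvg t) (ccvgM (ccvg_cst (-1)) (chf_cvg s)).
rewrite mulN1r in h; apply: ccvg_le h => n.
rewrite mulr_sumr -big_split /=; apply: le_trans (cabs_sum _ _ _) _.
have k0 k : 0 <= k%:R * q k by rewrite mulr_ge0.
apply: (@le_trans _ _ ((\sum_(k < n) k%:R * q k) * `|t - s|)); last first.
  by rewrite ler_wpM2r //; exact: (@sum_ord_le (fun k => k%:R * q k) mu n k0 qmu).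
rewrite mulr_suml; apply: ler_sum => k _.
have -> : (q k)%:C%C * cis (k%:R * t) + -1 * ((q k)%:C%C * cis (k%:R * s)) =
   (q k)%:C%C * (cis (k%:R * s) * (cis (k%:R * (t - s)) - 1)).
  by rewrite mulrBr -cisD mulr1 -mulrDr [_ + (t - s)]addrC subrK; ring.
rewrite cabs_qz cabsM cabs_cis mul1r [_ * q k]mulrC -mulrA ler_wpM2l // (le_trans (cabs_cis_sub1 _)) //.
by rewrite normrM (ger0_norm (ler0n _ _)).
Qed.

Lemma chf_cont : ccont chf.
Proof.
have mu0 : 0 <= mu by have := sum_ord_le 0 (fun k => mulr_ge0 (ler0n _ k) (q0 k)) qmu; rewrite big_ord0.
have mu1 : 0 < mu + 1 by rewrite ltr_wpDl.
have key (f : Cx -> R) : (forall z w, f (z - w) = f z - f w) -> (forall z, `|f z| <= cabs z) ->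
    continuous (fun t => f (chf t)).
  move=> fB fle t; apply/cvgrPdist_le => e e0; near=> s.
  rewrite -fB (le_trans (fle _)) // (le_trans (chf_lip _ _)) //.
  apply: (@le_trans _ _ ((mu + 1) * `|t - s|)); first by rewrite ler_wpM2r // lerDl.
  rewrite mulrC -ler_pdivlMr //; near: s.
  have /cvgrPdist_le h : s @[s --> t] --> t by exact: cvg_id.
  by apply: h; rewrite divr_gt0.
split.
  by apply: (key (@complex.Re R)) => [z w|z]; [rewrite cReD cReN|exact: Re_le_cabs].
apply: (key (@complex.Im R)) => [z w|z]; first by rewrite cImD cImN.
by rewrite -sqrtr_sqr ler_wsqrtr // lerDr sqr_ge0.
Unshelve. all: by end_near. Qed.

(* Fourier inversion: truncating the law makes the integrand a trigonometric
   polynomial, at a uniformly small cost. *)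
Lemma cpow_fourier N n :
  itg 0 pi (fun t : R => Re (chf t ^+ N * cis (- n%:R * t))) = pi * cpow q N n.
Proof.
have cF (g : R -> Cx) : ccont g -> continuous (fun t : R => Re (g t ^+ N * cis (- n%:R * t))).
  by move=> cg; apply: (proj1 (ccontM (ccontX N cg) (ccont_cis _))).
pose chL L t := \sum_(k < L) (q k)%:C%C * cis (k%:R * t).
pose P L := \poly_(k < L) q k.
have chLE L t : chL L t = (map_poly (real_complex R) (P L)).[cis t].
  rewrite /chL (horner_coef_wide _ (n := L)); last first.
    by rewrite size_map_poly size_poly.
  by apply: eq_bigr => k _; rewrite coef_map coef_poly ltn_ord cisM.
have polyint (p : {poly R}) : itg 0 pi (fun t : R => Re ((map_poly (real_complex R) p).[cis t] * cis (- n%:R * t))) = pi * p`_n.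
  have -> : (fun t : R => Re ((map_poly (real_complex R) p).[cis t] * cis (- n%:R * t))) =
      (fun t : R => \sum_(m < size p) p`_m * cos ((m%:R - n%:R) * t)).
    apply/funext => t; rewrite (horner_coef_wide _ (n := size p)) ?size_map_poly // mulr_suml Re_sum.
    apply: eq_bigr => m _; rewrite coef_map /= -cisM -mulrA -cisD cReM /= mul0r subr0.
    by congr (_ * cos _); ring.
  have cc (x : R) : continuous (fun t : R => cos (x * t)).
    by move=> t; apply: continuous_comp; [exact: mulrl_continuous|exact: continuous_cos].
  rewrite (@itg_sum _ 0 pi _ (fun m t => p`_m * cos ((m%:R - n%:R) * t))); last first.
    by move=> m t; apply: cvgMr; exact: cc.
  (* The real part is even in [t], hence half a period is enough, and it yields [pi] instead of
     [2 pi]. *)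
  have I m : itg 0 pi (fun t : R => cos ((m%:R - n%:R) * t)) = if m == n then pi else 0.
    have [->|mn] := eqVneq m n.
      under [X in itg _ _ X]eq_fun do rewrite subrr mul0r cos0.
      by rewrite itg_cst ?pi_ge0 // mul1r subr0.
    have d0 : m%:R - n%:R != 0 :> R by rewrite subr_eq0 eqr_nat.
    have dS (t : R) : 0 <= t <= pi -> is_derive t 1 (fun t : R => (m%:R - n%:R)^-1 * sin ((m%:R - n%:R) * t))
        (cos ((m%:R - n%:R) * t)).
      move=> _; apply: is_derive_eq; rewrite /GRing.scale /=; field.
      exact: d0.
    rewrite (itg_FTC (pi_gt0 R) (continuous_subspaceT (cc _)) dS) mulr0 sin0 mulr0 subr0.
    suff -> : sin ((m%:R - n%:R) * pi) = 0 :> R by rewrite mulr0.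
    have sn k : sin (k%:R * pi) = 0 :> R.
      by elim: k => [|k IH]; rewrite ?mul0r ?sin0 // -natr1 mulrDl mul1r sinDpi IH oppr0.
    by rewrite mulrBl sinB !sn mul0r mulr0 subrr.
  have Iz m (k : R) : itg 0 pi (fun t : R => k * cos ((m%:R - n%:R) * t)) = k * (if m == n then pi else 0).
    by rewrite -I; exact: itgZ (cc _).
  under eq_bigr do rewrite Iz.
  have [np|pn] := ltnP n (size p); last first.
    rewrite nth_default // mulr0 big1 // => m _.
    by case: eqP (ltn_ord m) => [->|]; rewrite ?mulr0 // ltnNge pn.
  rewrite (bigD1 (Ordinal np)) //= eqxx big1 ?addr0 => [|m mn]; first by rewrite mulrC.
  by move: mn; rewrite -val_eqE /= => /negbTE ->; rewrite mulr0.
have intL L : (n < L)%N -> itg 0 pi (fun t : R => Re (chL L t ^+ N * cis (- n%:R * t))) = pi * cpow q N n.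
  move=> nL; rewrite (cpowE q N nL) -polyint; congr itg; apply/funext => t.
  by rewrite chLE rmorphXn /= horner_exp.
have chLcont L : ccont (chL L).
  split; [have -> : (fun t : R => Re (chL L t)) = (fun t : R => \sum_(k < L) q k * cos (k%:R * t))
         |have -> : (fun t : R => Im (chL L t)) = (fun t : R => \sum_(k < L) q k * sin (k%:R * t))].
  - by apply/funext => t; rewrite Re_sum; apply: eq_bigr => k _; rewrite ?cReM /= mul0r subr0.
  - elim: L => [|L IH] t.
      under [X in continuous_at _ X]eq_fun do rewrite big_ord0; exact: cvg_cst.
    under [X in continuous_at _ X]eq_fun do rewrite big_ord_recr /=.
    apply: cvgD; first exact: IH.
    by apply: cvgMr; apply: continuous_comp; [exact: mulrl_continuous|exact: continuous_cos].
  - by apply/funext => t; rewrite Im_sum; apply: eq_bigr => k _; rewrite ?cImM /= mul0r addr0.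
  - elim: L => [|L IH] t.
      under [X in continuous_at _ X]eq_fun do rewrite big_ord0; exact: cvg_cst.
    under [X in continuous_at _ X]eq_fun do rewrite big_ord_recr /=.
    apply: cvgD; first exact: IH.
    by apply: cvgMr; apply: continuous_comp; [exact: mulrl_continuous|exact: continuous_sin].
have chL1 L t : cabs (chL L t) <= 1.
  apply: le_trans (cabs_sum _ _ _) _; apply: le_trans (sum_ord_le L q0 q1).
  by apply: ler_sum => k _; rewrite cabs_qz cabs_cis mulr1.
have chdiff L t : cabs (chf t - chL L t) <= 1 - series q L.
  have h := ccvgD (chf_cvg t) (ccvg_cst (- chL L t)).
  have h' : ccvg (fun m => (\sum_(k < m + L) (q k)%:C%C * cis (k%:R * t)) - chL L t) (chf t - chL L t).
    by case: h => hr hi; split; [rewrite -(cvg_shiftn L) in hr|rewrite -(cvg_shiftn L) in hi].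
  apply: ccvg_le h' => m.
  have -> : (\sum_(k < m + L) (q k)%:C%C * cis (k%:R * t)) - chL L t =
      \sum_(L <= k < m + L) (q k)%:C%C * cis (k%:R * t).
    rewrite -(big_mkord xpredT (fun k => (q k)%:C%C * cis (k%:R * t))) (big_cat_nat (n := L)) ?leq_addl //=.
    by rewrite /chL big_mkord addrAC subrr add0r.
  apply: le_trans (cabs_sum _ _ _) _.
  apply: (@le_trans _ _ (\sum_(L <= k < m + L) q k)).
    by apply: ler_sum => k _; rewrite cabs_qz cabs_cis mulr1.
  rewrite lerBrDl; apply: le_trans (nnseries_le (m + L) q0 q1).
  by rewrite /series /= [leRHS](big_cat_nat (n := L)) ?leq_addl.
apply/eqP; rewrite -subr_eq0 -normr_eq0 eq_le normr_ge0 andbT.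
have bound : \forall L \near \oo, `|itg 0 pi (fun t : R => Re (chf t ^+ N * cis (- n%:R * t))) - pi * cpow q N n|
     <= N%:R * (1 - series q L) * pi.
  near=> L; have nL : (n < L)%N by near: L; exists n.+1.
  rewrite -(intL _ nL) -itgB; [|exact: cF chf_cont|exact: cF].
  apply: le_trans (itg_abs_le (g := fun=> N%:R * (1 - series q L)) _ _ _) _.
  - move=> t; apply: cvgB; [exact: (cF _ chf_cont)|exact: cF].
  - by move=> t; exact: cvg_cst.
  - move=> t _; rewrite -cReN -cReD -mulNr -mulrDl (le_trans (Re_le_cabs _)) // cabsM cabs_cis mulr1.
    case: {+}N => [|N']; first by rewrite !expr0 subrr mul0r /cabs /= expr0n /= addr0 sqrtr0.
    apply: le_trans (cabs_subX N' (chf_le1 t) (chL1 L t)) _.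
    by rewrite expr1n mulr1 ler_wpM2l.
  - by rewrite itg_cst ?pi_ge0 // subr0.
have h : N%:R * (1 - series q L) * pi @[L --> \oo] --> N%:R * (1 - 1) * pi.
  by apply: cvgMl; apply: cvgMr; apply: cvgB => //; exact: cvg_cst.
rewrite subrr mulr0 mul0r in h.
rewrite -[leRHS](cvg_lim _ h) //; apply: limr_ge; last exact: bound.
by apply/cvg_ex; exists 0.
Unshelve. all: by end_near. Qed.

End CharFun.

(** * Decay of characteristic functions away from 0 *)

Section Decay.
Variable R : realType.

(** The majorant [K / (1 + u) ^ 2] is chosen for its elementary primitive, and [K] depends on [c]
    only. *)
Lemma exp_decay_bound (c : R) : 0 < c -> exists2 K : R, 0 < K &
  forall u p g, 0 <= u -> 1 <= p -> 0 <= g <= 3 ->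
    expR (- (c * u `^ p)) * u `^ g <= K / (1 + u) ^+ 2.
Proof.
move=> c0; pose f5 : R := 5`!%:R; have f50 : 0 < f5 by rewrite ltr0n fact_gt0.
have exp5 x : 0 <= x -> x ^+ 5 / f5 <= expR x.
  by move=> x0; apply: le_trans (expR_ge1Dxn 4 x0); rewrite lerDr.
move: f5 f50 exp5 => f5 f50 exp5.
pose K1 : R := f5 / c ^+ 5.
have K10 : 0 < K1 by rewrite divr_gt0 ?exprn_gt0.
exists (4 + 4 * K1); first by rewrite addr_gt0 // mulr_gt0.
move=> u p g u0 p1 /andP[g0 g3].
have e0 : 0 < expR (- (c * u `^ p)) by exact: expR_gt0.
rewrite ler_pdivlMr ?exprn_gt0 ?ltr_pwDl //.
have [u1|u1] := leP u 1.
  have h1 : expR (- (c * u `^ p)) <= 1.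
    by rewrite -expR0 ler_expR oppr_le0 mulr_ge0 ?powR_ge0 // ltW.
  have h2 : u `^ g <= 1.
    have : u `^ g <= 1 `^ g by rewrite ge0_ler_powR ?nnegrE.
    by rewrite powR1.
  have h3 : (1 + u) ^+ 2 <= 4.
    have -> : 4 = 2 ^+ 2 :> R by rewrite expr2 -natrM.
    by rewrite ler_pXn2r ?nnegrE ?addr_ge0 //; lra.
  have h12 : expR (- (c * u `^ p)) * u `^ g <= 1 by rewrite mulr_ile1 ?powR_ge0 // ltW.
  apply: (@le_trans _ _ (1 * 4)); last by rewrite mul1r lerDl mulr_ge0 // ltW.
  by apply: ler_pM => //; rewrite ?exprn_ge0 ?addr_ge0 // mulr_ge0 ?powR_ge0 // ltW.
have u0' : 0 < u by lra.
have up : u <= u `^ p.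
  by rewrite -[leLHS](powRr1 u0) ler_powR // ltW.
have ug : u `^ g <= u ^+ 3.
  by rewrite -(powR_mulrn 3 u0) ler_powR // ltW.
have ex : expR (- (c * u `^ p)) <= K1 / u ^+ 5.
  apply: (@le_trans _ _ (expR (- (c * u)))).
    by rewrite ler_expR lerN2 ler_pM2l.
  have cu : 0 < c * u by rewrite mulr_gt0.
  have -> : K1 / u ^+ 5 = ((c * u) ^+ 5 / f5)^-1 by rewrite /K1 exprMn; field; rewrite !gt_eqF.
  rewrite expRN lef_pV2 ?posrE ?expR_gt0 ?divr_gt0 ?exprn_gt0 //.
  by rewrite exp5 // ltW.
have h3 : (1 + u) ^+ 2 <= 4 * u ^+ 2.
  have -> : 4 * u ^+ 2 = (2 * u) ^+ 2 by ring.
  by rewrite ler_pXn2r ?nnegrE ?addr_ge0 ?mulr_ge0 //; lra.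
apply: (@le_trans _ _ ((K1 / u ^+ 5 * u ^+ 3) * (4 * u ^+ 2))).
  apply: ler_pM => //; first by rewrite mulr_ge0 ?powR_ge0 // ltW.
    by rewrite exprn_ge0 // addr_ge0.
  by apply: ler_pM => //; rewrite ?powR_ge0 // ltW.
have -> : K1 / u ^+ 5 * u ^+ 3 * (4 * u ^+ 2) = 4 * K1 by field; rewrite gt_eqF.
by rewrite lerDr.
Qed.

Lemma inv_sq_continuous (k a t : R) : 0 < a -> 0 <= t ->
  {for t, continuous (fun t : R => k * ((1 + a * t) ^+ 2)^-1)}.
Proof.
move=> a0 t0; have p : 0 < 1 + a * t by rewrite ltr_pwDl // mulr_ge0 // ltW.
apply: cvgMr; apply: cvgV; first by rewrite expf_neq0 // gt_eqF.
have h : 1 + a * x @[x --> t] --> 1 + a * t.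
  by apply: cvgD; [exact: cvg_cst|apply: cvgMr; exact: cvg_id].
by rewrite expr2; under eq_fun do rewrite expr2; exact: cvgM.
Qed.

Lemma inv_sq_within (k a b : R) : 0 < a ->
  {within `[0, b], continuous (fun t : R => k * ((1 + a * t) ^+ 2)^-1)}.
Proof.
move=> a0; apply: continuous_in_subspaceT => t; rewrite inE /= in_itv /= => /andP[t0 _].
exact: inv_sq_continuous.
Qed.

Lemma itg_inv_sq (k a : R) : 0 < a -> 0 <= k ->
  itg 0 pi (fun t => k * ((1 + a * t) ^+ 2)^-1) <= k / a.
Proof.
move=> a0 k0.
have dF (t : R) : 0 <= t <= pi ->
    is_derive t 1 (fun t => - (k / a * (1 + a * t)^-1)) (k * ((1 + a * t) ^+ 2)^-1).
  move=> /andP[t0 _]; have p : 0 < 1 + a * t by rewrite ltr_pwDl // mulr_ge0 // ltW.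
  have d1 : is_derive t 1 (fun t : R => 1 + a * t) a.
    by apply: is_derive_eq; rewrite /GRing.scale /=; ring.
  have d2 := is_deriveV (f := fun t : R => 1 + a * t) (lt0r_neq0 p) d1.
  apply: is_derive_eq; rewrite /GRing.scale /=.
  by field; rewrite !gt_eqF.
rewrite (itg_FTC (pi_gt0 R) (@inv_sq_within k a pi a0) dF) mulr0 addr0 invr1 mulr1 opprK addrC gerDl.
rewrite oppr_le0; apply: mulr_ge0; first by rewrite divr_ge0 // ltW.
by rewrite invr_ge0 addr_ge0 // mulr_ge0 ?pi_ge0 // ltW.
Qed.

(** Rescaling by [u = N ^ (1 / p) * t]. In the Fourier estimates below, [p] is the exponent in the
    decay of the characteristic function and [g] the order at which the remaining factor vanishes at
    0. *)
Lemma itg_decay (c : R) : 0 < c -> exists2 K : R, 0 < K &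
  forall (p g D : R) (N : nat) (F : R -> R), 1 <= p -> 0 <= g <= 3 -> 0 <= D -> (0 < N)%N ->
    continuous F ->
    (forall t, 0 <= t <= pi -> `|F t| <= D * (expR (- (c * (N%:R * t `^ p))) * t `^ g)) ->
    `|itg 0 pi F| <= D * K * N%:R `^ (- ((1 + g) / p)).
Proof.
move=> c0; have [K K0 hK] := exp_decay_bound c0; exists K => //.
move=> p g D N F p1 g03 D0 N0 cF FD.
have p0 : 0 < p by lra.
have N0' : 0 < N%:R :> R by rewrite ltr0n.
pose a : R := N%:R `^ p^-1; have a0 : 0 < a by rewrite powR_gt0.
have ap : a `^ p = N%:R by rewrite /a -powRrM mulVf ?gt_eqF // powRr1 ?ltW.
have ag0 : 0 < a `^ g by rewrite powR_gt0.
have k0 : 0 <= D * K / a `^ g by rewrite divr_ge0 ?mulr_ge0 // ltW.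
apply: (@le_trans _ _ (itg 0 pi (fun t : R => D * K / a `^ g * ((1 + a * t) ^+ 2)^-1))).
  apply: le_trans (le_normr_Rintegral _ (itg_integrableT 0 pi cF)) _ => //.
  apply: itg_le; last 1 first.
  - move=> t /andP[t0 tpi]; apply: le_trans (FD t _) _; first by rewrite t0.
    have at0 : 0 <= a * t by rewrite mulr_ge0 // ltW.
    have -> : N%:R * t `^ p = (a * t) `^ p by rewrite powRM ?(ltW a0) // ap.
    have -> : t `^ g = (a * t) `^ g / a `^ g by rewrite powRM ?(ltW a0) //; field; rewrite gt_eqF.
    have h := hK (a * t) p g at0 p1 g03; set X := (a * t) `^ g in h *.
    have -> : D * (expR (- (c * (a * t) `^ p)) * (X / a `^ g)) =
       D / a `^ g * (expR (- (c * (a * t) `^ p)) * X) by ring.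
    have -> : D * K / a `^ g * ((1 + a * t) ^+ 2)^-1 = D / a `^ g * (K / (1 + a * t) ^+ 2) by ring.
    by rewrite ler_wpM2l // divr_ge0 // ltW.
  - by apply: continuous_subspaceT => t; apply: cvg_norm; exact: cF.
  - exact: inv_sq_within.
apply: le_trans (itg_inv_sq a0 k0) _.
have aE x : a `^ x = N%:R `^ (x / p) by rewrite /a -powRrM mulrC.
rewrite -mulNr -aE opprD powRD ?(gt_eqF a0) ?implybT // !powRN powRr1 ?(ltW a0) //.
by rewrite le_eqVlt; apply/orP; left; apply/eqP; ring.
Qed.

(** The constant is crude: from [1 / 2] on, [1 - cos t] is at least [1 / 16], while [t ^ 2 <= 16] on
    [[0, pi]]. *)
Lemma one_sub_cos_lower (t : R) : 0 <= t <= pi -> t ^+ 2 / 256 <= 1 - cos t.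
Proof.
move=> /andP[t0 tpi].
have small (u : R) : 0 <= u <= 2^-1 -> u ^+ 2 / 4 <= 1 - cos u.
  move=> /andP[u0 u1]; have := cos_sub_bound u; rewrite ler_norml => /andP[_ h].
  have e : u ^+ 4 = u ^+ 2 * u ^+ 2 by rewrite -exprD.
  have u2 : u ^+ 2 <= 4^-1.
    have -> : 4^-1 = (2^-1) ^+ 2 :> R by rewrite exprVn expr2 -natrM.
    by rewrite ler_pXn2r ?nnegrE.
  have := sqr_ge0 u; move: h u2; rewrite e; nra.
have [t1|t1] := leP t 2^-1.
  by apply: le_trans (small t _); [have := sqr_ge0 t; lra|rewrite t0].
have h := small 2^-1; have : cos t <= cos 2^-1.
  have hpi : (2^-1 : R) \in `[0, pi] by rewrite in_itv /=; have := pi_ge2 R; lra.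
  have tp : t \in `[0, pi] by rewrite in_itv /= t0.
  by rewrite leNgt (ltr_cos tp hpi) /= ltNge (ltW t1).
have p4 : pi < 4 :> R by have := pihalf_lt2 R; lra.
have : t ^+ 2 <= 16.
  have -> : 16 = 4 ^+ 2 :> R by rewrite expr2 -natrM.
  by rewrite ler_pXn2r ?nnegrE //; lra.
move: h; rewrite exprVn expr2 -natrM lexx invr_ge0 ler0n => /(_ isT).
lra.
Qed.

Variables (q : nat -> R).
Hypothesis q0 : forall k, 0 <= q k.
Hypothesis q1 : series q @ \oo --> (1 : R).

Local Notation chf := (chf q).

Lemma chf_rot_Re t (x : R) :
  series (fun k => q k * cos ((k%:R - x) * t)) @ \oo --> Re (chf t * cis (- (x * t))).
Proof.
have [h _] := ccvgM (chf_cvg q0 q1 t) (ccvg_cst (cis (- (x * t)))).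
move: h; apply: cvg_trans; apply: near_eq_cvg; apply: nearW => n /=.
rewrite mulr_suml Re_sum /series /= big_mkord; apply: eq_bigr => k _.
by rewrite [(k%:R - x) * t]mulrBl cosB cosN sinN; ring.
Qed.

(** Let [z] be [chf t] rotated by [- t]. The atom at 1 becomes the real number [q 1], the other
    atoms give [|z - q 1| <= 1 - q 1], and squaring yields [|z| ^ 2 <= 1 - 2 q 1 (1 - Re z)].
    Finally [1 - Re z] is a series of nonnegative terms, of which any block may be kept. *)
Lemma chf_sq_le t a b : (0 < q 1%N) ->
  cabs (chf t) ^+ 2 <= 1 - 2 * q 1%N * \sum_(a <= k < b) q k * (1 - cos ((k%:R - 1) * t)).
Proof.
move=> q10; pose z := chf t * cis (- (1 * t)).
have zc : cabs (chf t) = cabs z by rewrite cabsM cabs_cis mulr1.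
have hz : series (fun k => q k * cos ((k%:R - 1) * t)) @ \oo --> Re z by exact: chf_rot_Re.
have hw : cabs (z - (q 1%N)%:C%C) <= 1 - q 1%N.
  have h := ccvgD (ccvgM (chf_cvg q0 q1 t) (ccvg_cst (cis (- (1 * t))))) (ccvg_cst (- (q 1%N)%:C%C)).
  have h2 : ccvg (fun n => (\sum_(k < n.+2) (q k)%:C%C * cis (k%:R * t)) * cis (- (1 * t)) - (q 1%N)%:C%C)
     (z - (q 1%N)%:C%C).
    by case: h => hr hi; split; [rewrite -(cvg_shiftn 2) in hr; under eq_fun do rewrite -addn2|
       rewrite -(cvg_shiftn 2) in hi; under eq_fun do rewrite -addn2].
  apply: ccvg_le h2 => n.
  have qs : \sum_(k < n.+2) q k <= 1 by exact: sum_ord_le.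
  rewrite (bigD1 (Ordinal (isT : (1 < n.+2)%N))) //= mulrDl -mulrA -cisD subrr cis0 mulr1 addrAC subrr add0r.
  rewrite cabsM cabs_cis mulr1; apply: le_trans (cabs_sum _ _ _) _.
  rewrite (bigD1 (Ordinal (isT : (1 < n.+2)%N))) //= in qs.
  rewrite lerBrDl; apply: le_trans qs; rewrite lerD2l; apply: ler_sum => k _.
  by rewrite cabs_qz // cabs_cis mulr1.
have hs : \sum_(a <= k < b) q k * (1 - cos ((k%:R - 1) * t)) <= 1 - Re z.
  have h : series (fun k => q k * (1 - cos ((k%:R - 1) * t))) @ \oo --> 1 - Re z.
    have := cvg_seriesD q1 (cvg_seriesZ (c := -1) hz); rewrite mulN1r; apply: cvg_trans.
    apply: near_eq_cvg; apply: nearW => n /=; rewrite /series /=; apply: eq_bigr => k _; ring.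
  have pos k : 0 <= q k * (1 - cos ((k%:R - 1) * t)) by rewrite mulr_ge0 // subr_ge0 cos_le1.
  apply: le_trans (nnseries_le b pos h).
  have [ab|ba] := leqP a b; last by rewrite big_geq ?(ltnW ba) // sumr_ge0.
  by rewrite /series /= [leRHS](big_cat_nat (n := a)) //= lerDr sumr_ge0.
have sq : cabs z ^+ 2 = cabs (z - (q 1%N)%:C%C) ^+ 2 + 2 * q 1%N * Re z - q 1%N ^+ 2.
  by rewrite !cabs_sq cReD cImD cReN cImN /= oppr0 addr0; ring.
have hw2 : cabs (z - (q 1%N)%:C%C) ^+ 2 <= (1 - q 1%N) ^+ 2.
  by rewrite ler_pXn2r ?nnegrE ?cabs_ge0 // (le_trans (cabs_ge0 _) hw).
have : 2 * q 1%N * \sum_(a <= k < b) q k * (1 - cos ((k%:R - 1) * t)) <= 2 * q 1%N * (1 - Re z).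
  by rewrite ler_pM2l // mulr_gt0.
rewrite zc sq; move: hw2; rewrite sqrrB expr1n; lra.
Qed.

(** Two consecutive atoms ensure aperiodicity: their angles differ by [t], and [1 - cos t] is at
    most twice the sum of the values of [1 - cos] at the two angles. *)
Lemma chf_decay_quadratic k0 : 0 < q 1%N -> 0 < q k0 -> 0 < q k0.+1 ->
  exists2 c : R, 0 < c & forall t, 0 <= t <= pi -> cabs (chf t) ^+ 2 <= 1 - c * t `^ 2.
Proof.
move=> q10 qk qk1; pose m := Num.min (q k0) (q k0.+1).
have m0 : 0 < m by rewrite lt_min qk.
have mk : m <= q k0 by rewrite ge_min lexx.
have mk1 : m <= q k0.+1 by rewrite ge_min lexx orbT.
exists (q 1%N * m / 256); first by rewrite divr_gt0 // mulr_gt0.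
move=> t t0pi; have /andP[t0 _] := t0pi.
apply: le_trans (chf_sq_le t k0 k0.+2 q10) _.
rewrite lerD2l lerN2 big_nat_recr //= big_nat1.
rewrite powR_mulrn //.
have hc := one_sub_cos_lower t0pi.
pose a := (k0%:R - 1) * t; pose b := (k0.+1%:R - 1) * t.
have ba : t = b - a by rewrite /a /b -natr1; ring.
have tri : 1 - cos t <= 2 * ((1 - cos a) + (1 - cos b)).
  rewrite {1}ba cosB; have := cos2Dsin2 a; have := cos2Dsin2 b.
  have := sqr_ge0 (cos a + cos b - 2); have := sqr_ge0 (sin a + sin b).
  have := cos_le1 a; have := cos_le1 b.
  move: (cos a) (cos b) (sin a) (sin b) => x y u v; nra.
have a1 : 0 <= 1 - cos a by rewrite subr_ge0 cos_le1.
have b1 : 0 <= 1 - cos b by rewrite subr_ge0 cos_le1.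
have h1 : m * (1 - cos a) <= q k0 * (1 - cos a) by rewrite ler_wpM2r.
have h2 : m * (1 - cos b) <= q k0.+1 * (1 - cos b) by rewrite ler_wpM2r.
have h3 : m * (t ^+ 2 / 256) <= m * (2 * ((1 - cos a) + (1 - cos b))).
  by rewrite ler_pM2l // (le_trans hc).
rewrite -[(k0%:R - 1) * t]/a -[(k0.+1%:R - 1) * t]/b.
have -> : q 1%N * m / 256 * t ^+ 2 = q 1%N * (m * (t ^+ 2 / 256)) by field.
rewrite [2 * _]mulrC -[leRHS]mulrA ler_pM2l //; move: h1 h2 h3; lra.
Qed.

(** For small [t] the block [m < k <= 2 m] is kept, with [m] the integer part of [1 / t]. The angles
    [(k - 1) t] lie in [[1 / 2, 2]], and [m] atoms of size about [m ^ (- 1 - al)] contribute a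
    multiple of [m ^ (- al) >= t ^ al]. Away from 0 the quadratic bound suffices. *)
Lemma chf_decay_stable (al c : R) : 1 < al < 2 -> 0 < c -> 0 < q 1%N ->
  q k * k%:R `^ (1 + al) @[k --> \oo] --> c ->
  exists2 c' : R, 0 < c' & forall t, 0 <= t <= pi -> cabs (chf t) ^+ 2 <= 1 - c' * t `^ al.
Proof.
move=> /andP[al1 al2] c0 q10 qc.
have al0 : 0 < al by lra.
have [k0 hk0] : exists k0, forall k, (k0 <= k)%N -> c / 2 <= q k * k%:R `^ (1 + al).
  have : \forall k \near \oo, c / 2 <= q k * k%:R `^ (1 + al).
    by apply: (cvgr_ge _ qc); rewrite ltr_pdivrMr // ltr_pMr // ltr1n.
  by move=> -[k0 _ h]; exists k0.
pose k1 := k0.+2.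
have qlow k : (k0 <= k)%N -> (0 < k)%N -> c / 2 * k%:R `^ (- (1 + al)) <= q k.
  move=> kk k_gt0; rewrite powRN ler_pdivrMr ?powR_gt0 ?ltr0n //; exact: hk0.
have qpos k : (k0 <= k)%N -> (0 < k)%N -> 0 < q k.
  move=> kk kg; apply: lt_le_trans (qlow k kk kg).
  by rewrite mulr_gt0 ?divr_gt0 // powR_gt0 // ltr0n.
have [c2 c20 hc2] := chf_decay_quadratic q10 (qpos k1 (leqW (leqnSn _)) isT) (qpos k1.+1 (leqW (leqW (leqnSn _))) isT).
(* Here [2 ^ 10 = 4 * 256] comes from [one_sub_cos_lower] at an angle of at least [1 / 2], and
   [2 ^ (- (1 + al))] from [k <= 2 m]. *)
pose ca := 2 * q 1%N * (c / 2 * 2 `^ (- (1 + al)) / 2 ^+ 10).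
have ca0 : 0 < ca by rewrite mulr_gt0 ?mulr_gt0 // divr_gt0 ?exprn_gt0 // mulr_gt0 ?powR_gt0 // divr_gt0.
pose cb := c2 * (k1%:R^-1) `^ (2 - al).
have k1V : 0 < k1%:R^-1 :> R by rewrite invr_gt0 ltr0n.
have cb0 : 0 < cb by rewrite mulr_gt0 ?powR_gt0.
exists (Num.min ca cb); first by rewrite lt_min ca0.
move=> t /andP[t0 tpi].
have [t00|tn0] := eqVneq t 0.
  rewrite t00 powR0 ?gt_eqF // mulr0 subr0 -(expr1n _ 2) ler_pXn2r ?nnegrE ?cabs_ge0 //.
  exact: chf_le1.
have {}t0 : 0 < t by rewrite lt_neqAle eq_sym tn0.
have tal : 0 < t `^ al by rewrite powR_gt0.
have [tk|tk] := leP k1%:R^-1 t.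
  apply: le_trans (hc2 t _) _; first by rewrite ltW.
  rewrite lerD2l lerN2 (@le_trans _ _ (cb * t `^ al)) //; first by rewrite ler_pM2r // ge_min lexx orbT.
  have -> : t `^ 2 = t `^ (2 - al) * t `^ al by rewrite -powRD ?subrK // gt_eqF ?implybT.
  rewrite /cb -!mulrA ler_pM2l // ler_pM2r // ge0_ler_powR ?nnegrE ?(ltW k1V) ?(ltW t0) //.
  by rewrite subr_ge0 ltW.
pose m := Num.truncn t^-1.
have tV0 : 0 < t^-1 by rewrite invr_gt0.
have mle : m%:R <= t^-1 by rewrite truncn_le ltW.
have mlt : t^-1 < m.+1%:R by exact: truncnS_gt.
have km : (k1 <= m)%N.
  rewrite -ltnS -(ltr_nat R); apply: lt_trans mlt.
  by rewrite -[k1%:R]invrK ltf_pV2 ?posrE.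
have m0 : (0 < m)%N by exact: leq_trans km.
have m0' : 0 < m%:R :> R by rewrite ltr0n.
have mt1 : m%:R * t <= 1 by rewrite -ler_pdivlMr // div1r.
have mt2 : 2^-1 <= m%:R * t.
  have : 1 < m.+1%:R * t by rewrite -ltr_pdivrMr // div1r.
  have : (1 : R) <= m%:R by rewrite ler1n.
  rewrite -natr1; nra.
apply: le_trans (chf_sq_le t m.+1 (m + m).+1 q10) _.
rewrite lerD2l lerN2 (@le_trans _ _ (ca * t `^ al)) //; first by rewrite ler_pM2r // ge_min lexx.
rewrite /ca -[X in X <= _]mulrA ler_pM2l ?mulr_gt0 //.
apply: (@le_trans _ _ (\sum_(m.+1 <= k < (m + m).+1) (c / 2 * (2 * m%:R) `^ (- (1 + al)) / 2 ^+ 10))).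
  rewrite sumr_const_nat subSS addnK -[X in _ <= X]mulr_natl.
  rewrite powRM ?ler0n //.
  have -> : m%:R * (c / 2 * (2 `^ (- (1 + al)) * m%:R `^ (- (1 + al))) / 2 ^+ 10) =
     c / 2 * 2 `^ (- (1 + al)) / 2 ^+ 10 * (m%:R * m%:R `^ (- (1 + al))) by ring.
  rewrite ler_pM2l; last by rewrite divr_gt0 ?exprn_gt0 // mulr_gt0 ?powR_gt0 // divr_gt0.
  rewrite -{1}(powRr1 (ltW m0')) -powRD; last by rewrite (gt_eqF m0') implybT.
  have -> : 1 + - (1 + al) = - al by ring.
  have mal : m%:R `^ al <= (t^-1) `^ al by rewrite ge0_ler_powR ?nnegrE ?ler0n ?(ltW tV0) // ltW.
  have tal1 : t `^ al * (t^-1) `^ al = 1.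
    by rewrite -powRM ?(ltW t0) ?(ltW tV0) // divff ?gt_eqF // powR1.
  rewrite powRN -[leRHS]mul1r ler_pdivlMr ?powR_gt0 //.
  by apply: (@le_trans _ _ (t `^ al * (t^-1) `^ al)); [rewrite ler_pM2l|rewrite tal1].
apply: ler_sum_nat => k /andP[mk kmm].
have kg : (0 < k)%N by exact: leq_ltn_trans mk.
have k0k : (k0 <= k)%N by apply: leq_trans (ltnW mk); apply: leq_trans km; rewrite /k1 leqW.
have k2m : k%:R <= 2 * m%:R :> R by rewrite mulr_natl mulr2n -natrD ler_nat.
have km1 : m%:R <= k%:R - 1 :> R by rewrite lerBrDr natr1 ler_nat.
have pos : 0 <= (2 * m%:R) `^ (- (1 + al)) :> R by exact: powR_ge0.
have e10 : (2 : R) ^+ 10 = 1024 by ring.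
apply: ler_pM; [by apply: mulr_ge0 => //; rewrite divr_ge0 // ltW|by rewrite invr_ge0 exprn_ge0| |].
  apply: le_trans (qlow k k0k kg); rewrite ler_pM2l ?divr_gt0 // !powRN lef_pV2 ?posrE ?powR_gt0 ?mulr_gt0 ?ltr0n //.
  by rewrite ge0_ler_powR ?nnegrE ?ler0n ?mulr_ge0 //; lra.
have lo : 2^-1 <= (k%:R - 1) * t by apply: le_trans mt2 _; rewrite ler_pM2r.
have hi : (k%:R - 1) * t <= 2 by have : k%:R * t <= 2 * m%:R * t; [rewrite ler_pM2r|lra].
apply: le_trans (one_sub_cos_lower _); last by have := pi_ge2 R; lra.
have : (2^-1) ^+ 2 <= ((k%:R - 1) * t) ^+ 2 by rewrite ler_pXn2r ?nnegrE //; lra.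
rewrite e10 exprVn expr2 -natrM; lra.
Qed.

End Decay.

(** * A Tauberian theorem *)

Lemma cvg_sum_ord (R : realType) (T : Type) {F : set_system T} {FF : Filter F}
    n (f : nat -> T -> R) (l : nat -> R) : (forall i, f i x @[x --> F] --> l i) ->
  \sum_(i < n) f i x @[x --> F] --> \sum_(i < n) l i.
Proof.
move=> fl; elim: n => [|n IH].
  by rewrite big_ord0; under eq_fun do rewrite big_ord0; exact: cvg_cst.
by rewrite big_ord_recr; under eq_fun do rewrite big_ord_recr; apply: cvgD.
Qed.

Lemma cvg_right0 (R : realType) (T : Type) {F : set_system T} {FF : Filter F} (f : T -> R) :
  f x @[x --> F] --> 0 -> (\forall x \near F, 0 < f x) -> f x @[x --> F] --> 0^'+.
Proof. by move=> f0 fp A hA; apply: filterS2 fp (f0 _ hA) => x fx h; exact: h. Qed.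

Lemma sgM_lower (R : realDomainType) (x y d : R) : `|x - y| <= d -> `|x| - d <= Num.sg x * y.
Proof.
rewrite ler_norml => /andP[h1 h2].
by case: (ltrgt0P x) h1 h2 => h h1 h2; rewrite ?(gtr0_sg h) ?(ltr0_sg h) ?h ?sgr0; lra.
Qed.

Lemma powRN_summable (R : realType) (b : R) : 0 < b ->
  exists l : R, series (fun n : nat => n%:R `^ (- (1 + b))) @ \oo --> l.
Proof.
move=> b0; pose w (n : nat) : R := n%:R `^ (- (1 + b)).
have w0 k : 0 <= w k by exact: powR_ge0.
have [n|l wl _] := @nnseries_cvg _ w (1 + b^-1) w0; last by exists l.
have tele M : \sum_(0 <= k < M.+2) w k <= 1 + b^-1 * (1 - M.+1%:R `^ (- b)).
  elim: M => [|M IH].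
    by rewrite !big_nat_recl // big_geq // /w powR0 ?powR1 ?add0r ?subrr ?mulr0 ?addr0 // oppr_eq0 gt_eqF // addr_gt0.
  rewrite big_nat_recr //= (le_trans (lerD IH (lexx _))) // -addrA lerD2l.
  have /andP[h _] := powRN_tele b0 (isT : (0 < M.+1)%N).
  have h' : w M.+2 <= b^-1 * (M.+1%:R `^ (- b) - M.+2%:R `^ (- b)).
    by rewrite ler_pdivlMl.
  by apply: le_trans (lerD (lexx _) h') _; rewrite -mulrDr ler_pM2l ?invr_gt0 //; lra.
have mono : series w n <= series w n.+2.
  by apply: (@nondecreasing_series _ w xpredT 0) => //; rewrite -addn2 leq_addr.
apply: le_trans mono _; apply: le_trans (tele n) _.
by rewrite lerD2l ler_piMr ?invr_ge0 ?(ltW b0) // gerBl powR_ge0.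
Qed.

Section Tauberian.
Variable R : realType.
Variables (e : nat -> R) (b Ce : R).
Hypothesis b01 : 0 < b < 1.
Hypothesis Ce0 : 0 < Ce.
Hypothesis e_bound : forall n, `|e n| <= Ce * n%:R `^ (- (1 + b)).
Hypothesis e_osc : forall n m, (0 < n)%N -> (n <= m)%N -> (m <= 2 * n)%N ->
  `|e n - e m| <= Ce * (m%:R - n%:R) * n%:R `^ (- (2 + b)).
Hypothesis e_lap : (psum e 1 - psum e (expR (- s))) / s `^ b @[s --> 0^'+] --> (0 : R).

Let b0 : 0 < b. Proof. by case/andP: b01. Qed.
Let w (n : nat) : R := n%:R `^ (- (1 + b)).

Let w_cvg : exists l : R, series w @ \oo --> l := powRN_summable b0.

Lemma tauberian_psum_cvg z : 0 <= z <= 1 -> series (fun n => e n * z ^+ n) @ \oo --> psum e z.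
Proof.
move=> z01; have [l wl] := w_cvg.
by apply: (@psum_cvg1 _ e z (fun n => Ce * w n) (Ce * l)) => //; exact: cvg_seriesZ.
Qed.

(** With [E] the transform of [e] and [y = exp (- s)], the series is the sum of the [p_j E(y ^ j)].
    Since the [p_j] add up to 0, [E(1)] can be subtracted in each term, and each difference
    [E(1) - E(exp (- j s))] is negligible against [s ^ b] by [e_lap]. *)
Lemma tauberian_poly (p : {poly R}) : p.[1] = 0 ->
  exists K : R -> R, (forall s, 0 < s -> series (fun n => e n * p.[expR (- s) ^+ n]) @ \oo --> K s)
   /\ K s / s `^ b @[s --> 0^'+] --> 0.
Proof.
move=> p1.
exists (fun s => \sum_(j < size p) p`_j * psum e (expR (- s) ^+ j)); split => [s s0|].
  have y01 j : 0 <= expR (- s) ^+ j <= 1.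
    by rewrite exprn_ge0 ?expR_ge0 // exprn_ile1 ?expR_ge0 // -expR0 ler_expR oppr_le0 ltW.
  have -> : series (fun n => e n * p.[expR (- s) ^+ n]) =
     (fun M => \sum_(j < size p) p`_j * series (fun n => e n * (expR (- s) ^+ j) ^+ n) M).
    apply/funext => M; rewrite /series /=.
    under eq_bigr do rewrite horner_coef mulr_sumr.
    rewrite exchange_big /=; apply: eq_bigr => j _; rewrite mulr_sumr; apply: eq_bigr => n _.
    by rewrite -!exprM [(n * j)%N]mulnC mulrCA.
  apply: (cvg_sum_ord (f := fun j M => p`_j * series (fun n => e n * (expR (- s) ^+ j) ^+ n) M)
    (l := fun j => p`_j * psum e (expR (- s) ^+ j))) => j.
  by apply: cvgMr; exact: tauberian_psum_cvg.
have h j : (psum e 1 - psum e (expR (- s) ^+ j)) / s `^ b @[s --> 0^'+] --> 0.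
  case: j => [|j].
    under eq_fun do rewrite expr0 subrr mul0r; exact: cvg_cst.
  have js : j.+1%:R * s @[s --> (0 : R)^'+] --> (0 : R)^'+.
    apply: cvg_right0.
      have h : j.+1%:R * s @[s --> (0 : R)^'+] --> j.+1%:R * (0 : R).
        by apply: cvgMr; apply: cvg_at_right_filter; exact: cvg_id.
      by move: h; rewrite mulr0.
    by near=> s; rewrite mulr_gt0 ?ltr0n //; near: s; exact: nbhs_right_gt.
  have h1 : (psum e 1 - psum e (expR (- (j.+1%:R * s)))) / (j.+1%:R * s) `^ b @[s --> 0^'+] --> 0.
    exact: (@cvg_comp _ _ _ (fun s : R => j.+1%:R * s) (fun s => (psum e 1 - psum e (expR (- s))) / s `^ b) _ _ _ js e_lap).
  have h2 : j.+1%:R `^ b * ((psum e 1 - psum e (expR (- (j.+1%:R * s)))) / (j.+1%:R * s) `^ b) @[s --> 0^'+]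
      --> j.+1%:R `^ b * 0 by exact: cvgMr.
  move: h2; rewrite mulr0; apply: cvg_trans; apply: near_eq_cvg; near=> s.
  have s0 : 0 < s by near: s; exact: nbhs_right_gt.
  rewrite -expRM_natl mulrN powRM ?(ltW s0) //.
  by field; rewrite !gt_eqF ?powR_gt0.
have hs : - \sum_(j < size p) p`_j * ((psum e 1 - psum e (expR (- s) ^+ j)) / s `^ b) @[s --> 0^'+] --> - (\sum_(j < size p) p`_j * 0).
  apply: cvgN; apply: (cvg_sum_ord (f := fun j s => p`_j * ((psum e 1 - psum e (expR (- s) ^+ j)) / s `^ b))
    (l := fun j => p`_j * 0)) => j; exact: cvgMr.
move: hs; rewrite big1 ?oppr0 => [|j _]; last by rewrite mulr0.
apply: cvg_trans; apply: near_eq_cvg; apply: nearW => s.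
have pE : \sum_(j < size p) p`_j * psum e 1 = 0.
  rewrite -mulr_suml; have -> : \sum_(j < size p) p`_j = p.[1].
    by rewrite horner_coef; apply: eq_bigr => j _; rewrite expr1n mulr1.
  by rewrite p1 mul0r.
rewrite mulr_suml -[RHS]add0r -[X in X + _](_ : - (\sum_(j < size p) p`_j * psum e 1) / s `^ b = 0); last first.
  by rewrite pE oppr0 mul0r.
rewrite mulNr mulr_suml -sumrN -[X in X + _]sumrN -big_split /=; apply: eq_bigr => j _; ring.
Unshelve. all: by end_near. Qed.

(** As [|e n| <= Ce * w n], this controls the indices far from [n0] in the Tauberian argument, at
    the same scale [s ^ b] as the transform. *)
Let ref_bound : exists2 K : R, 0 < K & exists2 s0 : R, 0 < s0 &
  forall s M, 0 < s -> s < s0 -> \sum_(0 <= n < M) w n * (1 - expR (- s) ^+ n) <= K * s `^ b.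
Proof.
have w0 k : 0 <= w k by exact: powR_ge0.
have [l wl] := w_cvg.
have wc : w n * n%:R `^ (1 + b) @[n --> \oo] --> (1 : R).
  apply: cvg_near_cst; near=> n; rewrite /w powRN mulVf // gt_eqF // powR_gt0 // ltr0n.
  by near: n; exists 1%N.
have h := abelian_deficit b01 w0 wl wc.
have b' : 0 < 1 - b < 1 by case/andP: b01 => ? ?; rewrite subr_gt0 gtrBl; apply/andP.
have G0 := Gamma_integral_gt0 b'.
have K0 : 0 < 1 / b * Gamma_integral (1 - b) + 1 by rewrite addr_gt0 // mulr_gt0 // divr_gt0.
exists (1 / b * Gamma_integral (1 - b) + 1) => //.
have : \forall s \near 0^'+, (l - psum w (expR (- s))) / s `^ b <= 1 / b * Gamma_integral (1 - b) + 1.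
  by apply: (cvgr_le _ h); rewrite ltrDl.
rewrite near_withinE /= => -[d d0 hd]; exists d => // s M s0 sd.
have := hd s; rewrite /= sub0r normrN gtr0_norm // => /(_ sd s0).
rewrite ler_pdivrMr ?powR_gt0 //; apply: le_trans.
have y01 : 0 <= expR (- s) <= 1 by rewrite expR_ge0 -expR0 ler_expR oppr_le0 ltW.
have c1 : series (fun n => w n * expR (- s) ^+ n) @ \oo --> psum w (expR (- s)).
  by apply: (@psum_cvg1 _ w _ w l) => // n; rewrite ger0_norm.
have c2 : series (fun n => w n * (1 - expR (- s) ^+ n)) @ \oo --> l - psum w (expR (- s)).
  have := cvg_seriesD wl (cvg_seriesZ (c := -1) c1); rewrite mulN1r; apply: cvg_trans.
  apply: near_eq_cvg; apply: nearW => n; rewrite /series /=; apply: eq_bigr => k _; ring.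
apply: nnseries_le c2 => k; rewrite mulr_ge0 // subr_ge0 exprn_ile1 //; by case/andP: y01.
Unshelve. all: by end_near. Qed.

Let osc_window n0 n ep : (0 < n0)%N -> 0 < ep <= 2^-1 ->
  (1 - ep) * n0%:R <= n%:R -> n%:R <= (1 + ep) * n0%:R ->
  `|e n0 - e n| <= 8 * Ce * ep / n0%:R `^ (1 + b).
Proof.
move=> n0_gt0 /andP[ep0 ep12].
have n0' : 0 < n0%:R :> R by rewrite ltr0n.
set nb := _ `^ (1 + b); have nb0 : 0 < nb by rewrite powR_gt0.
move=> h1 h2.
have epn : ep * n0%:R <= 2^-1 * n0%:R by rewrite ler_pM2r.
have nb2 : n0%:R `^ (- (2 + b)) = (nb * n0%:R)^-1.
  rewrite powRN; have -> : 2 + b = (1 + b) + 1 by ring.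
  by rewrite powRD ?(gt_eqF n0') ?implybT // powRr1 ?ltW.
have [n0n|nn0] := leqP n0 n.
  apply: le_trans (e_osc n0_gt0 n0n _) _.
    by rewrite -(ler_nat R) natrM; lra.
  rewrite nb2 invfM; have -> : 8 * Ce * ep / nb = 8 * (Ce * (ep * n0%:R) * (nb^-1 / n0%:R)) by field; rewrite !gt_eqF.
  have h3 : Ce * (n%:R - n0%:R) * (nb^-1 / n0%:R) <= Ce * (ep * n0%:R) * (nb^-1 / n0%:R).
    rewrite ler_pM2r ?divr_gt0 ?invr_gt0 // ler_pM2l //; lra.
  apply: le_trans h3 _; rewrite ler_peMl ?ler1n // !mulr_ge0 ?invr_ge0 ?(ltW Ce0) ?(ltW ep0) // ltW //.
have n_gt0 : (0 < n)%N by rewrite -(ltr_nat R); lra.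
rewrite distrC; apply: le_trans (e_osc n_gt0 (ltnW nn0) _) _.
  by rewrite -(ler_nat R) natrM; lra.
(* Here [n >= n0 / 2], so replacing [n] by [n0] costs at most [2 ^ (2 + b) <= 8]. *)
have hh : n%:R `^ (- (2 + b)) <= 8 * n0%:R `^ (- (2 + b)).
  have np : 0 < n%:R :> R by rewrite ltr0n.
  rewrite !powRN -[8](invrK) -invfM lef_pV2 ?posrE ?mulr_gt0 ?powR_gt0 ?invr_gt0 ?ltr0n //.
  have -> : 8^-1 * n0%:R `^ (2 + b) <= n%:R `^ (2 + b) = true; last by [].
  apply: (@le_trans _ _ ((2^-1 * n0%:R) `^ (2 + b))).
    rewrite powRM ?invr_ge0 ?ler0n // ler_pM2r ?powR_gt0 //.
    have -> : 8^-1 = (2^-1) `^ 3 :> R by rewrite powR_mulrn ?invr_ge0 ?ler0n // exprVn; congr (_^-1); rewrite -natrX.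
    by apply: ger_powR; [rewrite invr_gt0 ltr0n invf_le1 ?ler1n|case/andP: b01 => _; lra].
  by rewrite ge0_ler_powR ?nnegrE ?mulr_ge0 ?invr_ge0 ?ler0n //; [case/andP: b01; lra|lra].
apply: (@le_trans _ _ (Ce * (ep * n0%:R) * (8 * n0%:R `^ (- (2 + b))))).
  apply: ler_pM; rewrite ?powR_ge0 ?mulr_ge0 ?(ltW Ce0) ?subr_ge0 ?ler_nat ?(ltnW nn0) //.
  rewrite ler_pM2l //; lra.
rewrite nb2 invfM le_eqVlt; apply/orP; left; apply/eqP; field; by rewrite !gt_eqF.
Qed.

(* The kernel [(y (1 - y)) ^ m] with [y = 2 ^ (- n / n0)] concentrates at [n = n0]
   as [m] grows, and it is a polynomial in [y]. *)
Theorem tauberian : e n * n%:R `^ (1 + b) @[n --> \oo] --> (0 : R).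
Proof.
have [Kr Kr0 [sr sr0 hr]] := ref_bound.
have ln2 : 0 < ln 2 :> R by rewrite ln_gt0 // ltr1n.
have ln21 : ln 2 <= 1 :> R.
  have h : -1 < (1 : R) by lra.
  exact: (le_ln1Dx h).
have expln2 : expR (- ln 2) = 2^-1 :> R by rewrite expRN lnK // posrE.
apply/cvgrPdist_le => e0 e00.
(* The window around [n0] has relative half-width [ep], chosen so that the oscillation of [e] across
   it accounts for at most [e0 / 2]. *)
pose ep : R := Num.min (2^-1) (e0 / (2 * (8 * Ce))).
have ep0 : 0 < ep by rewrite lt_min invr_gt0 ltr0n /= divr_gt0 // !mulr_gt0.
have ep12 : ep <= 2^-1 by rewrite ge_min lexx.
have epe : 8 * Ce * ep <= e0 / 2.
  have : ep <= e0 / (2 * (8 * Ce)) by rewrite ge_min lexx orbT.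
  by rewrite ler_pdivlMr ?mulr_gt0 // ler_pdivlMr //; lra.
(* Outside the window [y = 2 ^ (- n / n0)] is at distance at least [d] from [1 / 2], so
   [y (1 - y) <= tau]. For [n0 <= n <= (1 + ep') n0] the distance is at most [d / 2], so
   [y (1 - y) >= rho > tau]. *)
pose d : R := Num.min (2^-1 - expR (- ((1 + ep) * ln 2))) (expR (- ((1 - ep) * ln 2)) - 2^-1).
have d0 : 0 < d.
  by rewrite lt_min !subr_gt0 -expln2 !ltr_expR !ltrN2 -{1 4}[ln 2]mul1r !ltr_pM2r //; lra.
have d12 : d <= 2^-1 by rewrite ge_min gerBl expR_ge0.
pose ep' := Num.min d ep.
have ep'0 : 0 < ep' by rewrite lt_min d0.
pose tau : R := 4^-1 - d ^+ 2; pose rho : R := 4^-1 - (d / 2) ^+ 2.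
have tau0 : 0 <= tau.
  rewrite subr_ge0; have -> : 4^-1 = (2^-1) ^+ 2 :> R by rewrite exprVn expr2 -natrM.
  by rewrite ler_pXn2r ?nnegrE // ltW.
have taurho : tau < rho by rewrite /tau /rho; have := exprn_gt0 2 d0; rewrite expr_div_n; lra.
have rho0 : 0 < rho by exact: le_lt_trans taurho.
have [m hm] : exists m, Ce * Kr * tau ^+ m * (ln 2) `^ b / (rho ^+ m.+1 * ep') <= e0 / 4.
  have : (tau / rho) ^+ m @[m --> \oo] --> 0.
    by apply: cvg_expr; rewrite ger0_norm ?divr_ge0 // ?(ltW rho0) // ltr_pdivrMr // mul1r.
  pose k : R := Ce * Kr * (ln 2) `^ b / (rho * ep').
  have k0 : 0 < k by rewrite divr_gt0 // !mulr_gt0 // powR_gt0.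
  have e4k : 0 < e0 / 4 / k by apply: divr_gt0 => //; apply: divr_gt0.
  move=> /cvgrPdist_le /(_ _ e4k) [m _ /(_ m (leqnn _))].
  rewrite /= sub0r normrN ger0_norm ?exprn_ge0 ?divr_ge0 ?(ltW rho0) // ler_pdivlMr // => h.
  exists m; apply: le_trans h; rewrite /k exprS expr_div_n le_eqVlt; apply/orP; left; apply/eqP.
  by field; rewrite !gt_eqF // ?exprn_gt0.
(* Outside the window, one of the [m + 1] factors is bounded by [1 - y], to be summed by
   [ref_bound], and the others give [tau ^ m]. *)
pose p : {poly R} := ('X * (1 - 'X)) ^+ m.+1.
have pE y : p.[y] = (y * (1 - y)) ^+ m.+1 by rewrite horner_exp !hornerE.
have p1 : p.[1] = 0 by rewrite pE subrr mulr0 expr0n.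
have [K [Kcvg Klim]] := tauberian_poly p1.
pose eta : R := e0 / 4 * (rho ^+ m.+1 * ep') / (ln 2) `^ b.
have eta0 : 0 < eta by rewrite divr_gt0 ?powR_gt0 // !mulr_gt0 ?exprn_gt0 ?divr_gt0.
have Kb : \forall s \near 0^'+, `|K s / s `^ b| <= eta.
  by have /cvgrPdist_le/(_ _ eta0) := Klim; apply: filterS => s; rewrite sub0r normrN.
have sn : ln 2 / n%:R @[n --> \oo] --> (0 : R)^'+.
  apply: cvg_right0; last first.
    by near=> n; rewrite divr_gt0 // ltr0n; near: n; exists 1%N.
  have h : ln 2 * n%:R `^ (- 1) @[n --> \oo] --> ln 2 * (0 : R) by apply: cvgMr; exact: cvg_powRN0.
  by move: h; rewrite mulr0; under eq_fun do rewrite powR_inv1 ?ler0n //.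
have near_sr : \forall n \near \oo, ln 2 / n%:R < sr := sn _ (nbhs_right_lt sr0).
have near_K : \forall n \near \oo, `|K (ln 2 / n%:R) / (ln 2 / n%:R) `^ b| <= eta := sn _ Kb.
near=> n0.
have n0_gt0 : (0 < n0)%N by near: n0; exists 1%N.
have n0' : 0 < n0%:R :> R by rewrite ltr0n.
have ssr' : ln 2 / n0%:R < sr by near: n0; exact: near_sr.
have Ks' : `|K (ln 2 / n0%:R) / (ln 2 / n0%:R) `^ b| <= eta by near: n0; exact: near_K.
pose s : R := ln 2 / n0%:R; have s0 : 0 < s by rewrite divr_gt0.
have ssr : s < sr := ssr'.
have Ks : `|K s| <= eta * s `^ b.
  have : `|K s / s `^ b| <= eta := Ks'.
  by rewrite normrM [X in _ * X]ger0_norm ?invr_ge0 ?powR_ge0 // ler_pdivrMr // powR_gt0.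
pose y n := expR (- s) ^+ n.
have yE n : y n = expR (- (n%:R / n0%:R * ln 2)).
  by rewrite /y -expRM_natl /s; congr expR; field; rewrite gt_eqF.
have y0 n : 0 <= y n by rewrite yE expR_ge0.
have y1 n : y n <= 1.
  rewrite yE -[leRHS]expR0 ler_expR oppr_le0.
  exact: (mulr_ge0 (divr_ge0 (ler0n _ _) (ler0n _ _)) (ltW ln2)).
pose nb : R := n0%:R `^ (1 + b); have nb0 : 0 < nb by rewrite powR_gt0.
rewrite sub0r normrN normrM [X in _ * X]gtr0_norm // -/nb.
have [small|big] := leP (`|e n0| * nb) (8 * Ce * ep); first by apply: le_trans small (le_trans epe _); rewrite ler_pdivrMr // ler_peMr ?ler1n // ltW.
(* Throughout the window [sg (e n0) * e n >= A > 0], so that no cancellation occurs there. *)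
pose A := `|e n0| - 8 * Ce * ep / nb.
have A0 : 0 < A by rewrite subr_gt0 ltr_pdivrMr.
pose k := Num.truncn (ep' * n0%:R).
have kle : k%:R <= ep' * n0%:R by rewrite truncn_le mulr_ge0 // ltW.
have klt : ep' * n0%:R < k.+1%:R by exact: truncnS_gt.
have osc n : (1 - ep) * n0%:R <= n%:R -> n%:R <= (1 + ep) * n0%:R -> `|e n0 - e n| <= 8 * Ce * ep / nb.
  by apply: osc_window => //; rewrite ep0.
have sq y' : y' * (1 - y') = 4^-1 - (y' - 2^-1) ^+ 2 :> R by field.
have pos n : 0 <= y n * (1 - y n) by rewrite mulr_ge0 // subr_ge0.
have outer n : ~~ ((1 - ep) * n0%:R <= n%:R <= (1 + ep) * n0%:R) -> y n * (1 - y n) <= tau.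
  rewrite negb_and -!ltNge => ho; rewrite sq lerD2l lerN2.
  suff : d <= `|y n - 2^-1| by move=> h; rewrite -[leRHS]real_normK ?num_real // ler_pXn2r ?nnegrE // ltW.
  case/orP: ho => ho.
    apply: le_trans (ler_norm _); rewrite (@le_trans _ _ (expR (- ((1 - ep) * ln 2)) - 2^-1)) //.
      by rewrite ge_min lexx orbT.
    by rewrite lerD2r yE ler_expR lerN2 ler_pM2r // ler_pdivrMr // ltW.
  rewrite -normrN opprB; apply: le_trans (ler_norm _).
  rewrite (@le_trans _ _ (2^-1 - expR (- ((1 + ep) * ln 2)))) //; first by rewrite ge_min lexx.
  by rewrite lerD2l lerN2 yE ler_expR lerN2 ler_pM2r // ler_pdivlMr // ltW.
have inner n : (n0 <= n)%N -> (n <= n0 + k)%N -> rho <= y n * (1 - y n).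
  move=> h1 h2; rewrite sq lerD2l lerN2.
  have u1 : 1 <= n%:R / n0%:R :> R by rewrite ler_pdivlMr // mul1r ler_nat.
  have u2 : n%:R / n0%:R <= 1 + ep'.
    rewrite ler_pdivrMr // mulrDl mul1r (@le_trans _ _ (n0 + k)%:R) ?ler_nat // natrD lerD2l //.
  have ya : y n <= 2^-1 by rewrite yE -expln2 ler_expR lerN2 -{1}[ln 2]mul1r ler_pM2r.
  have yb : 2^-1 - d / 2 <= y n.
    apply: (@le_trans _ _ (2^-1 * (1 - ep' * ln 2))).
      have : ep' * ln 2 <= d by rewrite -[d]mulr1 ler_pM // ?(ltW ep'0) ?(ltW ln2) // ge_min lexx.
      by move=> h; rewrite mulrBr mulr1 lerD2l lerN2 [leRHS]mulrC ler_pM2l ?invr_gt0.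
    rewrite yE -expln2; apply: le_trans (_ : _ <= expR (- ln 2) * expR (- (ep' * ln 2))) _.
      by rewrite ler_pM2l ?expR_gt0 // expR_ge1Dx.
    rewrite -expRD ler_expR -opprD lerN2 -{2}[ln 2]mul1r -mulrDl ler_pM2r //.
  rewrite -[leLHS]real_normK ?num_real // ler_pXn2r ?nnegrE ?divr_ge0 ?(ltW d0) //.
  rewrite ler_norml lerBrDl yb /= lerBlDr; apply: le_trans ya _.
  by rewrite lerDr divr_ge0 // ltW.
have pw n : (A * rho ^+ m.+1) *+ ((n0 <= n)%N && (n <= n0 + k)%N) - Ce * tau ^+ m * (w n * (1 - y n))
    <= Num.sg (e n0) * (e n * p.[y n]).
  rewrite pE.
  have pm0 : 0 <= (y n * (1 - y n)) ^+ m by rewrite exprn_ge0.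
  have pm1 : 0 <= (y n * (1 - y n)) ^+ m.+1 by rewrite exprn_ge0.
  have w0 : 0 <= w n by exact: powR_ge0.
  have tw0 : 0 <= Ce * tau ^+ m * (w n * (1 - y n)).
    by rewrite !mulr_ge0 ?exprn_ge0 ?(ltW Ce0) // subr_ge0.
  have [inW|outW] := boolP ((1 - ep) * n0%:R <= n%:R <= (1 + ep) * n0%:R); last first.
    have -> : (n0 <= n)%N && (n <= n0 + k)%N = false.
      apply: contraNF outW => /andP[h1 h2]; move: h1 h2.
      rewrite -!(ler_nat R) natrD => h1 h2.
      have epn' : ep' * n0%:R <= ep * n0%:R by rewrite ler_pM2r // ge_min lexx orbT.
      have : 0 <= ep * n0%:R by rewrite mulr_ge0 // ltW.
      rewrite mulrBl mulrDl mul1r => epn; apply/andP; split.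
        by apply: le_trans h1; rewrite gerBl.
      by apply: le_trans h2 _; rewrite lerD2l (le_trans kle).
    rewrite mulr0n sub0r -lerN2 opprK; apply: le_trans (ler_norm _) _.
    rewrite normrN normrM; apply: (@le_trans _ _ (1 * (Ce * w n * (tau ^+ m * (1 - y n))))).
      apply: ler_pM => //; first by rewrite normr_sg lern1 leq_b1.
      rewrite normrM; apply: ler_pM => //.
      rewrite ger0_norm // exprSr; apply: ler_pM => //.
        by rewrite lerXn2r ?nnegrE // outer.
      by rewrite ler_piMl ?subr_ge0.
    by rewrite mul1r le_eqVlt; apply/orP; left; apply/eqP; ring.
  have /andP[W1 W2] := inW.
  have hA : A <= Num.sg (e n0) * e n.
    exact: sgM_lower (osc n W1 W2).
  apply: (@le_trans _ _ (A * (y n * (1 - y n)) ^+ m.+1)); last first.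
    by rewrite [leRHS]mulrA ler_wpM2r.
  case: (boolP ((n0 <= n)%N && (n <= n0 + k)%N)) => [/andP[h1 h2]|_].
    apply: (@le_trans _ _ (A * rho ^+ m.+1)); first by rewrite mulr1n gerBl.
    by rewrite ler_pM2l // lerXn2r ?nnegrE ?(ltW rho0) // inner.
  apply: (@le_trans _ _ 0); first by rewrite mulr0n sub0r oppr_le0.
  by rewrite mulr_ge0 // ltW.
have fin M : (n0 + k < M)%N ->
   A * rho ^+ m.+1 * k.+1%:R - Ce * tau ^+ m * (Kr * s `^ b) <= Num.sg (e n0) * series (fun n => e n * p.[y n]) M.
  move=> hM; rewrite /series /= mulr_sumr; apply: le_trans (ler_sum _ (fun n _ => pw n)).
  rewrite sumrB; apply: lerB; last first.
    by rewrite -mulr_sumr ler_wpM2l ?mulr_ge0 ?exprn_ge0 ?(ltW Ce0) //; exact: hr.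
  rewrite (big_cat_nat (n := n0)) //=; last by apply: leq_trans (ltnW hM); exact: leq_addr.
  rewrite (big_cat_nat (m := n0) (n := (n0 + k).+1)) //=; last by rewrite leqW // leq_addr.
  have p0 n : 0 <= (A * rho ^+ m.+1) *+ ((n0 <= n)%N && (n <= n0 + k)%N).
    by rewrite mulrn_wge0 // mulr_ge0 ?exprn_ge0 ?(ltW rho0) // ltW.
  apply: le_trans (_ : _ <= 0 + (_ + 0)) _; last first.
    by apply: lerD; [exact: sumr_ge0|apply: lerD; [exact: lexx|exact: sumr_ge0]].
  rewrite add0r addr0 (eq_big_nat _ _ (F2 := fun=> A * rho ^+ m.+1)) => [|n /andP[h1 h2]]; last first.
    by rewrite h1 -ltnS h2.
  by rewrite sumr_const_nat subSn ?leq_addr // addKn mulr_natr.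
have hlim : A * rho ^+ m.+1 * k.+1%:R - Ce * tau ^+ m * (Kr * s `^ b) <= Num.sg (e n0) * K s.
  have h : Num.sg (e n0) * series (fun n => e n * p.[y n]) M @[M --> \oo] --> Num.sg (e n0) * K s.
    by apply: cvgMr; exact: Kcvg.
  rewrite -(cvg_lim _ h) //; apply: limr_ge; first by apply/cvg_ex; eexists; exact: h.
  by exists (n0 + k).+1 => // M /= hM; exact: fin.
have hK : Num.sg (e n0) * K s <= eta * s `^ b.
  apply: le_trans (ler_norm _) _; rewrite normrM; apply: le_trans Ks.
  by rewrite ler_piMl // normr_sg lern1 leq_b1.
have sb : s `^ b = (ln 2) `^ b * (n0%:R / nb).
  rewrite /s powRM ?(ltW ln2) ?invr_ge0 ?ler0n // -powR_inv1 ?ler0n // -powRrM mulN1r; congr (_ * _).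
  rewrite /nb -[X in X / _](powRr1 (ltW n0')) -powRB ?(gt_eqF n0') ?implybT //; congr (_ `^ _); ring.
have lnb0 : 0 < (ln 2) `^ b :> R by rewrite powR_gt0.
have rm0 : 0 < rho ^+ m.+1 by exact: exprn_gt0.
(* More than [ep' * n0] indices contribute at least [A * rho ^ m.+1] each, while the total is of
   order [s ^ b], a multiple of [n0 / nb]; the factors [n0] cancel. *)
have main : A * nb <= e0 / 2.
  have h1 : A * rho ^+ m.+1 * (ep' * n0%:R) <= (eta + Ce * tau ^+ m * Kr) * s `^ b.
    apply: (@le_trans _ _ (A * rho ^+ m.+1 * k.+1%:R)); first by rewrite ler_pM2l ?mulr_gt0 // ltW.
    by rewrite [leRHS]mulrDl -lerBlDr -[X in _ - X]mulrA; exact: le_trans hlim hK.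
  have h2 : A * nb <= (eta + Ce * tau ^+ m * Kr) * (ln 2) `^ b / (rho ^+ m.+1 * ep').
    rewrite ler_pdivlMr ?mulr_gt0 //.
    rewrite -(ler_pM2r (_ : 0 < n0%:R / nb)) ?divr_gt0 //.
    rewrite -[leRHS]mulrA -sb; apply: le_trans h1.
    by rewrite le_eqVlt; apply/orP; left; apply/eqP; field; rewrite gt_eqF.
  apply: le_trans h2 _; rewrite mulrDl mulrDl.
  have -> : eta * ln 2 `^ b / (rho ^+ m.+1 * ep') = e0 / 4 by rewrite /eta; field; rewrite !gt_eqF.
  have -> : Ce * tau ^+ m * Kr * ln 2 `^ b / (rho ^+ m.+1 * ep') = Ce * Kr * tau ^+ m * ln 2 `^ b / (rho ^+ m.+1 * ep') by ring.
  by move: hm; lra.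
have -> : `|e n0| * nb = A * nb + 8 * Ce * ep by rewrite /A; field; rewrite gt_eqF.
lra.
Unshelve. all: by end_near. Qed.

End Tauberian.

(** * Oscillation of the coefficients *)

Section Oscillation.
Variable R : realType.
Local Notation Cx := (R[i])%C.

Lemma cabs_sub1X (z : Cx) d : cabs z <= 1 -> cabs (z ^+ d - 1) <= d%:R * cabs (z - 1).
Proof.
move=> z1; have c1 : cabs (1 : Cx) <= 1 by rewrite /cabs /= expr0n /= addr0 expr1n sqrtr1.
case: d => [|d]; first by rewrite expr0 subrr mul0r /cabs /= expr0n /= addr0 sqrtr0.
by have := cabs_subX d z1 c1; rewrite !expr1n mulr1.
Qed.

Variables (q : nat -> R) (mu p c : R).
Hypothesis q0 : forall k, 0 <= q k.
Hypothesis q1 : series q @ \oo --> (1 : R).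
Hypothesis qmu : series (fun k => k%:R * q k) @ \oo --> mu.
Hypothesis p12 : 1 <= p <= 2.
Hypothesis c0 : 0 < c.
Hypothesis decay : forall t, 0 <= t <= pi -> cabs (chf q t) ^+ 2 <= 1 - c * t `^ p.

Let mu0 : 0 <= mu.
Proof. by have := sum_ord_le 0 (fun k => mulr_ge0 (ler0n _ k) (q0 k)) qmu; rewrite big_ord0. Qed.

Lemma chf_pow_le t N : 0 <= t <= pi -> cabs (chf q t) ^+ N <= expR (- (c / 2 * (N%:R * t `^ p))).
Proof.
move=> t0pi; have h : cabs (chf q t) <= expR (- (c / 2 * t `^ p)).
  rewrite -(ler_pXn2r (n := 2)) ?nnegrE ?cabs_ge0 ?expR_ge0 // -expRM_natl.
  apply: le_trans (decay t0pi) _.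
  have -> : 2%:R * - (c / 2 * t `^ p) = - (c * t `^ p) by field.
  exact: expR_ge1Dx.
apply: (@le_trans _ _ (expR (- (c / 2 * t `^ p)) ^+ N)).
  by rewrite lerXn2r ?nnegrE ?cabs_ge0 ?expR_ge0.
by rewrite -expRM_natl ler_expR le_eqVlt; apply/orP; left; apply/eqP; ring.
Qed.

(** The argument [hK] is the conclusion of [itg_decay]: the caller fixes [K] before [N] and [n], so
    that the resulting constants are uniform. *)
Lemma cpow_sub_itg (g D : R) (K : R) N N' (n n' : nat) : 0 <= g <= 3 -> 0 <= D -> (0 < N)%N ->
  (forall (p g D : R) (N : nat) (F : R -> R), 1 <= p -> 0 <= g <= 3 -> 0 <= D -> (0 < N)%N ->
    continuous F ->
    (forall t, 0 <= t <= pi -> `|F t| <= D * (expR (- (c / 2 * (N%:R * t `^ p))) * t `^ g)) ->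
    `|itg 0 pi F| <= D * K * N%:R `^ (- ((1 + g) / p))) ->
  (forall t, 0 <= t <= pi ->
     cabs (chf q t ^+ (N' - N) * cis ((n%:R - n'%:R) * t) - 1) <= D * t `^ g) ->
  (N <= N')%N ->
  `|cpow q N n - cpow q N' n'| <= D * K / pi * N%:R `^ (- ((1 + g) / p)).
Proof.
move=> g03 D0 N0 hK hD NN'.
have cF (m M : nat) : continuous (fun t : R => Re (chf q t ^+ M * cis (- m%:R * t))).
  by apply: (proj1 (ccontM (ccontX M (chf_cont q0 q1 qmu)) (ccont_cis _))).
have E : pi * (cpow q N n - cpow q N' n') = itg 0 pi (fun t : R =>
     Re (chf q t ^+ N * cis (- n%:R * t)) - Re (chf q t ^+ N' * cis (- n'%:R * t))).
  by rewrite itgB // !(cpow_fourier q0 q1 qmu) mulrBr.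
have pi0 := pi_gt0 R.
rewrite -(ler_pM2l pi0) -[X in X * _](gtr0_norm pi0) -normrM E.
have -> : pi * (D * K / pi * N%:R `^ (- ((1 + g) / p))) = D * K * N%:R `^ (- ((1 + g) / p)).
  by rewrite mulrC mulrAC divfK // gt_eqF.
have [p1 _] := andP p12.
apply: hK => //.
  by move=> t; apply: cvgB; exact: cF.
move=> t t0pi; rewrite -cReN -cReD; apply: le_trans (Re_le_cabs _) _.
have -> : chf q t ^+ N * cis (- n%:R * t) - chf q t ^+ N' * cis (- n'%:R * t) =
   - (chf q t ^+ N * cis (- n%:R * t) * (chf q t ^+ (N' - N) * cis ((n%:R - n'%:R) * t) - 1)).
  have -> : cis (- n'%:R * t) = cis (- n%:R * t) * cis ((n%:R - n'%:R) * t).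
    by rewrite -cisD; congr cis; ring.
  have -> : chf q t ^+ N' = chf q t ^+ N * chf q t ^+ (N' - N) by rewrite -exprD subnKC.
  ring.
rewrite cabsN !cabsM cabs_cis mulr1 cabsX.
have -> : D * (expR (- (c / 2 * (N%:R * t `^ p))) * t `^ g) = expR (- (c / 2 * (N%:R * t `^ p))) * (D * t `^ g).
  by ring.
by apply: ler_pM; rewrite ?exprn_ge0 ?cabs_ge0 //; [exact: chf_pow_le|exact: hD].
Qed.

(** A change of either argument multiplies the Fourier integrand by a factor within [O(t)] of 1,
    whence the exponent [2 / p]. *)
Lemma cpow_osc : exists2 C : R, 0 < C & forall N N' n n', (0 < N)%N -> (N <= N')%N ->
  `|cpow q N n - cpow q N' n'| <= C * ((N' - N)%:R + `|n%:R - n'%:R|) * N%:R `^ (- (2 / p)).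
Proof.
have c20 : 0 < c / 2 by rewrite divr_gt0.
have [K K0 hK] := itg_decay c20.
have pi0 := pi_gt0 R; have mu1 : 0 < mu + 1 by rewrite ltr_wpDl.
exists ((mu + 1) * K / pi); first by rewrite divr_gt0 // mulr_gt0.
move=> N N' n n' N0 NN'.
pose D := (mu + 1) * ((N' - N)%:R + `|n%:R - n'%:R|).
have D0 : 0 <= D by rewrite mulr_ge0 ?(ltW mu1) // addr_ge0.
have -> : (mu + 1) * K / pi * ((N' - N)%:R + `|n%:R - n'%:R|) * N%:R `^ (- (2 / p)) =
  D * K / pi * N%:R `^ (- ((1 + 1) / p)) by rewrite /D; ring.
apply: cpow_sub_itg => //; first by rewrite ler01 ler1n.
move=> t /andP[t0 _]; rewrite powRr1 //.
have -> : chf q t ^+ (N' - N) * cis ((n%:R - n'%:R) * t) - 1 =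
   (chf q t ^+ (N' - N) - 1) * cis ((n%:R - n'%:R) * t) + (cis ((n%:R - n'%:R) * t) - 1) by ring.
apply: le_trans (cabsD _ _) _; rewrite cabsM cabs_cis mulr1.
have h1 := cabs_sub1X (N' - N) (chf_le1 q0 q1 t).
have h2 := chf_sub1 q0 q1 qmu t.
have h3 := cabs_cis_sub1 ((n%:R - n'%:R) * t).
rewrite normrM (ger0_norm t0) in h3; rewrite (ger0_norm t0) in h2.
have h4 : (N' - N)%:R * cabs (chf q t - 1) <= (N' - N)%:R * (mu * t) by rewrite ler_wpM2l.
have h5 : 0 <= (N' - N)%:R * t by rewrite mulr_ge0.
have h6 : 0 <= mu * (`|n%:R - n'%:R| * t) by rewrite !mulr_ge0.
rewrite /D; move: h1 h3 h4 h5 h6; lra.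
Qed.

Lemma cpow_bound : exists2 C : R, 0 < C & forall N n, (0 < N)%N ->
  0 <= cpow q N n <= C * N%:R `^ (- p^-1).
Proof.
have c20 : 0 < c / 2 by rewrite divr_gt0.
have [K K0 hK] := itg_decay c20.
have pi0 := pi_gt0 R; have [p1 _] := andP p12.
exists (K / pi); first by rewrite divr_gt0.
move=> N n N0; apply/andP; split.
  elim: N n {N0} => [|N IH] n /=; first by case: (n == 0%N).
  by apply: sumr_ge0 => m _; rewrite mulr_ge0.
apply: le_trans (ler_norm _) _.
rewrite -(ler_pM2l pi0) -[X in X * _](gtr0_norm pi0) -normrM -(cpow_fourier q0 q1 qmu).
have -> : pi * (K / pi * N%:R `^ (- p^-1)) = 1 * K * N%:R `^ (- ((1 + 0) / p)).
  by rewrite addr0 div1r mul1r mulrC mulrAC divfK // gt_eqF.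
apply: hK => //; first by rewrite lexx ler0n.
  by apply: (proj1 (ccontM (ccontX N (chf_cont q0 q1 qmu)) (ccont_cis _))).
move=> t t0pi; rewrite powRr0 mulr1 mul1r; apply: le_trans (Re_le_cabs _) _.
by rewrite cabsM cabs_cis mulr1 cabsX; exact: chf_pow_le.
Qed.

(** Adding [d] to both arguments multiplies the integrand by [(chf t * cis (- t)) ^ d], which
    differs from 1 by [O(d t ^ p)] under the hypothesis, instead of [O(d t)]. This gains the power
    of [N] that the Tauberian theorem requires. *)
Lemma cpow_osc_centered :
  (exists2 C : R, 0 < C & forall t, 0 <= t <= pi -> cabs (chf q t * cis (- t) - 1) <= C * t `^ p) ->
  exists2 C : R, 0 < C & forall N n d, (0 < N)%N ->
  `|cpow q N n - cpow q (N + d) (n + d)| <= C * d%:R * N%:R `^ (- ((1 + p) / p)).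
Proof.
move=> [Cc Cc0 hc].
have c20 : 0 < c / 2 by rewrite divr_gt0.
have [K K0 hK] := itg_decay c20.
have pi0 := pi_gt0 R; have [p1 p2] := andP p12.
exists (Cc * K / pi); first by rewrite divr_gt0 // mulr_gt0.
move=> N n d N0.
have -> : Cc * K / pi * d%:R * N%:R `^ (- ((1 + p) / p)) =
  (Cc * d%:R) * K / pi * N%:R `^ (- ((1 + p) / p)) by ring.
apply: cpow_sub_itg => //; [lra|by rewrite mulr_ge0 // ltW| |exact: leq_addr].
move=> t t0pi; rewrite addKn.
have -> : (n%:R - (n + d)%:R) * t = d%:R * (- t) by rewrite natrD; ring.
rewrite cisM -exprMn; apply: le_trans (cabs_sub1X _ _) _.
  by rewrite cabsM cabs_cis mulr1; exact: chf_le1.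
by rewrite [Cc * _]mulrC -mulrA ler_wpM2l // hc.
Qed.

End Oscillation.

(** * The characteristic function of a law of mean 1 near 0 *)

Section Centered.
Variable R : realType.
Local Notation Cx := (R[i])%C.

Lemma sum_powRN_le (a : R) K M : 0 < a -> (0 < K)%N ->
  \sum_(K.+1 <= k < M) k%:R `^ (- (1 + a)) <= K%:R `^ (- a) / a.
Proof.
move=> a0 K0.
have [MK|KM] := leqP M K.+1.
  by rewrite big_geq // divr_ge0 ?powR_ge0 // ltW.
rewrite -(subnKC (ltnW KM)); elim: (M - K.+1)%N => [|m IH].
  by rewrite addn0 big_geq // divr_ge0 ?powR_ge0 // ltW.
suff : forall m, \sum_(K.+1 <= k < K.+1 + m) k%:R `^ (- (1 + a)) <= (K%:R `^ (- a) - (K + m)%:R `^ (- a)) / a :> R.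
  move=> h; apply: le_trans (h _) _.
  by rewrite ler_pM2r ?invr_gt0 // gerBl powR_ge0.
elim => [|j IHj]; first by rewrite !addn0 big_geq // subrr mul0r.
rewrite addnS big_nat_recr ?leq_addr //=; apply: le_trans (lerD IHj (lexx _)) _.
have /andP[h _] := powRN_tele a0 (leq_trans K0 (leq_addr j K)).
rewrite -lerBrDl -mulrBl ler_pdivlMr // mulrC addSn addnS.
apply: le_trans h _; lra.
Qed.

Variables (q : nat -> R) (al Cq : R).
Hypothesis q0 : forall k, 0 <= q k.
Hypothesis q1 : series q @ \oo --> (1 : R).
Hypothesis qmu : series (fun k => k%:R * q k) @ \oo --> (1 : R).
Hypothesis al12 : 1 < al < 2.
Hypothesis Cq0 : 0 < Cq.
Hypothesis qle : forall k, (0 < k)%N -> q k <= Cq * k%:R `^ (- (1 + al)).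

(** Mean 1 removes the linear term: [q k] multiplies [cis u - 1 - i u] with [u = (k - 1) t]. This
    factor is [O((k t) ^ 2)] for [k <= 1 / t] and [O(k t)] beyond. As [q k] is at most of order
    [k ^ (- 1 - al)] with [1 < al < 2], both parts sum to [O(t ^ al)]. *)
Lemma chf_centered : exists2 C : R, 0 < C &
  forall t, 0 <= t <= pi -> cabs (chf q t * cis (- t) - 1) <= C * t `^ al.
Proof.
have [al1 al2] := andP al12.
have a1 : 0 < al - 1 by rewrite subr_gt0.
have a2 : 0 < 2 - al by rewrite subr_gt0.
pose C1 : R := 2 * Cq / (2 - al); pose C2 : R := 2 * Cq * 2 `^ (al - 1) / (al - 1).
have C10 : 0 < C1 by rewrite divr_gt0 // mulr_gt0.
have C20 : 0 < C2 by rewrite divr_gt0 // mulr_gt0 ?powR_gt0 // mulr_gt0.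
exists (2 + C1 + C2); first by rewrite !addr_gt0.
move=> t /andP[t0 _].
have ta : 0 <= t `^ al by exact: powR_ge0.
have [t1|t1] := leP 1 t.
  apply: le_trans (cabsD _ _) _; rewrite cabsM cabs_cis mulr1 cabsN.
  have -> : cabs (1 : Cx) = 1 by rewrite /cabs /= expr0n /= addr0 expr1n sqrtr1.
  have h := chf_le1 q0 q1 t.
  have : 1 <= t `^ al.
    have : 1 `^ al <= t `^ al by rewrite ge0_ler_powR ?nnegrE //; lra.
    by rewrite powR1.
  have : 0 <= (C1 + C2) * t `^ al by rewrite mulr_ge0 // ltW // addr_gt0.
  rewrite -addrA mulrDl; lra.
have [t00|tn0] := eqVneq t 0.
  rewrite t00 powR0 ?mulr0 ?oppr0 ?cis0 ?mulr1; last by rewrite gt_eqF //; lra.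
  by have := chf_sub1 q0 q1 qmu 0; rewrite normr0 mulr0.
have {}t0 : 0 < t by rewrite lt_neqAle eq_sym tn0.
pose g k : Cx := cis ((k%:R - 1) * t) - 1 - Complex 0 ((k%:R - 1) * t).
have hcv : ccvg (fun n => \sum_(k < n) (q k)%:C%C * g k) (chf q t * cis (- t) - 1).
  have h1 := ccvgM (chf_cvg q0 q1 t) (ccvg_cst (cis (- t))).
  have h2 : ccvg (fun n => (series q n - series (fun k => k%:R * q k) n)%:C%C) ((1 - 1)%:C%C : Cx).
    by apply: ccvgR; exact: cvgB.
  have h3 := ccvgD (ccvgD h1 (ccvgM (ccvg_cst (-1)) (ccvg_mass q1))) (ccvgM (ccvg_cst (Complex 0 t)) h2).
  have el : chf q t * cis (- t) + -1 * 1 + Complex 0 t * (1 - 1)%:C%C = chf q t * cis (- t) - 1.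
    by rewrite subrr mulN1r [X in Complex 0 t * X](_ : _ = 0) // mulr0 addr0.
  rewrite el in h3.
  suff -> : (fun n => \sum_(k < n) (q k)%:C%C * g k) = (fun n => (\sum_(k < n) (q k)%:C%C * cis (k%:R * t)) * cis (- t) +
     -1 * \sum_(k < n) (q k)%:C%C + Complex 0 t * (series q n - series (fun k => k%:R * q k) n)%:C%C) by [].
  apply/funext => n.
  have -> : (series q n - series (fun k => k%:R * q k) n)%:C%C = \sum_(k < n) (q k - k%:R * q k)%:C%C.
    by rewrite /series /= !big_mkord -sumrB rmorph_sum.
  rewrite mulr_suml !mulr_sumr -!big_split /=; apply: eq_bigr => k _.
  have -> : Complex 0 t * (q k - k%:R * q k)%:C%C = - ((q k)%:C%C * Complex 0 ((k%:R - 1) * t)).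
    by apply: Cx_eq; rewrite ?cReN ?cImN ?cReM ?cImM /=; ring.
  have -> : cis (k%:R * t) = cis ((k%:R - 1) * t) * cis t by rewrite -cisD; congr cis; ring.
  have e1 : cis t * cis (- t) = 1 by rewrite -cisD subrr cis0.
  by rewrite -!mulrA e1 /g; ring.
apply: ccvg_le hcv => n; apply: le_trans (cabs_sum _ _ _) _.
have tV0 : 0 < t^-1 by rewrite invr_gt0.
pose K := Num.truncn t^-1.
have Kle : K%:R <= t^-1 by rewrite truncn_le ltW.
have Klt : t^-1 < K.+1%:R by exact: truncnS_gt.
have K0 : (0 < K)%N.
  rewrite -(ltr_nat R) -(ltrD2r 1) add0r natr1; apply: le_lt_trans Klt.
  by rewrite -[1]invr1 lef_pV2 ?posrE // ltW.
have K0' : 0 < K%:R :> R by rewrite ltr0n.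
have K2 : t^-1 <= 2 * K%:R.
  have : (1 : R) <= K%:R by rewrite ler1n.
  move: Klt; rewrite -natr1; lra.
have g0 k : 0 <= cabs (g k) by exact: cabs_ge0.
have gs k : cabs ((q k)%:C%C * g k) = q k * cabs (g k) by rewrite cabs_qz.
under eq_bigr do rewrite gs.
have ext : \sum_(k < n) q k * cabs (g k) <= \sum_(0 <= k < K.+1 + n) q k * cabs (g k).
  rewrite -(big_mkord xpredT (fun k => q k * cabs (g k))) [leRHS](big_cat_nat (n := n)) ?leq_addl //=.
  by rewrite lerDl sumr_ge0 // => k _; rewrite mulr_ge0.
apply: le_trans ext _.
rewrite (big_cat_nat (n := K.+1)) ?leq_addr //= big_ltn //=.
have km1 (k : nat) : (0 < k)%N -> 0 <= (k%:R : R) - 1 <= (k%:R : R).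
  by move=> k0; rewrite subr_ge0 ler1n k0 gerBl ler01.
(* The atom at 0 is treated apart: neither [qle] nor [|k - 1| <= k] covers it. *)
have b0 : q 0%N * cabs (g 0%N) <= 2 * t `^ al.
  have q01 : q 0%N <= 1.
    by have := nnseries_le 1 q0 q1; rewrite /series /= big_nat1.
  have h : cabs (g 0%N) <= 2 * t ^+ 2.
    by have := cis_order2 ((0%:R - 1) * t); rewrite /g; congr (_ <= _); ring.
  have t2 : t ^+ 2 <= t `^ al.
    by rewrite -(powR_mulrn 2 (ltW t0)); apply: ger_powR; [rewrite t0 ltW|exact: ltW].
  have : q 0%N * cabs (g 0%N) <= 1 * (2 * t ^+ 2) by apply: ler_pM.
  lra.
have b1 : \sum_(1 <= k < K.+1) q k * cabs (g k) <= C1 * t `^ al.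
  apply: (@le_trans _ _ (\sum_(1 <= k < K.+1) 2 * Cq * t ^+ 2 * k%:R `^ ((2 - al) - 1))).
    apply: ler_sum_nat => k /andP[k1 _].
    have kp : 0 < k%:R :> R by rewrite ltr0n.
    have h : cabs (g k) <= 2 * (k%:R * t) ^+ 2.
      apply: le_trans (cis_order2 _) _; rewrite ler_pM2l // !exprMn ler_wpM2r ?sqr_ge0 //.
      by have /andP[? ?] := km1 k k1; rewrite ler_pXn2r ?nnegrE.
    have -> : 2 * Cq * t ^+ 2 * k%:R `^ (2 - al - 1) = Cq * k%:R `^ (- (1 + al)) * (2 * (k%:R * t) ^+ 2).
      have -> : k%:R `^ (2 - al - 1) = k%:R `^ (- (1 + al)) * k%:R ^+ 2.
        rewrite -(powR_mulrn 2 (ltW kp)) -powRD ?(gt_eqF kp) ?implybT //; congr (_ `^ _); ring.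
      ring.
    by apply: ler_pM => //; exact: qle.
  rewrite -mulr_sumr.
  have a2' : 0 < 2 - al <= 1 by rewrite a2; lra.
  have S := sum_powR_le K a2'.
  have h : 2 * Cq * t ^+ 2 * \sum_(1 <= i < K.+1) i%:R `^ (2 - al - 1) <= 2 * Cq * t ^+ 2 * ((t^-1) `^ (2 - al) / (2 - al)).
    apply: ler_wpM2l; first exact: (mulr_ge0 (mulr_ge0 (ler0n _ 2) (ltW Cq0)) (sqr_ge0 t)).
    apply: (le_trans S).
    by rewrite ler_pM2r ?invr_gt0 // ge0_ler_powR ?nnegrE ?ler0n ?(ltW tV0) // ltW.
  apply: le_trans h _; rewrite /C1.
  have -> : t `^ al = t ^+ 2 * (t^-1) `^ (2 - al).
    rewrite -(powR_mulrn 2 (ltW t0)) -[t^-1](powR_inv1 (ltW t0)) -powRrM -powRD ?(gt_eqF t0) ?implybT //.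
    congr (_ `^ _); ring.
  by rewrite le_eqVlt; apply/orP; left; apply/eqP; ring.
have b2 : \sum_(K.+1 <= k < K.+1 + n) q k * cabs (g k) <= C2 * t `^ al.
  apply: (@le_trans _ _ (\sum_(K.+1 <= k < K.+1 + n) 2 * Cq * t * k%:R `^ (- (1 + (al - 1))))).
    apply: ler_sum_nat => k /andP[k1 _].
    have kg : (0 < k)%N by exact: leq_ltn_trans k1.
    have kp : 0 < k%:R :> R by rewrite ltr0n.
    have h : cabs (g k) <= 2 * (k%:R * t).
      have /andP[h1 h2] := km1 k kg.
      apply: le_trans (cis_order1 _) _; rewrite ler_pM2l // ger0_norm ?mulr_ge0 ?(ltW t0) //.
      by rewrite ler_pM2r.
    have -> : 2 * Cq * t * k%:R `^ (- (1 + (al - 1))) = Cq * k%:R `^ (- (1 + al)) * (2 * (k%:R * t)).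
      have -> : k%:R `^ (- (1 + (al - 1))) = k%:R `^ (- (1 + al)) * k%:R.
        rewrite -{3}(powRr1 (ltW kp)) -powRD ?(gt_eqF kp) ?implybT //; congr (_ `^ _); ring.
      ring.
    by apply: ler_pM => //; exact: qle.
  rewrite -mulr_sumr.
  have S := sum_powRN_le (K.+1 + n) a1 K0.
  have h : 2 * Cq * t * \sum_(K.+1 <= i < K.+1 + n) i%:R `^ (- (1 + (al - 1))) <=
      2 * Cq * t * ((2 * t) `^ (al - 1) / (al - 1)).
    apply: ler_wpM2l; first by rewrite !mulr_ge0 ?(ltW Cq0) ?(ltW t0).
    apply: (le_trans S).
    rewrite ler_pM2r ?invr_gt0 // powRN -[2 * t]invrK -[leRHS](_ : ((2 * t)^-1 `^ (al - 1))^-1 = _).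
      rewrite lef_pV2 ?posrE ?powR_gt0 ?invr_gt0 ?mulr_gt0 // ge0_ler_powR ?nnegrE ?ler0n ?invr_ge0 ?mulr_ge0 ?(ltW t0) ?(ltW a1) //.
      by rewrite invfM ler_pdivrMl.
    by rewrite -powRN -[in RHS](powR_inv1 (_ : 0 <= (2 * t)^-1)) ?invr_ge0 ?mulr_ge0 ?(ltW t0) // -powRrM mulN1r.
  apply: le_trans h _; rewrite /C2 powRM ?(ltW t0) //.
  have -> : t `^ al = t * t `^ (al - 1).
    by rewrite mulr_powRB1 ?(ltW t0) //; lra.
  by rewrite le_eqVlt; apply/orP; left; apply/eqP; ring.
have -> : (2 + C1 + C2) * t `^ al = 2 * t `^ al + (C1 * t `^ al + C2 * t `^ al) by ring.
by rewrite -addrA; apply: lerD => //; exact: lerD.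
Qed.

End Centered.

(** * Lazy walks and hitting times *)

Section BinomialExpectation.
Variable R : realType.
Implicit Types (l : R) (g : nat -> R).

(* The expectation of [g] under the binomial law with parameters [n] and [l]. *)
Fixpoint binom_mean l n g : R :=
  if n is n'.+1 then (1 - l) * binom_mean l n' g + l * binom_mean l n' (g \o S) else g 0%N.

Lemma binom_mean_le l n g g' : 0 <= l <= 1 -> (forall k, g k <= g' k) -> binom_mean l n g <= binom_mean l n g'.
Proof.
move=> /andP[l0 l1]; elim: n g g' => [|n IH] g g' gg' /=; first exact: gg'.
apply: lerD; first by rewrite ler_wpM2l ?subr_ge0 //; exact: IH.
by rewrite ler_wpM2l //; apply: IH => k; exact: gg'.
Qed.

Lemma binom_meanD l n g g' : binom_mean l n (fun k => g k + g' k) = binom_mean l n g + binom_mean l n g'.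
Proof.
elim: n g g' => [//|n IH] g g' /=.
have h : binom_mean l n ((fun k => g k + g' k) \o S) = _ := IH (g \o S) (g' \o S).
rewrite IH h; ring.
Qed.

Lemma binom_meanZ l n c g : binom_mean l n (fun k => c * g k) = c * binom_mean l n g.
Proof.
elim: n g => [//|n IH] g /=.
have h : binom_mean l n ((fun k => c * g k) \o S) = _ := IH (g \o S).
rewrite IH h; ring.
Qed.

Lemma binom_mean_cst l n c : binom_mean l n (fun=> c) = c.
Proof.
elim: n => [//|n IH] /=; have h : binom_mean l n ((fun=> c) \o S) = c := IH.
rewrite h; ring.
Qed.

Lemma binom_mean_sum l n m (g : nat -> nat -> R) :
  binom_mean l n (fun k => \sum_(i < m) g i k) = \sum_(i < m) binom_mean l n (g i).
Proof.
elim: m => [|m IH].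
  rewrite big_ord0 -[RHS](binom_mean_cst l n 0); congr binom_mean.
  by apply/funext => k; rewrite big_ord0.
rewrite big_ord_recr /= -IH -binom_meanD; congr binom_mean.
by apply/funext => k; rewrite big_ord_recr.
Qed.

Lemma binom_mean_abs l n g c : 0 <= l <= 1 -> `|binom_mean l n g - c| <= binom_mean l n (fun k => `|g k - c|).
Proof.
move=> l01; have l1 : 0 <= 1 - l by rewrite subr_ge0; case/andP: l01.
have l0 : 0 <= l by case/andP: l01.
elim: n g => [//|n IH] g /=.
have -> : (1 - l) * binom_mean l n g + l * binom_mean l n (g \o S) - c =
  (1 - l) * (binom_mean l n g - c) + l * (binom_mean l n (g \o S) - c) by ring.
apply: le_trans (ler_normD _ _) _; rewrite !normrM (ger0_norm l0) (ger0_norm l1).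
by apply: lerD; rewrite ler_wpM2l //; exact: IH.
Qed.

(** Variance plus squared bias. *)
Lemma binom_mean_sqr l n (a : R) :
  binom_mean l n (fun k => (k%:R + a) ^+ 2) = n%:R * l * (1 - l) + (n%:R * l + a) ^+ 2.
Proof.
elim: n a => [|n IH] a /=; first by ring.
rewrite IH [X in _ + _ * X](_ : _ = binom_mean l n (fun k => (k%:R + (a + 1)) ^+ 2)); last first.
  by congr binom_mean; apply/funext => k /=; rewrite -natr1; ring.
by rewrite IH -natr1; ring.
Qed.

End BinomialExpectation.

Section Lazy.
Variable R : realType.
Local Notation Cx := (R[i])%C.
Variables (l : R) (q : nat -> R).

(* A step taken with probability [l] only: for [l] the inverse of the mean of
   [q] this law has mean 1, which makes the hitting time theory below apply. *)
Definition lazy k : R := (1 - l) * (k == 0%N)%:R + l * q k.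

(** Conditioning on the number of proper steps, which is binomial. *)
Lemma cpow_lazy n m : cpow lazy n m = binom_mean l n (fun N => cpow q N m).
Proof.
elim: n m => [//|n IH] m /=.
have -> : binom_mean l n ((fun N => cpow q N m) \o S) =
  \sum_(k < m.+1) q k * binom_mean l n (fun N => cpow q N (m - k)).
  rewrite -[LHS]/(binom_mean l n (fun N => \sum_(k < m.+1) q k * cpow q N (m - k))).
  by rewrite (binom_mean_sum l n m.+1 (fun k N => q k * cpow q N (m - k))); apply: eq_bigr => k _; rewrite binom_meanZ.
under eq_bigr do rewrite IH /lazy mulrDl.
rewrite big_split /= mulr_sumr; congr (_ + _); last by apply: eq_bigr => k _; rewrite mulrA.
rewrite big_ord_recl /= big1 ?addr0 ?mulr1 ?subn0 // => k _.
by rewrite mulr0 mul0r.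
Qed.

Hypothesis l01 : 0 < l < 1.
Let l0 : 0 < l. Proof. by case/andP: l01. Qed.
Let l1 : 0 < 1 - l. Proof. by rewrite subr_gt0; case/andP: l01. Qed.
Hypothesis q0 : forall k, 0 <= q k.
Hypothesis q1 : series q @ \oo --> (1 : R).

Lemma lazy_ge0 k : 0 <= lazy k.
Proof. by rewrite /lazy addr_ge0 ?mulr_ge0 ?ler0n // ltW. Qed.

Lemma lazy0_gt0 : 0 < lazy 0.
Proof. by rewrite /lazy eqxx mulr1 ltr_pwDl // mulr_ge0 // ltW. Qed.

Lemma lazyS k : lazy k.+1 = l * q k.+1.
Proof. by rewrite /lazy mulr0 add0r. Qed.

Let cvg_delta : series (fun k => (k == 0%N)%:R : R) @ \oo --> (1 : R).
Proof.
rewrite -(cvg_shiftS (series _)); under eq_fun do rewrite /series /= big_nat_recl //= big1 // addr0.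
exact: cvg_cst.
Qed.

Lemma lazy_mass : series lazy @ \oo --> (1 : R).
Proof.
have h := cvg_seriesD (cvg_seriesZ (c := 1 - l) cvg_delta) (cvg_seriesZ (c := l) q1).
by move: h; rewrite !mulr1 subrK.
Qed.

Lemma lazy_mean mu : series (fun k => k%:R * q k) @ \oo --> mu ->
  series (fun k => k%:R * lazy k) @ \oo --> l * mu.
Proof.
move=> qmu; have h := cvg_seriesZ (c := l) qmu.
rewrite (_ : (fun k => k%:R * lazy k) = (fun k => l * (k%:R * q k))) //.
by apply/funext => -[|k]; rewrite ?mul0r ?mulr0 // lazyS mulrCA.
Qed.

Lemma chf_lazy t : chf lazy t = (1 - l)%:C%C + l%:C%C * chf q t.
Proof.
have h1 := chf_cvg lazy_ge0 lazy_mass t.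
have h2 : ccvg (fun n => \sum_(k < n) (lazy k)%:C%C * cis (k%:R * t)) ((1 - l)%:C%C + l%:C%C * chf q t).
  have d : ccvg (fun n => (series (fun k => (k == 0%N)%:R : R) n)%:C%C) (1%:C%C : Cx).
    exact: ccvgR.
  have := ccvgD (ccvgM (ccvg_cst (1 - l)%:C%C) d) (ccvgM (ccvg_cst l%:C%C) (chf_cvg q0 q1 t)).
  rewrite (_ : (1 - l)%:C%C * 1%:C%C = (1 - l)%:C%C :> Cx); last exact: mulr1.
  congr (ccvg _ _); apply/funext => n.
  rewrite /series /= big_mkord rmorph_sum !mulr_sumr -big_split /=.
  have RM (a d : R) : (a * d)%:C%C = a%:C%C * d%:C%C :> Cx := rmorphM _ a d.
  apply: eq_bigr => k _.
  have -> : (lazy k)%:C%C = (1 - l)%:C%C * ((k == 0%N :> nat)%:R)%:C%C + l%:C%C * (q k)%:C%C :> Cx.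
    by rewrite -!RM; apply: Cx_eq; rewrite ?cReD ?cImD //= addr0.
  rewrite mulrDl -mulrA; congr (_ + _); last by rewrite mulrA.
  case: eqP => [->|_]; last by rewrite !(mulr0, mul0r).
  by rewrite mul0r cis0 mulr1.
case: h1 => h1r h1i; case: h2 => h2r h2i.
by apply: Cx_eq; [exact: cvg_unique h1r h2r|exact: cvg_unique h1i h2i].
Qed.

(** The lazy characteristic function is a convex combination of 1 and [chf q t], and the square is
    convex. *)
Lemma chf_lazy_decay c p t : cabs (chf q t) ^+ 2 <= 1 - c * t `^ p ->
  cabs (chf lazy t) ^+ 2 <= 1 - l * c * t `^ p.
Proof.
move=> h; have z1 := chf_le1 q0 q1 t.
have h1 : cabs (chf lazy t) <= 1 - l + l * cabs (chf q t).
  rewrite chf_lazy; apply: le_trans (cabsD _ _) _; rewrite cabsM !cabsR.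
  by rewrite (gtr0_norm l0) (gtr0_norm l1).
have h2 : cabs (chf lazy t) ^+ 2 <= (1 - l + l * cabs (chf q t)) ^+ 2.
  by rewrite ler_pXn2r ?nnegrE ?cabs_ge0 // addr_ge0 ?mulr_ge0 ?cabs_ge0 ?(ltW l1) ?(ltW l0).
have h3 : (1 - l + l * cabs (chf q t)) ^+ 2 <= 1 - l + l * cabs (chf q t) ^+ 2.
  rewrite -subr_ge0.
  have -> : 1 - l + l * cabs (chf q t) ^+ 2 - (1 - l + l * cabs (chf q t)) ^+ 2 =
    l * (1 - l) * (1 - cabs (chf q t)) ^+ 2 by ring.
  by rewrite mulr_ge0 ?sqr_ge0 // mulr_ge0 // ltW.
apply: le_trans h2 (le_trans h3 _).
have : l * cabs (chf q t) ^+ 2 <= l * (1 - c * t `^ p) by rewrite ler_pM2l.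
by move: (cabs _ ^+ 2) => x; rewrite -mulrA mulrBr mulr1; move: (l * _) => y; lra.
Qed.

End Lazy.

(** * The cycle lemma and hitting times *)

Section CycleLemma.
Variable R : comNzRingType.
Variable w : nat -> R.

(** Coefficient extraction in [x (W ^ n.+1)' = n.+1 x W' W ^ n]. In probabilistic terms, given that
    [n.+1] exchangeable steps add up to [m], each has conditional mean [m / n.+1]; this is the core
    of the cycle lemma. *)
Lemma cpow_deriv n m :
  n.+1%:R * \sum_(j < m.+1) j%:R * w j * cpow w n (m - j) = m%:R * cpow w n.+1 m.
Proof.
pose W := \poly_(k < m.+1) w k.
have e : ('X * (W ^+ n.+1)^`())`_m = m%:R * cpow w n.+1 m.
  rewrite (cpowE w n.+1 (ltnSn m)) coefXM coef_deriv; case: m @W => [|m] W /=; first by rewrite mul0r.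
  by rewrite mulr_natl.
rewrite -e deriv_exp /= mulrnAr coefMn -[RHS]mulr_natl; congr (_ * _).
rewrite mulrA coefM; apply: eq_bigr => j _.
rewrite -(cpowE w n (_ : (m - j < m.+1)%N)) ?ltnS ?leq_subr //; congr (_ * _).
rewrite coefXM coef_deriv coef_poly; case: (j : nat) (ltn_ord j) => [|i] hi /=; first by rewrite mul0r.
by rewrite hi mulr_natl.
Qed.

End CycleLemma.

Section Hitting.
Variable R : realType.
Variable w : nat -> R.

Lemma cpow_ge0 n m : (forall k, 0 <= w k) -> 0 <= cpow w n m.
Proof.
move=> w0; elim: n m => [|n IH] m /=; first by case: (m == 0%N).
by apply: sumr_ge0 => k _; rewrite mulr_ge0.
Qed.

(* By the cycle lemma this is the probability that a walk started at [k], with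
   steps distributed as [w] shifted by [-1], first visits [0] at time [n]. *)
Definition hit k n : R :=
  if n == 0%N then (k == 0%N)%:R else if (k <= n)%N then k%:R / n%:R * cpow w n (n - k) else 0.

Lemma hit_gt k n : (n < k)%N -> hit k n = 0.
Proof.
rewrite /hit; case: eqP => [->|_]; first by case: k.
by move=> h; rewrite leqNgt h.
Qed.

(** Decomposition at the first step, which leads from [k.+1] to [k + j]; it is verified on the
    closed form of [hit] by means of [cpow_deriv]. Any [J] beyond [n.+1] will do, because [hit]
    vanishes when the start exceeds the time. *)
Lemma hit_rec k n J : (n.+1 < J)%N -> hit k.+1 n.+1 = \sum_(j < J) w j * hit (k + j) n.
Proof.
move=> nJ; have [kn|kn] := ltnP n k.
  rewrite hit_gt // big1 // => j _; rewrite hit_gt ?mulr0 //.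
  exact: leq_trans kn (leq_addr _ _).
have sJ : ((n - k).+1 <= J)%N by apply: leq_trans nJ; rewrite ltnS (leq_trans (leq_subr _ _)).
rewrite -(big_mkord xpredT (fun j => w j * hit (k + j) n)) (big_cat_nat (n := (n - k).+1)) //=.
rewrite [X in _ + X]big_nat_cond [X in _ + X]big1 ?addr0; last first.
  move=> j /andP[/andP[h _] _]; rewrite hit_gt ?mulr0 //.
  by rewrite -ltn_subLR.
rewrite big_mkord; case: n kn {nJ sJ} => [|n] kn.
  move: kn; rewrite leqn0 => /eqP ->; rewrite subnn big_ord_recl big_ord0 /hit /= big_ord_recl big_ord0.
  by rewrite !mulr1 !addr0 divr1 !mul1r.
have n0 : n.+1%:R != 0 :> R by rewrite pnatr_eq0.
have n1 : n.+2%:R != 0 :> R by rewrite pnatr_eq0.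
set m := (n.+1 - k)%N.
have -> : \sum_(j < m.+1) w j * hit (k + j) n.+1 =
    n.+1%:R^-1 * (k%:R * cpow w n.+2 m + \sum_(j < m.+1) j%:R * w j * cpow w n.+1 (m - j)).
  rewrite /= mulr_sumr -big_split mulr_sumr; apply: eq_bigr => j _ /=.
  have jm : (j <= m)%N by rewrite -ltnS.
  rewrite /hit /= ifT; last by rewrite -leq_subRL.
  rewrite subnDA -/m natrD; ring.
have := cpow_deriv w n.+1 m; set S := \sum_(j < m.+1) _ => hS.
have -> : S = m%:R / n.+2%:R * cpow w n.+2 m.
  by apply: (mulfI n1); rewrite hS; field; rewrite -?natr1 ?n1 // natr1 n1.
have -> : hit k.+1 n.+2 = k.+1%:R / n.+2%:R * cpow w n.+2 m by rewrite /hit /= ltnS kn subSS.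
set c := cpow w n.+2 m.
have -> : m%:R = n.+1%:R - k%:R :> R by rewrite natrB.
rewrite -[in X in X / _](natr1 k) -[in X in _ = X](natr1 n.+1) -[in LHS](natr1 n.+1).
have n1' : n.+1%:R + 1 != 0 :> R by rewrite natr1.
move: n0 n1'; move: (n.+1%:R : R) => x n0 n1'.
by field; rewrite n0 n1'.
Qed.

Hypothesis w0 : forall k, 0 <= w k.
Hypothesis w1 : series w @ \oo --> (1 : R).

Lemma psum_series_le z n : 0 <= z <= 1 -> series (fun k => w k * z ^+ k) n <= psum w z.
Proof.
move=> z01; apply: nnseries_le => [k|]; first by rewrite mulr_ge0 ?exprn_ge0 //; case/andP: z01.
by apply: (psum_cvg1 (w := w) (l := 1)) => // k; rewrite ger0_norm.
Qed.

Lemma psum_law_cvg z : 0 <= z <= 1 -> series (fun k => w k * z ^+ k) @ \oo --> psum w z.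
Proof. by move=> z01; apply: (psum_cvg1 (w := w) (l := 1)) => // k; rewrite ger0_norm. Qed.

Lemma psum_law_le1 z : 0 <= z <= 1 -> psum w z <= 1.
Proof.
move=> z01; apply: series_ge_cvg (psum_law_cvg z01) => n.
apply: le_trans (nnseries_le n w0 w1); rewrite /series /= ler_sum // => k _.
by case/andP: z01 => ? ?; rewrite ler_piMr // exprn_ile1.
Qed.

Section FixedPoint.
Variables z t : R.
Hypothesis z01 : 0 <= z <= 1.
Hypothesis t01 : 0 <= t <= 1.
Hypothesis tE : t = z * psum w t.

Let z0 : 0 <= z. Proof. by case/andP: z01. Qed.
Let t0 : 0 <= t. Proof. by case/andP: t01. Qed.

(** Both bounds propagate through the recursion [hit_rec], as [t ^ k] solves it in generating
    function form. In probabilistic terms, [z ^ n t ^ S_n] is a martingale up to the hitting time of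
    0, and the walks still alive after time [M] weigh at most [z ^ M.+1]. For [z < 1] the generating
    function is thereby identified with any fixed point. *)
Lemma hit_sum_bounds M k :
  t ^+ k - z ^+ M.+1 <= \sum_(n < M.+1) hit k n * z ^+ n <= t ^+ k.
Proof.
have t1 : t <= 1 by case/andP: t01.
elim: M k => [|M IH] [|k].
- by rewrite big_ord_recl big_ord0 /hit /= !expr0 mulr1 addr0 lexx expr1 gerBl z0.
- rewrite big_ord_recl big_ord0 /hit /= mul0r addr0 exprn_ge0 // andbT subr_le0 expr1 exprS.
  rewrite {1}tE -mulrA ler_piMr // mulr_ile1 ?exprn_ge0 ?exprn_ile1 ?psum_law_le1 //.
  by apply: le_trans (psum_series_le 0 t01); rewrite /series /= big_geq.
- rewrite big_ord_recl /= big1 ?addr0; last by move=> i _; rewrite /hit /= !mul0r.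
  by rewrite /hit /= !expr0 mulr1 lexx gerBl exprn_ge0.
have E J : (M.+2 <= J)%N -> \sum_(n < M.+2) hit k.+1 n * z ^+ n =
     z * \sum_(j < J) w j * \sum_(n < M.+1) hit (k + j) n * z ^+ n.
  move=> MJ; rewrite big_ord_recl /= {1}/hit /= mul0r add0r.
  under [X in z * X]eq_bigr do rewrite mulr_sumr.
  rewrite exchange_big /= mulr_sumr; apply: eq_bigr => n _.
  rewrite (hit_rec k (J := J)); last exact: leq_ltn_trans (ltn_ord n) MJ.
  rewrite exprS mulr_suml mulr_sumr; apply: eq_bigr => j _; ring.
apply/andP; split; last first.
  rewrite (E M.+2) // [leRHS](_ : _ = z * (t ^+ k * psum w t)); last by rewrite mulrCA -tE exprSr.
  rewrite ler_wpM2l //; apply: (@le_trans _ _ (t ^+ k * series (fun k => w k * t ^+ k) M.+2)).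
    rewrite /series /= big_mkord mulr_sumr; apply: ler_sum => j _.
    by rewrite mulrCA -exprD ler_wpM2l //; case/andP: (IH (k + j)%N).
  by rewrite ler_wpM2l ?exprn_ge0 // psum_series_le.
rewrite lerBlDr [leLHS](_ : _ = z * t ^+ k * psum w t); last by rewrite mulrAC -tE -exprS.
have hc : z * t ^+ k * series (fun k => w k * t ^+ k) J @[J --> \oo] --> z * t ^+ k * psum w t.
  by apply: cvgMr; exact: psum_law_cvg.
rewrite -[leLHS](cvg_lim _ hc) //; apply: limr_le; first by apply/cvg_ex; eexists; exact: hc.
exists M.+2 => // J /= MJ; rewrite (E J) // -lerBlDr.
have h : \sum_(j < J) w j * (t ^+ (k + j) - z ^+ M.+1) <= \sum_(j < J) w j * \sum_(n < M.+1) hit (k + j) n * z ^+ n.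
  by apply: ler_sum => j _; rewrite ler_wpM2l //; case/andP: (IH (k + j)%N).
apply: (le_trans _ (ler_wpM2l z0 h)).
have wJ : \sum_(j < J) w j <= 1 by rewrite -(big_mkord xpredT w); exact: nnseries_le.
have -> : \sum_(j < J) w j * (t ^+ (k + j) - z ^+ M.+1) =
   t ^+ k * series (fun k => w k * t ^+ k) J - z ^+ M.+1 * \sum_(j < J) w j.
  rewrite /series /= big_mkord !mulr_sumr -sumrB; apply: eq_bigr => j _; rewrite exprD; ring.
rewrite mulrBr mulrA; apply: lerB => //.
by rewrite [leRHS]exprS ler_wpM2l // ler_piMr // exprn_ge0.
Qed.

End FixedPoint.

Lemma hit_ge0 k n : 0 <= hit k n.
Proof.
rewrite /hit; case: ifP => _; first exact: ler0n.
by case: ifP => _ //; rewrite mulr_ge0 ?divr_ge0 ?cpow_ge0.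
Qed.

Lemma psum_law1 : psum w 1 = 1.
Proof.
have h : series (fun k => w k * 1 ^+ k) @ \oo --> psum w 1 by apply: psum_law_cvg; rewrite ler01 lexx.
have e : (fun k => w k * 1 ^+ k) = w by apply/funext => k; rewrite expr1n mulr1.
by rewrite e in h; exact: cvg_unique h w1.
Qed.

Lemma hit_psum z t : 0 <= z < 1 -> 0 <= t <= 1 -> t = z * psum w t -> psum (hit 1) z = t.
Proof.
move=> /andP[z0 z1] t01 tE.
have z01 : 0 <= z <= 1 by rewrite z0 ltW.
have zc : (fun n : nat => z ^+ n) @ \oo --> 0 by apply: cvg_expr; rewrite ger0_norm.
suff h : series (fun n => hit 1 n * z ^+ n) @ \oo --> t by rewrite /psum (cvg_lim _ h).
rewrite -(cvg_shiftS (series _)).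
apply: (squeeze_cvgr (f := fun M => t - z ^+ M.+1) (h := fun=> t)).
- by apply: nearW => M; rewrite /series /= big_mkord -[t]expr1; exact: hit_sum_bounds.
- rewrite -[X in _ --> X]subr0; apply: cvgB; first exact: cvg_cst.
  by rewrite (cvg_shiftS (fun n : nat => z ^+ n)).
- exact: cvg_cst.
Qed.

(** The upper half of [hit_sum_bounds] at [z = 1], where 1 is a fixed point. *)
Lemma hit_series_le n : series (hit 1) n <= 1.
Proof.
have o01 : 0 <= (1 : R) <= 1 by rewrite ler01 lexx.
have e : (1 : R) = 1 * psum w 1 by rewrite psum_law1 mulr1.
apply: (@le_trans _ _ (series (hit 1) n.+1)).
  by rewrite seriesSr lerDl hit_ge0.
have /andP[_] := hit_sum_bounds o01 o01 e n 1.
rewrite /series /= big_mkord expr1; apply: le_trans.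
by rewrite le_eqVlt; apply/orP; left; apply/eqP; apply: eq_bigr => i _; rewrite expr1n mulr1.
Qed.

Hypothesis wmean : series (fun k => k%:R * w k) @ \oo --> (1 : R).

(** The slope is at most the mean, which is 1. *)
Lemma psum_law_lip x y : 0 <= x -> x <= y -> y <= 1 -> 0 <= psum w y - psum w x <= y - x.
Proof.
move=> x0 xy y1; have y0 := le_trans x0 xy; have x1 := le_trans xy y1.
have h : series (fun k => w k * y ^+ k) n - series (fun k => w k * x ^+ k) n @[n --> \oo] --> psum w y - psum w x.
  by apply: cvgB; apply: psum_law_cvg; rewrite ?x0 ?y0.
have E n : series (fun k => w k * y ^+ k) n - series (fun k => w k * x ^+ k) n =
   \sum_(0 <= k < n) w k * (y ^+ k - x ^+ k).
  by rewrite /series /= -sumrB; apply: eq_bigr => k _; rewrite mulrBr.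
have d k : 0 <= y ^+ k - x ^+ k <= k%:R * (y - x).
  rewrite subr_ge0 lerXn2r ?nnegrE //=; elim: k => [|k IH]; first by rewrite !expr0 subrr mul0r.
  have -> : y ^+ k.+1 - x ^+ k.+1 = y * (y ^+ k - x ^+ k) + x ^+ k * (y - x) by rewrite !exprS; ring.
  rewrite -natr1 mulrDl mul1r; apply: lerD.
    by apply: le_trans IH; rewrite ler_piMl // subr_ge0 lerXn2r ?nnegrE.
  by rewrite ler_piMl ?subr_ge0 // exprn_ile1.
apply/andP; split; rewrite -(cvg_lim _ h) //; [apply: limr_ge|apply: limr_le].
- by apply/cvg_ex; eexists; exact: h.
- by apply: nearW => n; rewrite E sumr_ge0 // => k _; rewrite mulr_ge0 //; case/andP: (d k).
- by apply/cvg_ex; eexists; exact: h.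
apply: nearW => n; rewrite E; apply: (@le_trans _ _ (series (fun k => k%:R * w k) n * (y - x))).
  rewrite /series /= mulr_suml; apply: ler_sum => k _.
  by rewrite [k%:R * _]mulrC -mulrA ler_wpM2l //; case/andP: (d k).
rewrite ler_piMl ?subr_ge0 //; apply: nnseries_le wmean => k; exact: mulr_ge0.
Qed.

Lemma fixed_point z : 0 <= z < 1 -> exists2 t, 0 <= t < 1 & t = z * psum w t.
Proof.
move=> /andP[z0 z1].
(* Clamping to [[0, 1]] makes the function Lipschitz on the whole line, so that no one-sided
   continuity is involved in the intermediate value theorem. *)
pose cl (x : R) := Num.min 1 (Num.max 0 x).
have cl01 x : 0 <= cl x <= 1.
  by rewrite /cl le_min ler01 le_max lexx ge_min lexx.
have clE x : [\/ x <= 0 /\ cl x = 0, 0 <= x <= 1 /\ cl x = x | 1 <= x /\ cl x = 1].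
  rewrite /cl; have [h|h] := leP x 0; first by constructor 1; rewrite min_r ?ler01.
  have [h1|h1] := leP x 1; last by constructor 3; rewrite (ltW h1).
  by constructor 2; rewrite (ltW h).
have cllip x y : x <= y -> 0 <= cl y - cl x <= y - x.
  by move=> xy; case: (clE x) (clE y) => -[? ->] [] [? ->]; lra.
pose g x := x - z * psum w (cl x).
have glip x y : x <= y -> `|g y - g x| <= 2 * (y - x).
  move=> xy; have /andP[c1 c2] := cllip _ _ xy.
  have /andP[x0 x1] := cl01 x; have /andP[y0 y1] := cl01 y.
  have clxy : cl x <= cl y by rewrite -subr_ge0.
  have /andP[p1 p2] := psum_law_lip x0 clxy y1.
  have -> : g y - g x = (y - x) - z * (psum w (cl y) - psum w (cl x)) by rewrite /g; ring.
  have h1 : 0 <= z * (psum w (cl y) - psum w (cl x)) by rewrite mulr_ge0.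
  have h2 : z * (psum w (cl y) - psum w (cl x)) <= psum w (cl y) - psum w (cl x).
    by rewrite ler_piMl // ltW.
  rewrite ler_norml; move: p2 h1 h2 c2; lra.
have gcont : continuous g.
  move=> x; apply/cvgrPdist_le => e e0; near=> y.
  have h : `|x - y| <= e / 2.
    near: y; have /cvgrPdist_le/(_ (e / 2)) := (@cvg_id _ (nbhs x)); apply.
    by rewrite divr_gt0.
  have [xy|yx] := leP x y.
    rewrite distrC; apply: le_trans (glip _ _ xy) _.
    by move: h; rewrite distrC ger0_norm ?subr_ge0 //; lra.
  apply: le_trans (glip _ _ (ltW yx)) _.
  by move: h; rewrite ger0_norm ?subr_ge0 ?(ltW yx) //; lra.
have g0 : g 0 <= 0.
  have e : cl 0 = 0 by rewrite /cl maxxx min_r.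
  rewrite /g e sub0r oppr_le0 mulr_ge0 //.
  by apply: le_trans (psum_series_le 0 _); rewrite ?lexx ?ler01 // /series /= big_geq.
have g1 : 0 < g 1.
  have e : cl 1 = 1 by rewrite /cl max_r // minxx.
  by rewrite /g e psum_law1 mulr1 subr_gt0.
have gw : {within `[0, 1], continuous g} by exact: continuous_subspaceT.
have gm : Num.min (g 0) (g 1) <= 0 <= Num.max (g 0) (g 1) by rewrite ge_min g0 /= le_max (ltW g1) orbT.
have [t] := IVT ler01 gw gm.
rewrite in_itv /= => /andP[t0 t1] gt.
have clt : cl t = t by rewrite /cl max_r // min_r.
have e : t = z * psum w t by move/eqP: gt; rewrite /g clt subr_eq0 => /eqP.
exists t => //; rewrite t0 lt_neqAle t1 andbT.
by apply/eqP => t1'; move: g1; rewrite -t1' gt ltxx.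
Unshelve. all: by end_near. Qed.

End Hitting.

(** * The critical local limit theorem *)

Section HittingDeficit.
Variable R : realType.
Variables (w : nat -> R) (al a : R).
Hypothesis w0 : forall k, 0 <= w k.
Hypothesis w1 : series w @ \oo --> (1 : R).
Hypothesis wmean : series (fun k => k%:R * w k) @ \oo --> (1 : R).
Hypothesis w00 : 0 < w 0%N.
Hypothesis al12 : 1 < al < 2.
Hypothesis wa : w k * k%:R `^ (1 + al) @[k --> \oo] --> a.

(** The tails [T] have total mass equal to the mean of [w], that is 1. They form a law again and
    have tails [r] of their own, and two summations by parts exhibit the factor [(1 - t) ^ 2] of
    [psum w t - t]. *)
Let T m := 1 - series w m.+1.
Let r m := 1 - series T m.+1.

Let T_ge0 m : 0 <= T m. Proof. by rewrite subr_ge0; exact: nnseries_le. Qed.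

(** Summation by parts; the boundary term is of order at most [M ^ (1 - al)]. *)
Let T_mass : series T @ \oo --> (1 : R).
Proof.
have [al1 _] := andP al12; have al0 : 0 < al by lra.
have E M : series T M = series (fun k => k%:R * w k) M + M%:R * (1 - series w M).
  elim: M => [|M IH]; first by rewrite /series /= !big_geq // mul0r addr0.
  rewrite seriesSr IH /T !seriesSr -natr1; ring.
have h : (1 - series w m) * m%:R `^ al * m%:R `^ (- (al - 1)) @[m --> \oo] --> a / al * 0.
  by apply: cvgM; [exact: cvg_tail|apply: cvg_powRN0; rewrite subr_gt0].
have h2 : series (fun k => k%:R * w k) M + (1 - series w M) * M%:R `^ al * M%:R `^ (- (al - 1)) @[M --> \oo] --> 1 + a / al * 0.
  exact: cvgD.
move: h2; rewrite mulr0 addr0; apply: cvg_trans; apply: near_eq_cvg; near=> M.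
have M0 : 0 < M%:R :> R by rewrite ltr0n; near: M; exists 1%N.
have P : M%:R `^ al * M%:R `^ (- (al - 1)) = M%:R :> R.
  rewrite -powRD ?(gt_eqF M0) ?implybT // -[in RHS](powRr1 (ler0n R M)); congr (_ `^ _); ring.
by rewrite E -mulrA P [(1 - _) * _]mulrC.
Unshelve. all: by end_near. Qed.

Let r_ge0 m : 0 <= r m. Proof. by rewrite subr_ge0; exact: nnseries_le. Qed.

Let r_asymp : r m * m%:R `^ (al - 1) @[m --> \oo] --> a / al / (al - 1).
Proof.
have [al1 _] := andP al12; have al0 : 0 < al by lra.
apply: cvg_tailS => //; first by rewrite subr_gt0.
rewrite (_ : 1 + (al - 1) = al); last by ring.
exact: cvg_tailS.
Qed.

Let law_sub t : 0 <= t < 1 -> psum w t - t = (1 - t) ^+ 2 * psum r t.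
Proof.
move=> t01; have h1 := psum_tail w0 w1 t01; have h2 := psum_tail T_ge0 T_mass t01.
by rewrite expr2 -mulrA -h2 mulrBr -h1 mulr1; ring.
Qed.

Let r_psum_ge t : 0 <= t < 1 -> w 0%N <= psum r t.
Proof.
move=> /andP[t0 t1].
have h : series (fun n => r n * t ^+ n) @ \oo --> psum r t.
  apply: (@psum_cvg _ _ _ 1); last by rewrite ger0_norm.
  by move=> n; rewrite ger0_norm // gerBl /series /= sumr_ge0.
have := nnseries_le 1 (fun k => mulr_ge0 (r_ge0 k) (exprn_ge0 k t0)) h.
by rewrite /series /= big_nat1 expr0 mulr1 /r /T /series /= !big_nat1 opprB addrC subrK.
Qed.

Let t s := psum (hit w 1) (expR (- s)).

Let t_spec s : 0 < s -> 0 <= t s < 1 /\ t s = expR (- s) * psum w (t s).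
Proof.
move=> s0; have z01 : 0 <= expR (- s) < 1 by rewrite expR_ge0 expR_lt1 oppr_lt0.
have [u u01 uE] := fixed_point w0 w1 wmean z01.
suff -> : t s = u by [].
apply: hit_psum => //; case/andP: u01 => -> /ltW -> //.
Qed.

(** With [z = exp (- s)], the fixed point equation and [law_sub] give [(1 - t) ^ 2 * psum r t = (1 -
    z) * psum w t <= s], and [psum r t] is at least [w 0 > 0]. *)
Lemma hitting_lim : t s @[s --> 0^'+] --> (1 : R).
Proof.
have h : (1 - t s) ^+ 2 @[s --> 0^'+] --> (0 : R).
  apply: (@squeeze_cvgr _ _ _ _ (fun=> 0) (fun s => s / w 0%N)).
  - near=> s; have s0 : 0 < s by near: s; exact: nbhs_right_gt.
    have [t01 tE] := t_spec s0; rewrite sqr_ge0 /= ler_pdivlMr //.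
    apply: (@le_trans _ _ (psum w (t s) - t s)).
      by rewrite law_sub // ler_wpM2l ?sqr_ge0 // r_psum_ge.
    have W1 : psum w (t s) <= 1 by apply: psum_law_le1 => //; case/andP: t01 => -> /ltW ->.
    have W0 : 0 <= psum w (t s).
      rewrite -[psum w _](subrK (t s)) addr_ge0 //; last by case/andP: t01.
      by rewrite law_sub // mulr_ge0 ?sqr_ge0 // (le_trans (ltW w00)) // r_psum_ge.
    rewrite {2}tE -[X in X - _]mul1r -mulrBl.
    have e1 : 1 - expR (- s) <= s by have := expR_ge1Dx (- s); lra.
    have e2 : 0 <= 1 - expR (- s) by rewrite subr_ge0 -[leRHS]expR0 ler_expR oppr_le0 ltW.
    by apply: le_trans (ler_piMr e2 W1) _.
  - exact: cvg_cst.
  - have h : s / w 0%N @[s --> (0 : R)^'+] --> 0 / w 0%N.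
      by apply: cvgMl; apply: cvg_at_right_filter; exact: cvg_id.
    by move: h; rewrite mul0r.
have h2 : Num.sqrt ((1 - t s) ^+ 2) @[s --> 0^'+] --> Num.sqrt (0 : R).
  by apply: (@cvg_comp _ _ _ (fun s => (1 - t s) ^+ 2) Num.sqrt) h _; exact: sqrt_continuous.
rewrite sqrtr0 in h2.
have h3 : 1 - Num.sqrt ((1 - t s) ^+ 2) @[s --> 0^'+] --> 1 - (0 : R).
  by apply: cvgB => //; exact: cvg_cst.
move: h3; rewrite subr0; apply: cvg_trans; apply: near_eq_cvg; near=> s.
have s0 : 0 < s by near: s; exact: nbhs_right_gt.
have [/andP[_ t1] _] := t_spec s0.
by rewrite sqrtr_sqr ger0_norm ?subr_ge0 ?(ltW t1) // opprB addrC subrK.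
Unshelve. all: by end_near. Qed.

(** In the identity behind [hitting_lim], [psum r t] is equivalent to [kap * (1 - t) ^ (al - 2)], by
    [abelian] at [u = - ln t]. Hence [(1 - t) ^ al] is equivalent to [s / kap]. *)
Lemma hitting_deficit : 0 < a ->
  (1 - t s) / s `^ al^-1 @[s --> 0^'+] -->
    (a / al / (al - 1) * Gamma_integral (2 - al)) `^ (- al^-1).
Proof.
move=> a0; have [al1 al2] := andP al12; have al0 : 0 < al by lra.
have x01 : 0 < 2 - al < 1 by apply/andP; split; lra.
set kap := a / al / (al - 1) * _.
have kap0 : 0 < kap.
  by rewrite mulr_gt0 ?Gamma_integral_gt0 // divr_gt0 ?subr_gt0 // divr_gt0.
pose u s := - ln (t s).
have tpos : \forall s \near (0 : R)^'+, 0 < t s.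
  by have := hitting_lim; move/cvgr_gt; apply; exact: ltr01.
have ulim : u s @[s --> 0^'+] --> (0 : R)^'+.
  apply: cvg_right0.
    have h : ln (t s) @[s --> 0^'+] --> ln (1 : R).
          apply: (@cvg_comp _ _ _ t (@ln R) _ _ _ hitting_lim); exact: continuous_ln.
    by rewrite ln1 in h; rewrite -[X in _ --> X]oppr0; exact: cvgN.
  near=> s; have s0 : 0 < s by near: s; exact: nbhs_right_gt.
  have [/andP[_ t1] _] := t_spec s0.
  rewrite oppr_gt0 ln_lt0 // t1 andbT; near: s; exact: tpos.
have ua : u s `^ (2 - al) * psum r (expR (- u s)) @[s --> 0^'+] --> kap.
  have hr : r n * n%:R `^ (1 - (2 - al)) @[n --> \oo] --> a / al / (al - 1).
    by rewrite (_ : 1 - (2 - al) = al - 1); last by ring.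
  exact: (@cvg_comp _ _ _ u (fun s => s `^ (2 - al) * psum r (expR (- s))) _ _ _ ulim (abelian x01 hr)).
have ub : ((1 - expR (- u s)) / u s) `^ (al - 2) @[s --> 0^'+] --> (1 : R).
  suff : ((1 - expR (- u s)) / u s) `^ (al - 2) @[s --> 0^'+] --> (1 : R) `^ (al - 2) by rewrite powR1.
  apply: cvg_powR => //.
  exact: (@cvg_comp _ _ _ u (fun s => (1 - expR (- s)) / s) _ _ _ ulim (@expR_ratio R)).
have uc : t s / expR (- s) @[s --> 0^'+] --> (1 : R).
  have h : t s * expR s @[s --> 0^'+] --> 1 * expR (0 : R).
    apply: cvgM; first exact: hitting_lim.
    by apply: cvg_at_right_filter; exact: continuous_expR.
  move: h; rewrite expR0 mulr1; apply: cvg_trans; apply: near_eq_cvg; apply: nearW => s.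
  by rewrite expRN invrK.
have h : (1 - expR (- s)) / s * (t s / expR (- s)) * (((1 - expR (- u s)) / u s) `^ (al - 2)
    / (u s `^ (2 - al) * psum r (expR (- u s)))) @[s --> 0^'+] --> 1 * 1 * (1 / kap).
  apply: cvgM; first by apply: cvgM => //; exact: expR_ratio.
  by apply: cvgM => //; apply: cvgV => //; rewrite gt_eqF.
have {}h : (1 - t s) `^ al / s @[s --> 0^'+] --> kap^-1.
  move: h; rewrite !mul1r; apply: cvg_trans; apply: near_eq_cvg; near=> s.
  have s0 : 0 < s by near: s; exact: nbhs_right_gt.
  have t0 : 0 < t s by near: s; exact: tpos.
  have [t01 tE] := t_spec s0; have /andP[_ t1] := t01.
  have eu : expR (- u s) = t s by rewrite opprK lnK // posrE.
  have u0 : 0 < u s by rewrite oppr_gt0 ln_lt0 // t0.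
  have e0 : 0 < 1 - t s by rewrite subr_gt0.
  have r0 : 0 < psum r (t s) by apply: lt_le_trans (r_psum_ge t01).
  have z0 : 0 < expR (- s) by exact: expR_gt0.
  have We : t s / expR (- s) = psum w (t s) by rewrite {1}tE mulrAC divff ?mul1r ?gt_eqF.
  have Ke : (1 - expR (- s)) * psum w (t s) = (1 - t s) ^+ 2 * psum r (t s).
    by rewrite mulrBl mul1r -tE law_sub.
  rewrite eu We powRM ?invr_ge0 ?(ltW u0) ?(ltW e0) //.
  have -> : (u s)^-1 `^ (al - 2) = u s `^ (2 - al).
    by rewrite -(powR_inv1 (ltW u0)) -powRrM; congr (_ `^ _); ring.
  have -> : (1 - t s) `^ al = (1 - t s) `^ (al - 2) * (1 - t s) ^+ 2.
    rewrite -(powR_mulrn 2 (ltW e0)) -powRD ?(gt_eqF e0) ?implybT //; congr (_ `^ _); ring.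
  have up : 0 < u s `^ (2 - al) by exact: powR_gt0.
  rewrite [X in X * _ = _]mulrAC Ke.
  by field; rewrite !gt_eqF.
have h2 : ((1 - t s) `^ al / s) `^ al^-1 @[s --> 0^'+] --> kap^-1 `^ al^-1.
  by apply: cvg_powR => //; rewrite invr_gt0.
rewrite (_ : kap `^ (- al^-1) = kap^-1 `^ al^-1); last first.
  by rewrite -[kap^-1](powR_inv1 (ltW kap0)) -powRrM mulN1r.
apply: cvg_trans h2; apply: near_eq_cvg; near=> s.
have s0 : 0 < s by near: s; exact: nbhs_right_gt.
have [/andP[_ t1] _] := t_spec s0.
have e0 : 0 < 1 - t s by rewrite subr_gt0.
rewrite powRM ?powR_ge0 ?invr_ge0 ?(ltW s0) // -powRrM divff ?gt_eqF // powRr1 ?(ltW e0) //.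
by rewrite -(powR_inv1 (ltW s0)) -powRrM mulN1r powRN.
Unshelve. all: by end_near. Qed.

End HittingDeficit.

Lemma law_bound (R : realType) (w : nat -> R) (al a : R) :
  w k * k%:R `^ (1 + al) @[k --> \oo] --> a ->
  exists2 C : R, 0 < C & forall k, (0 < k)%N -> w k <= C * k%:R `^ (- (1 + al)).
Proof.
move=> wa; have : bounded_fun (fun k => w k * k%:R `^ (1 + al)) by apply: cvg_seq_bounded; apply/cvg_ex; exists a.
move=> [M [_ hM]]; exists (`|M| + 1) => [|k k0]; first by rewrite ltr_wpDl.
have k0' : 0 < k%:R :> R by rewrite ltr0n.
rewrite powRN ler_pdivlMr ?powR_gt0 //; apply: le_trans (ler_norm _) _.
by apply: (hM (`|M| + 1)) => //; rewrite (le_lt_trans (ler_norm _)) // ltrDl.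
Qed.

Section CriticalLLT.
Variable R : realType.
Variables (w : nat -> R) (al a cd : R).
Hypothesis w0 : forall k, 0 <= w k.
Hypothesis w1 : series w @ \oo --> (1 : R).
Hypothesis wmean : series (fun k => k%:R * w k) @ \oo --> (1 : R).
Hypothesis w00 : 0 < w 0%N.
Hypothesis al12 : 1 < al < 2.
Hypothesis a0 : 0 < a.
Hypothesis wa : w k * k%:R `^ (1 + al) @[k --> \oo] --> a.
Hypothesis cd0 : 0 < cd.
Hypothesis decay : forall t, 0 <= t <= pi -> cabs (chf w t) ^+ 2 <= 1 - cd * t `^ al.

Let b := al^-1.
Let b01 : 0 < b < 1.
Proof. by have /andP[al1 _] := al12; rewrite /b invr_gt0 invf_lt1; lra. Qed.

(* [cpow w n n.-1 / n] is the law of a hitting time, whose generating function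
   is known near 1; the oscillation bounds allow to invert the transform. *)
Lemma critical_llt :
  cpow w n n.-1 * n%:R `^ b @[n --> \oo] -->
    (a / al / (al - 1) * Gamma_integral (2 - al)) `^ (- b) * b / Gamma_integral (1 - b).
Proof.
have [b0 b1] := andP b01; have [al1 al2] := andP al12; have al0 : 0 < al by lra.
have alp : 1 <= al <= 2 by rewrite !ltW.
set kp := _ `^ (- b); have kp0 : 0 <= kp by exact: powR_ge0.
set G := Gamma_integral (1 - b).
have G0 : 0 < G by apply: Gamma_integral_gt0; apply/andP; split; lra.
(* By [abelian_deficit] the model [K * g] has deficit equivalent to [K * G / b * s ^ b]; [K] matches
   this with the deficit of the hitting time. *)
pose K := kp * b / G; have K0 : 0 <= K by rewrite divr_ge0 ?(ltW G0) // mulr_ge0 // ltW.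
pose h := hit w 1; pose g (n : nat) : R := n%:R `^ (- (1 + b)).
pose e n := h n - K * g n.
have hE n : (0 < n)%N -> h n = cpow w n n.-1 / n%:R.
  by case: n => // n _; rewrite /h /hit /= subn1 mul1r mulrC.
have h0 : h 0%N = 0 by [].
have g0 : g 0%N = 0 by rewrite /g powR0 // oppr_eq0 gt_eqF // addr_gt0.
have [C1 C10 hC1] := cpow_bound w0 w1 wmean alp cd0 decay.
have [Cw Cw0 hCw] := law_bound wa.
have [C2 C20 hC2] := cpow_osc_centered w0 w1 wmean alp cd0 decay (chf_centered w0 w1 wmean al12 Cw0 hCw).
pose Ce := C1 + C2 + K * (2 + b) + 1.
have Ce0 : 0 < Ce.
  have : 0 <= K * b by rewrite mulr_ge0 // ltW.
  rewrite /Ce; lra.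
have pw n x y : (0 < n)%N -> n%:R `^ x * n%:R `^ y = n%:R `^ (x + y) :> R.
  by move=> n0; rewrite powRD // pnatr_eq0 -lt0n n0 implybT.
have e_bound n : `|e n| <= Ce * n%:R `^ (- (1 + b)).
  case: n => [|n]; first by rewrite /e h0 g0 mulr0 subrr normr0 mulr_ge0 ?powR_ge0 // ltW.
  have n0 : 0 < n.+1%:R :> R by rewrite ltr0n.
  have /andP[v1 v2] := hC1 n.+1 n.+1.-1 isT.
  apply: le_trans (ler_normB _ _) _.
  have gp : 0 <= g n.+1 by exact: powR_ge0.
  have hp : 0 <= h n.+1 by exact: hit_ge0.
  rewrite (ger0_norm hp) (ger0_norm (mulr_ge0 K0 gp)) hE //.
  have l1 : cpow w n.+1 n.+1.-1 / n.+1%:R <= C1 * g n.+1.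
    rewrite ler_pdivrMr //; apply: le_trans v2 _; rewrite -mulrA ler_pM2l //.
    rewrite -[X in _ * X](powRr1 (ltW n0)) /g pw // le_eqVlt; apply/orP; left; apply/eqP.
    congr (_ `^ _); rewrite /b; ring.
  apply: le_trans (lerD l1 (lexx _)) _; rewrite -mulrDl ler_wpM2r ?powR_ge0 // /Ce.
  have : 0 <= K * b by rewrite mulr_ge0 // ltW.
  lra.
have g_osc n m : (0 < n)%N -> (n <= m)%N -> `|g n - g m| <= (1 + b) * (m%:R - n%:R) * n%:R `^ (- (2 + b)).
  move=> n0; rewrite leq_eqVlt => /predU1P[->|nm]; first by rewrite !subrr normr0 mulr0 mul0r.
  have n0' : 0 < n%:R :> R by rewrite ltr0n.
  have nm' : n%:R < m%:R :> R by rewrite ltr_nat.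
  have [c /andP[nc cm] cE] := powR_mvt (- (1 + b)) n0' nm'.
  have c0 : 0 < c by exact: lt_trans nc.
  rewrite distrC cE !normrM normrN (ger0_norm (powR_ge0 _ _)).
  have bp : 0 < 1 + b by rewrite addr_gt0.
  have dp : 0 < m%:R - n%:R :> R by rewrite subr_gt0.
  rewrite (gtr0_norm bp) (gtr0_norm dp) mulrAC ler_wpM2l //.
    by rewrite mulr_ge0 ?subr_ge0 ?(ltW nm') // addr_ge0 // ltW.
  have -> : - (1 + b) - 1 = - (2 + b) by ring.
  rewrite !powRN lef_pV2 ?posrE ?powR_gt0 // ge0_ler_powR ?nnegrE ?(ltW n0') ?(ltW c0) ?(ltW nc) //.
  by rewrite addr_ge0 // ltW.
have e_osc n m : (0 < n)%N -> (n <= m)%N -> (m <= 2 * n)%N ->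
    `|e n - e m| <= Ce * (m%:R - n%:R) * n%:R `^ (- (2 + b)).
  move=> n0 nm _; have m0 : (0 < m)%N := leq_trans n0 nm.
  have n0' : 0 < n%:R :> R by rewrite ltr0n.
  have m0' : 0 < m%:R :> R by rewrite ltr0n.
  have nm' : n%:R <= m%:R :> R by rewrite ler_nat.
  have -> : e n - e m = (cpow w n n.-1 - cpow w m m.-1) / n%:R +
     cpow w m m.-1 * (n%:R^-1 - m%:R^-1) - K * (g n - g m).
    by rewrite /e !hE //; field; rewrite !gt_eqF.
  (* Passing from [n] to [m] adds [m - n] to both arguments of [cpow], so [cpow_osc_centered]
     applies; with the division by [n] the exponent is [(1 + al) / al + 1 = 2 + b]. *)
  have l1 : `|(cpow w n n.-1 - cpow w m m.-1) / n%:R| <= C2 * (m%:R - n%:R) * n%:R `^ (- (2 + b)).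
    have := hC2 n n.-1 (m - n)%N n0; rewrite subnKC // -natrB //.
    have -> : (n.-1 + (m - n) = m.-1)%N by rewrite -!subn1 addnC addnBA // subnK.
    move=> v; rewrite normrM [X in _ * X]gtr0_norm ?invr_gt0 // ler_pdivrMr //.
    apply: le_trans v _; rewrite -[leRHS]mulrA ler_wpM2l ?mulr_ge0 ?(ltW C20) //.
    rewrite -[X in _ <= _ * X](powRr1 (ltW n0')) pw // le_eqVlt; apply/orP; left; apply/eqP.
    by congr (_ `^ _); rewrite /b; field; rewrite gt_eqF.
  have l2 : `|cpow w m m.-1 * (n%:R^-1 - m%:R^-1)| <= C1 * (m%:R - n%:R) * n%:R `^ (- (2 + b)).
    have /andP[v1 v2] := hC1 m m.-1 m0.
    have mn : m%:R `^ (- al^-1) <= n%:R `^ (- al^-1) :> R.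
      by rewrite !powRN lef_pV2 ?posrE ?powR_gt0 // ge0_ler_powR ?nnegrE ?ler0n // ltW.
    have d0 : 0 <= n%:R^-1 - m%:R^-1 :> R by rewrite subr_ge0 lef_pV2.
    rewrite normrM ger0_norm // ger0_norm //.
    have d1 : n%:R^-1 - m%:R^-1 <= (m%:R - n%:R) * n%:R `^ (- 2) :> R.
      have -> : n%:R^-1 - m%:R^-1 = (m%:R - n%:R) * (n%:R^-1 * m%:R^-1) :> R by field; rewrite !gt_eqF.
      rewrite ler_wpM2l ?subr_ge0 // powRN (powR_mulrn 2) ?ler0n // expr2 invfM.
      by rewrite ler_pM2l ?invr_gt0 // lef_pV2.
    apply: (@le_trans _ _ (C1 * n%:R `^ (- al^-1) * ((m%:R - n%:R) * n%:R `^ (- 2)))).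
      by apply: ler_pM => //; apply: le_trans v2 _; rewrite ler_pM2l.
    rewrite le_eqVlt; apply/orP; left; apply/eqP.
    have -> : - (2 + b) = - al^-1 + - 2 by rewrite /b; ring.
    by rewrite -pw //; ring.
  have l3 : `|K * (g n - g m)| <= K * (1 + b) * (m%:R - n%:R) * n%:R `^ (- (2 + b)).
    by have := ler_wpM2l K0 (g_osc n m n0 nm); rewrite normrM (ger0_norm K0) !mulrA.
  apply: le_trans (ler_normB _ _) _; apply: le_trans (lerD (ler_normD _ _) (lexx _)) _.
  apply: le_trans (lerD (lerD l1 l2) l3) _; rewrite -!mulrDl.
  rewrite ler_wpM2r ?powR_ge0 // ler_wpM2r ?subr_ge0 // /Ce.
  lra.
have [lg glim] := powRN_summable b0.
have h_ge0 n : 0 <= h n by exact: hit_ge0.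
have [lh hlim lh1] := nnseries_cvg h_ge0 (hit_series_le w0 w1).
have absn f n : (forall n : nat, 0 <= f n) -> `|f n| <= f n :> R by move=> ?; rewrite ger0_norm.
have psE x : 0 <= x <= 1 -> psum e x = psum h x - K * psum g x.
  move=> x01.
  have c1 := psum_cvg1 (fun n => absn h n h_ge0) hlim x01.
  have c2 := psum_cvg1 (fun n => absn g n (fun k => powR_ge0 _ _)) glim x01.
  have c3 := tauberian_psum_cvg b01 e_bound x01.
  have c4 : series (fun n => h n * x ^+ n) n - K * series (fun n => g n * x ^+ n) n @[n --> \oo] --> psum h x - K * psum g x.
    by apply: cvgB => //; exact: cvgMr.
  suff E : (fun n => series (fun n => h n * x ^+ n) n - K * series (fun n => g n * x ^+ n) n) = series (fun n => e n * x ^+ n).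
    by rewrite E in c4; exact: cvg_unique c3 c4.
  apply/funext => n; rewrite /series /= mulr_sumr -sumrB; apply: eq_bigr => k _.
  by rewrite /e; ring.
have one01 : 0 <= (1 : R) <= 1 by rewrite ler01 lexx.
have at1 f l : series f @ \oo --> l -> psum f 1 = l :> R.
  move=> fl; rewrite /psum (_ : (fun n => _) = f); last by apply/funext => n; rewrite expr1n mulr1.
  exact: cvg_lim fl.
(* The hitting time is almost surely finite: its transform tends to 1 and never exceeds [lh]. *)
have lhE : lh = 1.
  apply/eqP; rewrite eq_le lh1 /=.
  have hl := hitting_lim w0 w1 wmean w00 al12 wa.
  rewrite -[leLHS](cvg_lim _ hl) //; apply: limr_le; first by apply/cvg_ex; eexists; exact: hl.
  near=> s; have s0 : 0 < s by near: s; exact: nbhs_right_gt.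
  have x01 : 0 <= expR (- s) <= 1 by rewrite expR_ge0 -[leRHS]expR0 ler_expR oppr_le0 ltW.
  have c1 := psum_cvg1 (fun n => absn h n h_ge0) hlim x01.
  apply: series_ge_cvg c1 => n; apply: le_trans (nnseries_le n h_ge0 hlim).
  rewrite /series /=; apply: ler_sum => k _; rewrite ler_piMr // exprn_ile1 //; by case/andP: x01.
have e_lap : (psum e 1 - psum e (expR (- s))) / s `^ b @[s --> 0^'+] --> (0 : R).
  have l1 := hitting_deficit w0 w1 wmean w00 al12 wa a0.
  have gc : g n * n%:R `^ (1 + b) @[n --> \oo] --> (1 : R).
    rewrite -(cvg_shiftS (fun n => g n * n%:R `^ (1 + b))).
    under eq_fun do rewrite /g pw // addNr powRr0.
    exact: cvg_cst.
  have l2 := abelian_deficit b01 (fun k => powR_ge0 _ _) glim gc.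
  have l3 : (1 - psum h (expR (- s))) / s `^ b - K * ((lg - psum g (expR (- s))) / s `^ b)
     @[s --> 0^'+] --> kp - K * (1 / b * G).
    by apply: cvgB => //; exact: cvgMr.
  have kE : kp - K * (1 / b * G) = 0 by rewrite /K; field; rewrite !gt_eqF.
  rewrite kE in l3; apply: cvg_trans l3; apply: near_eq_cvg; near=> s.
  have s0 : 0 < s by near: s; exact: nbhs_right_gt.
  have x01 : 0 <= expR (- s) <= 1 by rewrite expR_ge0 -[leRHS]expR0 ler_expR oppr_le0 ltW.
  by rewrite !psE // (at1 _ _ hlim) (at1 _ _ glim) lhE; ring.
have eT := tauberian b01 Ce0 e_bound e_osc e_lap.
have eT2 : e n * n%:R `^ (1 + b) + K @[n --> \oo] --> 0 + K by apply: cvgD => //; exact: cvg_cst.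
rewrite add0r in eT2; apply: cvg_trans eT2; apply: near_eq_cvg; near=> n.
have n0 : (0 < n)%N by near: n; exists 1%N.
have n0' : 0 < n%:R :> R by rewrite ltr0n.
have P : n%:R `^ (1 + b) = n%:R * n%:R `^ b :> R.
  by rewrite -[X in _ = X * _](powRr1 (ltW n0')) pw.
have Gn : g n = (n%:R * n%:R `^ b)^-1 by rewrite /g powRN P.
rewrite /e hE // Gn P.
by field; rewrite !gt_eqF ?powR_gt0.
Unshelve. all: by end_near. Qed.

End CriticalLLT.

(** * Removal of the laziness *)

Section StableLLT.
Variable R : realType.
Variables (q : nat -> R) (l al a : R).
Hypothesis l01 : 0 < l < 1.
Hypothesis q0 : forall k, 0 <= q k.
Hypothesis q1 : series q @ \oo --> (1 : R).
Hypothesis qmu : series (fun k => k%:R * q k) @ \oo --> l^-1.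
Hypothesis q1_gt0 : 0 < q 1%N.
Hypothesis al12 : 1 < al < 2.
Hypothesis a0 : 0 < a.
Hypothesis qa : q k * k%:R `^ (1 + al) @[k --> \oo] --> a.

Let l0 : 0 < l. Proof. by case/andP: l01. Qed.

Lemma cpow_le1 N n : cpow q N n <= 1.
Proof.
elim: N n => [|N IH] n /=; first by case: (n == 0%N); rewrite ?ler01.
apply: le_trans (sum_ord_le n.+1 q0 q1); apply: ler_sum => m _.
by rewrite ler_piMr.
Qed.

Lemma truncn_bounds n : l * n%:R - 1 < (Num.truncn (l * n%:R))%:R <= l * n%:R.
Proof.
rewrite truncn_le ?mulr_ge0 ?(ltW l0) // andbT.
by rewrite ltrBlDr natr1 truncnS_gt.
Qed.

(* The binomial number of proper steps of the lazy walk concentrates around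
   [l * n], at scale [n ^ (1 / 2)], much below the scale [n ^ (2 / al)]
   on which the coefficients oscillate. *)
Lemma delazy : exists2 C : R, 0 < C & \forall n \near \oo,
  `|cpow (lazy l q) n n.-1 - cpow q (Num.truncn (l * n%:R)) n| <=
    C * (n%:R `^ (2^-1 - 2 / al) + n%:R `^ (- 1)).
Proof.
have [al1 al2] := andP al12; have al0 : 0 < al by lra.
have alp : 1 <= al <= 2 by rewrite !ltW.
have [cd cd0 decay] := chf_decay_stable q0 q1 al12 a0 q1_gt0 qa.
have [C1 C10 osc] := cpow_osc q0 q1 qmu alp cd0 decay.
(* With this [x], [N0 >= 2 x n] for large [n], so a binomial value below [x n] is at distance at
   least [x n] from [N0]. *)
pose x : R := l / 4; have x0 : 0 < x by rewrite divr_gt0.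
have xp : 0 < x `^ (- (2 / al)) by exact: powR_gt0.
have x2 : 0 < x ^+ 2 by exact: exprn_gt0.
exists (C1 * (4 * x `^ (- (2 / al))) + 2 / x ^+ 2).
  by rewrite addr_gt0 ?divr_gt0 // mulr_gt0 // mulr_gt0.
near=> n.
have n0 : (0 < n)%N by near: n; exists 1%N.
have n0' : 0 < n%:R :> R by rewrite ltr0n.
have n1' : 1 <= n%:R :> R by rewrite ler1n.
have ln2 : 2 <= l * n%:R.
  rewrite -ler_pdivrMl //; near: n; exact: nbhs_infty_ger.
set N0 := Num.truncn (l * n%:R).
have /andP[N0l N0u] := truncn_bounds n; rewrite -/N0 in N0l N0u.
have N02 : 2 * x * n%:R <= N0%:R by rewrite /x; lra.
pose d N : R := (N%:R - N0%:R) ^+ 2.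
have sn : 0 < Num.sqrt n%:R :> R by rewrite sqrtr_gt0.
have snn : Num.sqrt n%:R * Num.sqrt n%:R = n%:R :> R by rewrite -expr2 sqr_sqrtr // ltW.
have sn1 : 1 <= Num.sqrt n%:R :> R by rewrite -[leLHS](@sqrtr1 R) ler_wsqrtr.
pose P := (x * n%:R) `^ (- (2 / al)).
have P0 : 0 < P by apply: powR_gt0; rewrite mulr_gt0.
have big_dev N : (0 <= d N) by exact: sqr_ge0.
have xn : 0 < x * n%:R by rewrite mulr_gt0.
(* The bound is quadratic in [N - N0], so that its mean involves only a second moment. For
   [N >= x n] it follows from [cpow_osc] and [|N - N0| <= (N - N0) ^ 2 / sqrt n + sqrt n], the
   summand 1 being the distance between the targets [n.-1] and [n]. For smaller [N] the last term is
   at least 1, a trivial bound. *)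
have pw N : `|cpow q N n.-1 - cpow q N0 n| <=
    C1 * P * (d N / Num.sqrt n%:R + (Num.sqrt n%:R + 1)) + d N / (x * n%:R) ^+ 2.
  have dn : 0 <= d N / (x * n%:R) ^+ 2 by rewrite divr_ge0 // sqr_ge0.
  have an : `|N%:R - N0%:R| + 1 <= d N / Num.sqrt n%:R + (Num.sqrt n%:R + 1).
    rewrite addrA lerD2r /d -(real_normK (num_real (N%:R - N0%:R))).
    have := normr_ge0 (N%:R - N0%:R : R); move: `|N%:R - N0%:R : R| => y y0.
    have hy := sqr_ge0 (y - Num.sqrt n%:R).
    rewrite -(ler_pM2r sn) mulrDl divfK ?gt_eqF // snn.
    move: hy; rewrite sqrrB expr2 [Num.sqrt _ ^+ 2]expr2 snn mulr2n.
    have : 0 <= y * Num.sqrt n%:R by rewrite mulr_ge0 // ltW.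
    rewrite -expr2; lra.
  have [NN|NN] := leP (x * n%:R) N%:R.
    apply: (@le_trans _ _ (C1 * (`|N%:R - N0%:R| + 1) * P)); last first.
      rewrite -[leLHS]addr0 lerD // mulrAC ler_pM2l // mulr_gt0 //.
    have key M M' m m' : (M <= M')%N -> x * n%:R <= M%:R -> `|m%:R - m'%:R| = 1 :> R ->
        `|cpow q M m - cpow q M' m'| <= C1 * (`|M%:R - M'%:R| + 1) * P.
      move=> MM Mx mm; have M0 : 0 < M%:R :> R by exact: lt_le_trans Mx.
      apply: le_trans (osc M M' m m' _ MM) _; first by rewrite -(ltr0n R).
      rewrite mm natrB // distrC ger0_norm ?subr_ge0 ?ler_nat // ler_wpM2l //.
        by apply: mulr_ge0; [exact: ltW|rewrite addr_ge0 // subr_ge0 ler_nat].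
      rewrite /P !powRN lef_pV2 ?posrE ?powR_gt0 // ge0_ler_powR ?nnegrE ?divr_ge0 // ltW //.
    have nn1 : n%:R - n.-1%:R = 1 :> R by rewrite -[in X in X - _](prednK n0) -natr1 addrAC subrr add0r.
    have [le|le] := leqP N N0; first by apply: key => //; rewrite distrC nn1 normr1.
    rewrite distrC [`|N%:R - _|]distrC; apply: key; [exact: ltnW| |by rewrite nn1 normr1].
    by apply: le_trans N02; rewrite -mulrA; lra.
  apply: (@le_trans _ _ 1).
    have a1 := cpow_le1 N n.-1; have a2 := cpow_le1 N0 n.
    have a3 := cpow_ge0 N n.-1 q0; have a4 := cpow_ge0 N0 n q0.
    rewrite ler_norml; lra.
  apply: (@le_trans _ _ (d N / (x * n%:R) ^+ 2)); last first.
    rewrite lerDr; apply: mulr_ge0; first by rewrite mulr_ge0 // ltW.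
    by rewrite !addr_ge0 // ?divr_ge0 // ltW.
  rewrite ler_pdivlMr ?exprn_gt0 // mul1r /d -[leRHS]sqrrN opprB.
  rewrite ler_pXn2r ?nnegrE ?(ltW xn) //; last by rewrite subr_ge0; lra.
  by lra.
have l01' : 0 <= l <= 1 by case/andP: l01 => /ltW -> /ltW ->.
rewrite cpow_lazy; apply: le_trans (binom_mean_abs n _ _ l01') _.
apply: le_trans (binom_mean_le n l01' pw) _.
have Ed : binom_mean l n d <= 2 * n%:R.
  rewrite (binom_mean_sqr l n (- N0%:R)).
  have h1 : (n%:R * l - N0%:R) ^+ 2 <= 1.
    by rewrite -[leRHS](expr1n _ 2) ler_pXn2r ?nnegrE ?ler01 ?subr_ge0 // mulrC; lra.
  have h2 : l * (1 - l) <= 1.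
    by rewrite mulr_ile1 ?subr_ge0 ?(ltW l0) ?gerBl //; case/andP: l01'.
  have h3 : n%:R * (l * (1 - l)) <= n%:R * 1 by rewrite ler_pM2l.
  rewrite -mulrA; lra.
have Ed0 : 0 <= binom_mean l n d.
  by rewrite -(binom_mean_cst l n 0); apply: binom_mean_le.
have -> : binom_mean l n (fun N => C1 * P * (d N / Num.sqrt n%:R + (Num.sqrt n%:R + 1)) + d N / (x * n%:R) ^+ 2) =
   (C1 * P / Num.sqrt n%:R + ((x * n%:R) ^+ 2)^-1) * binom_mean l n d + C1 * P * (Num.sqrt n%:R + 1).
  rewrite -binom_meanZ -[in RHS](binom_mean_cst l n (C1 * P * (Num.sqrt n%:R + 1))) -binom_meanD.
  by congr binom_mean; apply/funext => N; ring.
apply: (@le_trans _ _ ((C1 * P / Num.sqrt n%:R + ((x * n%:R) ^+ 2)^-1) * (2 * n%:R) + C1 * P * (2 * Num.sqrt n%:R))).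
  apply: lerD; first by rewrite ler_wpM2l // addr_ge0 ?invr_ge0 ?sqr_ge0 // !mulr_ge0 ?invr_ge0 ?(ltW P0) ?(ltW C10) ?(ltW sn).
  rewrite ler_pM2l ?mulr_gt0 //; lra.
have e1 : C1 * P / Num.sqrt n%:R * (2 * n%:R) = C1 * P * (2 * Num.sqrt n%:R).
  by rewrite -{2}snn; field; rewrite gt_eqF.
have e2 : ((x * n%:R) ^+ 2)^-1 * (2 * n%:R) = 2 / x ^+ 2 * n%:R `^ (- 1).
  by rewrite powR_inv1 ?ler0n //; field; rewrite !gt_eqF.
have e3 : P * Num.sqrt n%:R = x `^ (- (2 / al)) * n%:R `^ (2^-1 - 2 / al).
  rewrite /P powRM ?(ltW x0) ?ler0n // -mulrA; congr (_ * _).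
  by rewrite -powR12_sqrt ?ler0n // -powRD ?(gt_eqF n0') ?implybT // addrC.
rewrite mulrDl e1 e2 addrAC.
have -> : C1 * P * (2 * Num.sqrt n%:R) + C1 * P * (2 * Num.sqrt n%:R) = C1 * (4 * (P * Num.sqrt n%:R)) by ring.
rewrite e3; set u := n%:R `^ _; set v := n%:R `^ _; set X := x `^ _.
have u0 : 0 <= u by exact: powR_ge0.
have v0 : 0 <= v by exact: powR_ge0.
have X0 : 0 <= X by exact: powR_ge0.
rewrite -subr_ge0 (_ : _ - _ = 2 / x ^+ 2 * u + C1 * (4 * X) * v); last by ring.
have x20 : 0 <= 2 / x ^+ 2 by rewrite divr_ge0 // ltW.
have C1X : 0 <= C1 * (4 * X) by rewrite mulr_ge0 ?(ltW C10) // mulr_ge0.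
by rewrite addr_ge0 // mulr_ge0.
Unshelve. all: by end_near. Qed.

Theorem stable_llt :
  cpow q (Num.truncn (l * n%:R)) n * n%:R `^ al^-1 @[n --> \oo] -->
   (l * a / al / (al - 1) * Gamma_integral (2 - al)) `^ (- al^-1) * al^-1 / Gamma_integral (1 - al^-1).
Proof.
have [al1 al2] := andP al12; have al0 : 0 < al by lra.
have [cd cd0 decay] := chf_decay_stable q0 q1 al12 a0 q1_gt0 qa.
have w0 := lazy_ge0 l01 q0; have w1 := lazy_mass l q1.
have wmean : series (fun k => k%:R * lazy l q k) @ \oo --> (1 : R).
  have h : series (fun k => k%:R * lazy l q k) @ \oo --> l * l^-1 by exact: lazy_mean.
  by rewrite mulfV ?gt_eqF in h.
have wa : lazy l q k * k%:R `^ (1 + al) @[k --> \oo] --> l * a.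
  have h : l * (q k * k%:R `^ (1 + al)) @[k --> \oo] --> l * a by exact: cvgMr.
  apply: cvg_trans h; apply: near_eq_cvg; exists 1%N => // -[|k] //= _.
  by rewrite lazyS mulrA.
have la0 : 0 < l * a by rewrite mulr_gt0.
have lcd0 : 0 < l * cd by rewrite mulr_gt0.
have wdecay t : 0 <= t <= pi -> cabs (chf (lazy l q) t) ^+ 2 <= 1 - l * cd * t `^ al.
  by move=> t0; apply: chf_lazy_decay => //; exact: decay.
have main := critical_llt w0 w1 wmean (lazy0_gt0 l01 q0) al12 la0 wa lcd0 wdecay.
have [C C0 hC] := delazy.
(* After multiplication by [n ^ b], the errors of [delazy] are of orders [n ^ (1 / 2 - b)] and
   [n ^ (b - 1)]; both vanish as [1 / 2 < b < 1]. *)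
pose b := al^-1; have b1 : 2^-1 < b < 1 by rewrite /b ltf_pV2 ?posrE // invf_lt1 // al2.
have /andP[b12 b11] := b1.
have err : C * (n%:R `^ (- (b - 2^-1)) + n%:R `^ (- (1 - b))) @[n --> \oo] --> (0 : R).
  have h : C * (n%:R `^ (- (b - 2^-1)) + n%:R `^ (- (1 - b))) @[n --> \oo] --> C * (0 + 0).
    by apply: cvgMr; apply: cvgD; apply: cvg_powRN0; rewrite subr_gt0.
  by move: h; rewrite addr0 mulr0.
have d0 : cpow (lazy l q) n n.-1 * n%:R `^ b - cpow q (Num.truncn (l * n%:R)) n * n%:R `^ b @[n --> \oo] --> (0 : R).
  apply/cvgrPdist_le => e e0; near=> n.
  have n0 : 0 < n%:R :> R by rewrite ltr0n; near: n; exists 1%N.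
  rewrite sub0r normrN -mulrBl normrM [X in _ * X]gtr0_norm ?powR_gt0 //.
  apply: (@le_trans _ _ (C * (n%:R `^ (- (b - 2^-1)) + n%:R `^ (- (1 - b))))); last first.
    near: n; have /cvgrPdist_le/(_ _ e0) := err; apply: filterS => n.
    by rewrite sub0r normrN; apply: le_trans (ler_norm _).
  apply: (@le_trans _ _ (C * (n%:R `^ (2^-1 - 2 / al) + n%:R `^ (- 1)) * n%:R `^ b)).
    by rewrite ler_wpM2r ?powR_ge0 //; near: n; exact: hC.
  rewrite -mulrA mulrDl -!powRD ?(gt_eqF n0) ?implybT // le_eqVlt; apply/orP; left; apply/eqP.
  by congr (_ * (_ `^ _ + _ `^ _)); rewrite /b; ring.
have h : cpow (lazy l q) n n.-1 * n%:R `^ b - (cpow (lazy l q) n n.-1 * n%:R `^ b -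
    cpow q (Num.truncn (l * n%:R)) n * n%:R `^ b) @[n --> \oo] -->
   (l * a / al / (al - 1) * Gamma_integral (2 - al)) `^ (- al^-1) * al^-1 / Gamma_integral (1 - al^-1) - 0.
  by apply: cvgB; [exact: main|exact: d0].
rewrite subr0 in h.
apply: cvg_trans h; apply: near_eq_cvg; apply: nearW => n.
by rewrite opprB addrC subrK.
Unshelve. all: by end_near. Qed.

End StableLLT.

(** * The Gaussian local limit theorem *)

Section GaussIntegral.
Variable R : realType.

Definition gauss_prim (x : R) : R := itg 0 x gauss_fun.

Lemma gauss_prim_cvg (u : nat -> R) : u n @[n --> \oo] --> +oo ->
  gauss_prim (u n) @[n --> \oo] --> (Num.sqrt pi / 2 : R).
Proof.
move=> uy.
have h : gauss_prim x ^+ 2 @[x --> +oo] --> (pi / 4 : R).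
  exact: gauss_integral_proof.cvg_integral0_gauss_sqr.
have h2 : Num.sqrt (gauss_prim x ^+ 2) @[x --> +oo] --> Num.sqrt (pi / 4 : R).
  by apply: (@cvg_comp _ _ _ (fun x => gauss_prim x ^+ 2) (@Num.sqrt R) _ _ _ h); exact: sqrt_continuous.
have h3 : Num.sqrt (gauss_prim (u n) ^+ 2) @[n --> \oo] --> Num.sqrt (pi / 4 : R).
  exact: (@cvg_comp _ _ _ u (fun x => Num.sqrt (gauss_prim x ^+ 2)) _ _ _ uy h2).
have e : Num.sqrt (pi / 4) = Num.sqrt pi / 2 :> R.
  rewrite sqrtrM ?pi_ge0 // (_ : 4^-1 = 2^-1 ^+ 2 :> R); last by field.
  by rewrite sqrtr_sqr ger0_norm // invr_ge0.
rewrite e in h3; apply: cvg_trans h3; apply: near_eq_cvg; apply: nearW => n.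
rewrite sqrtr_sqr ger0_norm //; exact: gauss_integral_proof.integral0_gauss_ge0.
Qed.

Lemma itg_gauss_scale (a : R) : 0 < a ->
  itg 0 pi (fun t => gauss_fun (a * t)) = gauss_prim (a * pi) / a.
Proof.
move=> a0; have pi0 := pi_gt0 R.
(* The base point [-1] makes 0 an interior point, at which [G] is differentiable. *)
pose G (t : R) := itg (-1) t gauss_fun.
have cg : continuous (@gauss_fun R) by exact: continuous_gauss_fun.
have dG (x : R) : -1 < x -> is_derive x 1 G (gauss_fun x).
  move=> x0.
  have [] := @continuous_FTC1 R gauss_fun (BLeft (-1)) x (x + 1) _ _ _ _.
  - by rewrite ltrDl.
  - exact/itg_integrable/continuous_subspaceT.
  - by rewrite lte_fin.
  - exact: cg.
  move=> d e; apply: DeriveDef; first exact: d.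
  by rewrite -derive1E.
have h : itg 0 pi (fun t => gauss_fun (a * t)) = a^-1 * G (a * pi) - a^-1 * G (a * 0).
  apply: (itg_FTC (F := fun t => a^-1 * G (a * t))) => //.
    apply: continuous_subspaceT => t; apply: continuous_comp; last exact: cg.
    exact: mulrl_continuous.
  move=> x /andP[x0 _].
  have d1 : is_derive x 1 (fun t : R => a * t) a.
    have h : is_derive x 1 (a \*: (@id R)) (a *: (1 : R)) by exact: is_deriveZ.
    by rewrite /GRing.scale /= mulr1 in h.
  have ax : -1 < a * x by rewrite (lt_le_trans _ (_ : 0 <= _)) ?ltrN10 // mulr_ge0 // ltW.
  have d2 := is_derive1_comp (dG _ ax) d1.
  have d3 : is_derive x 1 (a^-1 \*: (G \o *%R a)) (a^-1 *: (gauss_fun (a * x) * a)) by exact: is_deriveZ.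
  rewrite (_ : a^-1 *: _ = gauss_fun (a * x)) in d3; first exact: d3.
  by rewrite /GRing.scale /= mulrCA mulVf ?mulr1 // gt_eqF.
rewrite h mulr0 -mulrBr mulrC; congr (_ / _).
rewrite /G /gauss_prim (@itg_cat _ (-1) 0 (a * pi)) ?lerN10 ?mulr_ge0 ?(ltW a0) ?(ltW pi0) //.
  by rewrite addrAC subrr add0r.
exact: continuous_subspaceT.
Qed.

End GaussIntegral.

Section GaussianLLT.
Variable R : realType.
Local Notation Cx := (R[i])%C.
Variables (q : nat -> R) (mu s2 m3 c : R).
Hypothesis q0 : forall k, 0 <= q k.
Hypothesis q1 : series q @ \oo --> (1 : R).
Hypothesis qmu : series (fun k => k%:R * q k) @ \oo --> mu.
Hypothesis qvar : series (fun k => (k%:R - mu) ^+ 2 * q k) @ \oo --> s2.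
Hypothesis q3 : forall n, series (fun k => k%:R ^+ 3 * q k) n <= m3.
Hypothesis s20 : 0 < s2.
Hypothesis c0 : 0 < c.
Hypothesis decay : forall t, 0 <= t <= pi -> cabs (chf q t) ^+ 2 <= 1 - c * t `^ 2.

Let mu0 : 0 <= mu.
Proof. by have := sum_ord_le 0 (fun k => mulr_ge0 (ler0n _ k) (q0 k)) qmu; rewrite big_ord0. Qed.

Lemma chf_order3 : exists2 C : R, 0 < C & forall t, 0 <= t ->
  cabs (chf q t * cis (- mu * t) - 1 + (s2 * t ^+ 2 / 2)%:C%C) <= C * t ^+ 3.
Proof.
have m30 : 0 <= m3 by apply: le_trans (q3 0); rewrite /series /= big_geq.
(* [12 = 3 * 4], with 3 from [cis_order3] and 4 from the convexity bound
   [(k + mu) ^ 3 <= 4 (k ^ 3 + mu ^ 3)]. *)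
exists (12 * (m3 + mu ^+ 3) + 1).
  by rewrite ltr_wpDl // mulr_ge0 // addr_ge0 // exprn_ge0.
move=> t t0.
pose d k : R := k%:R - mu.
pose g k : Cx := cis (d k * t) - 1 - Complex 0 (d k * t) + ((d k * t) ^+ 2 / 2)%:C%C.
have hcv : ccvg (fun n => \sum_(k < n) (q k)%:C%C * g k) (chf q t * cis (- mu * t) - 1 + (s2 * t ^+ 2 / 2)%:C%C).
  have h1 := ccvgM (chf_cvg q0 q1 t) (ccvg_cst (cis (- mu * t))).
  have h2 : ccvg (fun n => (series (fun k => k%:R * q k) n - mu * series q n)%:C%C) ((mu - mu * 1)%:C%C : Cx).
    by apply: ccvgR; apply: cvgB => //; exact: cvgMr.
  have h4 := ccvgR qvar.
  have h3 := ccvgD (ccvgD (ccvgD h1 (ccvgM (ccvg_cst (-1)) (ccvg_mass q1))) (ccvgM (ccvg_cst (- Complex 0 t)) h2))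
     (ccvgM (ccvg_cst ((t ^+ 2 / 2)%:C%C)) h4).
  have el : chf q t * cis (- mu * t) + -1 * 1 + - Complex 0 t * (mu - mu * 1)%:C%C + (t ^+ 2 / 2)%:C%C * s2%:C%C =
     chf q t * cis (- mu * t) - 1 + (s2 * t ^+ 2 / 2)%:C%C.
    have z : (mu - mu * 1)%:C%C = 0 :> Cx by rewrite mulr1 subrr.
    rewrite z mulr0 addr0 mulr1; congr (_ + _).
    by apply: Cx_eq; rewrite ?cReM ?cImM /=; ring.
  rewrite el in h3.
  suff -> : (fun n => \sum_(k < n) (q k)%:C%C * g k) = (fun n => (\sum_(k < n) (q k)%:C%C * cis (k%:R * t)) * cis (- mu * t) +
     -1 * \sum_(k < n) (q k)%:C%C + - Complex 0 t * (series (fun k => k%:R * q k) n - mu * series q n)%:C%C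
      + (t ^+ 2 / 2)%:C%C * (series (fun k => (k%:R - mu) ^+ 2 * q k) n)%:C%C) by [].
  apply/funext => n.
  have -> : (series (fun k => k%:R * q k) n - mu * series q n)%:C%C = \sum_(k < n) (d k * q k)%:C%C.
    rewrite /series /= !big_mkord mulr_sumr -sumrB rmorph_sum; apply: eq_bigr => k _.
    by rewrite /d mulrBl.
  have -> : (series (fun k => (k%:R - mu) ^+ 2 * q k) n)%:C%C = \sum_(k < n) (d k ^+ 2 * q k)%:C%C.
    by rewrite /series /= !big_mkord rmorph_sum.
  rewrite mulr_suml !mulr_sumr -!big_split /=; apply: eq_bigr => k _.
  have A1 : (q k)%:C%C * cis (k%:R * t) * cis (- mu * t) = (q k)%:C%C * cis (d k * t).
    by rewrite -mulrA -cisD; congr (_ * cis _); rewrite /d; ring.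
  have A2 : - Complex 0 t * (d k * q k)%:C%C = (q k)%:C%C * - Complex 0 (d k * t).
    by apply: Cx_eq; rewrite ?cReM ?cImM ?cReN ?cImN /=; ring.
  have A3 : (t ^+ 2 / 2)%:C%C * (d k ^+ 2 * q k)%:C%C = (q k)%:C%C * ((d k * t) ^+ 2 / 2)%:C%C.
    by apply: Cx_eq; rewrite ?cReM ?cImM /=; ring.
  by rewrite A1 A2 A3 /g; ring.
apply: ccvg_le hcv => n; apply: le_trans (cabs_sum _ _ _) _.
apply: (@le_trans _ _ (12 * t ^+ 3 * (\sum_(k < n) k%:R ^+ 3 * q k + mu ^+ 3 * \sum_(k < n) q k))).
  rewrite mulr_sumr -big_split /= mulr_sumr; apply: ler_sum => k _.
  rewrite cabs_qz //.
  have h1 : cabs (g k) <= 3 * `|d k * t| ^+ 3 by exact: cis_order3.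
  have h2 : `|d k * t| ^+ 3 = `|d k| ^+ 3 * t ^+ 3 by rewrite normrM exprMn (ger0_norm t0).
  have h3 : `|d k| ^+ 3 <= 4 * (k%:R ^+ 3 + mu ^+ 3).
    have h : `|d k| <= k%:R + mu.
      have k0 : 0 <= k%:R :> R by [].
      by have m0 := mu0; rewrite ler_norml /d; lra.
    apply: (@le_trans _ _ ((k%:R + mu) ^+ 3)); first by rewrite lerXn2r ?nnegrE ?addr_ge0.
    have k0 : 0 <= k%:R :> R by [].
    move: (k%:R : R) k0 => y y0; rewrite -subr_ge0.
    have -> : 4 * (y ^+ 3 + mu ^+ 3) - (y + mu) ^+ 3 = 3 * (y + mu) * (y - mu) ^+ 2 by ring.
    by rewrite mulr_ge0 ?sqr_ge0 // mulr_ge0 // addr_ge0.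
  have -> : 12 * t ^+ 3 * (k%:R ^+ 3 * q k + mu ^+ 3 * q k) = q k * (3 * (4 * (k%:R ^+ 3 + mu ^+ 3) * t ^+ 3)) by ring.
  rewrite ler_wpM2l //; apply: le_trans h1 _.
  by rewrite h2 ler_pM2l // ler_wpM2r // exprn_ge0.
apply: (@le_trans _ _ (12 * t ^+ 3 * (m3 + mu ^+ 3 * 1))).
  rewrite ler_wpM2l ?mulr_ge0 ?exprn_ge0 //; apply: lerD.
    by have := q3 n; rewrite /series /= big_mkord.
  by rewrite ler_wpM2l ?exprn_ge0 // sum_ord_le.
have : 0 <= t ^+ 3 by exact: exprn_ge0.
rewrite mulr1 => h.
have -> : (12 * (m3 + mu ^+ 3) + 1) * t ^+ 3 = 12 * t ^+ 3 * (m3 + mu ^+ 3) + t ^+ 3 by ring.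
by rewrite lerDl.
Qed.

Lemma expRN_order2 (x : R) : 0 <= x -> `|expR (- x) - 1 + x| <= x ^+ 2.
Proof.
move=> x0; have h1 := expR_ge1Dx (- x); have h2 := expR_ge1Dx x.
rewrite ger0_norm; last by lra.
have e1 : expR (- x) * (1 + x) <= 1.
  by rewrite -[leRHS](expR0) -(addNr x) expRD ler_pM2l ?expR_gt0.
have e2 : 0 < 1 + x by lra.
rewrite -(ler_pM2r e2); have e3 : 0 <= x ^+ 3 by exact: exprn_ge0.
have -> : (expR (- x) - 1 + x) * (1 + x) = expR (- x) * (1 + x) - 1 + x ^+ 2 by ring.
have -> : x ^+ 2 * (1 + x) = x ^+ 2 + x ^+ 3 by ring.
lra.
Qed.

(** Two errors are separated. That of centring carries the factor [cis (x t) - 1], of order [x t];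
    that of replacing the centred characteristic function by a Gaussian is at most [N] times the
    cubic Taylor error. Integrated against a Gaussian of width [N ^ (- 1 / 2)], they give [|x| / N]
    and [1 / N]. *)
Lemma gaussian_bound : exists2 C : R, 0 < C & forall N n, (0 < N)%N ->
  `|pi * cpow q N n - itg 0 pi (fun t => gauss_fun (Num.sqrt (N%:R * s2 / 2) * t))| <=
   C * (1 + `|N%:R * mu - n%:R|) / N%:R.
Proof.
have [C3 C30 h3] := chf_order3.
pose d := Num.min (c / 2) (s2 / 2); have d0 : 0 < d by rewrite lt_min !divr_gt0.
have dc : d <= c / 2 by rewrite ge_min lexx.
have ds : d <= s2 / 2 by rewrite ge_min lexx orbT.
have [K K0 hK] := itg_decay d0.
have pi0 := pi_gt0 R.
pose C4 := C3 + (s2 / 2) ^+ 2 * pi.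
have C40 : 0 < C4 by rewrite ltr_wpDr // mulr_ge0 ?sqr_ge0 // ltW.
(* [E] makes up for the exponential bound having only [N - 1] factors in a difference of [N]-th
   powers. *)
pose E := expR (d * pi ^+ 2); have E0 : 0 < E by exact: expR_gt0.
exists (K * (1 + C4 * E)); first by rewrite mulr_gt0 // addr_gt0 // mulr_gt0.
move=> N n N0; have N0' : 0 < N%:R :> R by rewrite ltr0n.
set x := N%:R * mu - n%:R.
pose psi t := chf q t * cis (- mu * t).
pose ga t : R := expR (- (s2 / 2 * t ^+ 2)).
have gaN t : gauss_fun (Num.sqrt (N%:R * s2 / 2) * t) = ga t ^+ N.
  rewrite /gauss_fun /ga -expRM_natl exprMn sqr_sqrtr ?divr_ge0 ?mulr_ge0 ?(ltW s20) //.
  congr expR; ring.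
have cpsi : ccont psi by apply: ccontM; [exact: chf_cont q0 q1 qmu|exact: ccont_cis].
have cgs : continuous (fun t => gauss_fun (Num.sqrt (N%:R * s2 / 2) * t)).
  move=> t; apply: continuous_comp; first exact: mulrl_continuous.
  exact: continuous_gauss_fun.
pose F1 t := Re (psi t ^+ N * (cis (x * t) - 1)).
pose F2 t := Re (psi t ^+ N) - gauss_fun (Num.sqrt (N%:R * s2 / 2) * t).
have cF1 : continuous F1.
  by apply: (proj1 (ccontM (ccontX N cpsi) (ccontB (ccont_cis _) (ccont_cst 1)))).
have cF2 : continuous F2.
  move=> t; apply: cvgB; [exact: (proj1 (ccontX N cpsi))|exact: cgs].
have -> : pi * cpow q N n - itg 0 pi (fun t => gauss_fun (Num.sqrt (N%:R * s2 / 2) * t)) = itg 0 pi F1 + itg 0 pi F2.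
  rewrite -(cpow_fourier q0 q1 qmu) -itgD // -itgB //; last first.
    by apply: (proj1 (ccontM (ccontX N (chf_cont q0 q1 qmu)) (ccont_cis _))).
  congr itg; apply/funext => t; rewrite /F1 /F2 addrA; congr (_ - _).
  rewrite -cReD; congr Re; rewrite mulrBr mulr1 subrK /psi exprMn -mulrA; congr (_ * _).
  by rewrite -cisM -cisD; congr cis; rewrite /x; ring.
have td (t : R) : 0 <= t <= pi -> cabs (psi t) <= expR (- (d * t ^+ 2)).
  move=> t0pi; rewrite /psi cabsM cabs_cis mulr1.
  rewrite -(ler_pXn2r (n := 2)) ?nnegrE ?cabs_ge0 ?expR_ge0 // -expRM_natl.
  apply: le_trans (decay t0pi) _; have /andP[t0 _] := t0pi.
  rewrite powR_mulrn //; apply: le_trans (expR_ge1Dx _).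
  have : d * t ^+ 2 <= c / 2 * t ^+ 2 by rewrite ler_wpM2r ?sqr_ge0.
  lra.
have gd (t : R) : cabs (ga t)%:C%C <= expR (- (d * t ^+ 2)).
  rewrite cabsR ger0_norm ?expR_ge0 // ler_expR lerN2 ler_wpM2r ?sqr_ge0 //.
have t2E (t : R) : 0 <= t -> t `^ 2 = t ^+ 2 by move=> ?; rewrite powR_mulrn.
have p12 : (1 : R) <= 2 by rewrite ler1n.
have B1 : `|itg 0 pi F1| <= `|x| * K * N%:R `^ (- ((1 + 1) / 2)).
  apply: hK => //; first by rewrite ler01 ler1n.
  move=> t t0pi; have /andP[t0 _] := t0pi.
  rewrite powRr1 // t2E //; apply: le_trans (Re_le_cabs _) _; rewrite cabsM cabsX mulrCA.
  apply: ler_pM; rewrite ?exprn_ge0 ?cabs_ge0 //.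
    apply: (@le_trans _ _ (expR (- (d * t ^+ 2)) ^+ N)).
      by rewrite lerXn2r ?nnegrE ?cabs_ge0 ?expR_ge0 // td.
    by rewrite -expRM_natl ler_expR le_eqVlt; apply/orP; left; apply/eqP; ring.
  by apply: le_trans (cabs_cis_sub1 _) _; rewrite normrM (ger0_norm t0).
have B2 : `|itg 0 pi F2| <= N%:R * (C4 * E) * K * N%:R `^ (- ((1 + 3) / 2)).
  apply: hK => //; first by rewrite ler0n lexx.
    by rewrite !mulr_ge0 // ltW.
  move=> t t0pi; have /andP[t0 tpi] := t0pi.
  have -> : F2 t = Re (psi t ^+ N - (ga t)%:C%C ^+ N).
    by rewrite /F2 gaN cReD cReN -rmorphXn.
  apply: le_trans (Re_le_cabs _) _.
  have := cabs_subX N.-1 (td t t0pi) (gd t); rewrite prednK // => hh; apply: le_trans hh _.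
  have t3E : t `^ 3 = t ^+ 3 by rewrite powR_mulrn.
  rewrite t2E // t3E.
  have e1 : expR (- (d * t ^+ 2)) ^+ N.-1 <= E * expR (- (d * (N%:R * t ^+ 2))).
    rewrite -expRM_natl /E -expRD ler_expR.
    have -> : N.-1%:R = N%:R - 1 :> R by rewrite -[in RHS](prednK N0) -natr1 addrK.
    have : d * t ^+ 2 <= d * pi ^+ 2 by rewrite ler_pM2l // ler_pXn2r ?nnegrE // ltW.
    have -> : (N%:R - 1) * - (d * t ^+ 2) = d * t ^+ 2 - d * (N%:R * t ^+ 2) by ring.
    lra.
  have e2 : cabs (psi t - (ga t)%:C%C) <= C4 * t ^+ 3.
    have -> : psi t - (ga t)%:C%C = (psi t - 1 + (s2 * t ^+ 2 / 2)%:C%C) - ((ga t - 1 + s2 / 2 * t ^+ 2)%:C%C).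
      by apply: Cx_eq; rewrite ?cReD ?cImD ?cReN ?cImN ?cReD ?cImD ?cReN ?cImN /=; ring.
    apply: le_trans (cabsD _ _) _; rewrite cabsN cabsR /C4 mulrDl; apply: lerD; first exact: h3.
    apply: le_trans (expRN_order2 _) _; first by rewrite mulr_ge0 ?sqr_ge0 // divr_ge0 // ltW.
    rewrite exprMn -mulrA ler_wpM2l ?sqr_ge0 // -exprM -[leLHS]mulr1 (exprSr t 3) -mulrA mulr1.
    by rewrite mulrC ler_wpM2r // exprn_ge0.
  have -> : N%:R * (C4 * E) * (expR (- (d * (N%:R * t ^+ 2))) * t ^+ 3) =
    N%:R * (E * expR (- (d * (N%:R * t ^+ 2)))) * (C4 * t ^+ 3) by ring.
  apply: ler_pM; rewrite ?cabs_ge0 ?mulr_ge0 ?exprn_ge0 ?expR_ge0 //.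
  by rewrite ler_pM2l.
have e1 : N%:R `^ (- ((1 + 1) / 2)) = N%:R^-1 :> R.
  by rewrite (_ : - _ = -1) ?powR_inv1 ?ler0n //; field.
have e2 : N%:R `^ (- ((1 + 3) / 2)) = N%:R^-1 ^+ 2 :> R.
  by rewrite (_ : - _ = -2) ?powRN ?powR_mulrn ?ler0n ?exprVn //; field.
apply: le_trans (ler_normD _ _) _; apply: le_trans (lerD B1 B2) _; rewrite e1 e2.
have -> : `|x| * K / N%:R + N%:R * (C4 * E) * K * N%:R^-1 ^+ 2 = K * (`|x| + C4 * E) / N%:R.
  by field; rewrite gt_eqF.
rewrite ler_pM2r ?invr_gt0 // -mulrA ler_pM2l //.
have : 0 <= C4 * E * `|x| by rewrite !mulr_ge0 // ltW.
have := normr_ge0 x; move: `|x| => y; move: (C4 * E) => z; lra.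
Qed.

Theorem gaussian_llt l : 0 < l -> l * mu = 1 ->
  cpow q (Num.truncn (l * n%:R)) n * n%:R `^ 2^-1 @[n --> \oo] --> (2 * pi * s2 * l) `^ (- 2^-1).
Proof.
move=> l0 lmu; have [C C0 hC] := gaussian_bound; have pi0 := pi_gt0 R.
pose N (n : nat) : nat := Num.truncn (l * n%:R).
have mul1 : mu = l^-1 by rewrite -[LHS]mul1r -(mulVf (lt0r_neq0 l0)) -mulrA lmu mulr1.
have Nb n : l * n%:R - 1 < (N n)%:R <= l * n%:R.
  by rewrite truncn_le ?mulr_ge0 ?(ltW l0) // andbT ltrBlDr natr1 truncnS_gt.
have invn : n%:R^-1 @[n --> \oo] --> (0 : R).
  have h : n%:R `^ (- 1) @[n --> \oo] --> (0 : R) by exact: cvg_powRN0.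
  by move: h; under eq_fun do rewrite powR_inv1 ?ler0n //.
have ratio : (N n)%:R / n%:R @[n --> \oo] --> l.
  apply: (squeeze_cvgr (f := fun n : nat => l - n%:R^-1) (h := fun=> l)); last exact: cvg_cst.
    near=> n; have n0 : 0 < n%:R :> R by rewrite ltr0n; near: n; exists 1%N.
    have /andP[b1 b2] := Nb n.
    rewrite ler_pdivlMr // ler_pdivrMr // b2 andbT mulrBl mulVf ?gt_eqF //; exact: ltW.
  by rewrite -[X in _ --> X]subr0; apply: cvgB => //; exact: cvg_cst.
pose a n : R := Num.sqrt ((N n)%:R * s2 / 2).
have Npos : \forall n \near \oo, (0 < N n)%N.
  near=> n; rewrite -(ltr0n R); have /andP[b1 _] := Nb n; apply: le_lt_trans b1.
  rewrite subr_ge0 -ler_pdivrMl // mulr1; near: n; exact: nbhs_infty_ger.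
have dif : Num.sqrt n%:R * (pi * cpow q (N n) n - itg 0 pi (fun t => gauss_fun (a n * t))) @[n --> \oo] --> (0 : R).
  have h : C * (1 + mu) * ((N n)%:R / n%:R)^-1 * n%:R `^ (- 2^-1) @[n --> \oo] --> C * (1 + mu) * l^-1 * 0.
    apply: cvgM; last by exact: cvg_powRN0.
    by apply: cvgM; [exact: cvg_cst|apply: cvgV => //; rewrite gt_eqF].
  rewrite mulr0 in h; apply/cvgrPdist_le => e e0; near=> n.
  have n0 : 0 < n%:R :> R by rewrite ltr0n; near: n; exists 1%N.
  have N0 : (0 < N n)%N by near: n; exact: Npos.
  have N0' : 0 < (N n)%:R :> R by rewrite ltr0n.
  rewrite sub0r normrN normrM (ger0_norm (sqrtr_ge0 _)).
  (* As [l * mu = 1] and [N n] is the integer part of [l * n], the centring error stays bounded. *)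
  have xb : `|(N n)%:R * mu - n%:R| <= mu.
    have /andP[b1 b2] := Nb n.
    have -> : (N n)%:R * mu - n%:R = - (mu * (l * n%:R - (N n)%:R)) by rewrite mul1; field; rewrite gt_eqF.
    rewrite normrN normrM (ger0_norm mu0) ger0_norm ?subr_ge0 // ler_piMr //; lra.
  apply: (@le_trans _ _ (C * (1 + mu) * ((N n)%:R / n%:R)^-1 * n%:R `^ (- 2^-1))); last first.
    apply: le_trans (ler_norm _) _; rewrite -normrN -sub0r.
    near: n; have /cvgrPdist_le/(_ _ e0) := h; exact.
  apply: le_trans (ler_wpM2l (sqrtr_ge0 _) (hC _ n N0)) _.
  apply: (@le_trans _ _ (Num.sqrt n%:R * (C * (1 + mu) / (N n)%:R))).
    by rewrite ler_wpM2l ?sqrtr_ge0 // ler_pM2r ?invr_gt0 // ler_pM2l // lerD2l.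
  have -> : n%:R `^ (- 2^-1) = Num.sqrt n%:R / n%:R :> R.
    rewrite -powR12_sqrt ?ler0n // -[in X in _ / X](powRr1 (ler0n R n)) -powRN -powRD ?(gt_eqF n0) ?implybT //.
    congr (_ `^ _); lra.
  by rewrite le_eqVlt; apply/orP; left; apply/eqP; field; rewrite !gt_eqF.
have main : Num.sqrt n%:R * itg 0 pi (fun t => gauss_fun (a n * t)) @[n --> \oo] -->
    Num.sqrt pi / 2 / Num.sqrt (l * s2 / 2).
  have aa : a n / Num.sqrt n%:R @[n --> \oo] --> Num.sqrt (l * s2 / 2).
    have h : Num.sqrt ((N n)%:R / n%:R * s2 / 2) @[n --> \oo] --> Num.sqrt (l * s2 / 2).
      apply: (@cvg_comp _ _ _ (fun n => (N n)%:R / n%:R * s2 / 2) (@Num.sqrt R) _ (nbhs (l * s2 / 2))).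
        by apply: cvgMl; apply: cvgMl.
      exact: sqrt_continuous.
    apply: cvg_trans h; apply: near_eq_cvg; near=> n.
    have n0 : 0 < n%:R :> R by rewrite ltr0n; near: n; exists 1%N.
    rewrite /a -sqrtrV ?ler0n // -sqrtrM ?divr_ge0 ?mulr_ge0 ?ler0n ?(ltW s20) //.
    congr Num.sqrt; ring.
  have sl0 : 0 < Num.sqrt (l * s2 / 2) by rewrite sqrtr_gt0 divr_gt0 // mulr_gt0.
  have sqy : Num.sqrt (n%:R : R) @[n --> \oo] --> +oo.
    have h : (n%:R : R) `^ 2^-1 @[n --> \oo] --> +oo by apply: (@cvg_powRy R); rewrite invr_gt0.
    by move: h; under eq_fun do rewrite powR12_sqrt ?ler0n //.
  have ay : a n * pi @[n --> \oo] --> +oo.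
    apply/cvgryPge => A; near=> n.
    have n0 : 0 < n%:R :> R by rewrite ltr0n; near: n; exists 1%N.
    have s0 : 0 < Num.sqrt n%:R :> R by rewrite sqrtr_gt0.
    have h1 : Num.sqrt (l * s2 / 2) / 2 <= a n / Num.sqrt n%:R.
      by near: n; apply: (cvgr_ge _ aa); rewrite ltr_pdivrMr // ltr_pMr // ltr1n.
    have h2 : `|A| / (Num.sqrt (l * s2 / 2) / 2 * pi) <= Num.sqrt n%:R.
      by near: n; move/cvgryPge : sqy; apply.
    have k0 : 0 < Num.sqrt (l * s2 / 2) / 2 * pi by rewrite mulr_gt0 // divr_gt0.
    rewrite ler_pdivrMr // in h2; apply: le_trans (ler_norm A) _; apply: le_trans h2 _.
    rewrite mulrA ler_pM2r // mulrC -ler_pdivlMr //.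
  have h := gauss_prim_cvg ay.
  have h2 : gauss_prim (a n * pi) / (a n / Num.sqrt n%:R) @[n --> \oo] --> Num.sqrt pi / 2 / Num.sqrt (l * s2 / 2).
    by apply: cvgM => //; apply: cvgV => //; rewrite gt_eqF.
  apply: cvg_trans h2; apply: near_eq_cvg; near=> n.
  have n0 : 0 < n%:R :> R by rewrite ltr0n; near: n; exists 1%N.
  have N0 : (0 < N n)%N by near: n; exact: Npos.
  have a0 : 0 < a n by rewrite sqrtr_gt0 divr_gt0 // mulr_gt0 // ltr0n.
  rewrite itg_gauss_scale // invfM invrK; ring.
have h : pi^-1 * (Num.sqrt n%:R * (pi * cpow q (N n) n - itg 0 pi (fun t => gauss_fun (a n * t))) +
   Num.sqrt n%:R * itg 0 pi (fun t => gauss_fun (a n * t))) @[n --> \oo] --> pi^-1 * (0 + Num.sqrt pi / 2 / Num.sqrt (l * s2 / 2)).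
  by apply: cvgMr; exact: cvgD.
have -> : (2 * pi * s2 * l) `^ (- 2^-1) = pi^-1 * (0 + Num.sqrt pi / 2 / Num.sqrt (l * s2 / 2)).
  have e1 : 2 * pi * s2 * l = (2 * Num.sqrt pi * Num.sqrt (l * s2 / 2)) ^+ 2.
    have slp : 0 <= l * s2 / 2 by rewrite divr_ge0 // mulr_ge0 // ltW.
    by rewrite !exprMn (sqr_sqrtr (ltW pi0)) (sqr_sqrtr slp); field.
  have sp : 0 < Num.sqrt pi :> R by rewrite sqrtr_gt0.
  have sl0 : 0 < Num.sqrt (l * s2 / 2) by rewrite sqrtr_gt0 divr_gt0 // mulr_gt0.
  have pp : pi = Num.sqrt pi ^+ 2 :> R by rewrite sqr_sqrtr // ltW.
  rewrite powRN powR12_sqrt; last by rewrite e1 sqr_ge0.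
  rewrite e1 sqrtr_sqr ger0_norm ?mulr_ge0 ?sqrtr_ge0 // add0r [X in X^-1 * _]pp.
  by field; rewrite !gt_eqF.
apply: cvg_trans h; apply: near_eq_cvg; apply: nearW => n.
rewrite powR12_sqrt ?ler0n //= -/(N n) -mulrDr subrK mulrCA mulKf ?gt_eqF // mulrC.
Unshelve. all: by end_near. Qed.

End GaussianLLT.

(** * One big jump *)

Section NonnegPoly.
Variable R : realType.
Implicit Types p q : {poly R}.

Definition poly_ge0 p := forall i, 0 <= p`_i.

Lemma poly_ge0D p q : poly_ge0 p -> poly_ge0 q -> poly_ge0 (p + q).
Proof. by move=> hp hq i; rewrite coefD addr_ge0. Qed.

Lemma poly_ge0M p q : poly_ge0 p -> poly_ge0 q -> poly_ge0 (p * q).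
Proof. by move=> hp hq i; rewrite coefM sumr_ge0 // => j _; rewrite mulr_ge0. Qed.

Lemma poly_ge0X p n : poly_ge0 p -> poly_ge0 (p ^+ n).
Proof.
move=> hp; elim: n => [|n IH]; first by move=> i; rewrite expr0 coef1 ler0n.
by rewrite exprS; exact: poly_ge0M.
Qed.

Lemma poly_ge0_horner p x : poly_ge0 p -> 0 <= x -> 0 <= p.[x].
Proof. by move=> hp x0; rewrite horner_coef sumr_ge0 // => i _; rewrite mulr_ge0 ?exprn_ge0. Qed.

Lemma poly_ge0_coef_le p x n : poly_ge0 p -> 0 <= x -> p`_n * x ^+ n <= p.[x].
Proof.
move=> hp x0; rewrite (@horner_coef_wide _ (maxn (size p) n.+1)) ?leq_maxl //.
have nM : (n < maxn (size p) n.+1)%N by rewrite leq_maxr.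
rewrite (bigD1 (Ordinal nM)) //= lerDl sumr_ge0 // => i _.
by rewrite mulr_ge0 ?exprn_ge0.
Qed.

Lemma poly_ge0_coefM_le p q M n : poly_ge0 p -> poly_ge0 q -> (forall i, p`_i <= M) ->
  (p * q)`_n <= M * q.[1].
Proof.
move=> hp hq pM; rewrite coefMr.
have M0 : 0 <= M := le_trans (hp 0%N) (pM 0%N).
rewrite (@horner_coef_wide _ (maxn (size q) n.+1)) ?leq_maxl //.
rewrite -(big_mkord xpredT (fun i => p`_(n - i) * q`_i)) -(big_mkord xpredT (fun i => q`_i * 1 ^+ i)).
rewrite mulr_sumr [leRHS](big_cat_nat (n := n.+1)) ?leq_maxr //=; apply: ler_wpDr.
  by apply: sumr_ge0 => i _; rewrite expr1n mulr1 mulr_ge0.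
by apply: ler_sum => i _; rewrite expr1n mulr1 ler_wpM2r.
Qed.

(* The three terms correspond to no, exactly one and at least two factors [q]. *)
Lemma poly_pow_split p q N : poly_ge0 p -> poly_ge0 q -> p.[1] + q.[1] <= 1 ->
  exists g : {poly R}, [/\ poly_ge0 g, g.[1] <= N.+1%:R ^+ 2 &
    (p + q) ^+ N.+1 = p ^+ N.+1 + N.+1%:R *: (q * p ^+ N) + q * q * g].
Proof.
move=> hp hq pq1; have p0 := poly_ge0_horner hp ler01; have q0 := poly_ge0_horner hq ler01.
elim: N => [|N [g [g0 g1 gE]]].
  exists 0; split; first by move=> i; rewrite coef0.
    by rewrite horner0 exprn_ge0.
  by rewrite !expr1 expr0 mulr1 scale1r mulr0 addr0.
have c0 : poly_ge0 (N.+1%:R *: p ^+ N) by move=> i; rewrite coefZ mulr_ge0 //; exact: poly_ge0X.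
exists ((p + q) * g + N.+1%:R *: p ^+ N); split.
- by apply: poly_ge0D => //; apply: poly_ge0M => //; exact: poly_ge0D.
- rewrite hornerD hornerM hornerZ hornerD horner_exp.
  have h1 : (p.[1] + q.[1]) * g.[1] <= g.[1].
    by rewrite ler_piMl //; exact: poly_ge0_horner.
  have h2 : N.+1%:R * p.[1] ^+ N <= N.+1%:R.
    by rewrite ler_piMr // exprn_ile1 //; lra.
  have : (0 : R) <= N.+1%:R by [].
  rewrite -(natr1 N.+1); move: (N.+1%:R : R) g1 h2 => y g1 h2 y0.
  have -> : (y + 1) ^+ 2 = y ^+ 2 + y * 2 + 1 by ring.
  lra.
rewrite exprS gE -!mul_polyC -(natr1 N.+1) polyCD polyC1.
by rewrite !(exprSr p); move: (N.+1%:R%:P) => c; ring.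
Qed.

End NonnegPoly.

Section PowerExp.
Variable R : realType.

Lemma expRN_le_pow (x : R) m : 0 < x -> expR (- x) <= (m.+1%:R / x) ^+ m.+1.
Proof.
move=> x0; have m0 : 0 < m.+1%:R :> R by rewrite ltr0n.
have h : x / m.+1%:R <= expR (x / m.+1%:R).
  by apply: le_trans (expR_ge1Dx _); rewrite lerDr.
have -> : expR (- x) = (expR (x / m.+1%:R) ^+ m.+1)^-1.
  by rewrite -expRM_natl mulrC divfK ?gt_eqF // expRN.
rewrite -[m.+1%:R / x]invrK invf_div exprVn lef_pV2 ?posrE ?exprn_gt0 ?expR_gt0 ?divr_gt0 //.
by rewrite lerXn2r ?nnegrE ?expR_ge0 // divr_ge0 // ltW.
Qed.

Lemma cvg_powR_exp (p c r : R) : 0 < c -> 0 < r ->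
  n%:R `^ p * expR (- (c * n%:R `^ r)) @[n --> \oo] --> (0 : R).
Proof.
move=> c0 r0; pose m := Num.truncn (`|p| / r).
have mr : p < m.+1%:R * r.
  by apply: le_lt_trans (ler_norm p) _; rewrite -ltr_pdivrMr // truncnS_gt.
have h : (m.+1%:R / c) ^+ m.+1 * n%:R `^ (- (m.+1%:R * r - p)) @[n --> \oo] --> (m.+1%:R / c) ^+ m.+1 * (0 : R).
  by apply: cvgMr; apply: cvg_powRN0; rewrite subr_gt0.
rewrite mulr0 in h; apply: (squeeze_cvgr _ (cvg_cst _) h); near=> n.
have n0 : 0 < n%:R :> R by rewrite ltr0n; near: n; exists 1%N.
rewrite mulr_ge0 ?powR_ge0 ?expR_ge0 //=.
have nr : 0 < n%:R `^ r :> R by exact: powR_gt0.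
apply: (@le_trans _ _ (n%:R `^ p * (m.+1%:R / (c * n%:R `^ r)) ^+ m.+1)).
  by rewrite ler_wpM2l ?powR_ge0 // expRN_le_pow // mulr_gt0.
rewrite le_eqVlt; apply/orP; left; apply/eqP.
rewrite invfM mulrA exprMn mulrCA; congr (_ * _).
rewrite -[(n%:R `^ r)^-1]powRN -powR_mulrn ?powR_ge0 // -powRrM -powRD ?(gt_eqF n0) ?implybT //.
by congr (_ `^ _); ring.
Unshelve. all: by end_near. Qed.

Lemma series_tail_le (u : nat -> R) (Cu g l : R) : 0 < g -> 0 <= Cu ->
  (forall k, (0 < k)%N -> u k <= Cu * k%:R `^ (- (1 + g))) -> series u @ \oo --> l ->
  forall m, (0 < m)%N -> l - series u m.+1 <= Cu / g * m%:R `^ (- g).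
Proof.
move=> g0 C0 ub ul m m0; rewrite lerBlDr.
rewrite -[leLHS](cvg_lim _ ul) //; apply: limr_le; first by apply/cvg_ex; exists l.
exists m.+1 => // M /= mM; rewrite /series /= [leLHS](big_cat_nat (n := m.+1)) //= addrC lerD2r.
apply: (@le_trans _ _ (\sum_(m.+1 <= k < M) Cu * k%:R `^ (- (1 + g)))).
  apply: ler_sum_nat => k /andP[k1 _]; apply: ub; exact: leq_ltn_trans k1.
rewrite -mulr_sumr -mulrA ler_wpM2l // mulrC; exact: sum_powRN_le.
Qed.

Lemma expR_le_quad (x : R) : `|x| <= 1 -> expR x <= 1 + x + 2 * x ^+ 2.
Proof.
rewrite ler_norml => /andP[x1 x2].
have [x0|x0] := leP x 0.
  have e1 : expR x * (1 - x) <= 1.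
    by rewrite -[leRHS](expR0) -(subrr x) expRD ler_pM2l ?expR_gt0 // expR_ge1Dx.
  have e2 : 0 < 1 - x by lra.
  rewrite -(ler_pM2r e2); apply: le_trans e1 _.
  have -> : (1 + x + 2 * x ^+ 2) * (1 - x) = 1 + x ^+ 2 * (1 - 2 * x) by ring.
  by rewrite lerDl mulr_ge0 ?sqr_ge0 //; lra.
have e1 : expR (x / 2) * (1 - x / 2) <= 1.
  have h := expR_ge1Dx (- (x / 2)).
  by rewrite -[leRHS](expR0) -(subrr (x / 2)) expRD ler_pM2l ?expR_gt0.
have e2 : 0 < 1 - x / 2 by lra.
have e3 : 0 < (1 - x / 2) ^+ 2 by exact: exprn_gt0.
have e4 : expR x * (1 - x / 2) ^+ 2 <= 1.
  have -> : expR x = expR (x / 2) ^+ 2 by rewrite -expRM_natl; congr expR; field.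
  by rewrite -exprMn -[leRHS](expr1n _ 2) ler_pXn2r ?nnegrE ?ler01 // mulr_ge0 ?expR_ge0 // ltW.
rewrite -(ler_pM2r e3); apply: le_trans e4 _.
have -> : (1 + x + 2 * x ^+ 2) * (1 - x / 2) ^+ 2 = 1 + x ^+ 2 * ((1 - x) * (5 / 2 - x)) / 2 by field.
by rewrite lerDl divr_ge0 // mulr_ge0 ?sqr_ge0 // mulr_ge0; lra.
Qed.

End PowerExp.

Section BigJump.
Variable R : realType.
Variables (q : nat -> R) (mu l al a : R).
Hypothesis q0 : forall k, 0 <= q k.
Hypothesis q1 : series q @ \oo --> (1 : R).
Hypothesis qmu : series (fun k => k%:R * q k) @ \oo --> mu.
Hypothesis al12 : 1 < al < 2.
Hypothesis a0 : 0 < a.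
Hypothesis qa : q k * k%:R `^ (1 + al) @[k --> \oo] --> a.
Hypothesis l01 : 0 < l < 1.
Hypothesis lmu : l * mu < 1.

Let l0 : 0 < l. Proof. by case/andP: l01. Qed.
Let al0 : 0 < al. Proof. by case/andP: al12 => h _; lra. Qed.
Let mu0 : 0 <= mu.
Proof. by have := sum_ord_le 0 (fun k => mulr_ge0 (ler0n _ k) (q0 k)) qmu; rewrite big_ord0. Qed.

Definition trunc_gf (L : nat) : {poly R} := \poly_(k < L.+1) q k.

(** Cutting at degree [n] keeps this a polynomial and does not affect coefficients of degree [n]. *)
Definition jump_gf (L n : nat) : {poly R} := \poly_(k < n.+1) (if (k <= L)%N then 0 else q k).

Lemma trunc_gf_ge0 L : poly_ge0 (trunc_gf L).
Proof. by move=> i; rewrite coef_poly; case: ifP. Qed.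

Lemma jump_gf_ge0 L n : poly_ge0 (jump_gf L n).
Proof. by move=> i; rewrite coef_poly; case: ifP => // _; case: ifP. Qed.

Lemma trunc_gf1 L : (trunc_gf L).[1] = series q L.+1.
Proof.
rewrite horner_poly /series /= big_mkord; apply: eq_bigr => i _.
by rewrite expr1n mulr1.
Qed.

Lemma gf_split L n : (L <= n)%N -> trunc_gf L + jump_gf L n = \poly_(k < n.+1) q k.
Proof.
move=> Ln; apply/polyP => i; rewrite coefD !coef_poly ltnS.
case: (leqP i L) => iL; last by rewrite add0r.
by rewrite (leq_ltn_trans iL) ?ltnS // addr0.
Qed.

Lemma jump_gf1 L n : (L <= n)%N -> (trunc_gf L).[1] + (jump_gf L n).[1] <= 1.
Proof.
move=> Ln; rewrite -hornerD gf_split // horner_poly.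
by under eq_bigr do rewrite expr1n mulr1; exact: sum_ord_le.
Qed.

Let law_bound : exists2 C : R, 0 < C & forall k, (0 < k)%N -> q k <= C * k%:R `^ (- (1 + al)).
Proof. exact: (law_bound qa). Qed.

(** Second-order expansion of the exponential, available as [|s| k <= 1] below the cut. The mean
    lost by truncation is [O(L ^ (1 - al))] and the truncated second moment [O(L ^ (2 - al))];
    weighted by [s] and [s ^ 2], both become [O(L ^ (- al))]. *)
Lemma trunc_laplace : exists2 C : R, 0 < C & forall L s, (0 < L)%N -> `|s| = L%:R^-1 ->
  (trunc_gf L).[expR s] <= expR (s * mu + C * L%:R `^ (- al)).
Proof.
have [al1 al2] := andP al12; have [Cq Cq0 hq] := law_bound.
have g1 : 0 < al - 1 by rewrite subr_gt0.
have g2 : 0 < 2 - al by rewrite subr_gt0.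
pose C1 := Cq / (al - 1); pose C2 := 2 * (Cq / (2 - al)).
have C10 : 0 < C1 by rewrite divr_gt0.
have C20 : 0 < C2 by rewrite mulr_gt0 // divr_gt0.
exists (C1 + C2); first by rewrite addr_gt0.
move=> L s L0 sL; have L0' : 0 < L%:R :> R by rewrite ltr0n.
have pw x y : L%:R `^ x * L%:R `^ y = L%:R `^ (x + y) :> R.
  by rewrite powRD // pnatr_eq0 -lt0n L0 implybT.
have h1 : (trunc_gf L).[expR s] <= \sum_(k < L.+1) q k * (1 + s * k%:R + 2 * (s * k%:R) ^+ 2).
  rewrite horner_poly; apply: ler_sum => k _; rewrite ler_wpM2l // -expRM_natl mulrC.
  apply: expR_le_quad; rewrite normrM sL ger0_norm // mulrC ler_pdivrMr // mul1r ler_nat.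
  by rewrite -ltnS.
apply: le_trans h1 _; apply: (@le_trans _ _ (1 + (s * mu + (C1 + C2) * L%:R `^ (- al)))); last exact: expR_ge1Dx.
have -> : \sum_(k < L.+1) q k * (1 + s * k%:R + 2 * (s * k%:R) ^+ 2) =
   \sum_(k < L.+1) q k + s * (\sum_(k < L.+1) k%:R * q k) + 2 * s ^+ 2 * (\sum_(k < L.+1) k%:R ^+ 2 * q k).
  by rewrite !mulr_sumr -!big_split /=; apply: eq_bigr => k _; ring.
rewrite -addrA; apply: lerD; first exact: sum_ord_le.
rewrite [X in _ <= _ + X]mulrDl [leRHS]addrA; apply: lerD.
  rewrite -lerBlDl -mulrBr; apply: le_trans (ler_norm _) _.
  rewrite normrM sL -normrN opprB ger0_norm; last first.
    rewrite subr_ge0; exact: (sum_ord_le L.+1 (fun k => mulr_ge0 (ler0n R k) (q0 k)) qmu).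
  have h := @series_tail_le R (fun k => k%:R * q k) Cq (al - 1) mu g1 (ltW Cq0) _ qmu L L0.
  rewrite -(big_mkord xpredT (fun k => k%:R * q k)) -powR_inv1 ?ler0n //.
  apply: (@le_trans _ _ (L%:R `^ (- 1) * (C1 * L%:R `^ (- (al - 1))))).
    rewrite ler_wpM2l ?powR_ge0 //; apply: h => k k0.
    have k0' : 0 < k%:R :> R by rewrite ltr0n.
    have := hq k k0; rewrite -(ler_pM2l k0'); move/le_trans; apply.
    rewrite mulrCA ler_pM2l // -[X in X * _](powRr1 (ltW k0')) -powRD ?(gt_eqF k0') ?implybT //.
    by rewrite le_eqVlt; apply/orP; left; apply/eqP; congr (_ `^ _); ring.
  rewrite mulrCA pw ler_pM2l // le_eqVlt; apply/orP; left; apply/eqP; congr (_ `^ _); ring.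
have s2 : s ^+ 2 = L%:R `^ (- 2) by rewrite -real_normK ?num_real // sL powRN powR_mulrn ?ler0n // exprVn.
have h : \sum_(k < L.+1) k%:R ^+ 2 * q k <= Cq / (2 - al) * L%:R `^ (2 - al).
  rewrite -(big_mkord xpredT (fun k => k%:R ^+ 2 * q k)) big_ltn //= expr0n mul0r add0r.
  apply: (@le_trans _ _ (\sum_(1 <= k < L.+1) Cq * k%:R `^ ((2 - al) - 1))).
    apply: ler_sum_nat => k /andP[k0 _].
    have k0' : 0 < k%:R :> R by rewrite ltr0n.
    have k2 : 0 < k%:R ^+ 2 :> R by exact: exprn_gt0.
    apply: (le_trans (ler_wpM2l (ltW k2) (hq k k0))).
    rewrite mulrCA ler_pM2l // -(powR_mulrn 2 (ltW k0')) -powRD ?(gt_eqF k0') ?implybT //.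
    by rewrite le_eqVlt; apply/orP; left; apply/eqP; congr (_ `^ _); ring.
  have a2' : 0 < 2 - al <= 1 by rewrite g2; lra.
  rewrite -mulr_sumr -mulrA ler_pM2l // mulrC; exact: sum_powR_le.
rewrite s2; apply: (@le_trans _ _ (2 * L%:R `^ (- 2) * (Cq / (2 - al) * L%:R `^ (2 - al)))).
  by rewrite ler_wpM2l ?mulr_ge0 ?powR_ge0.
have -> : 2 * L%:R `^ (- 2) * (Cq / (2 - al) * L%:R `^ (2 - al)) = C2 * (L%:R `^ (- 2) * L%:R `^ (2 - al)).
  by rewrite /C2; ring.
rewrite pw ler_pM2l // le_eqVlt; apply/orP; left; apply/eqP; congr (_ `^ _); ring.
Qed.

(** [th] is the exponent of the truncation level. Two jumps are negligible when
    [th (1 + 2 al) > 2 + al], that is [th > th0]; [th al > 1] makes [n L ^ (- al)] tend to 0;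
    [th < 1] makes [n / L] grow like a power of [n]. Since [al > 1], [th0 < 1], and [th] is the
    midpoint between [th0] and 1. *)
Let th0 := (2 + al) / (1 + 2 * al).
Let th := (1 + th0) / 2.

Let th_bounds : [/\ 0 < th, th < 1, 1 < th * al & 2 + al < th * (1 + 2 * al)].
Proof.
have [al1 al2] := andP al12.
have d0 : 0 < 1 + 2 * al by lra.
have t1 : th0 < 1 by rewrite /th0 ltr_pdivrMr //; lra.
have t0 : 0 < th0 by rewrite /th0 divr_gt0 //; lra.
have t2 : 1 < th0 * al.
  rewrite /th0 mulrAC ltr_pdivlMr // mul1r; nra.
have t3 : th0 * (1 + 2 * al) = 2 + al by rewrite /th0 divfK // gt_eqF.
have tt : th0 < th by rewrite /th; lra.
split; [by rewrite /th; lra|by rewrite /th; lra| |].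
  by apply: lt_trans t2 _; rewrite ltr_pM2r.
by rewrite -t3 ltr_pM2r.
Qed.

Let L n := (Num.truncn (n%:R `^ th : R)).+1.
Let N n := Num.truncn (l * n%:R).

Let L_bounds n : (0 < n)%N -> n%:R `^ th <= (L n)%:R <= 2 * (n%:R `^ th : R).
Proof.
move=> n0; have [t0 _ _ _] := th_bounds.
have p1 : 1 <= n%:R `^ th :> R.
  have n1 : 1 <= n%:R :> R by rewrite ler1n.
  have : 1 `^ th <= n%:R `^ th :> R by rewrite ge0_ler_powR ?nnegrE // ltW.
  by rewrite powR1.
rewrite (ltW (truncnS_gt _)) /= /L -natr1.
have : (Num.truncn (n%:R `^ th : R))%:R <= n%:R `^ th :> R by rewrite truncn_le powR_ge0.
lra.
Qed.

Let L_al n : (0 < n)%N -> (L n)%:R `^ (- al) <= n%:R `^ (- (th * al)) :> R.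
Proof.
move=> n0; have /andP[h _] := L_bounds n0; have n0' : 0 < n%:R :> R by rewrite ltr0n.
have -> : - (th * al) = th * - al by ring.
rewrite powRrM !powRN lef_pV2 ?posrE ?powR_gt0 ?ltr0n // ge0_ler_powR ?nnegrE ?powR_ge0 // ltW //.
Qed.

(* Two-sided exponential moments at scale [L n] of the truncated sums around
   their mean stay bounded. *)
Let laplace_const : exists2 K : R, 0 < K & forall n M s, (0 < n)%N -> (M <= n)%N ->
  `|M%:R - l * n%:R| <= 2 -> `|s| = (L n)%:R^-1 ->
  (trunc_gf (L n) ^+ M).[expR s] <= K * expR (s * (l * mu * n%:R)).
Proof.
have [_ _ t1 _] := th_bounds.
have [C C0 hC] := trunc_laplace.
exists (expR (2 * mu + C)); first exact: expR_gt0.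
move=> n M s n0 Mn Ml sL; have n0' : 0 < n%:R :> R by rewrite ltr0n.
have Ln0 : (0 < L n)%N by [].
rewrite horner_exp -expRD; apply: (@le_trans _ _ (expR (s * mu + C * (L n)%:R `^ (- al)) ^+ M)).
  rewrite lerXn2r ?nnegrE ?expR_ge0 ?hC //.
  by apply: poly_ge0_horner; [exact: trunc_gf_ge0|exact: expR_ge0].
rewrite -expRM_natl ler_expR.
have -> : M%:R * (s * mu + C * (L n)%:R `^ (- al)) =
   s * (l * mu * n%:R) + (s * (M%:R - l * n%:R) * mu + C * (M%:R * (L n)%:R `^ (- al))) by ring.
rewrite [leRHS]addrC lerD2l; apply: lerD.
  rewrite ler_wpM2r //; apply: le_trans (ler_norm _) _; rewrite normrM sL.
  have : (L n)%:R^-1 <= 1 :> R by rewrite invf_le1 ?ltr0n // ler1n.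
  by move=> h; rewrite -[leRHS]mul1r; apply: ler_pM; rewrite ?invr_ge0.
rewrite -[leRHS]mulr1 ler_pM2l //.
apply: (@le_trans _ _ (n%:R * n%:R `^ (- (th * al)))).
  by apply: ler_pM; rewrite ?powR_ge0 ?ler_nat ?L_al.
rewrite -[X in X * _](powRr1 (ltW n0')) -powRD ?(gt_eqF n0') ?implybT // -[leRHS](powRr0 n%:R).
by apply: ler_powR; [rewrite ler1n|lra].
Qed.

(** [y * n] is the distance left to the jump, and [T] is the limit of [n ^ (1 + al) * q k] when [k]
    is equivalent to [y * n]. *)
Let y := 1 - l * mu.
Let y0 : 0 < y. Proof. by rewrite subr_gt0. Qed.
Let T := a * y `^ (- (1 + al)).
Let T0 : 0 < T. Proof. by rewrite mulr_gt0 ?powR_gt0. Qed.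

Let N_le n : (N n <= n)%N.
Proof.
rewrite -(ler_nat R); apply: (@le_trans _ _ (l * n%:R)); first by case/andP: (truncn_bounds l01 n).
by rewrite ler_piMl //; case/andP: l01 => _ /ltW.
Qed.

Let exp_scale n c : (0 < n)%N -> 0 <= c ->
  expR (- (c * n%:R / (L n)%:R)) <= expR (- (c / 2 * n%:R `^ (1 - th))).
Proof.
move=> n0 c0; have n0' : 0 < n%:R :> R by rewrite ltr0n.
have /andP[_ h] := L_bounds n0; rewrite ler_expR lerN2 -!mulrA ler_wpM2l //.
rewrite ler_pdivlMr ?ltr0n // -ler_pdivlMl ?mulr_gt0 ?invr_gt0 ?powR_gt0 //.
apply: le_trans h _; rewrite le_eqVlt; apply/orP; left; apply/eqP.
have -> : n%:R `^ th = n%:R / n%:R `^ (1 - th) :> R.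
  rewrite -{2}(powRr1 (ltW n0')) -powRN -powRD ?(gt_eqF n0') ?implybT //; congr (_ `^ _); ring.
by rewrite invfM invrK; ring.
Qed.

Let L_le : \forall n \near \oo, (L n <= n)%N.
Proof.
have [_ t1 _ _] := th_bounds; have r0 : 0 < 1 - th by rewrite subr_gt0.
have big : \forall n \near \oo, 2 <= n%:R `^ (1 - th) :> R by move/cvgryPge : (cvg_powRy r0); apply.
near=> n; have n0 : (0 < n)%N by near: n; exists 1%N.
have n0' : 0 < n%:R :> R by rewrite ltr0n.
have /andP[_ h] := L_bounds n0; rewrite -(ler_nat R); apply: le_trans h _.
have e : n%:R = n%:R `^ (1 - th) * n%:R `^ th :> R.
  by rewrite -powRD ?(gt_eqF n0') ?implybT // subrK powRr1 // ltW.
rewrite [leRHS]e ler_pM2r ?powR_gt0 //; near: n; exact: big.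
Unshelve. all: by end_near. Qed.

Let N_gt0 : \forall n \near \oo, (0 < N n)%N.
Proof.
near=> n; rewrite -(ltr0n R); have /andP[b1 _] := truncn_bounds l01 n; apply: le_lt_trans b1.
rewrite subr_ge0 -ler_pdivrMl // mulr1; near: n; exact: nbhs_infty_ger.
Unshelve. all: by end_near. Qed.

(** Chernoff bound at [s = 1 / L]: the mean falls short of [n] by [y n], so the coefficient is at
    most a constant times [exp (- y n / L)], where [n / L] is of order [n ^ (1 - th)]. *)
Let zero_jump_cvg : (trunc_gf (L n) ^+ N n)`_n * n%:R `^ al @[n --> \oo] --> (0 : R).
Proof.
have [_ t1 _ _] := th_bounds; have [K K0 hK] := laplace_const.
have r0 : 0 < 1 - th by rewrite subr_gt0.
have c0 : 0 < y / 2 by rewrite divr_gt0.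
have h : K * (n%:R `^ al * expR (- (y / 2 * n%:R `^ (1 - th)))) @[n --> \oo] --> K * (0 : R).
  by apply: cvgMr; exact: cvg_powR_exp.
rewrite mulr0 in h.
apply: (squeeze_cvgr _ (cvg_cst _) h); near=> n.
have n0 : (0 < n)%N by near: n; exists 1%N.
have ge0 : 0 <= (trunc_gf (L n) ^+ N n)`_n by apply: poly_ge0X; exact: trunc_gf_ge0.
rewrite mulr_ge0 ?powR_ge0 //= mulrC mulrCA ler_wpM2l ?powR_ge0 //.
pose s : R := (L n)%:R^-1.
have sN : `|s| = (L n)%:R^-1 by rewrite ger0_norm // invr_ge0.
have /andP[b1 b2] := truncn_bounds l01 n; rewrite -/(N n) in b1 b2.
have b3 : `|(N n)%:R - l * n%:R| <= 2 by rewrite ler_norml; lra.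
have h1 := hK n (N n) s n0 (N_le n) b3 sN.
have h2 := poly_ge0_coef_le n (poly_ge0X (N n) (trunc_gf_ge0 (L n))) (expR_ge0 s).
have h3 := le_trans h2 h1.
rewrite -expRM_natl in h3.
have h4 : (trunc_gf (L n) ^+ N n)`_n <= K * expR (- (y * n%:R / (L n)%:R)).
  rewrite -(ler_pM2r (expR_gt0 (n%:R * s))); apply: le_trans h3 _.
  rewrite -[leRHS]mulrA ler_pM2l // -expRD ler_expR le_eqVlt; apply/orP; left; apply/eqP.
  by rewrite /s /y; ring.
apply: le_trans h4 _; rewrite ler_pM2l //; exact: exp_scale n0 (ltW y0).
Unshelve. all: by end_near. Qed.

(** One jump is bounded by its largest weight, of order [L ^ (- 1 - al)], another by its total mass,
    of order [L ^ (- al)], and [g] by its value at 1, at most [n ^ 2]. *)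
Let multi_jump_cvg (g : nat -> {poly R}) : (forall n, poly_ge0 (g n)) ->
  (forall n, (0 < N n)%N -> (g n).[1] <= (N n)%:R ^+ 2) ->
  (jump_gf (L n) n * jump_gf (L n) n * g n)`_n * n%:R `^ al @[n --> \oo] --> (0 : R).
Proof.
move=> g0 g1; have [_ t1 _ t3] := th_bounds; have [Cq Cq0 hq] := law_bound.
pose C := Cq * (Cq / al); have C0 : 0 < C by rewrite mulr_gt0 // divr_gt0.
have h : C * n%:R `^ (- (th * (1 + 2 * al) - (2 + al))) @[n --> \oo] --> C * 0.
  by apply: cvgMr; apply: cvg_powRN0; rewrite subr_gt0.
rewrite mulr0 in h; apply: (squeeze_cvgr _ (cvg_cst _) h); near=> n.
have n0 : (0 < n)%N by near: n; exists 1%N.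
have n0' : 0 < n%:R :> R by rewrite ltr0n.
have Ln : (L n <= n)%N by near: n; exact: L_le.
have N0 : (0 < N n)%N by near: n; exact: N_gt0.
have B0 := jump_gf_ge0 (L n) n.
have ge0 : 0 <= (jump_gf (L n) n * jump_gf (L n) n * g n)`_n.
  by apply: poly_ge0M => //; exact: poly_ge0M.
rewrite mulr_ge0 ?powR_ge0 //=.
have L0' : 0 < (L n)%:R :> R by rewrite ltr0n.
have Bc i : (jump_gf (L n) n)`_i <= Cq * (L n)%:R `^ (- (1 + al)).
  rewrite coef_poly; case: ifP => _; last by rewrite mulr_ge0 ?powR_ge0 // ltW.
  case: (leqP i (L n)) => iL; first by rewrite mulr_ge0 ?powR_ge0 // ltW.
  have i0 : (0 < i)%N by exact: leq_ltn_trans iL.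
  apply: le_trans (hq i i0) _; rewrite ler_pM2l // !powRN lef_pV2 ?posrE ?powR_gt0 ?ltr0n //.
  rewrite ge0_ler_powR ?nnegrE ?ler_nat // ?(ltnW iL) //; have := al0; lra.
have B1 : (jump_gf (L n) n).[1] <= Cq / al * (L n)%:R `^ (- al).
  have := jump_gf1 Ln; rewrite trunc_gf1 => h1.
  have h2 := series_tail_le al0 (ltW Cq0) hq q1 (isT : (0 < L n)%N); lra.
have B1' : 0 <= (jump_gf (L n) n).[1] by apply: poly_ge0_horner.
have G1' : 0 <= (g n).[1] by apply: poly_ge0_horner.
have G1 : (g n).[1] <= n%:R ^+ 2.
  apply: le_trans (g1 n N0) _; rewrite lerXn2r ?nnegrE // ler_nat; exact: N_le.
rewrite -mulrA; apply: (@le_trans _ _ (Cq * (L n)%:R `^ (- (1 + al)) * (Cq / al * (L n)%:R `^ (- al) * n%:R ^+ 2) * n%:R `^ al)).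
  rewrite ler_wpM2r ?powR_ge0 //.
  apply: le_trans (poly_ge0_coefM_le n B0 (poly_ge0M B0 (g0 n)) Bc) _.
  rewrite ler_wpM2l ?mulr_ge0 ?powR_ge0 ?(ltW Cq0) // hornerM; exact: ler_pM.
have -> : Cq * (L n)%:R `^ (- (1 + al)) * (Cq / al * (L n)%:R `^ (- al) * n%:R ^+ 2) * n%:R `^ al =
   C * ((L n)%:R `^ (- (1 + al)) * (L n)%:R `^ (- al) * (n%:R ^+ 2 * n%:R `^ al)) by rewrite /C; ring.
rewrite ler_pM2l // -powRD ?(gt_eqF L0') ?implybT //.
rewrite -(powR_mulrn 2 (ltW n0')) -powRD ?(gt_eqF n0') ?implybT //.
have -> : - (1 + al) + - al = - (1 + 2 * al) by ring.
have e : (L n)%:R `^ (- (1 + 2 * al)) <= n%:R `^ (th * - (1 + 2 * al)) :> R.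
  have /andP[hL _] := L_bounds n0.
  rewrite powRrM !powRN lef_pV2 ?posrE ?powR_gt0 ?ltr0n // ge0_ler_powR ?nnegrE ?powR_ge0 //.
  by have := al0; lra.
apply: le_trans (ler_wpM2r (powR_ge0 _ _) e) _.
rewrite -powRD ?(gt_eqF n0') ?implybT // le_eqVlt; apply/orP; left; apply/eqP.
by congr (_ `^ _); ring.
Unshelve. all: by end_near. Qed.

(** Regular variation of [q], made uniform over a neighbourhood of [y * n] of linear size. *)
Let jump_regular eta : 0 < eta -> exists2 ep : R, 0 < ep <= y / 2 & exists m0, forall n m : nat,
  (0 < n)%N -> (m0 <= m)%N -> `|m%:R - y * n%:R| <= ep * n%:R -> `|n%:R `^ (1 + al) * q m - T| <= eta.
Proof.
move=> eta0; pose G (u : R) := u `^ (- (1 + al)).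
pose e1 := Num.min 1 (eta / (2 * a)); have e10 : 0 < e1 by rewrite lt_min ltr01 divr_gt0 // mulr_gt0.
pose e2 := eta / (2 * (G y + 1)); have Gy : 0 < G y by exact: powR_gt0.
have e20 : 0 < e2 by rewrite divr_gt0 // mulr_gt0 // addr_gt0.
have cG : G u @[u --> y] --> G y by apply: cvg_powR => //; exact: cvg_id.
have : \forall u \near y, `|G y - G u| <= e1 by move/cvgrPdist_le : cG; apply.
move=> /nbhs_ballP[d /= d0 hd].
have [m0 _ hm0] : \forall m \near \oo, `|a - q m * m%:R `^ (1 + al)| <= e2.
  by move/cvgrPdist_le : qa; apply.
exists (Num.min (d / 2) (y / 2)); first by rewrite lt_min !divr_gt0 //= ge_min lexx orbT.
exists m0 => n m n0 mm0; have n0' : 0 < n%:R :> R by rewrite ltr0n.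
set ep := Num.min _ _ => hm.
have epd : ep <= d / 2 by rewrite ge_min lexx.
have epy : ep <= y / 2 by rewrite ge_min lexx orbT.
pose u : R := m%:R / n%:R.
have mu' : m%:R = u * n%:R by rewrite /u divfK // gt_eqF.
have uy : `|u - y| <= ep.
  by rewrite -(ler_pM2r n0') -[X in _ * X <= _](gtr0_norm n0') -normrM mulrBl -mu'.
have u0 : 0 < u by move: uy; rewrite ler_norml => /andP[v1 v2]; have := y0; lra.
have m0' : 0 < m%:R :> R by rewrite mu' mulr_gt0.
have hG : `|G y - G u| <= e1.
  apply: hd; rewrite /ball /= distrC; apply: le_lt_trans uy _; apply: le_lt_trans epd _.
  by rewrite ltr_pdivrMr // ltr_pMr // ltr1n.
have ha := hm0 m mm0.
pose am := q m * m%:R `^ (1 + al).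
have E : n%:R `^ (1 + al) * q m = am * G u.
  rewrite /am /G mu' powRM ?(ltW u0) ?ler0n // powRN; field.
  by rewrite gt_eqF // powR_gt0.
have -> : n%:R `^ (1 + al) * q m - T = - ((a - am) * G u + a * (G y - G u)).
  by rewrite E /T -/(G y); ring.
rewrite normrN; apply: le_trans (ler_normD _ _) _; rewrite !normrM (gtr0_norm a0).
have Gu : `|G u| <= G y + 1.
  rewrite ger0_norm ?powR_ge0 //; have : e1 <= 1 by rewrite ge_min lexx.
  by move: hG; rewrite ler_norml => /andP[v1 v2]; lra.
have h1 : `|a - am| * `|G u| <= e2 * (G y + 1) by apply: ler_pM.
have h2 : a * `|G y - G u| <= a * (eta / (2 * a)).
  by rewrite ler_pM2l //; apply: le_trans hG _; rewrite ge_min lexx orbT.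
have k1 : e2 * (G y + 1) = eta / 2 by rewrite /e2; field; rewrite gt_eqF // addr_gt0.
have k2 : a * (eta / (2 * a)) = eta / 2 by field; rewrite gt_eqF.
by move: h1 h2; rewrite k1 k2; lra.
Qed.

Let near_index n (j : nat) ep : 0 < ep <= y / 2 -> (0 < n)%N ->
  `|j%:R - l * mu * n%:R| <= ep * n%:R -> (j <= n)%N /\ y / 2 * n%:R <= n%:R - j%:R.
Proof.
move=> /andP[ep0 epy] n0; have n0' : 0 < n%:R :> R by rewrite ltr0n.
have -> : l * mu = 1 - y by rewrite /y; ring.
rewrite ler_norml => /andP[_ v2].
have h : ep * n%:R <= y / 2 * n%:R by rewrite ler_pM2r.
have jn : j%:R <= (1 - y / 2) * n%:R by lra.
split; last by lra.
by rewrite -(ler_nat R); apply: le_trans jn _; rewrite ler_piMl // gerBl divr_ge0 // ltW.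
Qed.

Let bernoulli_le (z : R) k : 0 <= z <= 1 -> 1 - k%:R * (1 - z) <= z ^+ k.
Proof.
move=> /andP[z0 z1]; elim: k => [|k IH]; first by rewrite expr0 mul0r subr0.
rewrite exprS -natr1; have e1 : z ^+ k <= 1 by exact: exprn_ile1.
have e2 : (1 - z) * z ^+ k <= 1 - z by rewrite ler_piMr // subr_ge0.
rewrite mulrDl mul1r; move: IH e2; rewrite mulrBl mul1r; lra.
Qed.

Let N_pred n : (0 < N n)%N -> `|(N n).-1%:R - l * n%:R| <= 2.
Proof.
move=> N0; have /andP[b1 b2] := truncn_bounds l01 n; rewrite -/(N n) in b1 b2.
have -> : (N n).-1%:R = (N n)%:R - 1 :> R by rewrite -[in RHS](prednK N0) -natr1 addrK.
by rewrite ler_norml; lra.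
Qed.

(** The coefficient is an average of [phi j], the rescaled weight of a jump [n - j], over the sum
    [j] of the other, truncated steps. Near the mean, [phi] is close to [T]; far from it,
    exponential moments beat the bound [n ^ (1 + al)]. The truncated steps keep a mass tending to 1
    because [n L ^ (- al)] vanishes. *)
Let single_jump_cvg :
  n%:R `^ (1 + al) * (jump_gf (L n) n * trunc_gf (L n) ^+ (N n).-1)`_n @[n --> \oo] --> T.
Proof.
have [t0 t1 t2 _] := th_bounds; have [K K0 hK] := laplace_const; have [Cq Cq0 hq] := law_bound.
have r0 : 0 < 1 - th by rewrite subr_gt0.
apply/cvgrPdist_le => eta3 eta30; pose eta := eta3 / 3; have eta0 : 0 < eta by rewrite divr_gt0.
have eta3E : eta + eta + eta = eta3 by rewrite /eta; field.
have [ep /andP[ep0 epy] [m0 hm0]] := jump_regular eta0.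
have c0 : 0 < ep / 2 by rewrite divr_gt0.
have far : \forall n \near \oo, 2 * K * (n%:R `^ (1 + al) + T) * expR (- (ep / 2 * n%:R `^ (1 - th))) <= eta.
  have h : 2 * K * (n%:R `^ (1 + al) * expR (- (ep / 2 * n%:R `^ (1 - th))) +
      T * (n%:R `^ 0 * expR (- (ep / 2 * n%:R `^ (1 - th))))) @[n --> \oo] --> 2 * K * (0 + T * (0 : R)).
    by apply: cvgMr; apply: cvgD; [|apply: cvgMr]; exact: cvg_powR_exp.
  rewrite mulr0 addr0 mulr0 in h; have /cvgrPdist_le/(_ _ eta0) := h; apply: filterS => n.
  rewrite sub0r normrN => hh; apply: le_trans hh; apply: le_trans (ler_norm _).
  by rewrite le_eqVlt; apply/orP; left; apply/eqP; rewrite powRr0; ring.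
have mass : \forall n \near \oo, T * (Cq / al) * n%:R `^ (- (th * al - 1)) <= eta.
  have h : T * (Cq / al) * n%:R `^ (- (th * al - 1)) @[n --> \oo] --> T * (Cq / al) * (0 : R).
    by apply: cvgMr; apply: cvg_powRN0; rewrite subr_gt0.
  rewrite mulr0 in h; have /cvgrPdist_le/(_ _ eta0) := h; apply: filterS => n.
  by rewrite sub0r normrN => hh; apply: le_trans hh; exact: ler_norm.
have big : \forall n \near \oo, 6 / y <= n%:R `^ (1 - th) :> R by move/cvgryPge : (cvg_powRy r0); apply.
near=> n.
have n0 : (0 < n)%N by near: n; exists 1%N.
have n0' : 0 < n%:R :> R by rewrite ltr0n.
have N0 : (0 < N n)%N by near: n; exact: N_gt0.
have massn : T * (Cq / al) * n%:R `^ (- (th * al - 1)) <= eta by near: n.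
have bign : 6 / y <= n%:R `^ (1 - th) :> R by near: n.
have farn' : 2 * K * (n%:R `^ (1 + al) + T) * expR (- (ep / 2 * n%:R `^ (1 - th))) <= eta by near: n.
have ym0 : m0%:R <= y / 2 * n%:R.
  by rewrite -ler_pdivrMl ?divr_gt0 //; near: n; exact: nbhs_infty_ger.
have yL : (L n)%:R < y / 2 * n%:R.
  have /andP[_ h] := L_bounds n0; apply: le_lt_trans h _.
  have e : n%:R = n%:R `^ th * n%:R `^ (1 - th) :> R.
    by rewrite -powRD ?(gt_eqF n0') ?implybT // addrC subrK powRr1 // ltW.
  rewrite [X in _ < _ * X]e mulrCA [ltLHS]mulrC ltr_pM2l ?powR_gt0 //.
  rewrite -ltr_pdivrMl ?divr_gt0 // invf_div; apply: lt_le_trans bign.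
  by rewrite mulrAC -natrM ltr_pM2r ?invr_gt0 // ltr_nat.
pose M := (N n).-1; pose A := trunc_gf (L n); pose B := jump_gf (L n) n.
have Mn : (M <= n)%N by apply: leq_trans (leq_pred _) (N_le n).
have b3 : `|M%:R - l * n%:R| <= 2 by exact: N_pred.
have AM0 : poly_ge0 (A ^+ M) by apply: poly_ge0X; exact: trunc_gf_ge0.
pose W := maxn (size (A ^+ M)) n.+1.
pose phi j : R := if (j <= n)%N then n%:R `^ (1 + al) * B`_(n - j) else 0.
have E : n%:R `^ (1 + al) * (B * A ^+ M)`_n = \sum_(0 <= j < W) (A ^+ M)`_j * phi j.
  rewrite coefMr [RHS](big_cat_nat (n := n.+1)) ?leq_maxr //= [X in _ = _ + X]big_nat_cond [X in _ = _ + X]big1 ?addr0; last first.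
    by move=> j /andP[/andP[h _] _]; rewrite /phi leqNgt h mulr0.
  rewrite big_mkord mulr_sumr; apply: eq_bigr => j _.
  by rewrite /phi -ltnS ltn_ord; ring.
have lap s : `|s| = (L n)%:R^-1 -> \sum_(0 <= j < W) (A ^+ M)`_j * expR (s * (j%:R - l * mu * n%:R)) <= K.
  move=> sL; have := hK n M s n0 Mn b3 sL.
  rewrite -/A (@horner_coef_wide _ W) ?leq_maxl // => h.
  rewrite -(ler_pM2r (expR_gt0 (s * (l * mu * n%:R)))); apply: le_trans h.
  rewrite big_mkord mulr_suml le_eqVlt; apply/orP; left; apply/eqP; apply: eq_bigr => j _.
  rewrite -[LHS]mulrA -expRD -expRM_natl; congr (_ * expR _); ring.
have q_le1 k : q k <= 1.
  have := nnseries_le k.+1 q0 q1; rewrite seriesSr; apply: le_trans; rewrite lerDr.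
  by rewrite /series /= sumr_ge0.
pose s : R := (L n)%:R^-1; have s0 : 0 < s by rewrite invr_gt0 ltr0n.
(* [br j] exceeds [exp (ep n s)] when [j] is farther than [ep n] from the mean, on either side.
   After rescaling it dominates the indicator of a large deviation. *)
pose br j : R := expR (s * (j%:R - l * mu * n%:R)) + expR (- s * (j%:R - l * mu * n%:R)).
have pw j : `|phi j - T| <= eta + (n%:R `^ (1 + al) + T) * expR (- (ep * n%:R * s)) * br j.
  have nT : 0 <= n%:R `^ (1 + al) + T by rewrite addr_ge0 ?powR_ge0 // ltW.
  have [nr|fr] := leP `|j%:R - l * mu * n%:R| (ep * n%:R).
    have v : 0 <= (n%:R `^ (1 + al) + T) * expR (- (ep * n%:R * s)) * br j.
      by apply: mulr_ge0; [rewrite mulr_ge0 ?expR_ge0|rewrite addr_ge0 ?expR_ge0].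
    rewrite -[leLHS]addr0; apply: lerD v => //.
    have [|jn' jy] := near_index _ n0 nr; first by rewrite ep0.
    have mE : (n - j)%:R = n%:R - j%:R :> R by rewrite natrB.
    have mL : (L n < n - j)%N by rewrite -(ltr_nat R) mE; exact: lt_le_trans yL jy.
    rewrite /phi jn' coef_poly ltnS leq_subr.
    rewrite leqNgt mL /=; apply: hm0 => //.
      by rewrite -(ler_nat R) mE; exact: le_trans ym0 jy.
    rewrite mE distrC; move: nr; rewrite (_ : y * n%:R - (n%:R - j%:R) = j%:R - l * mu * n%:R) //.
    by rewrite /y; ring.
  have p1 : 0 <= phi j <= n%:R `^ (1 + al).
    rewrite /phi; case: ifP => _; last by rewrite lexx powR_ge0.
    rewrite mulr_ge0 ?powR_ge0 //=; last exact: jump_gf_ge0.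
    rewrite ler_piMr ?powR_ge0 // coef_poly; case: ifP => _ //; case: ifP => _ //.
  have b1' : 1 <= expR (- (ep * n%:R * s)) * br j.
    rewrite /br mulrDr -!expRD.
    have [w0|w0] := leP 0 (j%:R - l * mu * n%:R).
      rewrite ger0_norm // in fr.
      apply: (@le_trans _ _ (expR (- (ep * n%:R * s) + s * (j%:R - l * mu * n%:R)))); last by rewrite lerDl expR_ge0.
      rewrite -[leLHS]expR0 ler_expR addrC subr_ge0 [leRHS]mulrC ler_pM2r // ltW //.
    rewrite ltr0_norm // in fr.
    apply: (@le_trans _ _ (expR (- (ep * n%:R * s) + - s * (j%:R - l * mu * n%:R)))); last by rewrite lerDr expR_ge0.
    rewrite -[leLHS]expR0 ler_expR addrC subr_ge0 mulNr -mulrN [leRHS]mulrC ler_pM2r // ltW //.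
  have h1 : `|phi j - T| <= n%:R `^ (1 + al) + T.
    have /andP[p11 p12] := p1; apply: le_trans (ler_normB _ _) _.
    by rewrite (ger0_norm p11) (gtr0_norm T0) lerD2r.
  apply: le_trans h1 _; rewrite -mulrA; apply: ler_wpDl; first exact: ltW.
  by rewrite -[leLHS]mulr1 ler_wpM2l.
have A1 : (A ^+ M).[1] <= 1.
  rewrite horner_exp exprn_ile1 ?trunc_gf1 //; last exact: nnseries_le.
  by rewrite /series /= sumr_ge0.
have AW : \sum_(0 <= j < W) (A ^+ M)`_j = (A ^+ M).[1].
  rewrite (@horner_coef_wide _ W) ?leq_maxl // big_mkord; apply: eq_bigr => j _.
  by rewrite expr1n mulr1.
have A1' : 1 - M%:R * (Cq / al * (L n)%:R `^ (- al)) <= (A ^+ M).[1].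
  have h2 := series_tail_le al0 (ltW Cq0) hq q1 (isT : (0 < L n)%N).
  rewrite horner_exp trunc_gf1; move: h2; set z := series q _; set x := Cq / al * _ => h2.
  have z1 : z <= 1 by exact: nnseries_le.
  have z0 : 0 <= z by rewrite /z /series /= sumr_ge0.
  apply: le_trans (bernoulli_le M (introT andP (conj z0 z1))).
  by rewrite lerD2l lerN2 ler_wpM2l // lerBlDl -lerBlDr.
rewrite distrC E; have -> : \sum_(0 <= j < W) (A ^+ M)`_j * phi j - T =
   \sum_(0 <= j < W) (A ^+ M)`_j * (phi j - T) - T * (1 - (A ^+ M).[1]).
  have -> : \sum_(0 <= j < W) (A ^+ M)`_j * (phi j - T) = \sum_(0 <= j < W) (A ^+ M)`_j * phi j - (A ^+ M).[1] * T.
    by rewrite -AW mulr_suml -sumrB; apply: eq_bigr => j _; rewrite mulrBr.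
  ring.
apply: le_trans (ler_normB _ _) _.
have first : `|\sum_(0 <= j < W) (A ^+ M)`_j * (phi j - T)| <= eta + eta.
  apply: le_trans (ler_norm_sum _ _ _) _.
  apply: (@le_trans _ _ (\sum_(0 <= j < W) (A ^+ M)`_j * (eta + (n%:R `^ (1 + al) + T) * expR (- (ep * n%:R * s)) * br j))).
    by apply: ler_sum => j _; rewrite normrM ger0_norm // ler_wpM2l.
  rewrite (eq_bigr (fun j => (A ^+ M)`_j * eta + (n%:R `^ (1 + al) + T) * expR (- (ep * n%:R * s)) * ((A ^+ M)`_j * br j))); last first.
    by move=> j _; rewrite mulrDr; congr (_ + _); rewrite mulrCA.
  rewrite big_split /= -mulr_suml AW -mulr_sumr; apply: lerD.
    by rewrite ler_piMl // ltW.
  have brK : \sum_(0 <= j < W) (A ^+ M)`_j * br j <= 2 * K.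
    under eq_bigr do rewrite mulrDr.
    rewrite big_split /= mulr2n mulrDl mul1r; apply: lerD; apply: lap.
      by rewrite gtr0_norm.
    by rewrite normrN gtr0_norm.
  have nT : 0 <= n%:R `^ (1 + al) + T by rewrite addr_ge0 ?powR_ge0 // ltW.
  apply: le_trans farn'; rewrite -[leRHS]mulrA [leRHS]mulrC; apply: ler_pM => //.
  - by rewrite mulr_ge0 ?expR_ge0.
  - by apply: sumr_ge0 => j _; rewrite mulr_ge0 // addr_ge0 ?expR_ge0.
  by rewrite ler_wpM2l //; exact: exp_scale n0 (ltW ep0).
have second : `|T * (1 - (A ^+ M).[1])| <= eta.
  rewrite ger0_norm; last by rewrite mulr_ge0 ?subr_ge0 // ltW.
  apply: le_trans massn; rewrite -mulrA ler_pM2l //.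
  apply: (@le_trans _ _ (M%:R * (Cq / al * (L n)%:R `^ (- al)))); first by rewrite lerBlDr -lerBlDl.
  rewrite mulrCA ler_pM2l ?divr_gt0 //.
  apply: (@le_trans _ _ (n%:R * n%:R `^ (- (th * al)))).
    by apply: ler_pM; rewrite ?powR_ge0 ?ler_nat ?L_al.
  rewrite -[X in X * _](powRr1 (ltW n0')) -powRD ?(gt_eqF n0') ?implybT //.
  by rewrite le_eqVlt; apply/orP; left; apply/eqP; congr (_ `^ _); ring.
by apply: le_trans (lerD first second) _; rewrite eta3E.
Unshelve. all: by end_near. Qed.

Theorem big_jump :
  cpow q (Num.truncn (l * n%:R)) n * n%:R `^ al @[n --> \oo] --> l * a * (1 - l * mu) `^ (- (1 + al)).
Proof.
(* A polynomial is needed for every [n]; 0 is taken where [poly_pow_split] does not apply. *)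
have ex n : exists g : {poly R}, [/\ poly_ge0 g, g.[1] <= (N n)%:R ^+ 2 & (0 < N n)%N -> (L n <= n)%N ->
    (trunc_gf (L n) + jump_gf (L n) n) ^+ N n = trunc_gf (L n) ^+ N n +
     (N n)%:R *: (jump_gf (L n) n * trunc_gf (L n) ^+ (N n).-1) + jump_gf (L n) n * jump_gf (L n) n * g].
  have z : poly_ge0 (0 : {poly R}) /\ (0 : {poly R}).[1] <= (N n)%:R ^+ 2.
    by split; [move=> i; rewrite coef0|rewrite horner0 exprn_ge0].
  case: (posnP (N n)) => N0; first by exists 0; case: z; split => //; rewrite N0.
  case: (leqP (L n) n) => Ln; last by exists 0; case: z; split.
  have [g [g1 g2 g3]] := poly_pow_split (N n).-1 (trunc_gf_ge0 (L n)) (jump_gf_ge0 (L n) n) (jump_gf1 Ln).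
  by exists g; rewrite prednK // in g2 g3.
have [g hg] := choice ex.
have ratio : (N n)%:R / n%:R @[n --> \oo] --> l.
  have h : l - n%:R `^ (- 1) @[n --> \oo] --> l - 0.
    by apply: cvgB; [exact: cvg_cst|exact: cvg_powRN0].
  rewrite subr0 in h; apply: (squeeze_cvgr _ h (cvg_cst l)); near=> n.
  have n0 : 0 < n%:R :> R by rewrite ltr0n; near: n; exists 1%N.
  have /andP[b1 b2] := truncn_bounds l01 n; rewrite -/(N n) in b1 b2.
  rewrite powR_inv1 ?ler0n // ler_pdivlMr // ler_pdivrMr // b2 andbT mulrBl mulVf ?gt_eqF //; exact: ltW.
have m3 : (jump_gf (L n) n * jump_gf (L n) n * g n)`_n * n%:R `^ al @[n --> \oo] --> (0 : R).
  by apply: multi_jump_cvg => n; case: (hg n).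
have h : (trunc_gf (L n) ^+ N n)`_n * n%:R `^ al +
    (N n)%:R / n%:R * (n%:R `^ (1 + al) * (jump_gf (L n) n * trunc_gf (L n) ^+ (N n).-1)`_n) +
    (jump_gf (L n) n * jump_gf (L n) n * g n)`_n * n%:R `^ al @[n --> \oo] --> 0 + l * T + 0.
  apply: cvgD; [apply: cvgD|exact: m3]; first exact: zero_jump_cvg.
  by apply: cvgM; [exact: ratio|exact: single_jump_cvg].
rewrite add0r addr0 /T mulrA in h; apply: cvg_trans h; apply: near_eq_cvg; near=> n.
have n0 : 0 < n%:R :> R by rewrite ltr0n; near: n; exists 1%N.
have N0 : (0 < N n)%N by near: n; exact: N_gt0.
have Ln : (L n <= n)%N by near: n; exact: L_le.
have [_ _ /(_ N0 Ln) e] := hg n.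
rewrite -/(N n) (cpowE q (N n) (ltnSn n)) -(gf_split Ln) e !coefD coefZ.
rewrite [n%:R `^ (1 + al)]powRD ?(gt_eqF n0) ?implybT // powRr1 ?(ltW n0) //.
by field; rewrite gt_eqF.
Unshelve. all: by end_near. Qed.

End BigJump.

(** * Asymptotic equivalents and the saddle point *)

Section Equivalents.
Variable R : realType.
Implicit Types f g : nat -> R.

Lemma ratio_equiv f g : (\forall n \near \oo, 0 < g n) ->
  f n / g n @[n --> \oo] --> (1 : R) -> f ~_\oo g.
Proof.
move=> g0 fg; apply/eqaddoP => e e0; near=> n.
have gn : 0 < g n by near: n; exact: g0.
have h : `|1 - f n / g n| <= e by near: n; move/cvgrPdist_le : fg; apply.
have -> : (f - g) n = - ((1 - f n / g n) * g n).
  by rewrite /= mulrBl mul1r divfK ?gt_eqF // opprB.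
by rewrite normrN normrM ler_wpM2r.
Unshelve. all: by end_near. Qed.

Lemma equiv_ratio f g : (\forall n \near \oo, 0 < g n) -> f ~_\oo g ->
  f n / g n @[n --> \oo] --> (1 : R).
Proof.
move=> g0 /eqaddoP fg; apply/cvgrPdist_le => e e0; near=> n.
have gn : 0 < g n by near: n; exact: g0.
have h : `|(f - g) n| <= e * `|g n| by near: n; exact: fg.
rewrite -(ler_pM2r gn) -[X in _ * X <= _](gtr0_norm gn) -normrM mulrBl mul1r divfK ?gt_eqF //.
by rewrite distrC; move: h; rewrite (gtr0_norm gn).
Unshelve. all: by end_near. Qed.

(** Exponential tilting commutes with convolution. *)
Lemma cpow_scale (p : nat -> R) (c x : R) N n :
  cpow (fun k => p k * x ^+ k / c) N n = cpow p N n * x ^+ n / c ^+ N.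
Proof.
elim: N n => [|N IH] n /=.
  by rewrite expr0 divr1; case: eqP => [->|_]; rewrite ?expr0 ?mulr1 ?mul0r.
rewrite mulr_suml mulr_suml; apply: eq_bigr => m _; rewrite IH.
have e : x ^+ n = x ^+ m * x ^+ (n - m) by rewrite -exprD subnKC // -ltnS.
by rewrite e exprS invfM; ring.
Qed.

End Equivalents.

(** * The generating function up to its radius of convergence *)

Section GeneratingFunction.
Variable R : realType.
Variables (p : nat -> R) (b rho al : R).
Hypothesis p_ge0 : forall k, 0 <= p k.
Hypothesis p1_gt0 : 0 < p 1%N.
Hypothesis b0 : 0 < b.
Hypothesis rho0 : 0 < rho.
Hypothesis al12 : 1 < al < 2.
Hypothesis p_asymp : p k * rho ^+ k * k%:R `^ (1 + al) @[k --> \oo] --> b.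

Let al1 : 1 < al. Proof. by case/andP: al12. Qed.
Let al0 : 0 < al. Proof. by have := al1; lra. Qed.

Let p_bound : exists2 C : R, 0 < C & forall k, (0 < k)%N -> p k * rho ^+ k <= C * k%:R `^ (- (1 + al)).
Proof. exact: (law_bound (w := fun k => p k * rho ^+ k) p_asymp). Qed.

Let term_ge0 (j k : nat) x : 0 <= x -> 0 <= k%:R ^+ j * p k * x ^+ k.
Proof. by move=> x0; rewrite !mulr_ge0 ?exprn_ge0. Qed.

Let dominated (u : nat -> R) (C g : R) : 0 < g -> (forall k, 0 <= u k) ->
  (forall k, (0 < k)%N -> u k <= C * k%:R `^ (- (1 + g))) -> exists s : R, series u @ \oo --> s.
Proof.
move=> g0 u0 uC; have [s hs] := powRN_summable g0.
have h : series (fun k => u 0%N * (k == 0%N)%:R + C * k%:R `^ (- (1 + g))) @ \oo --> u 0%N * 1 + C * s.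
  apply: cvg_seriesD; apply: cvg_seriesZ => //.
  rewrite -(cvg_shiftS (series _)); under eq_fun do rewrite /series /= big_nat_recl //= big1 // addr0.
  exact: cvg_cst.
have hu k : `|u k| <= u 0%N * (k == 0%N)%:R + C * k%:R `^ (- (1 + g)); last first.
  by have [s' h' _] := cvg_series_abs hu h; exists s'.
rewrite ger0_norm //; case: k => [|k].
  by rewrite eqxx mulr1 powR0 ?mulr0 ?addr0 // oppr_eq0 gt_eqF // addr_gt0.
by rewrite mulr0 add0r; exact: uC.
Qed.

(** This says that the radius of convergence is at least [rho], in a form stable under shifts and
    multiplication by the index, hence under termwise differentiation. *)
Definition geom_bounded (a : nat -> R) :=
  forall y, 0 < y < rho -> exists M : R, forall k, `|a k| * y ^+ k <= M.

Lemma geom_bounded_p : geom_bounded p.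
Proof.
move=> y /andP[y0 yr]; have [C C0 hC] := p_bound; exists (p 0%N + C) => k.
rewrite ger0_norm //; apply: (@le_trans _ _ (p k * rho ^+ k)).
  by rewrite ler_wpM2l // lerXn2r ?nnegrE // ltW.
case: k => [|k]; first by rewrite expr0 mulr1 lerDl ltW.
apply: le_trans (hC k.+1 isT) _; apply: ler_wpDl => //; rewrite ler_piMr ?(ltW C0) //.
rewrite -[leRHS](powRr0 k.+1%:R) ler_powR ?ler1n //.
by rewrite oppr_le0 addr_ge0 // ltW.
Qed.

Lemma geom_bounded_shift a : geom_bounded a -> geom_bounded (a \o S).
Proof.
move=> ha y yr; have [M hM] := ha y yr; have /andP[y0 _] := yr; exists (M / y) => k.
by rewrite /= ler_pdivlMr // -mulrA -exprSr; exact: hM.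
Qed.

Lemma geom_boundedD a c : geom_bounded a -> geom_bounded c -> geom_bounded (fun k => a k + c k).
Proof.
move=> ha hc y yr; have [M hM] := ha y yr; have [M' hM'] := hc y yr; have /andP[y0 _] := yr.
exists (M + M') => k; apply: le_trans (lerD (hM k) (hM' k)).
by rewrite -mulrDl ler_wpM2r ?exprn_ge0 ?(ltW y0) // ler_normD.
Qed.

Lemma geom_boundedZ (c : R) a : geom_bounded a -> geom_bounded (fun k => c * a k).
Proof.
move=> ha y yr; have [M hM] := ha y yr; exists (`|c| * M) => k.
by rewrite normrM -mulrA ler_wpM2l.
Qed.

Lemma geom_bounded_muln a : geom_bounded a -> geom_bounded (fun k => k%:R * a k).
Proof.
move=> ha y /andP[y0 yr]; pose z := (y + rho) / 2.
have yz : y < z by rewrite /z; lra.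
have zr : z < rho by rewrite /z; lra.
have z0 : 0 < z by exact: lt_trans yz.
have [|M hM] := ha z; first by rewrite z0.
have d0 : 0 < z / y - 1 by rewrite subr_gt0 ltr_pdivlMr // mul1r.
exists (M / (z / y - 1)) => k; rewrite ler_pdivlMr // normrM normr_nat.
apply: le_trans (hM k).
have -> : z ^+ k = (1 + (z / y - 1)) ^+ k * y ^+ k by rewrite addrC subrK -exprMn divfK // gt_eqF.
have bern : k%:R * (z / y - 1) <= (1 + (z / y - 1)) ^+ k.
  move: (z / y - 1) d0 => d d0; elim: k => [|k IH]; first by rewrite mul0r expr0.
  have h : 1 <= (1 + d) ^+ k by rewrite exprn_ege1 // lerDl ltW.
  rewrite exprS mulrDl mul1r -natr1 mulrDl mul1r; apply: lerD => //.
  by rewrite ler_peMr // ltW.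
have -> : k%:R * `|a k| * y ^+ k * (z / y - 1) = k%:R * (z / y - 1) * (`|a k| * y ^+ k) by ring.
by rewrite [leRHS]mulrCA ler_wpM2r // mulr_ge0 // exprn_ge0 // ltW.
Qed.

Lemma geom_bounded_cvg a x : geom_bounded a -> 0 < x < rho ->
  exists s : R, series (fun k => a k * x ^+ k) @ \oo --> s.
Proof.
move=> ha /andP[x0 xr]; pose z := (x + rho) / 2.
have xz : x < z by rewrite /z; lra.
have zr : z < rho by rewrite /z; lra.
have z0 : 0 < z by exact: lt_trans xz.
have [|M hM] := ha z; first by rewrite z0.
have nM n : `|a n * z ^+ n| <= M by rewrite normrM (ger0_norm (exprn_ge0 _ (ltW z0))).
have r0 : 0 <= x / z by rewrite divr_ge0 // ltW.
have r1 : `|x / z| < 1 by rewrite (ger0_norm r0) ltr_pdivrMr // mul1r.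
exists (psum (fun n => a n * z ^+ n) (x / z)); have h := psum_cvg nM r1.
rewrite (_ : (fun k => a k * x ^+ k) = (fun k => a k * z ^+ k * (x / z) ^+ k)) //.
by apply/funext => k; rewrite -mulrA -exprMn mulrCA mulfV ?mulr1 // gt_eqF.
Qed.

Lemma weighted_cvg j x : 0 < x < rho -> exists s : R, series (fun k => k%:R ^+ j * p k * x ^+ k) @ \oo --> s.
Proof.
apply: (@geom_bounded_cvg (fun k => k%:R ^+ j * p k)); elim: j => [|j IH].
  by under [X in geom_bounded X]eq_fun do rewrite expr0 mul1r; exact: geom_bounded_p.
by under [X in geom_bounded X]eq_fun do rewrite exprS -mulrA; exact: geom_bounded_muln.
Qed.

(** At [rho] itself a weight up to [k] is allowed: the terms are [O(k ^ (- al))], summable because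
    [al > 1]. *)
Lemma weighted_cvg_le j x : (j <= 1)%N -> 0 < x <= rho ->
  exists s : R, series (fun k => k%:R ^+ j * p k * x ^+ k) @ \oo --> s.
Proof.
move=> j1 /andP[x0 xr]; have [C C0 hC] := p_bound.
have a1 : 0 < al - 1 by rewrite subr_gt0.
apply: (@dominated _ C (al - 1) a1).
  by move=> k; apply: term_ge0; exact: ltW.
move=> k k0; have k0' : 0 < k%:R :> R by rewrite ltr0n.
have k1' : 1 <= k%:R :> R by rewrite ler1n.
apply: (@le_trans _ _ (k%:R * (p k * rho ^+ k))).
  rewrite -mulrA; apply: ler_pM; rewrite ?exprn_ge0 ?mulr_ge0 ?exprn_ge0 ?(ltW x0) //.
    by case: j j1 => [|[|]].
  by rewrite ler_wpM2l // lerXn2r ?nnegrE // ltW.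
apply: le_trans (ler_wpM2l (ltW k0') (hC k k0)) _.
rewrite mulrCA ler_pM2l // -[X in X * _](powRr1 (ltW k0')) -powRD ?(gt_eqF k0') ?implybT //.
by rewrite le_eqVlt; apply/orP; left; apply/eqP; congr (_ `^ _); ring.
Qed.

(** Convertible with [egf] when [p] is [egf_coef], so that results on [gf] apply to the theorem
    without rewriting. *)
Definition gf k x : R := limn (pseries (iter k (@pseries_diffs R) p) x).

Lemma gf0_cvg x : 0 < x <= rho -> series (fun k => p k * x ^+ k) @ \oo --> gf 0 x.
Proof.
move=> xr; have [s hs] := weighted_cvg_le (leq0n 1) xr.
have e : (fun k : nat => k%:R ^+ 0 * p k * x ^+ k) = (fun k => p k * x ^+ k).
  by apply/funext => k; rewrite expr0 mul1r.
rewrite e in hs; suff -> : gf 0 x = s by [].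
exact: cvg_lim hs.
Qed.

Lemma gf1_cvg x : 0 < x <= rho -> series (fun k => k%:R * p k * x ^+ k) @ \oo --> x * gf 1 x.
Proof.
move=> xr; have [s hs] := weighted_cvg_le (leqnn 1) xr; have /andP[x0 _] := xr.
have e : (fun k : nat => k%:R ^+ 1 * p k * x ^+ k) = (fun k => k%:R * p k * x ^+ k).
  by apply/funext => k; rewrite expr1.
rewrite e in hs; have h := cvg_seriesZ (c := x^-1) (cvg_seriesS hs).
rewrite !mul0r subr0 in h.
suff -> : gf 1 x = x^-1 * s by rewrite mulrA mulfV ?mul1r // gt_eqF.
rewrite /gf /= (_ : pseries _ x = series (fun k => x^-1 * (k.+1%:R * p k.+1 * x ^+ k.+1))).
  exact: cvg_lim h.
rewrite /pseries; congr (series _); apply/funext => k; rewrite /pseries_diffs exprS /=.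
by field; rewrite gt_eqF.
Qed.

Lemma gf2_cvg x : 0 < x < rho ->
  series (fun k => k%:R * (k%:R - 1) * p k * x ^+ k) @ \oo --> x ^+ 2 * gf 2 x.
Proof.
move=> xr; have /andP[x0 _] := xr.
have [s2 h2] := weighted_cvg 2 xr; have [s1 h1] := weighted_cvg 1 xr.
have hs : series (fun k => k%:R * (k%:R - 1) * p k * x ^+ k) @ \oo --> s2 + -1 * s1.
  have h := cvg_seriesD h2 (cvg_seriesZ (c := -1) h1).
  rewrite (_ : (fun k => _) = (fun k => k%:R ^+ 2 * p k * x ^+ k + -1 * (k%:R ^+ 1 * p k * x ^+ k))) //.
  by apply/funext => k; ring.
have h := cvg_seriesZ (c := x^-1 ^+ 2) (cvg_seriesS (cvg_seriesS hs)).
rewrite !mul0r subrr mulr0 !mul0r !subr0 in h.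
suff -> : gf 2 x = x^-1 ^+ 2 * (s2 + -1 * s1).
  by rewrite mulrA -exprMn mulfV ?gt_eqF // expr1n mul1r.
rewrite /gf /= (_ : pseries _ x = series (fun k => x^-1 ^+ 2 * (k.+2%:R * (k.+2%:R - 1) * p k.+2 * x ^+ k.+2))).
  exact: cvg_lim h.
rewrite /pseries; congr (series _); apply/funext => k; rewrite /pseries_diffs !exprS.
have -> : k.+2%:R - 1 = k.+1%:R :> R by rewrite -[k.+2%:R]natr1 addrK.
rewrite /=; by field; rewrite gt_eqF.
Qed.

Lemma gf0_gt0 x : 0 < x <= rho -> 0 < gf 0 x.
Proof.
move=> xr; have /andP[x0 _] := xr.
have h := nnseries_le 2 (fun k => mulr_ge0 (p_ge0 k) (exprn_ge0 k (ltW x0))) (gf0_cvg xr).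
apply: lt_le_trans h; rewrite /series /= big_nat_recr //= big_nat1 ltr_wpDl ?mulr_ge0 ?exprn_ge0 ?(ltW x0) //.
by rewrite mulr_gt0.
Qed.

Definition gf_law x k : R := p k * x ^+ k / gf 0 x.

Section Law.
Variable x : R.
Hypothesis x_le : 0 < x <= rho.
Let x0 : 0 < x. Proof. by case/andP: x_le. Qed.
Let F0 := gf0_gt0 x_le.

Lemma gf_law_ge0 k : 0 <= gf_law x k.
Proof. by rewrite divr_ge0 ?(ltW F0) // mulr_ge0 // exprn_ge0 // ltW. Qed.

Lemma gf_law_gt0 k : 0 < p k -> 0 < gf_law x k.
Proof. by move=> pk; rewrite divr_gt0 // mulr_gt0 // exprn_gt0. Qed.

Lemma gf_law_mass : series (gf_law x) @ \oo --> (1 : R).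
Proof.
have h := cvg_seriesZ (c := (gf 0 x)^-1) (gf0_cvg x_le).
rewrite mulVf ?gt_eqF // in h.
by rewrite (_ : gf_law x = (fun k => (gf 0 x)^-1 * (p k * x ^+ k))) //; apply/funext => k; rewrite mulrC.
Qed.

Lemma gf_law_mean : series (fun k => k%:R * gf_law x k) @ \oo --> x * gf 1 x / gf 0 x.
Proof.
have h := cvg_seriesZ (c := (gf 0 x)^-1) (gf1_cvg x_le).
rewrite [X in _ --> X]mulrC (_ : (fun k => _) = (fun k => (gf 0 x)^-1 * (k%:R * p k * x ^+ k))) //.
by apply/funext => k; rewrite /gf_law; ring.
Qed.

(** Undoes the tilting: [x ^ n] and [gf 0 x ^ N] are the factors that [cpow_scale] introduces. *)
Lemma equiv_of_llt (l e K : R) (f : nat -> R) : 0 < K ->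
  (forall n, f n = cpow p (Num.truncn (l * n%:R)) n) ->
  cpow (gf_law x) (Num.truncn (l * n%:R)) n * n%:R `^ e @[n --> \oo] --> K ->
  f ~_\oo (fun n => K * n%:R `^ (- e) * x ^- n * gf 0 x ^+ Num.truncn (l * n%:R)).
Proof.
move=> K0 fE h; apply: ratio_equiv.
  near=> n; have n0 : 0 < n%:R :> R by rewrite ltr0n; near: n; exists 1%N.
  by rewrite !mulr_gt0 ?powR_gt0 ?invr_gt0 ?exprn_gt0.
have h2 : cpow (gf_law x) (Num.truncn (l * n%:R)) n * n%:R `^ e * K^-1 @[n --> \oo] --> K * K^-1.
  by apply: cvgMl.
rewrite mulfV ?gt_eqF // in h2; apply: cvg_trans h2; apply: near_eq_cvg; near=> n.
have n0 : 0 < n%:R :> R by rewrite ltr0n; near: n; exists 1%N.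
rewrite cpow_scale fE powRN.
have e1 : 0 < x ^+ n by exact: exprn_gt0.
have e2 : 0 < gf 0 x ^+ Num.truncn (l * n%:R) by exact: exprn_gt0.
have e3 : 0 < n%:R `^ e :> R by exact: powR_gt0.
move: (cpow _ _ _) (x ^+ n) (gf 0 x ^+ _) (n%:R `^ e : R) e1 e2 e3 => u v w z e1 e2 e3.
by field; rewrite !gt_eqF.
Unshelve. all: by end_near. Qed.

End Law.

Let rho_le : 0 < rho <= rho. Proof. by rewrite rho0 lexx. Qed.

Lemma gf_law_asymp : gf_law rho k * k%:R `^ (1 + al) @[k --> \oo] --> b / gf 0 rho.
Proof.
have h : p k * rho ^+ k * k%:R `^ (1 + al) / gf 0 rho @[k --> \oo] --> b / gf 0 rho by exact: cvgMl.
apply: cvg_trans h; apply: near_eq_cvg; apply: nearW => k; rewrite /gf_law; ring.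
Qed.

(** * The saddle point equation *)

Section Saddle.
Variable l : R.
Hypothesis l01 : 0 < l < 1.
(** With [F] the generating function and [p 0 = 0], these are the coefficients of
    [(x F' - F / l) / x], whose zeros are the saddle points. They are nonpositive up to
    [k.+1 = 1 / l] and nonnegative afterwards, which drives both uniqueness and existence. *)
Let h k : R := (k.+1%:R - l^-1) * p k.+1.

Let l0 : 0 < l. Proof. by case/andP: l01. Qed.
Let lV1 : 1 < l^-1. Proof. by case/andP: l01 => ? ?; rewrite invf_gt1. Qed.

Let saddle_fun_cvg x : 0 < x <= rho ->
  series (fun k => h k * x ^+ k) @ \oo --> (x * gf 1 x - l^-1 * gf 0 x + l^-1 * p 0%N) / x.
Proof.
move=> xr; have /andP[x0 _] := xr.
have h1 := cvg_seriesD (gf1_cvg xr) (cvg_seriesZ (c := - l^-1) (gf0_cvg xr)).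
have h2 := cvg_seriesZ (c := x^-1) (cvg_seriesS h1).
rewrite mul0r mul0r add0r expr0 mulr1 in h2.
have -> : (x * gf 1 x - l^-1 * gf 0 x + l^-1 * p 0%N) / x = x^-1 * (x * gf 1 x + - l^-1 * gf 0 x - - l^-1 * p 0%N) by ring.
rewrite (_ : (fun k => h k * x ^+ k) = (fun k => x^-1 * (k.+1%:R * p k.+1 * x ^+ k.+1 + - l^-1 * (p k.+1 * x ^+ k.+1)))) //.
by apply/funext => k; rewrite /h exprS; field; rewrite !gt_eqF.
Qed.

Hypothesis p0 : p 0%N = 0.

Let saddle_zero x : 0 < x <= rho -> x * gf 1 x / gf 0 x = l^-1 ->
  series (fun k => h k * x ^+ k) @ \oo --> (0 : R).
Proof.
move=> xr e; have := saddle_fun_cvg xr.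
have -> : x * gf 1 x = l^-1 * gf 0 x by rewrite -e divfK // gt_eqF // gf0_gt0.
by rewrite subrr p0 mulr0 addr0 mul0r.
Qed.

(** Descartes' rule for a single sign change, at index [K]. With [H] the sum of the series of [h],
    all terms of [x ^ K H(y) - y ^ K H(x)] are nonnegative and that of index 0 is positive, so [H]
    cannot vanish at both points. *)
Lemma saddle_unique x y : 0 < x -> x < y -> y <= rho ->
  x * gf 1 x / gf 0 x = l^-1 -> y * gf 1 y / gf 0 y = l^-1 -> False.
Proof.
move=> x0 xy yr ex ey; have y0 := lt_trans x0 xy.
have hx := saddle_zero (_ : 0 < x <= rho) ex; have hy := saddle_zero (_ : 0 < y <= rho) ey.
have {}hx := hx (introT andP (conj x0 (ltW (lt_le_trans xy yr)))).
have {}hy := hy (introT andP (conj y0 yr)).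
pose K := Num.truncn l^-1.
have K1 : (0 < K)%N by rewrite truncn_gt0 ltW.
have KV : K%:R <= l^-1 by rewrite truncn_le invr_ge0 ltW.
have VK : l^-1 < K.+1%:R by exact: truncnS_gt.
have hh := cvg_seriesD (cvg_seriesZ (c := x ^+ K) hy) (cvg_seriesZ (c := - y ^+ K) hx).
rewrite !mulr0 addr0 in hh.
have t_ge0 k : 0 <= x ^+ K * (h k * y ^+ k) + - y ^+ K * (h k * x ^+ k).
  have -> : x ^+ K * (h k * y ^+ k) + - y ^+ K * (h k * x ^+ k) = h k * (x ^+ K * y ^+ k - y ^+ K * x ^+ k) by ring.
  have [kK|Kk] := ltnP k K.
    have -> : x ^+ K * y ^+ k - y ^+ K * x ^+ k = (x * y) ^+ k * (x ^+ (K - k) - y ^+ (K - k)).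
      have e u : u ^+ K = u ^+ k * u ^+ (K - k) :> R by rewrite -exprD subnKC // ltnW.
      by rewrite !e exprMn; ring.
    apply: mulr_le0.
      rewrite mulr_le0_ge0 // subr_le0; apply: le_trans KV; by rewrite ler_nat.
    by rewrite mulr_ge0_le0 ?exprn_ge0 ?mulr_ge0 ?(ltW x0) ?(ltW y0) // subr_le0 lerXn2r ?nnegrE ?(ltW x0) ?(ltW y0) // ltW.
  have -> : x ^+ K * y ^+ k - y ^+ K * x ^+ k = (x * y) ^+ K * (y ^+ (k - K) - x ^+ (k - K)).
    have e u : u ^+ k = u ^+ K * u ^+ (k - K) :> R by rewrite -exprD subnKC.
    by rewrite !e exprMn; ring.
  apply: mulr_ge0.
    rewrite mulr_ge0 // subr_ge0; apply: le_trans (ltW VK) _; by rewrite ler_nat.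
  by rewrite mulr_ge0 ?exprn_ge0 ?mulr_ge0 ?(ltW x0) ?(ltW y0) // subr_ge0 lerXn2r ?nnegrE ?(ltW x0) ?(ltW y0) // ltW.
have := nnseries_le 1 t_ge0 hh; rewrite /series /= big_nat1 !expr0 !mulr1.
have -> : x ^+ K * h 0%N + - y ^+ K * h 0%N = - h 0%N * (y ^+ K - x ^+ K) by ring.
apply/negP; rewrite -ltNge; apply: mulr_gt0.
  rewrite /h -mulNr opprB mulr_gt0 // subr_gt0 //.
by rewrite subr_gt0 ltrXn2r // -?lt0n ?(ltW x0).
Qed.

Hypothesis above : l^-1 < rho * gf 1 rho / gf 0 rho.

(** The series [H] is positive at [rho], but its continuity is available only inside the disc. A
    partial sum reaching past the sign change is already positive at [rho], hence at some
    [x1 < rho], and the later coefficients are nonnegative. So [H x1 > 0], while [H 0 < 0]. *)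
Lemma saddle_exists : exists2 x, 0 < x < rho & x * gf 1 x / gf 0 x = l^-1.
Proof.
have hr := saddle_fun_cvg rho_le.
have Hr0 : 0 < (rho * gf 1 rho - l^-1 * gf 0 rho + l^-1 * p 0%N) / rho.
  rewrite p0 mulr0 addr0 divr_gt0 // subr_gt0 -ltr_pdivlMr ?gf0_gt0 //.
have [M M0 HM] : exists2 M, (Num.truncn l^-1 <= M)%N & 0 < series (fun k => h k * rho ^+ k) M.
  have [n0 _ hn] : \forall n \near \oo, 0 < series (fun k => h k * rho ^+ k) n by exact: (cvgr_gt _ hr).
  exists (maxn n0 (Num.truncn l^-1)); first exact: leq_maxr.
  by apply: hn => /=; exact: leq_maxl.
have pc : \sum_(k < M) h k * z ^+ k @[z --> rho^'-] --> \sum_(k < M) h k * rho ^+ k.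
  apply: (cvg_sum_ord (f := fun k z => h k * z ^+ k) (l := fun k => h k * rho ^+ k)) => k.
  by apply: cvgMr; apply: cvg_at_left_filter; exact: exprn_continuous.
have [x1 [/andP[x10 x1r] Hx1]] : exists x1, 0 < x1 < rho /\ 0 < \sum_(k < M) h k * x1 ^+ k.
  have near_pos : \forall z \near rho^'-, 0 < \sum_(k < M) h k * z ^+ k.
    apply: (cvgr_gt _ pc); by move: HM; rewrite /series /= big_mkord.
  have near_lt : \forall z \near rho^'-, z < rho by exact: nbhs_left_lt.
  have near_gt : \forall z \near rho^'-, 0 < z by exact: nbhs_left_gt.
  have : \forall z \near rho^'-, 0 < z < rho /\ 0 < \sum_(k < M) h k * z ^+ k.
    by near=> z; split; [apply/andP; split; near: z|near: z].
  by move/filter_ex.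
have H1 : 0 < (x1 * gf 1 x1 - l^-1 * gf 0 x1 + l^-1 * p 0%N) / x1.
  apply: lt_le_trans Hx1 _; have hc := saddle_fun_cvg (_ : 0 < x1 <= rho).
  have {}hc := hc (introT andP (conj x10 (ltW x1r))).
  rewrite -[leRHS](cvg_lim _ hc) //; apply: limr_ge; first by apply/cvg_ex; eexists; exact: hc.
  exists M => // n /= Mn; rewrite /series /= (big_cat_nat (n := M)) //= big_mkord lerDl.
  rewrite big_nat_cond; apply: sumr_ge0 => k /andP[/andP[Mk _] _].
  rewrite mulr_ge0 ?exprn_ge0 ?(ltW x10) // mulr_ge0 // subr_ge0 ltW //.
  apply: lt_le_trans (truncnS_gt _) _; rewrite ler_nat ltnS; exact: leq_trans Mk.
pose H x := limn (pseries h x).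
(* Convergence at a point [x2] beyond [x1], for the series and its termwise derivatives, gives
   differentiability on the whole of [[0, x1]]. *)
pose x2 := (x1 + rho) / 2; have x12 : x1 < x2 by rewrite /x2; lra.
have x2r : x2 < rho by rewrite /x2; lra.
have x20 : 0 < x2 by exact: lt_trans x12.
have x2b : 0 < x2 < rho by rewrite x20.
have cv j : cvgn (pseries (iter j (@pseries_diffs R) h) x2).
  have [|s hs] := @geom_bounded_cvg (iter j (@pseries_diffs R) h) x2 _ x2b; last by apply/cvg_ex; exists s.
  elim: j => [|j IH] /=; last exact: (geom_bounded_shift (geom_bounded_muln IH)).
  apply: (@geom_bounded_shift (fun k => (k%:R - l^-1) * p k)).
  under [X in geom_bounded X]eq_fun do rewrite mulrBl -mulNr.
  apply: geom_boundedD; first exact: (geom_bounded_muln geom_bounded_p).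
  exact: (geom_boundedZ _ geom_bounded_p).
have Hc : {within `[0, x1], continuous H}.
  apply: derivable_within_continuous => x; rewrite in_itv /= => /andP[z0 z1].
  have [] := @pseries_snd_diffs R h x2 x (cv 0%N) (cv 1%N) (cv 2%N).
    by rewrite !ger0_norm ?(ltW x20) // (le_lt_trans z1).
  by [].
have Hlim x : 0 < x <= rho -> H x = (x * gf 1 x - l^-1 * gf 0 x + l^-1 * p 0%N) / x.
  by move=> xr; exact: cvg_lim (saddle_fun_cvg xr).
have H0 : H 0 < 0.
  have e : series (fun k => h k * 0 ^+ k) @ \oo --> h 0%N.
    rewrite -(cvg_shiftS (series _)) (_ : (fun n => _) = fun=> h 0%N); first exact: cvg_cst.
    apply/funext => n; rewrite /series /= big_nat_recl //= big1 ?addr0 ?expr0 ?mulr1 // => i _.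
    by rewrite expr0n mulr0.
  rewrite /H /pseries (cvg_lim _ e) // /h nmulr_rlt0 // subr_lt0 //.
have Hx : H x1 = (x1 * gf 1 x1 - l^-1 * gf 0 x1 + l^-1 * p 0%N) / x1 by apply: Hlim; rewrite x10 ltW.
have Hm : Num.min (H 0) (H x1) <= 0 <= Num.max (H 0) (H x1).
  by rewrite ge_min (ltW H0) /= le_max Hx (ltW H1) orbT.
have [x] := IVT (ltW x10) Hc Hm.
rewrite in_itv /= => /andP[xg xl] Hx0.
have x0 : 0 < x by rewrite lt_neqAle xg andbT; apply/eqP => e; move: H0; rewrite [X in H X]e Hx0 ltxx.
have xr : x < rho by exact: le_lt_trans x1r.
exists x; first by rewrite x0.
move: Hx0; rewrite Hlim ?x0 ?(ltW xr) // p0 mulr0 addr0 => /eqP.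
rewrite mulf_eq0 invr_eq0 (gt_eqF x0) orbF subr_eq0 => /eqP ->.
by rewrite mulfK // gt_eqF // gf0_gt0 // x0 ltW.
Unshelve. all: by end_near. Qed.

End Saddle.

End GeneratingFunction.

Lemma Gamma_neg (R : realType) (x : R) : -1 < x < 0 -> Gamma x = Gamma_integral (x + 1) / x.
Proof.
move=> /andP[x1 x0]; rewrite /Gamma.
have -> : Num.truncn (1 - x) = 1%N.
  by apply: truncn_def; apply/andP; split; lra.
by rewrite big_ord1 addr0.
Qed.

(** On []-1, 0[] the value [Gamma x] is [Gamma_integral (x + 1) / x], which turns the integrals at
    [2 - al] and [1 - 1 / al] into the absolute values of [Gamma] at [1 - al] and [- 1 / al]. *)
Lemma critical_constant (R : realType) (al l b f : R) : 1 < al < 2 -> 0 < l -> 0 < b -> 0 < f ->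
  let K := (l * (b / f) / al / (al - 1) * Gamma_integral (2 - al)) `^ (- al^-1) * al^-1 / Gamma_integral (1 - al^-1) in
  0 < K /\ K = (al * f / (l * b * `|Gamma (1 - al)|)) `^ al^-1 / `|Gamma (- al^-1)|.
Proof.
move=> /andP[al1 al2] l0 b0 f0 K.
have al0 : 0 < al by lra.
have d0 : 0 < al - 1 by rewrite subr_gt0.
have be0 : 0 < al^-1 by rewrite invr_gt0.
have be1 : al^-1 < 1 by rewrite invf_lt1.
have G1 : 0 < Gamma_integral (2 - al) by apply: Gamma_integral_gt0; lra.
have G2 : 0 < Gamma_integral (1 - al^-1) by apply: Gamma_integral_gt0; lra.
have g1 : `|Gamma (1 - al)| = Gamma_integral (2 - al) / (al - 1).
  rewrite Gamma_neg; last by lra.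
  rewrite (_ : 1 - al + 1 = 2 - al); last by ring.
  by rewrite normrM gtr0_norm // normfV ltr0_norm ?opprB // subr_lt0.
have g2 : `|Gamma (- al^-1)| = Gamma_integral (1 - al^-1) / al^-1.
  rewrite Gamma_neg; last by lra.
  by rewrite [- _ + 1]addrC normrM gtr0_norm // normfV normrN gtr0_norm.
rewrite /K g1 g2; set X := _ * Gamma_integral (2 - al).
have X0 : 0 < X by rewrite mulr_gt0 // divr_gt0 // divr_gt0 // mulr_gt0 // divr_gt0.
split; first by rewrite divr_gt0 // mulr_gt0 // powR_gt0.
have -> : al * f / (l * b * (Gamma_integral (2 - al) / (al - 1))) = X^-1.
  by rewrite /X; field; rewrite !gt_eqF.
rewrite invf_div mulrA; congr (_ * _ / _).
by rewrite -[X^-1](powR_inv1 (ltW X0)) -powRrM mulN1r.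
Qed.

(** * The three regimes *)

Section Phases.
Variable R : realType.
Variables (p : nat -> R) (b rho al l : R).
Hypothesis p_ge0 : forall k, 0 <= p k.
Hypothesis p0 : p 0%N = 0.
Hypothesis p1_gt0 : 0 < p 1%N.
Hypothesis b0 : 0 < b.
Hypothesis rho0 : 0 < rho.
Hypothesis al12 : 1 < al < 2.
Hypothesis p_asymp : p k * rho ^+ k * k%:R `^ (1 + al) @[k --> \oo] --> b.
Hypothesis l01 : 0 < l < 1.
Variable f : nat -> R.
Hypothesis fE : forall n, f n = cpow p (Num.truncn (l * n%:R)) n.

Local Notation F := (gf p).
Let l0 : 0 < l. Proof. by case/andP: l01. Qed.
Let rho_le : 0 < rho <= rho. Proof. by rewrite rho0 lexx. Qed.
Let al1 : 1 < al. Proof. by case/andP: al12. Qed.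
Let al2 : al < 2. Proof. by case/andP: al12. Qed.

Let F0 x : 0 < x <= rho -> 0 < F 0 x.
Proof. exact: (gf0_gt0 p_ge0 p1_gt0 rho0 al12 p_asymp). Qed.

Let F1 : 0 < F 1 rho.
Proof.
have h := nnseries_le 2 (fun k => mulr_ge0 (mulr_ge0 (ler0n R k) (p_ge0 k)) (exprn_ge0 k (ltW rho0)))
  (gf1_cvg p_ge0 rho0 al12 p_asymp rho_le).
rewrite -(pmulr_rgt0 _ rho0); apply: lt_le_trans h.
by rewrite /series /= big_nat_recr //= big_nat1 !mul0r add0r mul1r mulr_gt0.
Qed.

Let lstar := F 0 rho / (rho * F 1 rho).
Let lstar0 : 0 < lstar. Proof. by rewrite divr_gt0 ?F0 // mulr_gt0. Qed.
Let mu_rho : rho * F 1 rho / F 0 rho = lstar^-1. Proof. by rewrite invf_div. Qed.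

Let q_ge0 := gf_law_ge0 p_ge0 p1_gt0 rho0 al12 p_asymp rho_le.
Let q_mass := gf_law_mass p_ge0 p1_gt0 rho0 al12 p_asymp rho_le.
Let q_mean := gf_law_mean p_ge0 rho0 al12 p_asymp rho_le.
Let q_asymp := gf_law_asymp p_asymp.
Let a0 : 0 < b / F 0 rho. Proof. by rewrite divr_gt0 // F0. Qed.

Lemma condensed_phase : l < lstar ->
  f ~_\oo (fun n => b * l / (F 0 rho * (1 - l / lstar) `^ (al + 1)) * n%:R `^ (- al) * rho ^- n *
    F 0 rho ^+ Num.truncn (l * n%:R)).
Proof.
move=> ll; have lmu : l * (rho * F 1 rho / F 0 rho) < 1 by rewrite mu_rho ltr_pdivrMr // mul1r.
have h := big_jump q_ge0 q_mass q_mean al12 a0 q_asymp l01 lmu.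
have y0 : 0 < 1 - l / lstar by rewrite subr_gt0 ltr_pdivrMr // mul1r.
have K0 : 0 < b * l / (F 0 rho * (1 - l / lstar) `^ (al + 1)).
  by rewrite divr_gt0 ?mulr_gt0 ?powR_gt0 ?F0.
apply: (equiv_of_llt p_ge0 p1_gt0 rho0 al12 p_asymp rho_le K0 fE).
have -> : b * l / (F 0 rho * (1 - l / lstar) `^ (al + 1)) =
   l * (b / F 0 rho) * (1 - l * (rho * F 1 rho / F 0 rho)) `^ (- (1 + al)).
  by rewrite mu_rho powRN [1 + al]addrC invfM; ring.
exact: h.
Qed.

Lemma critical_phase : l = lstar ->
  f ~_\oo (fun n => (al * F 0 rho / (lstar * b * `|Gamma (1 - al)|)) `^ al^-1 / `|Gamma (- al^-1)|
    * n%:R `^ (- al^-1) * rho ^- n * F 0 rho ^+ Num.truncn (l * n%:R)).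
Proof.
move=> ll; have qmu : series (fun k => k%:R * gf_law p rho k) @ \oo --> l^-1 by rewrite ll -mu_rho; exact: q_mean.
have q1g := gf_law_gt0 p_ge0 p1_gt0 rho0 al12 p_asymp rho_le p1_gt0.
have h := stable_llt l01 q_ge0 q_mass qmu q1g al12 a0 q_asymp.
have [K0 KE] := critical_constant al12 l0 b0 (F0 rho_le).
rewrite -ll -KE; exact: (equiv_of_llt p_ge0 p1_gt0 rho0 al12 p_asymp rho_le K0 fE h).
Qed.

(** Supplies the consecutive atoms required by [chf_decay_quadratic]. *)
Lemma p_eventually_gt0 : exists2 k0, 0 < p k0 & 0 < p k0.+1.
Proof.
have : \forall k \near \oo, 0 < p k * rho ^+ k * k%:R `^ (1 + al) by exact: (cvgr_gt _ p_asymp).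
move=> [k0 _ hk]; have pos k : (k0 <= k)%N -> 0 < p k.
  move=> kk; rewrite lt_neqAle p_ge0 andbT; apply/eqP => e.
  by move: (hk k kk); rewrite /= -e !mul0r ltxx.
by exists k0; apply: pos.
Qed.

Lemma gaussian_phase : lstar < l -> exists x : R,
  let s2 := x ^+ 2 * F 2 x / F 0 x + l^-1 - (l ^+ 2)^-1 in
  [/\ 0 < x < rho, x * F 1 x / F 0 x = l^-1,
      forall y : R, 0 < y < rho -> y * F 1 y / F 0 y = l^-1 -> y = x
    & f ~_\oo (fun n => (2 * pi * s2 * l) `^ (- 2^-1) * n%:R `^ (- 2^-1) * x ^- n *
        F 0 x ^+ Num.truncn (l * n%:R))].
Proof.
move=> ll.
have above : l^-1 < rho * F 1 rho / F 0 rho by rewrite mu_rho ltf_pV2 ?posrE.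
have [x xr xE] := saddle_exists p_ge0 p1_gt0 rho0 al12 p_asymp l01 p0 above.
have /andP[x0 x1] := xr; have xr' : 0 < x <= rho by rewrite x0 ltW.
exists x => s2.
have uniq y z : 0 < y -> y < z -> z <= rho -> y * F 1 y / F 0 y = l^-1 -> z * F 1 z / F 0 z = l^-1 -> False.
  exact: (saddle_unique p_ge0 p1_gt0 rho0 al12 p_asymp l01 p0).
have Fx := F0 xr'.
pose q := gf_law p x.
have qge0 : forall k, 0 <= q k := gf_law_ge0 p_ge0 p1_gt0 rho0 al12 p_asymp xr'.
have qmass : series q @ \oo --> (1 : R) := gf_law_mass p_ge0 p1_gt0 rho0 al12 p_asymp xr'.
have qmean : series (fun k => k%:R * q k) @ \oo --> l^-1.
  by rewrite -xE; exact: (gf_law_mean p_ge0 rho0 al12 p_asymp xr').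
have qpos k : 0 < p k -> 0 < q k by exact: (gf_law_gt0 p_ge0 p1_gt0 rho0 al12 p_asymp xr').
have qvar : series (fun k => (k%:R - l^-1) ^+ 2 * q k) @ \oo --> s2.
  have h2 := cvg_seriesZ (c := (F 0 x)^-1) (gf2_cvg p_ge0 rho0 al12 p_asymp xr).
  have h := cvg_seriesD h2 (cvg_seriesD (cvg_seriesZ (c := 1 - 2 * l^-1) qmean) (cvg_seriesZ (c := l^-1 ^+ 2) qmass)).
  have e : (F 0 x)^-1 * (x ^+ 2 * F 2 x) + ((1 - 2 * l^-1) * l^-1 + l^-1 ^+ 2 * 1) = s2.
    by rewrite /s2 exprVn; field; rewrite !gt_eqF.
  rewrite e in h; rewrite (_ : (fun k => _) = (fun k => (F 0 x)^-1 * (k%:R * (k%:R - 1) * p k * x ^+ k) +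
     ((1 - 2 * l^-1) * (k%:R * q k) + l^-1 ^+ 2 * q k))) //.
  by apply/funext => k; rewrite /q /gf_law; ring.
(* The variance is positive because the law charges 1, whereas its mean [1 / l] exceeds 1. *)
have s20 : 0 < s2.
  have h := nnseries_le 2 (fun k => mulr_ge0 (sqr_ge0 (k%:R - l^-1)) (qge0 k)) qvar.
  apply: lt_le_trans h; rewrite /series /= big_nat_recr //= big_nat1.
  apply: ltr_wpDl; first by rewrite mulr_ge0 ?sqr_ge0.
  rewrite mulr_gt0 ?qpos // exprn_even_gt0 //= subr_eq0 eq_sym gt_eqF // invf_gt1 //.
  by case/andP: l01.
have [m3 h3] := weighted_cvg p_ge0 rho0 al12 p_asymp 3 xr.
have q3 n : series (fun k => k%:R ^+ 3 * q k) n <= m3 / F 0 x.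
  have t0 k : 0 <= k%:R ^+ 3 * p k * x ^+ k by rewrite !mulr_ge0 ?exprn_ge0 // ltW.
  rewrite ler_pdivlMr // /series /= mulr_suml; apply: le_trans (nnseries_le n t0 h3).
  rewrite /series /=; apply: ler_sum => k _; rewrite /q /gf_law mulrA divfK ?gt_eqF // mulrA //.
have [k0 pk0 pk1] := p_eventually_gt0.
have [c c0 decay] := chf_decay_quadratic qge0 qmass (qpos _ p1_gt0) (qpos _ pk0) (qpos _ pk1).
have h := gaussian_llt qge0 qmass qmean qvar q3 s20 c0 decay l0 (mulfV (lt0r_neq0 l0)).
split => //.
  move=> y /andP[y0 yr] yE; have [yx|xy|//] := ltgtP y x.
    by case: (uniq y x y0 yx (ltW x1) yE xE).
  by case: (uniq x y x0 xy (ltW yr) xE yE).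
apply: (equiv_of_llt p_ge0 p1_gt0 rho0 al12 p_asymp xr' _ fE) => //.
by rewrite powR_gt0 // !mulr_gt0 // pi_gt0.
Qed.

End Phases.

Theorem theorem2p2 (R : realType) (C : species) (b rho alpha : R)
    (C_0 : #|C 'I_0| = 0%N) (C_1 : (0 < #|C 'I_1|)%N)
    (b_gt0 : 0 < b) (rho_gt0 : 0 < rho) (alpha_bounds : 1 < alpha < 2)
    (C_asymp : (fun n : nat => #|C 'I_n|%:R : R) ~_\oo
       (fun n : nat => b * n%:R `^ (- (1 + alpha)) * rho ^- n * n`!%:R))
    (lambda : R) (lambda_bounds : 0 < lambda < 1) :
  let C0 := egf C 0 in
  let C1 := egf C 1 in
  let C2 := egf C 2 in
  let N (n : nat) : nat := Num.truncn (lambda * n%:R) in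
  let lhs (n : nat) : R :=
    (N n)`!%:R / n`!%:R * (card_SET_of C n (N n))%:R in
  let lambda_star : R := C0 rho / (rho * C1 rho) in
  let c_minus : R :=
    b * lambda / (C0 rho * (1 - lambda / lambda_star) `^ (alpha + 1)) in
  let c : R :=
    (alpha * C0 rho / (lambda_star * b * `|Gamma (1 - alpha)|)) `^ alpha^-1
      / `|Gamma (- alpha^-1)| in
  [/\ lambda < lambda_star ->
        lhs ~_\oo (fun n : nat =>
          c_minus * n%:R `^ (- alpha) * rho ^- n * C0 rho ^+ N n),
      lambda = lambda_star ->
        lhs ~_\oo (fun n : nat =>
          c * n%:R `^ (- alpha^-1) * rho ^- n * C0 rho ^+ N n)
    & lambda_star < lambda ->
        exists x : R,
        let sigma2 : R :=
          x ^+ 2 * C2 x / C0 x + lambda^-1 - (lambda ^+ 2)^-1 in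
        let c_plus : R := (2 * pi * sigma2 * lambda) `^ (- 2^-1) in
        [/\ 0 < x < rho,
            x * C1 x / C0 x = lambda^-1,
            forall y : R, 0 < y < rho -> y * C1 y / C0 y = lambda^-1 -> y = x
          & lhs ~_\oo (fun n : nat =>
              c_plus * n%:R `^ (- 2^-1) * x ^- n * C0 x ^+ N n)]].
Proof.
pose p (n : nat) : R := egf_coef R C n.
have p_ge0 k : 0 <= p k by rewrite divr_ge0.
have p0 : p 0%N = 0 by rewrite /p /egf_coef C_0 mul0r.
have p1 : 0 < p 1%N by rewrite divr_gt0 ?ltr0n.
have p_asymp : p k * rho ^+ k * k%:R `^ (1 + alpha) @[k --> \oo] --> b.
  have pos : \forall n \near \oo, 0 < b * n%:R `^ (- (1 + alpha)) * rho ^- n * n`!%:R.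
    exists 1%N => // n /= n0; rewrite !mulr_gt0 ?powR_gt0 ?invr_gt0 ?exprn_gt0 ?ltr0n ?fact_gt0 //.
  have h := equiv_ratio pos C_asymp.
  have {}h : b * (#|C 'I_n|%:R / (b * n%:R `^ (- (1 + alpha)) * rho ^- n * n`!%:R)) @[n --> \oo] --> b * 1.
    exact: cvgMr.
  rewrite mulr1 in h; apply: cvg_trans h; apply: near_eq_cvg; near=> n.
  have n0 : 0 < n%:R :> R by rewrite ltr0n; near: n; exists 1%N.
  rewrite /p /egf_coef powRN.
  have e1 : 0 < n%:R `^ (1 + alpha) :> R by exact: powR_gt0.
  have e2 : 0 < rho ^+ n by exact: exprn_gt0.
  have e3 : 0 < n`!%:R :> R by rewrite ltr0n fact_gt0.
  move: (_ `^ _) (rho ^+ n) (n`!%:R : R) (#|_|%:R : R) e1 e2 e3 => u v w z u0 v0 w0.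
  by field; rewrite !gt_eqF.
move=> C0 C1 C2 N lhs lambda_star c_minus c.
have lhsE n : lhs n = cpow p (Num.truncn (lambda * n%:R)) n by exact: card_SET_ofE.
split.
- exact: (condensed_phase p_ge0 p1 b_gt0 rho_gt0 alpha_bounds p_asymp lambda_bounds lhsE).
- exact: (critical_phase p_ge0 p1 b_gt0 rho_gt0 alpha_bounds p_asymp lambda_bounds lhsE).
- exact: (gaussian_phase p_ge0 p0 p1 b_gt0 rho_gt0 alpha_bounds p_asymp lambda_bounds lhsE).
Unshelve. all: by end_near. Qed.
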